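(* Let $p$ be $\infty$ or a prime number, let $a$ be an algebraic number with $0<|a|_p<1$, and let $\{R_k\}_{k\geq0}$ be a linear recurrence of nonnegative integers satisfying $R_{k+n}=c_1R_{k+n-1}+\cdots+c_nR_k$ for all $k\geq0$, where $n\geq2$, $R_0,\ldots,R_{n-1}$ are not all zero, and $c_1,\ldots,c_n$ are nonnegative integers with $c_n\neq0$. Suppose that $\{R_k\}_{k\geq0}$ satisfies condition (R)$_p$ (defined in the context). Define the entire function on $\mathbb{C}_p\times\mathbb{C}_p$ $$\Theta(x,y)=\sum_{k=0}^\infty a^{R_k}x^k\prod_{j\geq0,\ j\neq k}\left(1-a^{R_j}y\right),\qquad G(y)=\prod_{k=0}^\infty\left(1-a^{R_k}y\right),$$ and for each algebraic number $\beta$ let $N_\beta=\#\{k\geq0\mid a^{-R_k}=\beta\}$. Then the infinite subset $$\left\{\frac{\partial^{l+m}\Theta}{\partial x^l\partial y^m}(\alpha,\beta)\ \middle|\ \alpha\in\overline{\mathbb{Q}}\setminus\{0\},\ \beta\in\overline{\mathbb{Q}},\ l\geq0,\ m\geq N_\beta\right\}\cup\left\{G^{(N_\beta)}(\beta)\ \middle|\ \beta\in\overline{\mathbb{Q}}\setminus\{0\}\right\}$$ of $\overline{\mathbb{Q}}_p$ is algebraically independent over $\mathbb{Q}$.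
   Context: $|\cdot|_p$ is the usual absolute value on $\mathbb{Q}$ if $p=\infty$ and the standard $p$-adic absolute value if $p$ is prime; $\mathbb{Q}_p$ is the completion of $\mathbb{Q}$ (so $\mathbb{Q}_\infty=\mathbb{R}$), $\overline{\mathbb{Q}}_p$ its algebraic closure, $\mathbb{C}_p$ the completion of $\overline{\mathbb{Q}}_p$ (so $\mathbb{C}_\infty=\mathbb{C}$); $\overline{\mathbb{Q}}$ is the algebraic closure of $\mathbb{Q}$ in $\mathbb{C}$, and for prime $p$ a fixed embedding $\overline{\mathbb{Q}}\hookrightarrow\mathbb{C}_p$ is used. Let $\Phi(X)=X^n-c_1X^{n-1}-\cdots-c_n$. Condition (R)$_\infty$: $\Phi(\pm1)\neq0$, the ratio of any pair of distinct roots of $\Phi$ is not a root of unity, and $\{R_k\}$ is not a geometric progression (i.e. it is not the case that $R_1\neq0$ and $R_kR_{k+2}=R_{k+1}^2$ for all $0\leq k\leq n-2$). For $p$ prime, condition (R)$_p$: $\Phi$ is irreducible over $\mathbb{Q}$ and its roots $\rho_1,\ldots,\rho_n$ satisfy $\rho_1>\max\{|\rho_2|_\infty,\ldots,|\rho_n|_\infty\}$. Under these conditions $\Theta$ and $G$ are entire. $G^{(N)}$ denotes the $N$-th derivative. *)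

(* Defs.v *)
From HB Require Import structures.
From mathcomp Require Import all_boot all_order all_algebra all_field.
From mathcomp Require Import all_classical all_reals all_analysis.
From mathcomp Require Import finmap.
(* The notations of mpoly clash with those of mathcomp-analysis. *)
From mathcomp Require mpoly.
Import -(notations) mpoly.

Set Implicit Arguments.
Unset Strict Implicit.
Unset Printing Implicit Defensive.

Import Order.TTheory GRing.Theory Num.Theory.
Import numFieldNormedType.Exports.

Local Open Scope classical_set_scope.
Local Open Scope ring_scope.

(* Fields with a real-valued absolute value.  The norm of [normedZmodType] cannot
   be used here: it is required to satisfy `|x *+ n| = `|x| *+ n, which fails
   for p-adic absolute values. *)
HB.mixin Record isValued (R : realType) K of GRing.Field K := {
  absv : K -> R ;
  absv_ge0 : forall x, 0 <= absv x ;
  absv_eq0 : forall x, (absv x == 0) = (x == 0) ;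
  absvM : forall x y, absv (x * y) = absv x * absv y ;
  absvD : forall x y, absv (x + y) <= absv x + absv y
}.

#[short(type="valuedFieldType")]
HB.structure Definition ValuedField (R : realType) :=
  {K of GRing.Field K & isValued R K}.

Section AbsvMetric.
Context {R : realType} (K : valuedFieldType R).
Implicit Types x y z : K.

Lemma absv0 : absv (0 : K) = 0.
Proof. by apply/eqP; rewrite absv_eq0. Qed.

Lemma absv1 : absv (1 : K) = 1.
Proof.
have n0 : absv (1 : K) != 0 by rewrite absv_eq0 oner_eq0.
by apply: (mulfI n0); rewrite mulr1 -absvM mulr1.
Qed.

Lemma absvN x : absv (- x) = absv x.
Proof.
suff N1 : absv (-1 : K) = 1 by rewrite -mulN1r absvM N1 mul1r.
apply/eqP; rewrite -(@eqrXn2 _ 2%N) ?absv_ge0 ?ler01//.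
by rewrite expr2 -absvM mulrNN mulr1 absv1 expr1n.
Qed.

Definition absv_dist x y : R := absv (x - y).

Lemma absv_distxx x : absv_dist x x = 0.
Proof. by rewrite /absv_dist subrr absv0. Qed.

Lemma absv_dist_eq0 x y : absv_dist x y = 0 -> x = y.
Proof. by move/eqP; rewrite absv_eq0 subr_eq0 => /eqP. Qed.

Lemma absv_distC x y : absv_dist x y = absv_dist y x.
Proof. by rewrite /absv_dist -absvN opprB. Qed.

Lemma absv_dist_triangle y x z :
  absv_dist x z <= absv_dist x y + absv_dist y z.
Proof. by rewrite /absv_dist (le_trans _ (absvD _ _))// addrA subrK. Qed.

#[non_forgetful_inheritance]
HB.instance Definition _ := isPointed.Build K 0.
#[non_forgetful_inheritance]
HB.instance Definition _ := @isMetric.Build R K absv_dist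
  absv_distxx absv_dist_eq0 absv_distC absv_dist_triangle.

End AbsvMetric.

Inductive place := infinite_place | finite_place (p : nat) of prime p.

Definition rat_absv (R : realType) (v : place) (q : rat) : R :=
  match v with
  | infinite_place => `|ratr q|
  | finite_place p _ => if q == 0 then 0 else
      p%:R ^+ logn p `|denq q|%N / p%:R ^+ logn p `|numq q|%N
  end.

Section Cv.
Context {R : realType} (K : valuedFieldType R).

Definition Qv : set K := closure (range (ratr : rat -> K)).

Definition Qvbar : set K :=
  [set x | exists P : {poly K}, [/\ P != 0, forall i, Qv P`_i & root P x]].

(* K is (a model of) C_v, the completion of an algebraic closure of the
   completion of rat at v: as K is complete, Qv is the completion of rat for
   |.|_v and K is the completion of its dense subset Qvbar, which has to be
   an algebraic closure of Qv.  Such a K is unique up to isometric isomorphism,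
   and for v = infinite_place it is the field of complex numbers. *)
Definition is_Cv (v : place) : Prop :=
  [/\ forall F : set_system K, ProperFilter F -> cauchy F -> cvg F,
      forall q : rat, absv (ratr q : K) = rat_absv R v q,
      forall P : {poly K}, (1 < size P)%N -> (forall i, Qvbar P`_i) ->
        exists2 x, Qvbar x & root P x
    & closure Qvbar = setT].

Definition derv (f : K -> K) (x : K) : K :=
  lim ((fun h => h^-1 * (f (x + h) - f x)) @ 0^').

(* (d/dx)^l (d/dy)^m F *)
Definition pderv (l m : nat) (F : K -> K -> K) (x y : K) : K :=
  iter l derv (fun x' => iter m derv (F x') y) x.

Definition Theta (a : K) (u : nat -> nat) (x y : K) : K :=
  lim (series (fun k => a ^+ u k * x ^+ k *
    lim ((fun n => \prod_(j < n | j != k :> nat) (1 - a ^+ u j * y)) @ \oo))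
    @ \oo).

Definition Gfun (a : K) (u : nat -> nat) (y : K) : K :=
  lim ((fun n => \prod_(k < n) (1 - a ^+ u k * y)) @ \oo).

Definition alg_independent (S : set K) : Prop :=
  forall (n : nat) (s : 'I_n -> K) (P : mpoly.mpoly n rat),
    injective s -> (forall i, S (s i)) -> P != 0 -> mpoly.mmap ratr s P != 0.

End Cv.

Arguments Qv {R} K.
Arguments Qvbar {R} K.

(* Conditions (R) below make u tend to infinity, so that for 0 < |a|_v < 1 the
   set is finite and [fset_set] does not take its default value. *)
Definition Nbeta (a : algC) (u : nat -> nat) (b : algC) : nat :=
  #|` fset_set [set k | a ^- u k = b] |%N.

Section Recurrence.
Variables (n : nat) (c : nat -> nat) (u : nat -> nat).

(* Only c 1, ..., c n are used. *)
Definition linear_recurrence : Prop :=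
  forall k, u (k + n)%N = (\sum_(1 <= i < n.+1) c i * u (k + n - i))%N.

Definition Phi (A : nzRingType) : {poly A} :=
  'X^n - \sum_(1 <= i < n.+1) (c i)%:R *: 'X^(n - i).

Definition geometric_progression : Prop :=
  u 1%N <> 0%N /\
  forall k, (k <= n - 2)%N -> (u k * u k.+2 = u k.+1 ^ 2)%N.

Definition condR_infty : Prop :=
  [/\ (Phi rat).[1] != 0 /\ (Phi rat).[-1] != 0,
      forall x y : algC, root (Phi algC) x -> root (Phi algC) y -> x != y ->
        forall m, (0 < m)%N -> ~~ m.-unity_root (x / y)
    & ~ geometric_progression].

(* In algC, the order x < y forces y - x to be real, so `|x| < rho1 makes rho1
   a (positive) real number. *)
Definition condR_prime : Prop :=
  irreducible_poly (Phi rat) /\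
  exists (rho1 : algC) (rho : seq algC),
    Phi algC = \prod_(x <- rho1 :: rho) ('X - x%:P) /\
    forall x, x \in rho -> `|x| < rho1.

Definition condR (v : place) : Prop :=
  match v with
  | infinite_place => condR_infty
  | finite_place _ _ => condR_prime
  end.

End Recurrence.

Section Values.
Context {R : realType} (K : valuedFieldType R).
Variables (iota : algC -> K) (a : algC) (u : nat -> nat).

Definition Theta_values : set K :=
  [set z | exists (alpha beta : algC) (l m : nat),
    [/\ alpha != 0, (Nbeta a u beta <= m)%N &
        z = pderv l m (Theta (iota a) u) (iota alpha) (iota beta)]].

Definition G_values : set K :=
  [set z | exists2 beta : algC, beta != 0 &
    z = iter (Nbeta a u beta) (@derv R K) (Gfun (iota a) u) (iota beta)].

End Values.

(* Main.v *)
(* Fix finitely many of the values and a number field L containing a and all the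
   points alpha, beta involved. Write x_r = a^(R_r). Expanding the partial products of
   G and Theta at beta to finite order shows that the field generated over L by the
   values contains the limits, as k tends to infinity, of
     Y_i(k) = prod_(k0 <= r < k) (1 - beta_i x_r)   and
     S_j(k) = sum_(k0 <= r < k) r(r-1)...(r-l+1) alpha^r (x_r / (1 - beta x_r))^(e+1),
   and there are as many limits as values, so it suffices that the limits are
   independent over L.  Mahler's method is applied directly along the index k. If the
   N limits were dependent, their monomials of degree < D in each variable would span a
   space of dimension O(D^(N-1)), which leaves enough freedom to find a nonzero polynomial
   in Y_i(k), S_j(k), k, alpha_j^k, x_k, ..., x_(k+n-1) whose value p(k) is at most
   |a|^(A R_k) with A large. Liouville's inequality then forces p(k) = 0 for all
   large k. Such an identity between sequences is impossible: comparing it with its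
   shift k -> k+1 reduces it, by induction on a weight for which S_j counts l + 1 and
   k counts 1, to first-order difference equations between sums of terms
   a^(lambda_k), with lambda in the integer recurrences, and these have no
   solution, as one sees by evaluating them at points where exactly one of the factors
   1 - beta x_r vanishes.  Condition (R) enters through the fact that 1 and the roots of
   Phi have no quotient that is a root of unity, so that no nonzero recurrence met here
   vanishes infinitely often. *)
Require Import Defs.
From mathcomp Require Import all_boot all_order all_algebra all_field.
From mathcomp Require Import all_classical all_reals all_analysis.
From mathcomp Require Import finmap.
From mathcomp Require mpoly.
Import -(notations) mpoly.
From mathcomp Require Import zify ring lra perm.

Set Implicit Arguments.
Unset Strict Implicit.
Unset Printing Implicit Defensive.

Import Order.TTheory GRing.Theory Num.Theory.

Local Open Scope classical_set_scope.
Local Open Scope ring_scope.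

(** * Sequences annihilated by a polynomial in the shift *)

(** The constants are fixed in an order that makes the count close. Clearing the denominators of
    p(k) costs all factors up to the index k, but the sum of R_r over r <= k is O(R_k), so
    Liouville's inequality bounds a nonzero p(k) below by exp(-O(D R_k)) with a constant independent
    of D. Hence vanishing up to degree T0 D in the x_r suffices, with T0 fixed before D. There are
    D^N * D * X(D) unknowns against O(D^(N-1)) * O(D) * X(O(D)) equations, where X(D) counts the
    distinct sequences among the monomials of degree < D in the alpha_j^k and x_k, ..., x_(k+n-1).
    Multiplicative relations between the alpha_j and linear relations between shifts of R may make X
    smaller than the generic power of D, so it is compared at the two scales only for suitable D.
    The obstacle in the independence of the sequences is that the numbers a^(lambda_k) cannot be
    specialised. Exponential sums are therefore read at arbitrary characters of the monoid of
    exponent sequences: an identity at all large k is an identity at every character, and some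
    characters make a prescribed factor vanish alone. *)

Section ShiftOperators.
Variable F : fieldType.
Implicit Types (p q : {poly F}) (w : nat -> F).

Definition act p w (k : nat) : F := \sum_(i < size p) p`_i * w (k + i)%N.

Lemma act_wide m p w k : (size p <= m)%N ->
  act p w k = \sum_(i < m) p`_i * w (k + i)%N.
Proof.
move=> le_pm; rewrite /act (big_ord_widen m (fun i => p`_i * w (k + i)%N))//.
rewrite big_mkcond /=; apply: eq_bigr => i _; case: ltnP => // le_pi.
by rewrite nth_default ?mul0r.
Qed.

Lemma actD p q w k : act (p + q) w k = act p w k + act q w k.
Proof.
pose m := maxn (size p) (size q).
rewrite (@act_wide m) ?size_polyD// (@act_wide m p) ?leq_maxl//.
rewrite (@act_wide m q) ?leq_maxr// -big_split /=.
by apply: eq_bigr => i _; rewrite coefD mulrDl.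
Qed.

Lemma actZ a p w k : act (a *: p) w k = a * act p w k.
Proof.
rewrite (@act_wide (size p)) ?size_scale_leq// mulr_sumr.
by apply: eq_bigr => i _; rewrite coefZ mulrA.
Qed.

Lemma actN p w k : act (- p) w k = - act p w k.
Proof. by rewrite -scaleN1r actZ mulN1r. Qed.

Lemma act0p w k : act 0 w k = 0.
Proof. by rewrite /act size_poly0 big_ord0. Qed.

Lemma actC a w k : act a%:P w k = a * w k.
Proof.
by rewrite (@act_wide 1%N) ?size_polyC_leq1// big_ord1 coefC addn0.
Qed.

Lemma actMX p w k : act (p * 'X) w k = act p w k.+1.
Proof.
rewrite (@act_wide (size p).+1); last first.
  by rewrite (leq_trans (size_polyMleq _ _))// size_polyX addn2.
rewrite big_ord_recl coefMX mul0r add0r /act.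
by apply: eq_bigr => i _; rewrite coefMX /= addnS addSn.
Qed.

Lemma actM p q w k : act (p * q) w k = act p (act q w) k.
Proof.
elim/poly_ind: p k => [|p c IHp] k; first by rewrite mul0r !act0p.
rewrite mulrDl mul_polyC !actD mulrAC !actMX actZ IHp.
by rewrite actC.
Qed.

Lemma actX p w k : act ('X * p) w k = act p w k.+1.
Proof. by rewrite mulrC actMX. Qed.

Lemma actXn d w k : act 'X^d w k = w (k + d)%N.
Proof.
elim: d k => [|d IHd] k; first by rewrite expr0 actC mul1r addn0.
by rewrite exprS actX IHd addSnnS.
Qed.

Lemma act_shift p w j k : act p (fun i => w (i + j)%N) k = act p w (k + j)%N.
Proof. by apply: eq_bigr => i _; rewrite addnAC. Qed.

Lemma act_ext p w w' k : w =1 w' -> act p w k = act p w' k.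
Proof. by move=> eqw; apply: eq_bigr => i _; rewrite eqw. Qed.

Lemma act_lin p a w w' k :
  act p (fun i => a * w i + w' i) k = a * act p w k + act p w' k.
Proof.
rewrite /act mulr_sumr -big_split /=; apply: eq_bigr => i _.
by rewrite mulrDr mulrCA.
Qed.

Lemma act_zero p w : (forall k, w k = 0) -> forall k, act p w k = 0.
Proof. by move=> w0 k; rewrite /act big1// => i _; rewrite w0 mulr0. Qed.

(** The constant coefficient is nonzero, so the recurrence can be run backwards from the vanishing
    tail. *)
Lemma act_back p w K : p`_0 != 0 -> (forall k, act p w k = 0) ->
  (forall k, (K <= k)%N -> w k = 0) -> forall k, w k = 0.
Proof.
move=> p0 aw; elim: K => [|K IHK] wK; first by move=> k; apply: wK.
apply: IHK => k; rewrite leq_eqVlt => /orP[/eqP<-|]; last exact: wK.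
have := aw K; rewrite (@act_wide (size p).+1)// big_ord_recl addn0 big1 => [|i _].
  by rewrite addr0 => /eqP; rewrite mulf_eq0 (negPf p0) => /eqP.
by rewrite wK ?mulr0//= addnS ltnS leq_addr.
Qed.

Lemma act_coprime p q w : coprimep p q ->
  (forall k, act p w k = 0) -> (forall k, act q w k = 0) -> forall k, w k = 0.
Proof.
move=> /Bezout_eq1_coprimepP[[u v] /= uv1] pw qw k.
rewrite -(mul1r (w k)) -(actC 1 w) -[1%:P]uv1 actD !actM.
by rewrite !act_zero ?addr0.
Qed.

End ShiftOperators.

(** * Simultaneous nonvanishing of nondegenerate recurrences *)

Section SimultaneousNonvanishing.
Let C := algC.
Implicit Types (w : nat -> C) (rs : seq C).

(** For nonzero elements: no quotient of two distinct ones is a root of unity. The form with powers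
    avoids division. *)
Definition nondeg rs := forall x y, x \in rs -> y \in rs -> x != y ->
  forall d, (0 < d)%N -> x ^+ d != y ^+ d.

Definition root_poly rs : {poly C} := \prod_(z <- rs) ('X - z%:P).

Lemma root_poly_coprime rs (h : {poly C}) :
  (forall x, x \in rs -> h.[x] != 0) -> coprimep h (root_poly rs).
Proof.
move=> hrs; rewrite coprimep_sym /root_poly big_seq.
apply: (big_ind (fun q => coprimep q h)) => [|x y cx cy|x xrs].
- exact: coprime1p.
- by rewrite coprimepMl cx.
- by rewrite coprimep_sym coprimep_XsubC /root hrs.
Qed.

Definition geometric_seq w := exists2 z, z != 0 & forall k, w k.+1 = z * w k.

Lemma geometric_seq_neq0 w : geometric_seq w -> (exists k, w k != 0) ->
  forall k, w k != 0.
Proof.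
move=> [z z0 wS] [k0 wk0] k.
have wE j : w j = z ^+ j * w 0%N.
  by elim: j => [|j IHj]; rewrite ?expr0 ?mul1r// wS IHj exprS mulrA.
move: wk0; rewrite wE mulf_eq0 negb_or => /andP[_ w0].
by rewrite wE mulf_neq0 ?expf_neq0.
Qed.

(* [z^d] kills the root [z] while the other roots survive by nondegeneracy, so
   [E^d - z^d] decreases the order without annihilating [w]. *)
Lemma nondeg_drop_root z rs w d :
  nondeg (z :: rs) -> 0 \notin z :: rs -> (0 < d)%N ->
  (forall k, act (root_poly (z :: rs)) w k = 0) ->
  (forall k, act (root_poly rs) (fun i => w (i + d)%N - z ^+ d * w i) k = 0) /\
  ((forall k, w (k + d)%N - z ^+ d * w k = 0) ->
    geometric_seq w).
Proof.
move=> nd nz d0 aw; pose D : {poly C} := 'X^d - (z ^+ d)%:P.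
have DE k : act D w k = w (k + d)%N - z ^+ d * w k.
  by rewrite actD actXn actN actC.
have [h Dh] : exists h, D = ('X - z%:P) * h.
  exists (\sum_(i < d) 'X^(d.-1 - i) * z%:P ^+ i).
  by rewrite /D polyC_exp subrXX.
split=> [k|Dw].
  rewrite (act_ext _ _ (fun k => esym (DE k))) -actM.
  have -> : root_poly rs * D = h * root_poly (z :: rs).
    by rewrite Dh /root_poly big_cons mulrC mulrAC mulrC.
  by rewrite actM; apply: act_zero.
have z0 : z != 0 by apply: contraNneq nz => <-; rewrite inE eqxx.
have hz x : x \in z :: rs -> h.[x] != 0.
  move=> xrs; case: (eqVneq x z) => [->|xz].
    have : D^`().[z] = h.[z].
      by rewrite Dh derivM derivXsubC hornerD !hornerM hornerC hornerXsubC subrr mul0r mul1r addr0.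
    rewrite /D derivB derivC subr0 derivXn hornerMn hornerXn => <-.
    by rewrite mulrn_eq0 negb_or -lt0n d0 expf_neq0.
  have := nd x z xrs (mem_head _ _) xz d d0.
  rewrite -subr_eq0; have -> : x ^+ d - z ^+ d = D.[x] by rewrite !hornerE.
  by rewrite Dh hornerM mulf_eq0 negb_or => /andP[].
exists z => // k; have cop := root_poly_coprime hz.
pose w' k := act ('X - z%:P) w k.
suff : w' k = 0.
  by rewrite /w' actD actN actC -['X]expr1 actXn addn1 => /eqP; rewrite subr_eq0 => /eqP.
apply: (act_coprime cop) => j; rewrite /w' -actM; last first.
  by rewrite mulrC actM; apply: act_zero.
by rewrite mulrC -Dh DE.
Qed.

(** Induction on the number [r] of roots. A geometric sequence that is nonzero somewhere never
    vanishes. Any other [w] has a root [z], and the sequences w(k+d1+d) - z^d w(k+d1) have one root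
    fewer without being zero. Take [k] where all of them are nonzero, for d1 and d up to the number
    [m] of these [w]. If each of the m + 1 indices k, ..., k+m were a zero of some [w], two of them
    would be zeros of the same one, and a difference would vanish at [k]. *)
Theorem common_nonvanishing rs0 (r : nat) (W : seq (nat -> C)) :
  nondeg rs0 -> 0 \notin rs0 ->
  (forall w, w \in W -> (exists k, w k != 0) /\
     exists2 rs, (size rs <= r)%N /\ {subset rs <= rs0} &
       forall k, act (root_poly rs) w k = 0) ->
  forall k0, exists2 k, (k0 <= k)%N & forall w, w \in W -> w k != 0.
Proof.
move=> nd nz0; elim: r W => [|r IHr] W HW k0.
  exists k0 => // w /HW[[k wk] [rs [rs0E _] aw]]; case/negP: wk.
  case: rs rs0E aw => // _ aw.
  by rewrite -(mul1r (w k)) -(actC 1 w); have := aw k; rewrite /root_poly big_nil => ->.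
pose isg w := `[< geometric_seq w >].
pose W2 := [seq w <- W | ~~ isg w].
have inW2 w : w \in W2 -> w \in W /\ ~ geometric_seq w.
  by rewrite mem_filter => /andP[/asboolP gw wW].
have inW w : w \in W -> geometric_seq w \/ w \in W2.
  by move=> wW; rewrite mem_filter wW andbT /isg; case: asboolP => gw; [left|right].
pose zof w := xget 0 [set z | exists rs, [/\ (size rs <= r)%N,
   {subset z :: rs <= rs0} & forall k, act (root_poly (z :: rs)) w k = 0]].
have zofP w : w \in W2 -> exists rs, [/\ (size rs <= r)%N,
   {subset zof w :: rs <= rs0} & forall k, act (root_poly (zof w :: rs)) w k = 0].
  move=> /inW2[/HW[[k wk] [rs [szrs rssub] aw]] _]; rewrite /zof; case: xgetP => [//|].
  case: rs szrs rssub aw => [|z rs] szrs rssub aw.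
    case/negP: wk; rewrite -(mul1r (w k)) -(actC 1 w).
    by have := aw k; rewrite /root_poly big_nil => ->.
  by move=> /(_ z)[]; exists rs.
pose m := size W2.
pose der w d1 d := fun k => w (k + d1 + d)%N - zof w ^+ d * w (k + d1)%N.
pose W' := [seq der x.1 x.2.1 x.2.2 | x <- [seq (w, y) | w <- W2,
   y <- [seq (d1, d) | d1 <- iota 0 m.+1, d <- iota 1 m]]].
have [|k k0k Hk] := IHr W' _ k0.
  move=> w' /mapP[_ /allpairsPdep[w [_ [wW2 /allpairsPdep[d1 [d [_ dm ->]]] ->]]] ->] /=.
  have {dm} d0 : (0 < d)%N by move: dm; rewrite mem_iota => /andP[].
  have [rs [szrs rssub aw]] := zofP w wW2.
  have nd' : nondeg (zof w :: rs) by move=> x y /rssub xr /rssub; apply: nd.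
  have nz' : 0 \notin zof w :: rs by apply: contra nz0; apply: rssub.
  have [a1 a2] := nondeg_drop_root nd' nz' d0 aw.
  have a1' j : act (root_poly rs) (der w d1 d) j = 0.
    by have := a1 (j + d1)%N; rewrite -act_shift.
  split; last by exists rs => //; split=> // x xrs; apply: rssub; rewrite inE xrs orbT.
  apply: contrapT => /forallNP H; have [_] := inW2 w wW2; apply; apply: a2.
  (* A difference vanishing from [d1] on vanishes everywhere, since 0 is not a root; then [w] would
     be geometric. *)
  apply: (@act_back _ (root_poly rs) _ d1) a1 _.
    rewrite -horner_coef0 /root_poly horner_prod prodf_seq_neq0.
    apply/allP => x xrs /=; rewrite hornerXsubC sub0r oppr_eq0.
    by apply: contraNneq nz' => <-; rewrite inE xrs orbT.
  move=> j d1j; have /negP := H (j - d1)%N; rewrite negbK /der subnK// => /eqP.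
  by [].
suff [i im Hi] : exists2 i, (i <= m)%N & forall w, w \in W2 -> w (k + i)%N != 0.
  exists (k + i)%N; first by rewrite (leq_trans k0k) ?leq_addr.
  move=> w wW; have [gw|/Hi//] := inW w wW.
  by apply: geometric_seq_neq0 => //; have [] := HW w wW.
apply: contrapT => /forall2NP Hn.
have bad i : (i <= m)%N -> exists2 j, (j < m)%N & nth (fun=> 0) W2 j (k + i)%N = 0.
  move=> im; have [//|/existsNP[w /not_implyP[wW2 /negP/negbNE/eqP wk]]] := Hn i.
  by exists (index w W2); rewrite ?index_mem// nth_index.
pose f (i : 'I_m.+1) : 'I_m := Ordinal (s2valP (cid2 (bad i (ltn_ord i)))).
have fP i : nth (fun=> 0) W2 (f i) (k + i)%N = 0.
  exact: (s2valP' (cid2 (bad i (ltn_ord i)))).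
have ninj : ~ injective f.
  by move=> /leq_card; rewrite !card_ord ltnn.
apply: ninj; suff H (i j : 'I_m.+1) : (i < j)%N -> f i != f j.
  move=> i j fij; apply: val_inj => /=.
  by case: (ltngtP i j) => // ij; have := H _ _ ij; rewrite fij eqxx.
move=> ij; apply/eqP => fij.
set w := nth (fun=> 0) W2 (f i).
have wW2 : w \in W2 by apply: mem_nth; exact: ltn_ord.
have /negP[] : der w i (j - i)%N k != 0.
  apply: Hk; apply/mapP; exists (w, (i : nat, (j - i)%N)) => //.
  apply/allpairsPdep; exists w, (i : nat, (j - i)%N); split=> //.
  apply/allpairsPdep; exists (i : nat), (j - i)%N; split=> //.
    by rewrite mem_iota add0n ltn_ord.
  by rewrite mem_iota subn_gt0 ij /= add1n ltnS leq_subLR (leq_trans (leq_ord j))// leq_addl.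
have wi : w (k + i)%N = 0 by apply: fP.
have wj : w (k + j)%N = 0 by rewrite /w fij; apply: fP.
by rewrite /der -addnA subnKC 1?ltnW// wi wj mulr0 subr0.
Qed.

End SimultaneousNonvanishing.

(** * Condition (R) *)

Section CharacteristicPolynomial.
Variables (n : nat) (c : nat -> nat).
Hypotheses (n_ge2 : (2 <= n)%N) (cn0 : c n <> 0%N).

Lemma size_Phi_tail (A : nzRingType) :
  (size (\sum_(1 <= i < n.+1) (c i)%:R *: 'X^(n - i) : {poly A})%R <= n)%N.
Proof.
rewrite big_add1 /= big_mkord; apply: leq_trans (size_sum _ _ _) _.
apply/bigmax_leqP => i _; rewrite (leq_trans (size_scale_leq _ _))// size_polyXn.
by case: i => i /=; lia.
Qed.

Lemma Phi_monic (A : nzRingType) : Phi n c A \is monic.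
Proof.
rewrite monicE /Phi lead_coefDl ?lead_coefXn//.
by rewrite size_polyN size_polyXn ltnS size_Phi_tail.
Qed.

Lemma size_Phi (A : nzRingType) : size (Phi n c A) = n.+1.
Proof.
by rewrite /Phi size_polyDl size_polyXn// size_polyN ltnS size_Phi_tail.
Qed.

Lemma map_Phi (A B : nzRingType) (f : {rmorphism A -> B}) :
  map_poly f (Phi n c A) = Phi n c B.
Proof.
rewrite /Phi rmorphB rmorph_sum /= map_polyXn; congr (_ - _).
by apply: eq_bigr => i _; rewrite map_polyZ map_polyXn rmorph_nat.
Qed.

Lemma act_Phi (F : fieldType) (w : nat -> F) k :
  act (Phi n c F) w k = w (k + n)%N - \sum_(1 <= i < n.+1) (c i)%:R * w (k + n - i)%N.
Proof.
rewrite /Phi actD actXn actN; congr (_ - _).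
rewrite big_seq [in RHS]big_seq.
apply: (big_ind2 (fun (p : {poly F}) s => act p w k = s)) => [|p s q t <- <-|i].
- by rewrite act0p.
- by rewrite actD.
rewrite mem_index_iota => /andP[_]; rewrite ltnS => le_in.
by rewrite actZ actXn addnBA.
Qed.

Lemma Phi_coef0 (F : numFieldType) : (Phi n c F)`_0 != 0.
Proof.
rewrite -horner_coef0 /Phi hornerD hornerN hornerXn expr0n.
have -> : n == 0%N = false by case: n n_ge2.
rewrite big_nat_recr/= ?hornerD; last by case: n n_ge2.
rewrite subnn expr0 hornerZ hornerC mulr1 sub0r oppr_eq0.
rewrite horner_sum big_nat big1 ?add0r ?pnatr_eq0; first by apply/eqP.
move=> i /andP[_ lt_in]; rewrite hornerZ hornerXn expr0n.
by rewrite subn_eq0 leqNgt lt_in mulr0.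
Qed.

Lemma root_poly_Phi (rs : seq algC) : Phi n c algC = root_poly rs ->
  forall x, (x \in rs) = root (Phi n c algC) x.
Proof.
by move=> -> x; rewrite /root_poly root_prod_XsubC.
Qed.

Lemma Phi_roots_exist : exists rs, Phi n c algC = root_poly rs.
Proof.
have [rs Drs] := closed_field_poly_normal (Phi n c algC).
exists rs; rewrite Drs (monicP (Phi_monic _)) scale1r.
by rewrite /root_poly.
Qed.

Lemma root_Phi_neq0 (x : algC) : root (Phi n c algC) x -> x != 0.
Proof.
by apply: contraTneq => ->; rewrite /root horner_coef0 Phi_coef0.
Qed.

Lemma root_Phi_conj (x : algC) : root (Phi n c algC) x -> root (Phi n c algC) x^*.
Proof.
rewrite -{2}(map_Phi Num.conj) => rx.
by rewrite /root horner_map fmorph_eq0.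
Qed.

(** For a root [x] with x^d = 1, the conjugate is a root with the same d-th power, so nondegeneracy
    makes [x] real. Then x is 1 or -1, which the values of [Phi] at these points exclude. This
    allows 1 to be adjoined to the roots. *)
Lemma Phi_nondeg (rs : seq algC) : Phi n c algC = root_poly rs ->
  (Phi n c rat).[1] != 0 -> (Phi n c rat).[-1] != 0 ->
  (forall x y : algC, root (Phi n c algC) x -> root (Phi n c algC) y -> x != y ->
    forall m, (0 < m)%N -> x ^+ m != y ^+ m) ->
  1 \notin rs /\ nondeg (1 :: rs).
Proof.
move=> Drs P1 PN1 nd.
have rsE := root_poly_Phi Drs.
have n1 x d : x \in rs -> (0 < d)%N -> x ^+ d != 1.
  rewrite rsE => rx d0; apply/negP => /eqP xd.
  have [xr|xnr] := eqVneq x^* x; last first.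
    have /negP[] := nd _ _ (root_Phi_conj rx) rx xnr d d0.
    by rewrite -rmorphXn xd rmorph1.
  have nx : `|x| = 1.
    by apply/eqP; rewrite -(@pexpr_eq1 _ _ d) ?normr_ge0// -normrX xd normr1.
  have : x ^+ 2 == 1 by rewrite expr2 -{2}xr -normCK nx expr1n.
  rewrite sqrf_eq1 => /orP[] /eqP xE; move: rx; rewrite xE /root.
    by rewrite -(map_Phi (ratr : {rmorphism rat -> algC})) -(rmorph1 ratr) horner_map fmorph_eq0 (negPf P1).
  by rewrite -(map_Phi (ratr : {rmorphism rat -> algC})) -(rmorphN1 ratr) horner_map fmorph_eq0 (negPf PN1).
split; first by apply/negP => /n1/(_ (ltn0Sn 0)); rewrite expr1n eqxx.
move=> x y; rewrite !inE => /orP[/eqP->|xrs] /orP[/eqP->|yrs].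
- by rewrite eqxx.
- by move=> _ d d0; rewrite expr1n eq_sym n1.
- by move=> _ d d0; rewrite expr1n n1.
- by move: xrs yrs; rewrite !rsE; apply: nd.
Qed.

End CharacteristicPolynomial.

Lemma root_dvdp (F : fieldType) (p q : {poly F}) x : p %| q -> root p x -> root q x.
Proof. by rewrite -!dvdp_XsubCl => pq xp; apply: dvdp_trans pq. Qed.

Local Notation toC p := (@map_poly rat algC ratr p).

Lemma irreducible_root (p q : {poly rat}) (x : algC) : irreducible_poly p ->
  root (toC p) x -> root (toC q) x -> p %| q.
Proof.
move=> [p1 irr] px qx; rewrite -[p %| q]/(p %| q).
have [//|cop] : p %| q \/ coprimep p q.
  have := dvdp_gcdl p q; case: (eqVneq (size (gcdp p q)) 1%N) => [cop _|g1 gp].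
    by right; rewrite coprimep_def cop.
  by left; have := irr _ g1 gp; rewrite /eqp => /andP[_ /dvdp_trans]; apply; apply: dvdp_gcdr.
have : coprimep (toC p) (toC q) by rewrite coprimep_map.
by move/coprimep_root => /(_ _ px); rewrite -rootE qx.
Qed.

(* If [r] were the only common root of [p] and [X^m - r^m], it would lie in Q(r^m),
   say [r = h(r^m)], and then [x = h(x^m)] for every other root [x] of [p]. *)
Lemma irreducible_pow_inj (p : {poly rat}) (r : algC) (m : nat) :
  irreducible_poly p -> root (toC p) r ->
  (forall s, root (toC p) s -> s ^+ m = r ^+ m -> s = r) ->
  mup r (toC p) = 1%N -> (0 < m)%N ->
  forall x y, root (toC p) x -> root (toC p) y ->
    x ^+ m = y ^+ m -> x = y.
Proof.
move=> irr pr only simple m0.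
suff [h hr] : exists h : {poly rat}, r = (toC h).[r ^+ m].
  suff H z : root (toC p) z -> z = (toC h).[z ^+ m].
    by move=> x y px py xy; rewrite (H _ px) (H _ py) xy.
  move=> pz; pose q := h \Po 'X^m - 'X.
  have qE t : (toC q).[t] = (toC h).[t ^+ m] - t :> algC.
    by rewrite rmorphB /= map_comp_poly map_polyXn map_polyX hornerD hornerN hornerX horner_comp hornerXn.
  have /dvdpP[q' qq'] : p %| q.
    by apply: irreducible_root irr pr _; rewrite rootE qE -hr subrr.
  have /eqP : (toC q).[z] = 0 by rewrite qq' rmorphM hornerM (rootP pz) mulr0.
  by rewrite qE subr_eq0 => /eqP.
have [Q [QC [s /= Ds gen]]] := num_field_exists [:: r].
case: s Ds gen => [//|t [|//]] [Dt] _.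
pose K1 := <<1; t ^+ m>>%VS.
pose mp : {poly algC} := map_poly QC (minPoly K1 t).
have QCr (f : {poly rat}) : map_poly QC (map_poly (in_alg Q) f) = toC f.
  rewrite -map_poly_comp; apply: eq_map_poly => a /=.
  by rewrite alg_num_field fmorph_rat.
have over (f : {poly rat}) : map_poly (in_alg Q) f \is a polyOver K1.
  by apply/polyOverP => i; rewrite coef_map /= rpredZ ?rpred1.
have mpp : mp %| toC p.
  rewrite -QCr dvdp_map; apply: minPoly_dvdp; first exact: over.
  by rewrite -(fmorph_root QC) QCr Dt.
have mpm : mp %| 'X^m - (r ^+ m)%:P.
  have -> : 'X^m - (r ^+ m)%:P = map_poly QC ('X^m - (t ^+ m)%:P).
    by rewrite rmorphB /= map_polyXn map_polyC /= (rmorphXn QC) Dt.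
  rewrite dvdp_map; apply: minPoly_dvdp.
    by rewrite rpredB ?rpredX ?polyOverX// polyOverC memv_adjoin.
  by rewrite /root hornerD hornerN hornerXn hornerC subrr.
(* By [only], the minimal polynomial of [t] over Q(t^m) has no root besides [r], and [r] is a simple
   root of [p]. *)
have sz2 : (size (minPoly K1 t) <= 2)%N.
  have [ss Dss] := closed_field_poly_normal mp.
  have mon : mp \is monic by rewrite map_monic monic_minPoly.
  rewrite (monicP mon) scale1r in Dss.
  have allr : all (pred1 r) ss.
    apply/allP => s ss_s /=; apply/eqP; apply: only.
      by apply: (root_dvdp mpp); rewrite Dss root_prod_XsubC.
    have : root ('X^m - (r ^+ m)%:P) s.
      by apply: (root_dvdp mpm); rewrite Dss root_prod_XsubC.
    by rewrite /root hornerD hornerN hornerXn hornerC subr_eq0 => /eqP.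
  have p0 : toC p != 0.
    by rewrite /= map_poly_eq0; have [p1 _] := irr; apply: contraTneq p1 => ->; rewrite size_poly0.
  have : ('X - r%:P) ^+ size ss %| toC p.
    apply: dvdp_trans mpp; rewrite Dss.
    suff -> : \prod_(z <- ss) ('X - z%:P) = ('X - r%:P) ^+ size ss by exact: dvdpp.
    elim: ss allr {Dss} => [|z ss IHs]; first by rewrite big_nil expr0.
    by move=> /= /andP[/eqP-> /IHs IH]; rewrite big_cons IH exprS.
  rewrite -mup_geq// simple => sz1.
  have : size mp = (size ss).+1 by rewrite Dss size_prod_XsubC.
  by rewrite size_map_poly => ->.
have tK : t \in K1.
  have deg1 : adjoin_degree K1 t == 1%N.
    by rewrite eqn_leq -ltnS -size_minPoly sz2.
  by rewrite -adjoin_deg_eq1.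
have /Fadjoin_polyP[f f1 tE] := tK.
have [g Dg] : exists g : {poly rat}, f = map_poly (in_alg Q) g.
  have fi i : exists b : rat, f`_i == b%:A by have /vlineP[b ->] := polyOverP f1 i; exists b.
  exists (\poly_(i < size f) xchoose (fi i)).
  apply/polyP => i; rewrite coef_map coef_poly /=.
  case: ltnP => lt_i; first exact/eqP/(xchooseP (fi i)).
  by rewrite nth_default// scale0r.
exists g; rewrite -QCr -Dg -Dt -(rmorphXn QC) horner_map.
by rewrite -tE.
Qed.

Section NondegenerateRecurrence.
Variables (n : nat) (c u : nat -> nat).
Hypotheses (n_ge2 : (2 <= n)%N) (cn0 : c n <> 0%N).
Hypotheses (u_rec : linear_recurrence n c u).
Hypothesis (u_neq0 : exists2 i, (i < n)%N & u i <> 0%N).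

(** If [u 1] were zero with [u 0] nonzero, the ratio would be zero and so would [u n]; but [u n] is
    at least c_n u_0. *)
Lemma geometric_start (q : algC) : (forall k, (u k.+1)%:R = q * (u k)%:R) ->
  (forall k, (u k)%:R = q ^+ k * (u 0%N)%:R) /\ (u 0%N <> 0%N) /\ (u 1%N <> 0%N).
Proof.
move=> geo; have uE k : (u k)%:R = q ^+ k * (u 0%N)%:R.
  by elim: k => [|k IHk]; rewrite ?expr0 ?mul1r// geo IHk exprS mulrA.
have u0 : u 0%N <> 0%N.
  move=> u0; have [i _] := u_neq0; apply.
  by apply/eqP; rewrite -(pnatr_eq0 algC) uE u0 mulr0.
split=> //; split=> // u1.
have q0 : q = 0.
  move/eqP: (geo 0%N); rewrite u1 eq_sym mulf_eq0 pnatr_eq0 => /orP[/eqP//|/eqP].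
  by move/u0.
have : u n = 0%N.
  by apply/eqP; rewrite -(pnatr_eq0 algC) uE q0 expr0n; case: n n_ge2 => // m _; rewrite mul0r.
have := u_rec 0%N; rewrite add0n => -> /eqP.
rewrite big_nat_recr /=; last by case: n n_ge2.
by rewrite addn_eq0 subnn muln_eq0 => /andP[_] /orP[] /eqP.
Qed.

Lemma condR_infty_nondeg : condR_infty n c u ->
  exists2 rs, Phi n c algC = root_poly rs &
  (1 \notin rs /\ nondeg (1 :: rs)) /\ ~ exists q : algC, forall k, (u k.+1)%:R = q * (u k)%:R.
Proof.
move=> [[P1 PN1] nd ng]; have [rs Drs] := Phi_roots_exist n_ge2 cn0.
exists rs => //; split.
  apply: (Phi_nondeg Drs P1 PN1) => x y rx ry xy m m0.
  apply: contra (nd x y rx ry xy m m0) => /eqP xym.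
  have y0 := root_Phi_neq0 n_ge2 cn0 ry.
  by rewrite unity_rootE exprMn xym -exprMn mulfV// expr1n.
move=> [q geo]; apply: ng; have [uE [u0 u1]] := geometric_start geo.
split=> // k _; apply/eqP; rewrite -(eqr_nat algC) natrX natrM (uE k) (uE k.+1) (uE k.+2).
by apply/eqP; rewrite !exprS; ring.
Qed.

(** The dominant root [r1] is simple and no other root has its absolute value, so no other root
    shares its m-th power; irreducibility carries this over to every root. A geometric progression
    would have a rational ratio, hence give [Phi] a rational root. *)
Lemma condR_prime_nondeg : condR_prime n c ->
  exists2 rs, Phi n c algC = root_poly rs &
  (1 \notin rs /\ nondeg (1 :: rs)) /\ ~ exists q : algC, forall k, (u k.+1)%:R = q * (u k)%:R.
Proof.
move=> [irr [r1 [rho [Dr dom]]]].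
have sz : size (Phi n c rat) = n.+1 by apply: size_Phi.
have noroot (q : rat) : ~~ root (Phi n c rat) q.
  apply/negP => rq; have := irr.2 ('X - q%:P); rewrite size_XsubC => /(_ isT).
  rewrite dvdp_XsubCl rq => /(_ isT) /eqp_size; rewrite size_XsubC sz.
  by move: n_ge2; lia.
have PhiC : map_poly ratr (Phi n c rat) = Phi n c algC by apply: map_Phi.
exists (r1 :: rho) => //; split.
  apply: (Phi_nondeg Dr).
  - by have := noroot 1; rewrite /root.
  - by have := noroot (-1); rewrite /root.
  have r1r : root (Phi n c algC) r1 by rewrite Dr root_prod_XsubC mem_head.
  move=> x y rx ry xy m m0; apply: contra xy => /eqP xym; apply/eqP.
  have mup1 : mup r1 (Phi n c algC) = 1%N.
    apply/eqP; rewrite eqn_leq; apply/andP; split; last first.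
      by rewrite mup_geq ?monic_neq0 ?Phi_monic// expr1 dvdp_XsubCl.
    rewrite leqNgt; apply/negP; rewrite mup_geq ?monic_neq0 ?Phi_monic//.
    rewrite Dr /root_poly big_cons expr2 dvdp_mul2l ?polyXsubC_eq0//.
    rewrite dvdp_XsubCl root_prod_XsubC => /dom lt1.
    have r10 : 0 <= r1 by apply: le_trans (ltW lt1).
    by rewrite ger0_norm// ltxx in lt1.
  apply: (@irreducible_pow_inj _ r1 m irr); rewrite ?PhiC// => s rs srm.
  move: rs; rewrite Dr root_prod_XsubC inE => /orP[/eqP//|/dom ds].
  have r10 : 0 <= r1 by apply: le_trans (ltW ds).
  have : `|s| ^+ m = r1 ^+ m by rewrite -normrX srm normrX ger0_norm.
  by move/eqP; rewrite eqrXn2 ?normr_ge0// => /eqP se; rewrite se ltxx in ds.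
move=> [q geo]; have [uE [u0 u1]] := geometric_start geo.
pose q' : rat := (u 1%N)%:R / (u 0%N)%:R.
have qE : q = ratr q'.
  rewrite fmorph_div !rmorph_nat (uE 1%N) expr1 mulfK// pnatr_eq0; exact/eqP.
suff : root (Phi n c algC) q by rewrite qE -PhiC fmorph_root; apply/negP/noroot.
have u0C : (u 0%N)%:R != 0 :> algC by rewrite pnatr_eq0; apply/eqP.
apply/eqP; apply: (mulIf u0C); rewrite mul0r.
rewrite /Phi hornerD hornerN hornerXn horner_sum mulrBl -uE.
have := u_rec 0%N; rewrite add0n => ->; rewrite natr_sum big_distrl /= -sumrB.
apply: big1_seq => i; rewrite mem_index_iota => /andP[_ /andP[_ lt_in]].
by rewrite hornerZ hornerXn natrM uE -mulrA subrr.
Qed.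

Lemma condR_nondeg (v : place) : condR n c u v ->
  exists2 rs, Phi n c algC = root_poly rs &
  (1 \notin rs /\ nondeg (1 :: rs)) /\ ~ exists q : algC, forall k, (u k.+1)%:R = q * (u k)%:R.
Proof. by case: v => [|p pp]; [apply: condR_infty_nondeg|apply: condR_prime_nondeg]. Qed.

End NondegenerateRecurrence.

(** * Growth of the recurrence *)

Lemma linear_le_exp2 (A B : nat) : exists I, forall i, (I <= i)%N -> (A * i + B <= 2 ^ i)%N.
Proof.
pose m := (A + B + 2)%N; exists (3 * m)%N => i /subnK <-.
elim: (i - 3 * m)%N => [|j IHj]; last first.
  have leA : (A <= A * (j + 3 * m))%N by apply: leq_pmulr; rewrite /m; lia.
  rewrite addSn expnS mulnS; move: IHj leA; move: (2 ^ _)%N (A * _)%N => X Y; lia.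
have -> : (2 ^ (0 + 3 * m) = 2 ^ m * (2 ^ m * 2 ^ m))%N by rewrite -!expnD; congr (2 ^ _)%N; lia.
have : (m.+1 <= 2 ^ m)%N by apply: ltn_expl.
have : (A <= m)%N by rewrite /m; lia.
have : (B <= m)%N by rewrite /m; lia.
by move: (2 ^ m)%N => X; nia.
Qed.

(* The numerical semigroup generated by [I] and [n] contains all large integers
   as soon as the gcd is [1]: it meets every residue class modulo [n]. *)
Lemma semigroup_cofinite (n : nat) (P : nat -> Prop) : (0 < n)%N -> P n -> P 0%N ->
  (forall x y, P x -> P y -> P (x + y)%N) ->
  (forall d, (forall x, P x -> d %| x)%N -> d = 1%N) ->
  exists s0, forall s, (s0 <= s)%N -> P s.
Proof.
move=> n0 Pn P0 Padd Pgcd.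
have Pmul k x : P x -> P (k * x)%N.
  by move=> Px; elim: k => [|k IHk]; rewrite ?mul0n// mulSn; apply: Padd.
pose T x := exists2 t, P t & t = x %[mod n].
have Tadd x y : T x -> T y -> T (x + y)%N.
  move=> [t Pt tx] [r Pr ry]; exists (t + r)%N; first exact: Padd.
  by rewrite -modnDm tx ry modnDm.
have Tmul k x : T x -> T (k * x)%N.
  by move=> [t Pt tx]; exists (k * t)%N; [apply: Pmul|rewrite -modnMmr tx modnMmr].
have Tgcd x y : (0 < x)%N -> T x -> T y -> T (gcdn x y).
  move=> x0 Tx Ty; case: (egcdnP y x0) => km kn kE _.
  have [t Pt tE] : T (km * x + (n.-1 * kn) * y)%N by apply: Tadd; apply: Tmul.
  exists t => //; rewrite tE kE addnAC -mulnDl -{1}(mul1n kn) -mulnDl add1n prednK//.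
  by rewrite -mulnA mulnC modnMDl.
have TP x : P x -> T x by exists x.
have [g [g0 Tg gdvd]] : exists g, [/\ (0 < g)%N, T g & forall x, P x -> (g %| x)%N].
  have exT : exists g, (0 < g)%N && `[< T g >] by exists n; rewrite n0; apply/asboolP/TP.
  exists (ex_minn exT); case: ex_minnP => g /andP[g0 /asboolP Tg] ming; split=> // x Px.
  have := ming (gcdn g x); rewrite gcdn_gt0 g0 => /(_ (asboolT _)) => H.
  have /H le : T (gcdn g x) by apply: Tgcd => //; apply: TP.
  have : gcdn g x = g by apply/eqP; rewrite eqn_leq le dvdn_leq// dvdn_gcdl.
  by move=> <-; rewrite dvdn_gcdr.
have T1 : T 1%N by rewrite -(Pgcd g gdvd).
have TA x : T x by rewrite -(muln1 x); apply: Tmul.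
pose t x := s2val (cid2 (TA x)).
exists (\sum_(i < n) t i)%N => s le_s.
have ts : (t (s %% n) <= s)%N.
  apply: leq_trans le_s; rewrite (bigD1 (Ordinal (ltn_pmod s n0)))//= leq_addr//.
have Pt : P (t (s %% n)%N) by rewrite /t; case: cid2.
have tmod : t (s %% n)%N = s %[mod n] by rewrite /t; case: cid2 => r /= _ ->; rewrite modn_mod.
rewrite -(subnK ts); apply: Padd => //.
have /dvdnP[q ->] : (n %| s - t (s %% n))%N by rewrite -eqn_mod_dvd// tmod.
exact: Pmul.
Qed.

Section Growth.
Variables (n : nat) (c u : nat -> nat).
Hypotheses (n_ge2 : (2 <= n)%N) (cn0 : c n <> 0%N).
Hypotheses (u_rec : linear_recurrence n c u).
Hypothesis (u_neq0 : exists2 i, (i < n)%N & u i <> 0%N).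
Variable rs : seq algC.
Hypotheses (Drs : Phi n c algC = root_poly rs) (rs1 : 1 \notin rs) (nd : nondeg (1 :: rs)).

Lemma rec_le k i : (n <= k)%N -> (1 <= i <= n)%N -> (c i * u (k - i) <= u k)%N.
Proof.
move=> nk i1n; rewrite -{2}(subnK nk) u_rec subnK//.
rewrite (bigD1_seq i) ?mem_index_iota ?iota_uniq//=; exact: leq_addr.
Qed.

Let step i := (1 <= i <= n)%N /\ c i <> 0%N.
(** The numerical semigroup generated by the indices of the nonzero coefficients. From index [n] on,
    [u] does not decrease along steps in it. *)
Let reach s := exists2 l : seq nat, sumn l = s & forall i, i \in l -> step i.

Lemma reach_le s k : reach s -> (n <= k)%N -> (u k <= u (k + s))%N.
Proof.
move=> [l <- stl] nk; elim: l k nk stl => [|i l IHl] k nk stl; first by rewrite addn0.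
have [i1n ci] := stl i (mem_head _ _).
apply: (@leq_trans (u (k + i))); last first.
  rewrite /= addnA; apply: IHl => [|j jl]; first by rewrite (leq_trans nk)// leq_addr.
  by apply: stl; rewrite inE jl orbT.
have := @rec_le (k + i)%N i; rewrite addnK => /(_ _ i1n) H.
by apply: leq_trans (H _); rewrite ?leq_pmull ?lt0n ?(leq_trans nk) ?leq_addr//; apply/eqP.
Qed.

(** If [d] divides all these indices, in particular [n], then [Phi] is a polynomial in X^d.
    Multiplying a root by a primitive d-th root of unity gives another root, against nondegeneracy
    unless d = 1. *)
Lemma reach_gcd1 d : (forall x, reach x -> d %| x)%N -> d = 1%N.
Proof.
move=> dvd.
have stepd i : step i -> (d %| i)%N.
  by move=> si; apply: dvd; exists [:: i]; rewrite /= ?addn0// => j; rewrite inE => /eqP->.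
have stn : step n by split=> //; rewrite leqnn andbT ltnW.
have dn := stepd n stn.
have d0 : (0 < d)%N by rewrite (dvdn_gt0 _ dn)// ltnW.
apply/eqP; rewrite eqn_leq d0 andbT leqNgt; apply/negP => d1.
have [z prz] := C_prim_root_exists d0.
have rsn : rs != [::].
  apply/eqP => rs0; have := size_Phi n_ge2 cn0 algC.
  by rewrite Drs rs0 /root_poly big_nil size_poly1; move: n_ge2; lia.
case: rs rsn Drs nd => // x rs' _ Drs' nd'.
have rx : root (Phi n c algC) x by rewrite Drs' /root_poly root_prod_XsubC mem_head.
have z1 e : (d %| e)%N -> z ^+ e = 1 by rewrite (prim_order_dvd prz) => /eqP.
have rzx : root (Phi n c algC) (z * x).
  rewrite /root /Phi hornerD hornerN hornerXn horner_sum exprMn z1// mul1r.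
  have := rx; rewrite /root /Phi hornerD hornerN hornerXn horner_sum.
  congr (is_true (_ - _ == 0)); apply: eq_big_nat => i i1n.
  rewrite !hornerZ !hornerXn exprMn; have [->|/eqP ci] := eqVneq (c i) 0%N; first by rewrite !mul0r.
  by rewrite z1 ?mul1r// dvdn_sub// stepd.
have x0 := root_Phi_neq0 n_ge2 cn0 rx.
have zn1 : z != 1.
  apply: contraTneq d1 => z1'; rewrite -leqNgt; apply: dvdn_leq => //.
  by rewrite (prim_order_dvd prz) z1' expr1n.
have : (z * x) ^+ d != x ^+ d.
  apply: nd' => //.
  - by move: rzx; rewrite Drs' /root_poly root_prod_XsubC => H; rewrite in_cons H orbT.
  - by rewrite inE mem_head orbT.
  - by rewrite -{2}(mul1r x) (inj_eq (mulIf x0)).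
by rewrite exprMn z1// mul1r eqxx.
Qed.

Lemma growth_mono : exists s0, forall k K, (n <= k)%N -> (k + s0 <= K)%N -> (u k <= u K)%N.
Proof.
have [||x y|d|s0 Hs0] := @semigroup_cofinite n reach (ltnW n_ge2).
- exists [:: n]; first by rewrite /= addn0.
  by move=> i; rewrite inE => /eqP->; split=> //; rewrite leqnn andbT ltnW.
- by exists [::].
- move=> [l <- stl] [l' <- stl']; exists (l ++ l'); first by rewrite sumn_cat.
  by move=> i; rewrite mem_cat => /orP[/stl|/stl'].
- exact: reach_gcd1.
exists s0 => k K nk kK; have kK' : (k <= K)%N by rewrite (leq_trans (leq_addr _ _) kK).
by rewrite -(subnKC kK'); apply: reach_le => //; apply: Hs0; rewrite leq_subRL.
Qed.

(** Otherwise the sum, which is at least c_n, equals 1, and 1 is a root of [Phi]. This is the source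
    of exponential growth. *)
Lemma sum_c_ge2 : (2 <= \sum_(1 <= i < n.+1) c i)%N.
Proof.
rewrite leqNgt; apply/negP; rewrite ltnS => sum1.
have cn1 : (1 <= c n)%N by rewrite lt0n; apply/eqP.
have : root (Phi n c algC) 1.
  rewrite /root /Phi hornerD hornerN hornerXn horner_sum expr1n.
  under eq_bigr => i _ do rewrite hornerZ hornerXn expr1n mulr1.
  rewrite -natr_sum; suff -> : (\sum_(1 <= i < n.+1) c i)%N = 1%N by rewrite subrr.
  apply/eqP; rewrite eqn_leq sum1 big_nat_recr /=; last by case: n n_ge2.
  by rewrite (leq_trans cn1)// leq_addl.
by rewrite Drs /root_poly root_prod_XsubC (negPf rs1).
Qed.

Lemma growth_double : exists2 s1, (0 < s1)%N &
  forall k K, (n <= k)%N -> (k + s1 <= K)%N -> (2 * u k <= u K)%N.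
Proof.
have [s0 Hs0] := growth_mono; exists (s0 + n)%N; first by rewrite addn_gt0 orbC ltnW.
move=> k K nk kK; have nK : (n <= K)%N by lia.
rewrite -(subnK nK) u_rec subnK//.
apply: (@leq_trans (\sum_(1 <= i < n.+1) c i * u k)%N).
  by rewrite -big_distrl leq_mul2r sum_c_ge2 orbT.
rewrite big_nat [leqRHS]big_nat; apply: leq_sum => i /andP[i1 i2].
by rewrite leq_mul2l Hs0 ?orbT//; lia.
Qed.

Lemma growth_pos : exists k1, forall k, (k1 <= k)%N -> (n <= k)%N && (0 < u k)%N.
Proof.
have [s0 Hs0] := growth_mono.
have [j nj uj] : exists2 j, (n <= j)%N & (0 < u j)%N.
  have [i lt_in ui] := u_neq0; exists (i + n)%N; first exact: leq_addl.
  have := @rec_le (i + n)%N n (leq_addl _ _); rewrite addnK leqnn andbT => /(_ (ltnW n_ge2)).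
  by apply: leq_trans; rewrite muln_gt0 !lt0n; apply/andP; split; apply/eqP.
exists (j + s0)%N => k jk; rewrite (leq_trans uj) ?Hs0//; lia.
Qed.

Lemma growth_upper : exists C k1, forall k, (k1 <= k)%N ->
  [/\ (n <= k)%N, (0 < u k)%N & forall j K, (K <= k + j)%N -> (u K <= C ^ j.+1 * u k)%N].
Proof.
have [s0 Hs0] := growth_mono; have [k1 Hk1] := growth_pos.
pose B := (\sum_(1 <= i < n.+1) c i)%N; pose M := (\sum_(i < n) u i).+1.
have B1 : (0 < B)%N by apply: ltn_trans sum_c_ge2.
exists (B ^ s0.+1 * M)%N, k1 => k /Hk1/andP[nk uk]; split=> // j K Kkj.
(* The exponent counts uses of the recurrence. By truncation it is zero as long as K + s0 <= k,
   where monotonicity applies; [M] covers the initial values. *)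
suff H : (u K <= B ^ (K + s0 - k) * M * u k)%N.
  apply: (leq_trans H); rewrite leq_mul2r; apply/orP; right.
  rewrite expnMn -expnM; apply: leq_mul; last by rewrite expnS leq_pmulr ?expn_gt0.
  apply: leq_pexp2l => //; nia.
elim/ltn_ind: K {Kkj} => K IHK.
have [Kn|nK] := ltnP K n.
  have uM : (u K <= M)%N by rewrite /M ltnW// ltnS (bigD1 (Ordinal Kn))//= leq_addr.
  rewrite (leq_trans uM)// -mulnA mulnCA; apply: leq_pmulr.
  by rewrite muln_gt0 uk expn_gt0 B1.
have [Kk|kK] := leqP (K + s0) k.
  rewrite (leq_trans (Hs0 K k nK Kk))// leq_pmull// muln_gt0 expn_gt0 B1//.
rewrite -{1}(subnK nK) u_rec subnK//.
apply: (@leq_trans (\sum_(1 <= i < n.+1) c i * (B ^ (K + s0 - k).-1 * M * u k))%N).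
  rewrite big_nat [leqRHS]big_nat; apply: leq_sum => i /andP[i1 i2].
  rewrite leq_mul2l; apply/orP; right; apply: leq_trans (IHK _ _) _; first by lia.
  by rewrite !leq_mul2r leq_pexp2l ?orbT//; lia.
rewrite -big_distrl /= -/B -!mulnA mulnA -expnS.
by have -> : (K + s0 - k).-1.+1 = (K + s0 - k)%N by lia.
Qed.

(** As [u] doubles within [s1] steps, the sum is comparable with its last block of [s1] terms.
    Thanks to this the height of a product of all factors up to [k] stays proportional to [u k]. *)
Lemma growth_sum : exists C k1, forall k, (k1 <= k)%N ->
  (\sum_(j < k.+1) u j <= C * u k)%N.
Proof.
have [C [k1 H1]] := growth_upper; have [s1 s10 H2] := growth_double.
have [k2 Hk2] := growth_pos.
(* One half of [C'] absorbs the last block, the other half the induction hypothesis; the further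
   summands serve the initial range. *)
pose C' := ((2 * s1 + k1 + k2 + n) * C)%N; exists C', (k1 + n)%N.
elim/ltn_ind => k IHk kk.
have [_ uk Hu] := H1 k (leq_trans (leq_addr _ _) kk).
have u1 K : (K <= k)%N -> (u K <= C * u k)%N.
  by move=> Kk; have := Hu 0%N K; rewrite addn0 expn1; apply.
have [small|big] := ltnP k (k1 + n + s1).
  apply: (@leq_trans (\sum_(j < k.+1) C * u k)%N).
    by apply: leq_sum => j _; apply: u1; rewrite -ltnS.
  rewrite sum_nat_const card_ord mulnA leq_mul2r /C' leq_mul2r; lia.
have [_ _ Hu2] := H1 (k - s1)%N ltac:(lia).
have IH := IHk (k - s1)%N ltac:(lia) ltac:(lia).
have dbl := H2 (k - s1)%N k ltac:(lia) ltac:(lia).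
have -> : k.+1 = ((k - s1).+1 + s1)%N by lia.
rewrite big_split_ord /=.
have h1 : (\sum_(i < s1) u ((k - s1).+1 + i) <= s1 * (C * u k))%N.
  apply: leq_trans (_ : \sum_(i < s1) C * u k <= _)%N; last by rewrite sum_nat_const card_ord.
  apply: leq_sum => i _; apply: u1.
  by have := ltn_ord i; lia.
have h2 : (2 * (C' * u (k - s1)) <= C' * u k)%N by rewrite mulnCA leq_mul2l dbl orbT.
have h3 : (2 * (s1 * (C * u k)) <= C' * u k)%N by rewrite /C'; nia.
apply: leq_trans (leq_add IH h1) _.
by move: h2 h3; move: (C' * u k)%N (C' * u (k - s1))%N (s1 * (C * u k))%N => X Y Z; lia.
Qed.

Lemma growth_iter A : exists J, forall j k, (J <= j)%N -> (n <= k)%N -> (A * u k <= u (k + j))%N.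
Proof.
have [s1 s10 H2] := growth_double.
have [I HI] := linear_le_exp2 0 A.
exists (I.+1 * s1)%N => j k jJ nk.
have H i K : (k + i.+1 * s1 <= K)%N -> (2 ^ i.+1 * u k <= u K)%N.
  elim: i K => [|i IHi] K kK; first by rewrite expn1; apply: H2 => //; lia.
  rewrite expnS -mulnA; apply: leq_trans (H2 (k + i.+1 * s1)%N K _ _).
  - by rewrite leq_mul2l IHi ?orbT.
  - by lia.
  - by move: kK; rewrite !mulSn; lia.
apply: leq_trans (H I _ _); last by rewrite leq_add2l.
by rewrite leq_mul2r -(add0n A) -(mul0n I.+1) HI ?orbT.
Qed.

Lemma growth_superlinear A : exists K, forall k, (K <= k)%N -> (A * k <= u k)%N.
Proof.
have [s1 s10 H2] := growth_double; have [k1 Hk1] := growth_pos.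
have H i K : (k1 + i.+1 * s1 <= K)%N -> (2 ^ i.+1 <= u K)%N.
  have [/andP[nk1 uk1]] := Hk1 k1 (leqnn _).
  elim: i K => [|i IHi] K kK.
    by rewrite expn1; apply: leq_trans (H2 k1 K _ _) => //; lia.
  rewrite expnS; apply: leq_trans (H2 (k1 + i.+1 * s1)%N K _ _).
  - by rewrite leq_mul2l IHi ?orbT.
  - by lia.
  - by move: kK; rewrite !mulSn; lia.
have [I HI] := linear_le_exp2 (A * s1) (A * (k1 + s1)).
exists (k1 + I.+1 * s1)%N => k kK.
pose i := ((k - k1) %/ s1)%N.
have iI : (I.+1 <= i)%N by rewrite /i leq_divRL//; lia.
have kE : ((k - k1) < i.+1 * s1)%N by rewrite -ltn_divLR.
have kE' : (i * s1 <= k - k1)%N by apply: leq_divM.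
case: i iI kE kE' => // i iI kE kE'.
apply: leq_trans (H i k _); last by lia.
apply: leq_trans (HI i.+1 _); last by lia.
have : (k <= s1 * i.+1 + (k1 + s1))%N by move: kE; rewrite !mulSn; lia.
by nia.
Qed.

End Growth.

(** * Exponential sums in the terms of recurrences *)

Lemma uniform_bound (T : eqType) (L : seq T) (P : T -> nat -> Prop) :
  (forall x b b', (b <= b')%N -> P x b -> P x b') ->
  (forall x, x \in L -> exists b, P x b) -> exists b, forall x, x \in L -> P x b.
Proof.
move=> mono; elim: L => [|x L IHL] H; first by exists 0%N.
have [b Hb] := IHL (fun y yL => H y (mem_behead (s := x :: L) yL)).
have [b' Hb'] := H x (mem_head _ _).
exists (maxn b b') => y; rewrite inE => /orP[/eqP->|/Hb]; apply: mono.
  exact: leq_maxr.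
  exact: Hb'.
exact: leq_maxl.
Qed.

Lemma small_expr (R : realType) (x e : R) : 0 <= x -> x < 1 -> 0 < e ->
  exists N, forall k, (N <= k)%N -> x ^+ k < e.
Proof.
move=> x0 x1 e0; have xn : `|x| < 1 by rewrite ger0_norm.
have /cvgrPdist_lt/(_ e e0)[N _ HN] := cvg_expr xn.
exists N => k Nk; have := HN k Nk; rewrite sub0r normrN ger0_norm//.
exact: exprn_ge0.
Qed.

Section ExponentialSums.
Variables (n : nat) (c u : nat -> nat).
Hypotheses (n_ge2 : (2 <= n)%N) (cn0 : c n <> 0%N).
Variable rs : seq algC.
Hypotheses (Drs : Phi n c algC = root_poly rs) (rs1 : 1 \notin rs) (nd : nondeg (1 :: rs)).
Variables (R : realType) (K : valuedFieldType R) (jC : {rmorphism algC -> K}) (a : algC).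
Hypothesis (a01 : 0 < absv (jC a) < 1).

Local Notation LR := (linear_recurrence n c).

Lemma LR_act (lam : nat -> nat) : LR lam ->
  forall k, act (Phi n c algC) (fun k => (lam k)%:R) k = 0.
Proof.
move=> Llam k; rewrite act_Phi// Llam natr_sum -sumrB big1// => i _.
by rewrite natrM subrr.
Qed.

Lemma LR_add lam mu : LR lam -> LR mu -> LR (fun k => lam k + mu k)%N.
Proof.
by move=> Ll Lm k; rewrite Ll Lm -big_split; apply: eq_bigr => i _; rewrite mulnDr.
Qed.

Lemma LR_shift lam N : LR lam -> LR (fun k => lam (k + N)%N).
Proof.
move=> Ll k; rewrite addnAC Ll; apply: eq_big_nat => i /andP[_]; rewrite ltnS => le_in.
by rewrite [in RHS](_ : (k + n - i + N = k + N + n - i)%N)//; clear - le_in; lia.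
Qed.

Lemma LR_mul m lam : LR lam -> LR (fun k => m * lam k)%N.
Proof.
by move=> Ll k; rewrite Ll big_distrr; apply: eq_bigr => i _; rewrite mulnCA.
Qed.

Lemma LR_0 : LR (fun=> 0%N).
Proof. by move=> k; rewrite big1// => i _; rewrite muln0. Qed.

Lemma LR_back lam mu N : LR lam -> LR mu ->
  (forall k, (N <= k)%N -> lam k = mu k) -> lam = mu.
Proof.
move=> Ll Lm E; apply/funext => k; apply/eqP; rewrite -(eqr_nat algC) -subr_eq0; apply/eqP.
have := @act_back _ (Phi n c algC) (fun k => -1 * (mu k)%:R + (lam k)%:R) N.
rewrite Phi_coef0// => /(_ isT).
have aw j : act (Phi n c algC) (fun k => -1 * (mu k)%:R + (lam k)%:R) j = 0.
  by rewrite act_lin !LR_act// mulr0 addr0.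
move=> /(_ aw) H; rewrite addrC -mulN1r; apply: H => j Nj.
by rewrite E// mulN1r addNr.
Qed.

Lemma zero_notin_rs : 0 \notin 1 :: rs.
Proof.
rewrite inE negb_or eq_sym oner_eq0 /=; apply/negP => H.
have := @root_Phi_neq0 n c n_ge2 cn0 0; rewrite -(root_poly_Phi Drs) => /(_ H).
by rewrite eqxx.
Qed.

Definition gap B k (lam mu : nat -> nat) :=
  (lam k + B <= mu k)%N || (mu k + B <= lam k)%N.

(** A difference of two distinct recurrences is not constant, because 1 is not a root of [Phi]. So
    subtracting an integer of absolute value at most [B] leaves a nonzero sequence, with roots among
    1 and those of [Phi], and finitely many such sequences are nonzero at a common index. *)
Lemma good_index (L : seq (nat -> nat)) B k0 : (forall lam, lam \in L -> LR lam) ->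
  exists2 k, (k0 <= k)%N &
    forall lam mu, lam \in L -> mu \in L -> lam <> mu -> gap B k lam mu.
Proof.
move=> HL; pose w (x : (nat -> nat) * (nat -> nat) * nat) : nat -> algC :=
  fun k => (x.1.1 k)%:R - (x.1.2 k)%:R - (x.2%:R - B%:R).
pose W := [seq w x | x <- [seq (y, i) | y <- [seq (lam, mu) | lam <- L,
   mu <- [seq mu <- L | mu != lam]], i <- iota 0 (2 * B).+1]].
have [w' |k k0k Hk] := common_nonvanishing (r := size (1 :: rs)) (W := W) nd zero_notin_rs _ k0.
  move=> /mapP[_ /allpairsPdep[_ [i [/allpairsPdep[lam [mu [lamL muL ->]]] _ ->]]] ->].
  move: muL; rewrite mem_filter => /andP[mulam muL].
  have Ll := HL _ lamL; have Lm := HL _ muL.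
  pose del k : algC := -1 * (mu k)%:R + (lam k)%:R.
  have adel k : act (root_poly rs) del k = 0.
    by rewrite act_lin -Drs !LR_act// mulr0 addr0.
  have wE k : w (lam, mu, i) k = -1 * (i%:R - B%:R) + del k.
    by rewrite /w /del /=; ring.
  have a1 (e : algC) k : act ('X - 1%:P) (fun=> e) k = 0.
    by rewrite actD actN actC -['X]expr1 actXn mul1r subrr.
  split.
    apply: contrapT => /forallNP H; move: mulam; apply/negP; rewrite negbK; apply/eqP.
    have wz k : w (lam, mu, i) k = 0 by have /negP := H k; rewrite negbK => /eqP.
    have dz : forall k, del k = 0.
      apply: (@act_coprime _ (root_poly rs) ('X - 1%:P)) => //.
        by rewrite coprimep_XsubC /root_poly root_prod_XsubC.
      move=> k; rewrite (act_ext _ (w' := fun=> i%:R - B%:R)) ?a1// => j.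
      by have := wz j; rewrite wE mulN1r addrC => /eqP; rewrite subr_eq0 => /eqP.
    apply/funext => k; apply/eqP; rewrite -(eqr_nat algC) eq_sym -subr_eq0; apply/eqP.
    by have := dz k; rewrite /del mulN1r addrC.
  exists (1 :: rs); first by split.
  move=> k; rewrite (act_ext _ _ wE) act_lin.
  have -> : root_poly (1 :: rs) = root_poly rs * ('X - 1%:P).
    by rewrite /root_poly big_cons mulrC.
  rewrite actM act_zero; last by move=> j; apply: a1.
  by rewrite mulrC [X in act X](mulrC (root_poly rs)) actM act_zero ?mul0r ?addr0.
exists k => // lam mu lamL muL lammu; rewrite /gap; apply: contrapT => /negP.
rewrite negb_or -!ltnNge => /andP[h1 h2].
have /negP[] : w (lam, mu, (lam k + B - mu k)%N) k != 0.
  apply: Hk; apply/mapP; exists (lam, mu, (lam k + B - mu k)%N) => //.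
  apply/allpairsPdep; exists (lam, mu), (lam k + B - mu k)%N; split=> //.
    apply/allpairsPdep; exists lam, mu; split=> //.
    by rewrite mem_filter muL andbT; apply/eqP => ml; apply: lammu.
  by rewrite mem_iota add0n /=; clear - h1 h2; lia.
rewrite /w /= natrB ?natrD; last exact: ltnW.
by apply/eqP; ring.
Qed.

(** Characters of the additive monoid of sequences of natural numbers. The numerical ones, [num k],
    evaluate a^lambda at the index [k]; the others can be chosen freely. *)
Definition point (th : (nat -> nat) -> algC) :=
  th (fun=> 0%N) = 1 /\ forall lam mu, th (fun k => lam k + mu k)%N = th lam * th mu.

Definition pshift N (th : (nat -> nat) -> algC) : (nat -> nat) -> algC :=
  fun lam => th (fun k => lam (k + N)%N).

Definition num k : (nat -> nat) -> algC := fun lam => a ^+ lam k.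

Lemma point_num k : point (num k).
Proof. by split=> [|lam mu]; rewrite /num ?expr0 ?exprD. Qed.

Lemma point_shift N th : point th -> point (pshift N th).
Proof. by move=> [th0 thD]; split=> [//|lam mu]; rewrite /pshift thD. Qed.

Lemma pshift_num N k : pshift N (num k) = num (k + N).
Proof. by []. Qed.

Lemma pshiftD N M th : pshift N (pshift M th) = pshift (M + N) th.
Proof.
apply/funext => lam; rewrite /pshift; congr th; apply/funext => k.
by rewrite addnA.
Qed.

Lemma point_mul m th lam : point th -> th (fun k => m * lam k)%N = th lam ^+ m.
Proof.
move=> [th0 thD]; elim: m => [|m IHm]; first by rewrite expr0 -th0; congr th.
by rewrite exprS -IHm -thD; congr th.
Qed.

Definition ev (s : seq (algC * (nat -> nat))) th : algC := \sum_(x <- s) x.1 * th x.2.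
Definition cf (s : seq (algC * (nat -> nat))) lam : algC := \sum_(x <- s | x.2 == lam) x.1.
Definition supp (s : seq (algC * (nat -> nat))) :=
  [seq lam <- undup [seq x.2 | x <- s] | cf s lam != 0].

Lemma evE s th : ev s th = \sum_(lam <- supp s) cf s lam * th lam.
Proof.
rewrite /supp big_filter big_mkcond /=.
transitivity (\sum_(lam <- undup [seq x.2 | x <- s]) cf s lam * th lam); last first.
  by apply: eq_bigr => lam _; case: eqP => //= ->; rewrite mul0r.
under [RHS]eq_bigr => lam _ do rewrite /cf big_distrl /= big_mkcond.
rewrite exchange_big /= /ev big_seq [RHS]big_seq; apply: eq_bigr => x xs.
rewrite -big_mkcond /=; under eq_bigl => lam do rewrite eq_sym.
have -> : \sum_(i <- undup [seq y.2 | y <- s] | i == x.2) x.1 * th i =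
    \sum_(i <- undup [seq y.2 | y <- s] | i == x.2) x.1 * th x.2.
  by apply: eq_bigr => i /eqP->.
rewrite big_const_seq count_uniq_mem ?undup_uniq// mem_undup map_f//=.
by rewrite addr0.
Qed.

Lemma supp_uniq s : uniq (supp s).
Proof. by rewrite filter_uniq ?undup_uniq. Qed.

Lemma supp_LR s : (forall x, x \in s -> LR x.2) -> forall lam, lam \in supp s -> LR lam.
Proof. by move=> Ls lam; rewrite mem_filter mem_undup => /andP[_ /mapP[x /Ls Lx ->]]. Qed.

Lemma mem_supp s lam : (lam \in supp s) = (cf s lam != 0).
Proof.
rewrite mem_filter mem_undup; apply: andb_idr; apply: contraNT => nin.
rewrite /cf big_seq_cond big1// => x /andP[xs /eqP xl].
by case/negP: nin; rewrite -xl map_f.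
Qed.

Let nm (x : algC) := absv (jC x).
Let nm0 : nm 0 = 0. Proof. by rewrite /nm rmorph0 absv0. Qed.
Let nmM x y : nm (x * y) = nm x * nm y. Proof. by rewrite /nm rmorphM absvM. Qed.
Let nmX x k : nm (x ^+ k) = nm x ^+ k.
Proof. by elim: k => [|k IHk]; rewrite ?expr0 ?exprS ?nmM ?IHk// /nm rmorph1 absv1. Qed.
Let nm_ge0 x : 0 <= nm x. Proof. exact: absv_ge0. Qed.
Let nm_gt0 x : x != 0 -> 0 < nm x.
Proof. by move=> x0; rewrite lt_neqAle nm_ge0 andbT eq_sym /nm absv_eq0 fmorph_eq0. Qed.
Let nm_sum (I : Type) (r : seq I) (P : pred I) (F : I -> algC) :
  nm (\sum_(i <- r | P i) F i) <= \sum_(i <- r | P i) nm (F i).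
Proof.
apply: (big_ind2 (fun x y => nm x <= y)) => [|x1 x2 y1 y2 h1 h2|//]; first by rewrite nm0.
by rewrite /nm rmorphD; apply: le_trans (absvD _ _) _; apply: lerD.
Qed.

(** At such an index the term with the smallest exponent dominates, since |a| < 1: [B] is taken so
    that S |a|^B lies below every nonzero coefficient, where [S] is the sum of the absolute values
    of the coefficients. *)
Lemma ev_num_neq0 s : supp s != [::] -> exists B, forall k,
  (forall lam mu, lam \in supp s -> mu \in supp s -> lam <> mu -> gap B k lam mu) ->
  ev s (num k) != 0.
Proof.
move=> s0; have /andP[a0 a1] := a01; pose S := \sum_(lam <- supp s) nm (cf s lam).
have S0 : 0 <= S by apply: sumr_ge0.
have [|lam|B HB] := @uniform_bound _ (supp s) (fun lam B => forall b, (B <= b)%N -> S * nm a ^+ b < nm (cf s lam)).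
- by move=> x b b' bb' H b'' b'b''; apply: H; apply: leq_trans b'b''.
- rewrite mem_supp => /nm_gt0 cf0.
  have [|N HN] := @small_expr R (nm a) (nm (cf s lam) / (S + 1)) (nm_ge0 _) a1.
    by rewrite divr_gt0// ltr_wpDl.
  exists N => b /HN; rewrite ltr_pdivlMr ?ltr_wpDl//; apply: le_lt_trans.
  by rewrite mulrC ler_wpM2l ?exprn_ge0// lerDl.
exists B => k Hgap; apply/negP => /eqP ev0.
have [lam0 l0s lmin] : exists2 lam0, lam0 \in supp s &
    forall lam, lam \in supp s -> (lam0 k <= lam k)%N.
  have ex : exists m, [exists i : 'I_(size (supp s)), nth (fun=> 0%N) (supp s) i k == m].
    case: (supp s) s0 => // l L _; exists (l k).
    by apply/existsP; exists ord0.
  case: (ex_minnP ex) => m /existsP[i /eqP im] minm.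
  exists (nth (fun=> 0%N) (supp s) i); first by apply: mem_nth.
  move=> lam ls; rewrite im; apply: minm; apply/existsP.
  have il : (index lam (supp s) < size (supp s))%N by rewrite index_mem.
  by exists (Ordinal il); rewrite /= nth_index.
move: ev0; rewrite evE (bigD1_seq lam0) ?supp_uniq//= => /eqP; rewrite addr_eq0 => /eqP E.
have : nm (cf s lam0) * nm a ^+ lam0 k <= S * nm a ^+ B * nm a ^+ lam0 k.
  rewrite -nmX -nmM -/(num k lam0) E -mulN1r nmM.
  have -> : nm (-1) = 1 by rewrite /nm rmorphN1 absvN absv1.
  rewrite mul1r; apply: le_trans (nm_sum _ _ _) _.
  rewrite /S !mulr_suml [leRHS](bigID (fun lam => lam != lam0)) /=.
  rewrite -[leLHS]addr0 lerD ?sumr_ge0// => [|i _]; last by rewrite !mulr_ge0 ?exprn_ge0.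
  rewrite big_seq_cond [leRHS]big_seq_cond; apply: ler_sum => lam /andP[ls ll].
  have -> : nm (cf s lam * num k lam) = nm (cf s lam) * nm a ^+ lam k by rewrite nmM /num nmX.
  have -> : nm (num k lam0) = nm a ^+ lam0 k by rewrite /num nmX.
  rewrite -[leRHS]mulrA -exprD; apply: ler_wpM2l => //.
  apply: ler_wiXn2l => //; first exact: ltW.
  have := Hgap lam0 lam l0s ls; have := lmin lam ls.
  have ne : lam0 <> lam by move=> E'; rewrite E' eqxx in ll.
  case: (posnP B) => [->|B0] lmin' /(_ ne) /orP[]; lia.
rewrite ler_pM2r ?exprn_gt0// leNgt => /negP; apply; exact: HB.
Qed.

Definition expsum (p : ((nat -> nat) -> algC) -> algC) :=
  exists2 s, (forall x, x \in s -> LR x.2) & forall th, point th -> p th = ev s th.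

Definition pzero (p : ((nat -> nat) -> algC) -> algC) := forall th, point th -> p th = 0.

Lemma expsum_num_neq0 (P : seq (((nat -> nat) -> algC) -> algC)) k0 :
  (forall p, p \in P -> expsum p /\ ~ pzero p) ->
  exists2 k, (k0 <= k)%N & forall p, p \in P -> p (num k) != 0.
Proof.
move=> HP; pose good (p : ((nat -> nat) -> algC) -> algC) (L : seq (nat -> nat)) B :=
  forall k, (forall lam mu, lam \in L -> mu \in L -> lam <> mu -> gap B k lam mu) -> p (num k) != 0.
have [L [B [HL Hg]]] : exists L B, (forall lam, lam \in L -> LR lam) /\ forall p, p \in P -> good p L B.
  elim: P HP => [|p P IHP] HP; first by exists [::], 0%N.
  have [L [B [HL Hg]]] := IHP (fun q qP => HP q (mem_behead (s := p :: P) qP)).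
  have [[s Ls sE] pn0] := HP p (mem_head _ _).
  have s0 : supp s != [::].
    by apply: contra_notN pn0 => /eqP s0 th pth; rewrite sE// evE s0 big_nil.
  have [B' HB'] := ev_num_neq0 s0.
  exists (supp s ++ L), (maxn B B'); split.
    by move=> lam; rewrite mem_cat => /orP[/(supp_LR Ls)|/HL].
  have wk (B1 k : nat) lam mu : (B1 <= maxn B B')%N -> gap (maxn B B') k lam mu -> gap B1 k lam mu.
    by move=> h; rewrite /gap => /orP[] H; apply/orP; [left|right]; lia.
  move=> q; rewrite inE => /orP[/eqP->|/Hg gq] k Hk.
    rewrite sE; last exact: point_num.
    apply: HB' => lam mu l m lm; apply: wk (leq_maxr _ _) _.
    by apply: Hk => //; rewrite mem_cat ?l ?m.
  apply: gq => lam mu l m lm; apply: wk (leq_maxl _ _) _.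
  by apply: Hk => //; rewrite mem_cat ?l ?m ?orbT.
have [k k0k Hk] := good_index (L := L) B k0 HL.
by exists k => // p /Hg; apply.
Qed.

(** A sum that is nonzero at some character has a nonempty support, hence is nonzero at arbitrarily
    late numerical points. This turns identities between numbers into identities at all
    characters. *)
Lemma expsum_transfer p k0 : expsum p -> (forall k, (k0 <= k)%N -> p (num k) = 0) -> pzero p.
Proof.
move=> ep pk; apply: contrapT => pn0.
have [|k k0k /(_ p (mem_head _ _))/negP[]] := @expsum_num_neq0 [:: p] k0.
  by move=> q; rewrite inE => /eqP->.
by rewrite pk.
Qed.

Lemma pzero_cf s : (forall x, x \in s -> LR x.2) -> pzero (ev s) -> forall lam, cf s lam = 0.
Proof.
move=> Ls z lam; apply/eqP; apply: contraT; rewrite -mem_supp => ls.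
have s0 : supp s != [::] by apply: contraTneq ls => ->.
have [B HB] := ev_num_neq0 s0.
have [k _ Hk] := good_index (L := supp s) B 0 (supp_LR Ls).
by have /negP[] := HB k Hk; rewrite z//; apply: point_num.
Qed.

Lemma expsum_ext p q : (forall th, point th -> p th = q th) -> expsum p -> expsum q.
Proof. by move=> pq [s Ls sE]; exists s => // th pth; rewrite -pq// sE. Qed.

Lemma expsum_const e : expsum (fun=> e).
Proof.
exists [:: (e, fun=> 0%N)] => [x|th [th0 _]]; first by rewrite inE => /eqP->; exact: LR_0.
by rewrite /ev big_seq1 /= th0 mulr1.
Qed.

Lemma expsum_mono lam : LR lam -> expsum (fun th => th lam).
Proof.
move=> Ll; exists [:: (1, lam)] => [x|th _]; first by rewrite inE => /eqP->.
by rewrite /ev big_seq1 mul1r.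
Qed.

Lemma expsumD p q : expsum p -> expsum q -> expsum (fun th => p th + q th).
Proof.
move=> [s Ls sE] [t Lt tE]; exists (s ++ t) => [x|th pth].
  by rewrite mem_cat => /orP[/Ls|/Lt].
by rewrite sE// tE// /ev big_cat.
Qed.

Lemma expsumM p q : expsum p -> expsum q -> expsum (fun th => p th * q th).
Proof.
move=> [s Ls sE] [t Lt tE].
exists [seq (x.1 * y.1, (fun k => x.2 k + y.2 k)%N) | x <- s, y <- t] => [z|th pth].
  by move=> /allpairsPdep[x [y [/Ls Lx /Lt Ly ->]]]; apply: LR_add.
rewrite sE// tE// /ev big_allpairs_dep mulr_suml; apply: eq_bigr => x _.
rewrite mulr_sumr; apply: eq_bigr => y _ /=.
by case: pth => _ ->; rewrite mulrACA.
Qed.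

Lemma expsumN p : expsum p -> expsum (fun th => - p th).
Proof.
move=> ep; apply: (expsum_ext _ (expsumM (expsum_const (-1)) ep)) => th _.
by rewrite mulN1r.
Qed.

Lemma expsumB p q : expsum p -> expsum q -> expsum (fun th => p th - q th).
Proof. by move=> ep eq; apply: expsumD => //; apply: expsumN. Qed.

Lemma expsumX p m : expsum p -> expsum (fun th => p th ^+ m).
Proof.
move=> ep; elim: m => [|m IHm]; first exact: expsum_const.
by apply: (expsum_ext _ (expsumM ep IHm)) => th _; rewrite exprS.
Qed.

Lemma expsum_sum (I : eqType) (r : seq I) (P : pred I) (F : I -> _) :
  (forall i, i \in r -> expsum (F i)) -> expsum (fun th => \sum_(i <- r | P i) F i th).
Proof.
elim: r => [|i r IHr] H.
  by apply: (expsum_ext _ (expsum_const 0)) => th _; rewrite big_nil.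
have H1 := H i (mem_head _ _).
have H2 := IHr (fun j jr => H j (mem_behead (s := i :: r) jr)).
case: (boolP (P i)) => Pi.
  by apply: (expsum_ext _ (expsumD H1 H2)) => th _; rewrite big_cons Pi.
by apply: (expsum_ext _ H2) => th _; rewrite big_cons (negPf Pi).
Qed.

Lemma expsum_prod (I : eqType) (r : seq I) (P : pred I) (F : I -> _) :
  (forall i, i \in r -> expsum (F i)) -> expsum (fun th => \prod_(i <- r | P i) F i th).
Proof.
elim: r => [|i r IHr] H.
  by apply: (expsum_ext _ (expsum_const 1)) => th _; rewrite big_nil.
have H1 := H i (mem_head _ _).
have H2 := IHr (fun j jr => H j (mem_behead (s := i :: r) jr)).
case: (boolP (P i)) => Pi.
  by apply: (expsum_ext _ (expsumM H1 H2)) => th _; rewrite big_cons Pi.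
by apply: (expsum_ext _ H2) => th _; rewrite big_cons (negPf Pi).
Qed.

Lemma expsum_shift p N : expsum p -> expsum (fun th => p (pshift N th)).
Proof.
move=> [s Ls sE]; exists [seq (x.1, (fun k => x.2 (k + N)%N)) | x <- s] => [x|th pth].
  by move=> /mapP[y /Ls Ly ->]; apply: LR_shift.
by rewrite sE; [rewrite /ev big_map|apply: point_shift].
Qed.

Lemma pzero_shift p N : expsum p -> pzero (fun th => p (pshift N th)) -> pzero p.
Proof.
move=> ep z; apply: (expsum_transfer (k0 := N)) => // k Nk.
by have := z _ (point_num (k - N)); rewrite pshift_num subnK.
Qed.

(** Exponential sums have no zero divisors: two nonzero ones are both nonzero at a common
    [num k]. *)
Lemma pzero_mul p q : expsum p -> expsum q -> ~ pzero p ->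
  pzero (fun th => p th * q th) -> pzero q.
Proof.
move=> ep eq pn0 z; apply: contrapT => qn0.
have [|k _ Hk] := @expsum_num_neq0 [:: p; q] 0.
  by move=> r; rewrite !inE => /orP[] /eqP->.
have /eqP := z _ (point_num k); rewrite mulf_eq0 => /orP[] /negPn/negP[]; apply: Hk.
  exact: mem_head.
by rewrite inE mem_head orbT.
Qed.

(* At an index [k] where all exponents differ, and with [N] so large that the
   exponents at [k + N] are separated by more than the exponents at [k]. *)
Lemma spread (L : seq (nat -> nat)) N0 : (forall lam, lam \in L -> LR lam) ->
  exists2 N, (N0 <= N)%N & forall l l' m m', l \in L -> l' \in L -> m \in L -> m' \in L ->
    (forall k, l (k + N) + m k = l' (k + N) + m' k)%N -> l = l' /\ m = m'.
Proof.
move=> HL; have [s _ Hs] := good_index (L := L) 1 0 HL.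
pose b := (\sum_(l <- L) l s)%N.
have bP l : l \in L -> (l s <= b)%N by move=> lL; rewrite /b (big_rem l)//= leq_addr.
have [k sk Hk] := good_index (L := L) b.+1 (s + N0) HL.
exists (k - s)%N; first by lia.
move=> l l' m m' lL l'L mL m'L E.
have Es := E s; rewrite subnKC in Es; last by lia.
have ll' : l = l'.
  apply: contrapT => ll'; have := Hk l l' lL l'L ll'; rewrite /gap.
  by have := bP m mL; have := bP m' m'L; lia.
split=> //; apply: contrapT => mm'; have := Hs m m' mL m'L mm'; rewrite /gap.
by move: Es; rewrite ll'; lia.
Qed.

Hypothesis (u_rec : linear_recurrence n c u).
Hypothesis (u_neq0 : exists2 i, (i < n)%N & u i <> 0%N).
Hypothesis (u_ngeo : ~ exists q : algC, forall k, (u k.+1)%:R = q * (u k)%:R).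

(** Under such a proportionality X^t - q annihilates [u], so it shares a root [z] with [Phi]. By
    nondegeneracy no other root has the same t-th power, and [u] would be geometric. *)
Lemma u_shift_indep A B t : (0 < t)%N -> (0 < A)%N ->
  ~ (forall k, (A * u k = B * u (k + t))%N).
Proof.
move=> t0 A0 E; apply: u_ngeo.
have AC : A%:R != 0 :> algC by rewrite pnatr_eq0 -lt0n.
have BC : B%:R != 0 :> algC.
  rewrite pnatr_eq0; apply/eqP => B0; have [i _] := u_neq0; apply.
  by apply/eqP; have := E i; rewrite B0 mul0n => /eqP; rewrite muln_eq0 eqn0Ngt A0.
pose q : algC := A%:R / B%:R; pose w k : algC := (u k)%:R.
have wE k : w (k + t)%N = q * w k.
  apply: (mulfI BC); rewrite mulrA [_ * q]mulrC /q divfK// /w.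
  by rewrite -!natrM E.
have aw k : act (root_poly rs) w k = 0 by rewrite -Drs LR_act.
have aX k : act ('X^t - q%:P) w k = 0 by rewrite actD actXn actN actC wE subrr.
have [z zrs zt] : exists2 z, z \in rs & z ^+ t = q.
  apply: contrapT => /forall2NP H.
  have [i _] := u_neq0; apply; apply/eqP; rewrite -(pnatr_eq0 algC); apply/eqP.
  apply: (act_coprime _ aX aw); apply: root_poly_coprime => x xrs.
  rewrite hornerD hornerN hornerXn hornerC subr_eq0; apply/eqP => xt.
  by have [|] := H x; [apply|].
have prs := perm_to_rem zrs.
have nd' : nondeg (z :: rem z rs).
  by move=> x y; rewrite -!(perm_mem prs) => xr yr; apply: nd; rewrite inE ?xr ?yr orbT.
have nz' : 0 \notin z :: rem z rs.
  by rewrite -(perm_mem prs); apply: contra zero_notin_rs; rewrite inE => ->; rewrite orbT.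
have aw' k : act (root_poly (z :: rem z rs)) w k = 0.
  by have := aw k; rewrite /root_poly (perm_big _ prs).
have [_ geo] := nondeg_drop_root nd' nz' t0 aw'.
have [|z' _ H] := geo; last by exists z'.
by move=> k; rewrite wE zt subrr.
Qed.

End ExponentialSums.

(** * Characters at which a single factor vanishes *)

Lemma poly_common_nonroot (ps : seq {poly algC}) : (forall p, p \in ps -> p != 0) ->
  exists2 m : nat, (0 < m)%N & forall p, p \in ps -> p.[m%:R] != 0.
Proof.
move=> nz; pose q := 'X * \prod_(p <- ps) p.
have q0 : q != 0.
  by rewrite mulf_neq0 ?polyX_eq0// prodf_seq_neq0; apply/allP => p /nz.
have [m qm] : exists m : nat, q.[m%:R] != 0.
  apply: contrapT => /forallNP H.
  have : (size [seq i%:R : algC | i <- iota 0 (size q)] < size q)%N; last first.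
    by rewrite size_map size_iota ltnn.
  apply: max_poly_roots => //.
    by apply/allP => x /mapP[i _ ->]; have /negP := H i; rewrite negbK.
  by rewrite map_inj_uniq ?iota_uniq// => i j /eqP; rewrite eqr_nat => /eqP.
move: qm; rewrite hornerM hornerX mulf_eq0 negb_or pnatr_eq0 -lt0n => /andP[m0 pm].
exists m => // p pps; move: pm; rewrite horner_prod prodf_seq_neq0 => /allP/(_ p pps).
by [].
Qed.

Definition laurent (s : seq (algC * int)) (T : algC) := \sum_(x <- s) x.1 * T ^ x.2.

Lemma laurent_common_nonroot (S : seq (seq (algC * int))) :
  (forall s, s \in S -> [/\ s != [::], uniq [seq x.2 | x <- s] &
     forall x, x \in s -> x.1 != 0]) ->
  exists2 T : algC, T != 0 & forall s, s \in S -> laurent s T != 0.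
Proof.
move=> HS; pose M (s : seq (algC * int)) := (\sum_(x <- s) `|x.2|)%N.
have MP s x : x \in s -> (`|x.2| <= M s)%N.
  by move=> xs; rewrite /M (big_rem x)//= leq_addr.
pose P (s : seq (algC * int)) : {poly algC} := \sum_(x <- s) x.1 *: 'X^(absz (x.2 + (M s)%:Z)).
have ex (s : seq (algC * int)) (x : algC * int) : x \in s -> Posz (absz (x.2 + (M s)%:Z)) = x.2 + (M s)%:Z.
  by move=> /MP; move: (M s) (x.2) => m z; clear; lia.
have PE s T : T != 0 -> (P s).[T] = laurent s T * T ^+ M s.
  move=> T0; rewrite horner_sum mulr_suml big_seq [RHS]big_seq; apply: eq_bigr => x xs.
  rewrite hornerZ hornerXn -mulrA; congr (_ * _).
  by rewrite [LHS]exprnP (ex _ _ xs) expfzDr.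
have [p|m m0 Hm] := @poly_common_nonroot [seq P s | s <- S].
  move=> /mapP[s sS ->]; have [s0 us cs] := HS s sS.
  case: s s0 us cs {sS} => [//|x0 s] _ us cs.
  set s' := x0 :: s; have x0s : x0 \in s' by apply: mem_head.
  apply/negP => /eqP E0; have := congr1 (fun p : {poly algC} => p`_(absz (x0.2 + (M s')%:Z))) E0.
  rewrite coef0 coef_sum /s' big_cons coefZ coefXn eqxx mulr1 big_seq big1 ?addr0; first exact/eqP/cs.
  move=> x xs; rewrite coefZ coefXn; case: eqP => [E|]; last by rewrite mulr0.
  move: us => /= /andP[/negP[]]; apply/mapP; exists x => //.
  have xs' : x \in s' by rewrite inE xs orbT.
  apply: (addIr (M s')%:Z).
  exact: etrans (esym (ex _ _ x0s)) (etrans (congr1 Posz E) (ex _ _ xs')).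
have m0C : m%:R != 0 :> algC by rewrite pnatr_eq0 -lt0n.
exists m%:R => // s sS; have := Hm (P s) (map_f _ sS).
by rewrite PE// mulf_eq0 negb_or => /andP[].
Qed.

Section SpecialPoints.
Variables (n : nat) (c u : nat -> nat).
Hypotheses (n_ge2 : (2 <= n)%N) (cn0 : c n <> 0%N).
Variable rs : seq algC.
Hypotheses (Drs : Phi n c algC = root_poly rs) (rs1 : 1 \notin rs) (nd : nondeg (1 :: rs)).
Hypothesis (u_rec : linear_recurrence n c u).
Hypothesis (u_neq0 : exists2 i, (i < n)%N & u i <> 0%N).
Hypothesis (u_ngeo : ~ exists q : algC, forall k, (u k.+1)%:R = q * (u k)%:R).

Local Notation LR := (linear_recurrence n c).
Local Notation expsum := (expsum n c).
Local Notation "u '_sh' j" := (fun k => u (k + j)%N) (at level 2).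

Lemma u_tail_indep A B j t : (0 < t)%N -> (0 < A)%N ->
  ~ (forall s, (A * u (s + j) = B * u (s + j + t))%N).
Proof.
move=> t0 A0 E; apply: (u_shift_indep n_ge2 cn0 Drs nd u_rec u_neq0 u_ngeo t0 A0 (B := B)).
suff E' : (fun k => A * u k)%N = (fun k => B * u (k + t))%N.
  by move=> k; apply: (congr1 (fun f : nat -> nat => f k) E').
apply: (LR_back n_ge2 cn0 (N := j)).
- exact: LR_mul u_rec.
- by apply: LR_mul; apply: LR_shift.
- by move=> k jk; have := E (k - j)%N; rewrite subnK//.
Qed.

(** Proportionality of [d] to the shift of [u] by [J], written with 2 by 2 minors to avoid
    division. *)
Let prop J (d : nat -> int) := forall s, d s * (u J)%:Z = d 0%N * (u (s + J))%:Z.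

Let prop_neq0 J d : (0 < u J)%N -> prop J d -> (exists s, d s != 0) -> d 0%N != 0.
Proof.
move=> uJ pd [s ds]; apply: contraNneq ds => d0; apply/eqP.
by have := pd s; rewrite d0 mul0r => /eqP; rewrite mulf_eq0 => /orP[/eqP//|]; rewrite eqz_nat; lia.
Qed.

Let prop_J J J' d : (J < J')%N -> (0 < u J)%N -> (0 < u J')%N -> (exists s, d s != 0) ->
  prop J d -> prop J' d -> False.
Proof.
move=> JJ uJ uJ' dn0 pd pd'; have d0 := prop_neq0 uJ pd dn0.
have t0 : (0 < J' - J)%N by rewrite subn_gt0.
apply: (@u_tail_indep (u J') (u J) J _ t0 uJ') => s.
have -> : (s + J + (J' - J) = s + J')%N by lia.
apply/eqP; rewrite -eqz_nat !PoszM -(inj_eq (mulfI d0)); apply/eqP.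
by rewrite mulrCA -(pd s) [RHS]mulrCA -(pd' s); ring.
Qed.

Let prop_N J N N' d : (N < N')%N -> (0 < u J)%N -> (exists s, d (s + N)%N != 0) ->
  prop J (fun s => d (s + N)%N) -> prop J (fun s => d (s + N')%N) -> False.
Proof.
move=> NN uJ dn0 pd pd'; have d0 := prop_neq0 uJ pd dn0; rewrite add0n in d0.
have t0 : (0 < N' - N)%N by rewrite subn_gt0.
have pt s : d (s + N')%N * (u J)%:Z = d N * (u (s + J + (N' - N)))%:Z.
  by have := pd (s + (N' - N))%N; rewrite !add0n addnAC (_ : s + N + _ = s + N')%N ?[X in _ = _ * (u X)%:Z](_ : _ = s + J + (N' - N))%N//; lia.
have uJt : (0 < u (J + (N' - N)))%N.
  rewrite lt0n; apply/eqP => u0; have := pt 0%N; rewrite !add0n u0 mulr0 => /eqP.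
  rewrite mulf_eq0 eqz_nat (gtn_eqF uJ) orbF => /eqP dN'.
  have [k1 Hk1] := growth_pos n_ge2 cn0 u_rec u_neq0 Drs rs1 nd.
  have := pd' k1; rewrite add0n dN' mul0r pt => /eqP; rewrite mulf_eq0 (negPf d0) eqz_nat.
  by have := Hk1 (k1 + J + (N' - N))%N; lia.
apply: (@u_tail_indep (u (J + (N' - N))) (u J) J _ t0 uJt) => s.
apply/eqP; rewrite -eqz_nat !PoszM -(inj_eq (mulfI d0)); apply/eqP.
have := pt 0%N; have := pt s; have := pd' s; rewrite !add0n.
move: (d _) (d _) (d _) (u J)%:Z (u (s + J))%:Z (u (s + J + _))%:Z (u (J + _))%:Z.
move=> x y z U V W X e1 e2 e3; rewrite mulrA -e3 mulrAC -e1 e2; ring.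
Qed.

(** The character is th(lam) = B^(lam 0) T^(g lam), where B^(u J) = 1/b and g(d) is the sum over s <
    S of (d_s u_J - d_0 u_(s+J)) y^s, which is additive with integer values. As g kills the shift of
    [u] by [J], the factor of index [J] vanishes. A sequence not proportional to that shift has g(d)
    nonzero for a suitable integer [y]; the remaining conditions then say that finitely many nonzero
    Laurent polynomials do not vanish at [T]. *)
Lemma special_point (P : seq (((nat -> nat) -> algC) -> algC)) (bs : seq algC) b :
  b != 0 -> (forall p, p \in P -> exists s, [/\ supp s != [::],
     forall x, x \in s -> LR x.2 & forall th, point th -> p th = ev s th]) ->
  exists J N th, [/\ (J < N)%N, point th, b * th (u _sh J) = 1,
    forall p, p \in P -> p th != 0 /\ p (pshift N th) != 0 &
    forall j b', (j < N)%N -> j != J -> b' \in bs -> 1 - b' * th (u _sh j) != 0].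
Proof.
move=> b0 HP.
have [k1 Hk1] := growth_pos n_ge2 cn0 u_rec u_neq0 Drs rs1 nd.
pose dif (x : (nat -> nat) * (nat -> nat)) (s : nat) : int := (x.1 s)%:Z - (x.2 s)%:Z.
have [L [HL HPL]] : exists L : seq (nat -> nat), (forall lam, lam \in L -> LR lam) /\
    forall p, p \in P -> exists s, [/\ supp s != [::], {subset supp s <= L} &
      forall th, point th -> p th = ev s th].
  elim: P HP => [|p P IHP] HP; first by exists [::].
  have [L [HL HPL]] := IHP (fun q qP => HP q (mem_behead (s := p :: P) qP)).
  have [s [s0 Ls sE]] := HP p (mem_head _ _).
  exists (supp s ++ L); split=> [lam|q].
    by rewrite mem_cat => /orP[/(supp_LR Ls)|/HL].
  rewrite inE => /orP[/eqP->|/HPL[t [t0 tL tE]]].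
    by exists s; split=> // lam ls; rewrite mem_cat ls.
  by exists t; split=> // lam /tL lL; rewrite mem_cat lL orbT.
pose pairs := [seq (l, m) | l <- L, m <- [seq m <- L | m != l]].
have pairsP x : x \in pairs -> [/\ LR x.1, LR x.2 & x.1 != x.2].
  move=> /allpairsPdep[l [m [lL]]]; rewrite mem_filter => /andP[ml mL] -> /=.
  by rewrite eq_sym; split=> //; apply: HL.
have mem_pairs l m : l \in L -> m \in L -> l != m -> (l, m) \in pairs.
  move=> lL mL lm; apply/allpairsPdep; exists l, m; split=> //.
  by rewrite mem_filter mL eq_sym lm.
have dif_tail x : x \in pairs -> forall N, exists s, dif x (s + N)%N != 0.
  move=> /pairsP[L1 L2 ne] N; apply: contrapT => /forallNP H.
  move/eqP: ne; apply; apply: (LR_back n_ge2 cn0 (N := N)) => // k Nk.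
  by have /negP := H (k - N)%N; rewrite negbK /dif subr_eq0 eqz_nat subnK// => /eqP.
(* A nonzero difference is proportional to at most one of the shifts of [u] with J >= k1, so every
   large [J] suits all pairs. *)
have [|x xp|J0 HJ0] := @uniform_bound _ pairs
    (fun x b => forall J, (b <= J)%N -> (k1 <= J)%N -> ~ prop J (dif x)).
- by move=> x b1 b2 b12 H J b2J; apply: H; apply: leq_trans b2J.
- have d0 := dif_tail x xp; apply: contrapT => /forallNP H.
  have ex b1 : exists J, [/\ (b1 <= J)%N, (k1 <= J)%N & prop J (dif x)].
    have /existsNP[J /not_implyP[h1 /not_implyP[h2 /contrapT h3]]] := H b1.
    by exists J.
  have [J [_ kJ pJ]] := ex 0%N; have [J' [JJ' kJ' pJ']] := ex J.+1.
  have /andP[_ uJ] := Hk1 J kJ; have /andP[_ uJ'] := Hk1 J' kJ'.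
  apply: (prop_J JJ' uJ uJ' _ pJ pJ').
  by have [s ds] := d0 0%N; exists (s + 0)%N.
pose J := maxn J0 k1.
have /andP[_ uJ] := Hk1 J (leq_maxr _ _).
have [|x xp|N0 HN0] := @uniform_bound _ pairs
    (fun x b => forall N, (b <= N)%N -> ~ prop J (fun s => dif x (s + N)%N)).
- by move=> x b1 b2 b12 H N b2N; apply: H; apply: leq_trans b2N.
- have d0 := dif_tail x xp; apply: contrapT => /forallNP H.
  have ex b1 : exists N, (b1 <= N)%N /\ prop J (fun s => dif x (s + N)%N).
    have /existsNP[N /not_implyP[h1 /contrapT h3]] := H b1.
    by exists N.
  have [N [_ pN]] := ex 0%N; have [N' [NN' pN']] := ex N.+1.
  exact: (prop_N NN' uJ (d0 N) pN pN').
pose N := maxn N0 J.+1.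
(* All sequences at which [g] must not vanish: differences of exponents, the same shifted by [N],
   and the other shifts of [u] below [N]. *)
pose D : seq (nat -> int) := [seq dif x | x <- pairs] ++
  [seq (fun s => dif x (s + N)%N) | x <- pairs] ++
  [seq (fun s => (u (s + j))%:Z) | j <- iota 0 N & j != J].
have DP d : d \in D -> ~ prop J d.
  rewrite !mem_cat => /or3P[] /mapP[x xp ->].
  - by apply: HJ0 => //; [apply: leq_maxl|apply: leq_maxr].
  - by apply: HN0 => //; apply: leq_maxl.
  move: xp; rewrite mem_filter => /andP[xJ _] pd.
  have ux : (0 < u x)%N.
    rewrite lt0n; apply/eqP => u0; have := pd k1; rewrite add0n u0 mul0r => /eqP.
    by rewrite mulf_eq0 !eqz_nat; have := Hk1 (k1 + x)%N; lia.
  case: (ltngtP x J) => // lt_x; last by rewrite lt_x eqxx in xJ.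
    have t0 : (0 < J - x)%N by rewrite subn_gt0.
    apply: (@u_tail_indep (u J) (u x) x _ t0 uJ) => s.
    have := pd s; rewrite add0n (_ : s + x + (J - x) = s + J)%N; last by lia.
    by rewrite mulrC => /eqP; rewrite -!PoszM eqz_nat => /eqP.
  have t0 : (0 < x - J)%N by rewrite subn_gt0.
  apply: (@u_tail_indep (u x) (u J) J _ t0 ux) => s.
  have := pd s; rewrite add0n (_ : s + J + (x - J) = s + x)%N; last by lia.
  by move=> /eqP; rewrite -!PoszM eqz_nat mulnC => /eqP ->; rewrite mulnC.
have [|d dD|S HS] := @uniform_bound _ D
    (fun d b => exists2 s, (s < b)%N & d s * (u J)%:Z - d 0%N * (u (s + J))%:Z != 0).
- by move=> d b1 b2 b12 [s sb H]; exists s => //; apply: leq_trans b12.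
- have /existsNP[s Hs] := DP d dD; exists s.+1, s => //.
  by rewrite subr_eq0; apply/eqP.
pose q (d : nat -> int) : {poly algC} :=
  \poly_(s < S) (d s * (u J)%:Z - d 0%N * (u (s + J))%:Z)%:~R.
have [p|y _ Hy] := @poly_common_nonroot [seq q d | d <- D].
  move=> /mapP[d /HS[s sS ds] ->]; apply: contraNneq ds => E0; have := congr1 (fun p : {poly algC} => p`_s) E0.
  by rewrite coef_poly sS coef0 => /eqP; rewrite intr_eq0.
pose g (d : nat -> int) : int :=
  \sum_(s < S) (d s * (u J)%:Z - d 0%N * (u (s + J))%:Z) * y%:Z ^+ s.
have gD d : d \in D -> g d != 0.
  move=> dD; have := Hy (q d) (map_f _ dD); apply: contraNneq => g0.
  rewrite horner_poly; apply/eqP; rewrite -[RHS](rmorph0 (intmul 1)) -g0 rmorph_sum.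
  by apply: eq_bigr => s _; rewrite rmorphM rmorphXn.
have gB d d' : g (fun s => d s - d' s) = g d - g d'.
  by rewrite /g -sumrB; apply: eq_bigr => s _; ring.
have gA d d' : g (fun s => d s + d' s) = g d + g d'.
  by rewrite /g -big_split; apply: eq_bigr => s _ /=; ring.
pose G (lam : nat -> nat) := g (fun s => (lam s)%:Z).
pose B := (u J).-root b^-1.
have BJ : b * B ^+ u J = 1 by rewrite rootCK// mulfV.
have B0 : B != 0.
  apply/eqP => B0; move: BJ; rewrite B0 expr0n (gtn_eqF uJ) mulr0 => /eqP.
  by rewrite eq_sym oner_eq0.
have GL l m : l \in L -> m \in L -> G l = G m -> l = m.
  move=> lL mL Glm; apply/eqP; apply: contraT => lm.
  have := gD (dif (l, m)); rewrite !mem_cat map_f ?mem_pairs// => /(_ isT).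
  by rewrite /dif gB -/(G l) -/(G m) Glm subrr eqxx.
have GLN l m : l \in L -> m \in L -> G (l _sh N) = G (m _sh N) -> l = m.
  move=> lL mL Glm; apply/eqP; apply: contraT => lm.
  have := gD (fun s => dif (l, m) (s + N)%N); rewrite !mem_cat.
  rewrite (map_f (fun x s => dif x (s + N)%N) (mem_pairs l m lL mL lm)) orbT => /(_ isT).
  by rewrite /dif gB -/(G (l _sh N)) -/(G (m _sh N)) Glm subrr eqxx.
pose sfor p := xget [::] [set s | [/\ supp s != [::], {subset supp s <= L} &
      forall th, point th -> p th = ev s th]].
have sforP p : p \in P -> [/\ supp (sfor p) != [::], {subset supp (sfor p) <= L} &
      forall th, point th -> p th = ev (sfor p) th].
  by move=> /HPL[s Hs]; rewrite /sfor; case: xgetP => [//|/(_ s)].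
pose l1 p := [seq (cf (sfor p) lam * B ^+ lam 0%N, G lam) | lam <- supp (sfor p)].
pose l2 p := [seq (cf (sfor p) lam * B ^+ lam N, G (lam _sh N)) | lam <- supp (sfor p)].
pose l3 (x : nat * algC) := if x.2 == 0 then [:: (1, 0)] else
  [:: (1, 0); (- x.2 * B ^+ u x.1, G (u _sh x.1))].
have [s|T T0 HT] := @laurent_common_nonroot ([seq l1 p | p <- P] ++ [seq l2 p | p <- P] ++
  [seq l3 x | x <- [seq (j, b') | j <- [seq j <- iota 0 N | j != J], b' <- bs]]).
  rewrite !mem_cat => /or3P[] /mapP[p pP ->].
  - have [s0 sL _] := sforP p pP; split.
    + by apply: contra s0; rewrite /l1; case: (supp _).
    + rewrite -map_comp map_inj_in_uniq ?supp_uniq// => l m /sL lL /sL mL; exact: GL.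
    + by move=> x /mapP[lam ls ->] /=; rewrite mulf_neq0 ?expf_neq0// -mem_supp.
  - have [s0 sL _] := sforP p pP; split.
    + by apply: contra s0; rewrite /l2; case: (supp _).
    + rewrite -map_comp map_inj_in_uniq ?supp_uniq// => l m /sL lL /sL mL; exact: GLN.
    + by move=> x /mapP[lam ls ->] /=; rewrite mulf_neq0 ?expf_neq0// -mem_supp.
  - move: pP => /allpairsPdep[j [b' [jN _ ->]]]; rewrite /l3 /=; have [b'0|b'0] := eqVneq b' 0.
      by split=> // x; rewrite inE => /eqP-> /=; apply: oner_neq0.
    split; [by []| |]; last first.
      move=> x; rewrite !inE => /orP[] /eqP-> /=; first exact: oner_neq0.
      by rewrite mulf_neq0 ?expf_neq0// oppr_eq0.
    rewrite /= inE andbT eq_sym; apply: gD; rewrite !mem_cat; apply/or3P/Or33.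
    by apply/mapP; exists j.
pose th (lam : nat -> nat) : algC := B ^+ lam 0%N * T ^ G lam.
have pth : point th.
  split=> [|l m]; rewrite /th.
    have -> : G (fun=> 0%N) = 0 by rewrite /G /g big1// => s _; ring.
    by rewrite !expr0 mulr1.
  rewrite exprD -mulrACA -expfzDr//; congr (_ * (_ ^ _)).
  by rewrite -gA; congr g; apply/funext => s; rewrite PoszD.
exists J, N, th; split=> //.
- exact: leq_maxr.
- rewrite /th add0n mulrA BJ mul1r /G /g big1 ?expr0z// => s _.
  by rewrite add0n; ring.
- move=> p pP; have [_ _ sE] := sforP p pP; rewrite !sE//; last exact: point_shift.
  rewrite !evE; split.
    have := HT (l1 p); rewrite mem_cat map_f// => /(_ isT).
    by rewrite /laurent big_map; under eq_bigr => lam _ do rewrite -mulrA.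
  have := HT (l2 p); rewrite !mem_cat (map_f l2 pP) orbT => /(_ isT).
  by rewrite /laurent big_map; under eq_bigr => lam _ do rewrite -mulrA.
- move=> j b' jN jJ b'bs; have := HT (l3 (j, b')); rewrite !mem_cat.
  rewrite (map_f l3) ?orbT => [/(_ isT)|]; last first.
    by apply/allpairsPdep; exists j, b'; split=> //; rewrite mem_filter jJ mem_iota.
  rewrite /laurent /l3 /=; have [->|_] := eqVneq b' 0; first by rewrite mul0r subr0 oner_neq0.
  by rewrite big_cons big_seq1 /= expr0z mulr1 mulNr mulNr /th add0n -!mulrA.
Qed.

End SpecialPoints.

(** * Difference equations in exponential sums *)

Section DifferenceEquations.
Variables (n : nat) (c u : nat -> nat).
Hypotheses (n_ge2 : (2 <= n)%N) (cn0 : c n <> 0%N).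
Variable rs : seq algC.
Hypotheses (Drs : Phi n c algC = root_poly rs) (rs1 : 1 \notin rs) (nd : nondeg (1 :: rs)).
Hypothesis (u_rec : linear_recurrence n c u).
Hypothesis (u_neq0 : exists2 i, (i < n)%N & u i <> 0%N).
Hypothesis (u_ngeo : ~ exists q : algC, forall k, (u k.+1)%:R = q * (u k)%:R).
Variables (R : realType) (K : valuedFieldType R) (jC : {rmorphism algC -> K}) (a : algC).
Hypothesis (a01 : 0 < absv (jC a) < 1).

Local Notation LR := (linear_recurrence n c).
Local Notation expsum := (expsum n c).
Local Notation "u '_sh' j" := (fun k => u (k + j)%N) (at level 2).
Local Notation pt := ((nat -> nat) -> algC).

Let transfer := expsum_transfer n_ge2 cn0 Drs rs1 nd a01.
Let nonvanishing := expsum_num_neq0 n_ge2 cn0 Drs rs1 nd a01.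
Let cancel_expsum := pzero_mul n_ge2 cn0 Drs rs1 nd a01.

Lemma expsum_poly (f : {poly algC}) j : expsum (fun th => f.[th (u _sh j)]).
Proof.
apply: (expsum_ext (p := fun th => \sum_(i < size f) f`_i * th (u _sh j) ^+ i)).
  by move=> th _; rewrite horner_coef.
apply: expsum_sum => i _; apply: expsumM; first exact: expsum_const.
by apply/expsumX/expsum_mono/LR_shift.
Qed.

Lemma expsum_nz_supp (p : pt -> algC) : expsum p -> ~ pzero p ->
  exists s, [/\ supp s != [::], forall x, x \in s -> LR x.2 &
    forall th, point th -> p th = ev s th].
Proof.
move=> [s Ls sE] pn0; exists s; split=> //.
by apply: contra_notN pn0 => /eqP s0 th pth; rewrite sE// evE s0 big_nil.
Qed.

Lemma pzero_unique (I : finType) (C : I -> algC) (E : I -> nat -> nat) i0 :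
  (forall i, LR (E i)) ->
  (forall th, point th -> \sum_i C i * th (E i) = 0) ->
  (forall i, i != i0 -> C i != 0 -> E i <> E i0) -> C i0 = 0.
Proof.
move=> LE z sep; pose s := [seq (C i, E i) | i <- index_enum I].
have Ls x : x \in s -> LR x.2 by move=> /mapP[i _ ->]; apply: LE.
have zs : pzero (ev s) by move=> th pth; rewrite /ev big_map z.
have := @pzero_cf n c n_ge2 cn0 rs Drs rs1 nd R K jC a a01 s Ls zs (E i0).
rewrite /cf big_map (bigD1 i0)//= big1 ?addr0// => i /andP[/eqP Ei ii0].
by apply/eqP; apply: contraT => Ci; case: (sep i ii0 Ci).
Qed.

(** The sum over j < N of e^j Q / D at the shifts u_j, multiplied by the product of all these D so
    that it keeps a meaning where one of them vanishes. *)
Fixpoint telescope_sum (e : algC) (D Q : {poly algC}) (th : pt) N : algC :=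
  if N is N'.+1 then
    e ^+ N' * Q.[th (u _sh N')] * \prod_(j < N') D.[th (u _sh j)] +
    D.[th (u _sh N')] * telescope_sum e D Q th N'
  else 0.

Lemma expsum_telescope e D Q N : expsum (fun th => telescope_sum e D Q th N).
Proof.
elim: N => [|N IHN]; first exact: expsum_const.
apply: expsumD.
  apply: expsumM; first by apply: expsumM; [apply: expsum_const|apply: expsum_poly].
  by apply: expsum_prod => j _; apply: expsum_poly.
by apply: expsumM => //; apply: expsum_poly.
Qed.

Section Telescoping.
Variables v v0 : pt -> algC.
Hypotheses (ev : expsum v) (ev0 : expsum v0) (v0_neq0 : ~ pzero v0).

Lemma shift_neq0 N : ~ pzero (fun th => v0 (pshift N th)).
Proof. by move/(pzero_shift n_ge2 cn0 Drs rs1 nd a01 ev0). Qed.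

(** Iteration of P1 f(shifted) = P0 f for the quotient f = v / v0. The value of [v0] at the
    intermediate shift is cancelled, exponential sums having no zero divisors. *)
Lemma telescope_mul (P1 P0 : {poly algC}) :
  (forall th, point th -> P1.[th u] * v (pshift 1 th) * v0 th =
                          P0.[th u] * v0 (pshift 1 th) * v th) ->
  forall N th, point th ->
    (\prod_(j < N) P1.[th (u _sh j)]) * v (pshift N th) * v0 th =
    (\prod_(j < N) P0.[th (u _sh j)]) * v0 (pshift N th) * v th.
Proof.
move=> E; elim=> [|N IHN] th pth.
  by rewrite !big_ord0 !mul1r mulrC; congr (v0 _ * v _); apply/funext => l; rewrite /pshift; congr th; apply/funext => k; rewrite addn0.
apply/eqP; rewrite -subr_eq0; apply/eqP; move: th pth.
apply: (cancel_expsum _ _ (shift_neq0 (N := N))).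
- exact: expsum_shift.
- by apply: expsumB; (apply: expsumM; first apply: expsumM); rewrite //; do ?exact: expsum_shift; apply: expsum_prod => j _; apply: expsum_poly.
move=> th pth; have := E _ (point_shift N pth); have := IHN th pth.
rewrite !pshiftD addn1 /= !big_ord_recr /=.
have -> : pshift N th u = th (u _sh N) by [].
set X := \prod_(j < N) P1.[_]; set Y := \prod_(j < N) P0.[_] => e1 e2.
rewrite mulrBr; apply/eqP; rewrite subr_eq0; apply/eqP.
transitivity (X * v0 th * (P1.[th (u _sh N)] * v (pshift N.+1 th) * v0 (pshift N th))); first by ring.
rewrite e2; transitivity (P0.[th (u _sh N)] * v0 (pshift N.+1 th) * (X * v (pshift N th) * v0 th)); first by ring.
by rewrite e1; ring.
Qed.

Lemma telescope_add e (D Q : {poly algC}) :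
  (forall th, point th -> D.[th u] * (e * v (pshift 1 th) * v0 th - v0 (pshift 1 th) * v th) =
     v0 th * v0 (pshift 1 th) * Q.[th u]) ->
  forall N th, point th ->
    (\prod_(j < N) D.[th (u _sh j)]) * (e ^+ N * v (pshift N th) * v0 th - v0 (pshift N th) * v th) =
    v0 th * v0 (pshift N th) * telescope_sum e D Q th N.
Proof.
move=> E; elim=> [|N IHN] th pth.
  have -> : pshift 0 th = th.
    by apply/funext => l; rewrite /pshift; congr th; apply/funext => k; rewrite addn0.
  by rewrite big_ord0 expr0 /= mulr0 !mul1r mulrC subrr.
apply/eqP; rewrite -subr_eq0; apply/eqP; move: th pth.
apply: (cancel_expsum _ _ (shift_neq0 (N := N))).
- exact: expsum_shift.
- apply: expsumB; apply: expsumM.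
  + by apply: expsum_prod => j _; apply: expsum_poly.
  + by apply: expsumB; do ?apply: expsumM; rewrite //; do ?exact: expsum_shift; exact: expsum_const.
  + by apply: expsumM => //; exact: expsum_shift.
  + exact: expsum_telescope.
move=> th pth; have := E _ (point_shift N pth); have := IHN th pth.
rewrite !pshiftD addn1 /= !big_ord_recr /=.
have -> : pshift N th u = th (u _sh N) by [].
move: (\prod_(_ < _) _) (telescope_sum _ _ _ _ _) => X S e1 e2.
rewrite mulrBr; apply/eqP; rewrite subr_eq0; apply/eqP; rewrite exprS.
set A := v0 (pshift N th) in e1 e2 *; set B := v0 (pshift N.+1 th) in e1 e2 *.
set G := v (pshift N th) in e1 e2 *; set H := v (pshift N.+1 th) in e1 e2 *.
set d := D.[_] in e1 e2 *; set q := Q.[_] in e1 e2 *.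
transitivity (X * v0 th * e ^+ N * (d * (e * H * A - B * G)) +
  d * B * (X * (e ^+ N * G * v0 th - A * v th))); first by ring.
by rewrite e1 e2; ring.
Qed.

End Telescoping.

(** Every term except the one of index [J] contains the vanishing factor. *)
Lemma telescope_sum_neq0 e (D Q : {poly algC}) th J N : e != 0 -> (J < N)%N ->
  D.[th (u _sh J)] = 0 -> Q.[th (u _sh J)] != 0 ->
  (forall j, (j < N)%N -> j != J -> D.[th (u _sh j)] != 0) ->
  telescope_sum e D Q th N != 0.
Proof.
move=> e0 JN DJ QJ Dj; elim: N JN Dj => [//|N IHN] JN Dj /=.
case: (ltngtP J N) => [lt_JN|lt_NJ|JE].
- rewrite (bigD1 (Ordinal lt_JN))//= DJ mul0r mulr0 add0r mulf_neq0//.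
    by apply: Dj => //; rewrite gtn_eqF.
  by apply: IHN => // j jN; apply: Dj; apply: ltnW.
- by move: JN; rewrite ltnS leqNgt lt_NJ.
- rewrite -JE DJ mul0r addr0 !mulf_neq0 ?expf_neq0//.
  apply/prodf_neq0 => j _; apply: Dj; last by rewrite ltn_eqF.
  exact: ltn_trans (ltn_ord j) JN.
Qed.

Definition pole_poly (I : finType) (b : I -> algC) (m : I -> nat) : {poly algC} :=
  \prod_i (1 - b i *: 'X) ^+ m i.

Lemma pole_polyE I b m x : (@pole_poly I b m).[x] = \prod_i (1 - b i * x) ^+ m i.
Proof.
rewrite /pole_poly horner_prod; apply: eq_bigr => i _.
by rewrite horner_exp hornerD hornerN hornerZ hornerX hornerC.
Qed.

Section PoleArguments.
Variables (I : finType) (b : I -> algC).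
Hypotheses (b_neq0 : forall i, b i != 0) (b_inj : injective b).

Lemma pole_poly_neq0 (m : I -> nat) x : (forall i, 1 - b i * x != 0) ->
  (pole_poly b m).[x] != 0.
Proof. by move=> H; rewrite pole_polyE; apply/prodf_neq0 => i _; rewrite expf_neq0. Qed.

Lemma pole_poly_pole m i : (0 < m i)%N -> (pole_poly b m).[(b i)^-1] = 0.
Proof.
move=> mi; rewrite pole_polyE (bigD1 i)//= mulfV// subrr expr0n (gtn_eqF mi).
by rewrite mul0r.
Qed.

Lemma pole_poly_nopole m i : m i = 0%N -> (pole_poly b m).[(b i)^-1] != 0.
Proof.
move=> mi; rewrite pole_polyE; apply/prodf_neq0 => j _.
have [->|ji] := eqVneq j i; first by rewrite mi expr0 oner_neq0.
rewrite expf_neq0// subr_eq0 eq_sym; apply: contra ji => /eqP E.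
by apply/eqP/b_inj; rewrite -[LHS](divfK (b_neq0 i)) E mul1r.
Qed.

(** Iterate [N] times and evaluate at a character where 1 - b_i th(u_J) is the only vanishing
    factor: the product on the left is zero, the one on the right is not. *)
Lemma no_extra_pole (v v0 : pt -> algC) x1 x0 m1 m0 i : x0 != 0 ->
  expsum v -> expsum v0 -> ~ pzero v -> ~ pzero v0 ->
  (forall th, point th -> (x1 *: pole_poly b m1).[th u] * v (pshift 1 th) * v0 th =
                          (x0 *: pole_poly b m0).[th u] * v0 (pshift 1 th) * v th) ->
  (0 < m1 i)%N -> m0 i = 0%N -> False.
Proof.
move=> x0n e1 e0 vn0 v0n0 E m1i m0i.
have [p|J [N [th [JN pth bth Hp Hb]]]] := special_point n_ge2 cn0 Drs rs1 nd u_rec u_neq0 u_ngeo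
   (P := [:: v; v0]) [seq b j | j <- enum I] (b_neq0 i).
  by rewrite !inE => /orP[] /eqP->; apply: expsum_nz_supp.
have thJ : th (u _sh J) = (b i)^-1 by rewrite -[LHS](mulKf (b_neq0 i)) bth mulr1.
have [vth _] := Hp v (mem_head _ _).
have [_ v0N] : v0 th != 0 /\ v0 (pshift N th) != 0 by apply: Hp; rewrite inE mem_head orbT.
have /eqP := telescope_mul e1 e0 v0n0 E N pth.
rewrite (bigD1 (Ordinal JN))//= hornerZ thJ pole_poly_pole// mulr0 !mul0r eq_sym !mulf_eq0.
rewrite (negPf v0N) (negPf vth) !orbF; apply/negP/prodf_neq0 => j _.
rewrite hornerZ mulf_neq0//; have [jJ|jJ] := eqVneq (j : nat) J; first by rewrite jJ thJ pole_poly_nopole.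
by apply: pole_poly_neq0 => l; apply: Hb => //; apply: map_f; rewrite mem_enum.
Qed.

(** At the same kind of character the left-hand side vanishes, while the telescoped sum keeps its
    term of index [J], which is nonzero because Q(1/b_i) is. *)
Lemma no_pole (v v0 : pt -> algC) e m (Q : {poly algC}) i : e != 0 ->
  expsum v -> expsum v0 -> ~ pzero v0 ->
  (forall th, point th -> (pole_poly b m).[th u] * (e * v (pshift 1 th) * v0 th - v0 (pshift 1 th) * v th) =
     v0 th * v0 (pshift 1 th) * Q.[th u]) ->
  (0 < m i)%N -> Q.[(b i)^-1] != 0 -> False.
Proof.
move=> en0 e1 e0 v0n0 E mi Qi.
have [p|J [N [th [JN pth bth Hp Hb]]]] := special_point n_ge2 cn0 Drs rs1 nd u_rec u_neq0 u_ngeo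
   (P := [:: v0]) [seq b j | j <- enum I] (b_neq0 i).
  by rewrite mem_seq1 => /eqP->; apply: expsum_nz_supp.
have thJ : th (u _sh J) = (b i)^-1 by rewrite -[LHS](mulKf (b_neq0 i)) bth mulr1.
have [v0th v0N] := Hp v0 (mem_head _ _).
have /eqP := telescope_add e1 e0 v0n0 E N pth.
rewrite (bigD1 (Ordinal JN))//= thJ pole_poly_pole// !mul0r eq_sym !mulf_eq0.
rewrite (negPf v0N) (negPf v0th) !orbF; apply/negP.
apply: (telescope_sum_neq0 en0 JN); rewrite ?thJ ?pole_poly_pole// => j jN jJ.
by apply: pole_poly_neq0 => l; apply: Hb => //; apply: map_f; rewrite mem_enum.
Qed.

End PoleArguments.

Section Supports.
Variables v v0 : pt -> algC.
Hypotheses (ev_ : expsum v) (ev0 : expsum v0).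

Lemma common_support : exists (q : nat) (L : 'I_q -> nat -> nat) (V V0 : 'I_q -> algC),
  [/\ injective L, forall i, LR (L i),
      forall th, point th -> v th = \sum_i V i * th (L i) &
      forall th, point th -> v0 th = \sum_i V0 i * th (L i)].
Proof.
have [s Ls sE] := ev_; have [t Lt tE] := ev0.
pose l := undup (supp s ++ supp t); pose L (i : 'I_(size l)) := nth (fun=> 0%N) l i.
have sumE w : {subset supp w <= l} -> forall th : pt,
    ev w th = \sum_(i < size l) cf w (L i) * th (L i).
  move=> wl th; rewrite evE -(big_mkord xpredT (fun i => cf w (nth (fun=> 0%N) l i) * th (nth (fun=> 0%N) l i))).
  rewrite -(big_nth (fun=> 0%N) xpredT (fun x => cf w x * th x)) /=.
  rewrite [RHS](bigID (mem (supp w))) /= [X in _ = _ + X]big1 ?addr0; last first.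
    by move=> x; rewrite mem_supp negbK => /eqP->; rewrite mul0r.
  rewrite -[RHS]big_filter; apply: perm_big; apply: uniq_perm.
  - exact: supp_uniq.
  - by rewrite filter_uniq ?undup_uniq.
  - move=> x; rewrite [in RHS]mem_filter; apply/idP/andP => [xw|[]//].
    by split=> //; exact: wl.
have memL i : L i \in l by apply: mem_nth.
exists (size l), L, (fun i => cf s (L i)), (fun i => cf t (L i)); split.
- by move=> i j /eqP; rewrite nth_uniq ?undup_uniq// => /eqP; apply: val_inj.
- by move=> i; have := memL i; rewrite mem_undup mem_cat => /orP[]; apply: supp_LR.
- by move=> th pth; rewrite sE// sumE// => x xs; rewrite mem_undup mem_cat xs.
- by move=> th pth; rewrite tE// sumE// => x xs; rewrite mem_undup mem_cat xs orbT.
Qed.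

End Supports.

Lemma spread_fin (q : nat) (L : 'I_q -> nat -> nat) N0 : injective L -> (forall i, LR (L i)) ->
  exists2 N, (N0 <= N)%N & forall l l' m m' : 'I_q,
    (forall k, L l (k + N) + L m k = L l' (k + N) + L m' k)%N -> l = l' /\ m = m'.
Proof.
move=> injL LL.
have [|N N0N H] := spread n_ge2 cn0 Drs rs1 nd a01 (L := [seq L i | i <- enum 'I_q]) N0.
  by move=> l /mapP[i _ ->].
exists N => // l l' m m' E.
have mem i : L i \in [seq L i | i <- enum 'I_q] by apply: map_f; rewrite mem_enum.
by have [/injL-> /injL->] := H _ _ _ _ (mem l) (mem l') (mem m) (mem m') E.
Qed.

Lemma bilinear_zero (q : nat) (L : 'I_q -> nat -> nat) N (C : 'I_q -> 'I_q -> algC) :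
  (forall i, LR (L i)) ->
  (forall l l' m m' : 'I_q,
    (forall k, L l (k + N) + L m k = L l' (k + N) + L m' k)%N -> l = l' /\ m = m') ->
  (forall th, point th -> \sum_l \sum_m C l m * (th ((L l) _sh N) * th (L m)) = 0) ->
  forall l m, C l m = 0.
Proof.
move=> LL sep z l0 m0.
apply: (@pzero_unique ('I_q * 'I_q)%type (fun x => C x.1 x.2)
  (fun x k => L x.1 (k + N) + L x.2 k)%N (l0, m0)).
- by move=> x; apply: LR_add => //; apply: LR_shift.
- move=> th pth; rewrite -[RHS](z th pth) pair_bigA /=; apply: eq_bigr => x _.
  by case: pth => _ ->.
- move=> [l m] /= ne _ E; case/negP: ne.
  by have [|-> ->] := sep l l0 m m0; [move=> k; apply: (congr1 (fun f : nat -> nat => f k) E)|].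
Qed.

(** After [N] steps, with [N] so large that the exponents at k + N and at k separate, comparing
    coefficients gives e^N V_l V0_m = V0_l V_m for all l and m. Hence [v] is a multiple of [v0], and
    the original equation gives e = 1. *)
Lemma homogeneous_solution (v v0 : pt -> algC) e :
  expsum v -> expsum v0 -> ~ pzero v -> ~ pzero v0 ->
  (forall th, point th -> e * v (pshift 1 th) * v0 th = v0 (pshift 1 th) * v th) ->
  e = 1 /\ exists2 f, f != 0 & forall th, point th -> v th = f * v0 th.
Proof.
move=> e1 e0 vn0 v0n0 E.
have [q [L [V [V0 [injL LL vE v0E]]]]] := common_support e1 e0.
have [N N0 sep] := spread_fin 1 injL LL.
have EN th : point th -> e ^+ N * v (pshift N th) * v0 th = v0 (pshift N th) * v th.
  move=> pth; have := @telescope_mul v v0 e1 e0 v0n0 e%:P 1 _ N th pth.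
  rewrite (eq_bigr (fun=> e)); last by move=> j _; rewrite hornerC.
  rewrite prodr_const card_ord (eq_bigr (fun=> 1)); last by move=> j _; rewrite hornerC.
  by rewrite big1_eq mul1r; apply => th' pth'; rewrite !hornerC mul1r E.
have C0 := @bilinear_zero q L N (fun l m => e ^+ N * V l * V0 m - V0 l * V m) LL sep _.
have {}C0 l m : e ^+ N * V l * V0 m = V0 l * V m.
  apply/eqP; rewrite -subr_eq0; apply/eqP; apply: C0 => th pth.
  have /eqP := EN th pth; rewrite -subr_eq0 => /eqP E0; rewrite -[RHS]E0.
  have pN := point_shift N pth.
  rewrite !vE// !v0E// [e ^+ N * _]mulr_sumr !big_distrl /= -sumrB; apply: eq_bigr => i _.
  rewrite !mulr_sumr -sumrB; apply: eq_bigr => j _; rewrite /pshift; ring.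
have [m0 V0m] : exists m, V0 m != 0.
  apply: contrapT => /forallNP H; apply: v0n0 => th pth.
  by rewrite v0E// big1// => i _; have /negP := H i; rewrite negbK => /eqP->; rewrite mul0r.
have en : e != 0.
  apply/eqP => e00; apply: vn0 => th pth; rewrite vE// big1// => i _.
  have := C0 m0 i; rewrite e00 expr0n (gtn_eqF N0) !mul0r => /esym/eqP.
  by rewrite mulf_eq0 (negPf V0m) => /eqP->; rewrite mul0r.
have Vm : V m0 != 0.
  apply/eqP => Vm; apply: vn0 => th pth; rewrite vE// big1// => i _.
  have := C0 i m0; rewrite Vm mulr0 => /eqP; rewrite !mulf_eq0 (negPf V0m) expf_eq0 (negPf en) andbF orbF orFb.
  by move/eqP->; rewrite mul0r.
have eN : e ^+ N = 1.
  apply: (mulIf Vm); apply: (mulIf V0m); rewrite mul1r C0; exact: mulrC.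
pose f := V m0 / V0 m0.
have f0 : f != 0 by rewrite mulf_neq0 ?invr_eq0.
have vf th : point th -> v th = f * v0 th.
  move=> pth; rewrite vE// v0E// mulr_sumr; apply: eq_bigr => i _; rewrite mulrA; congr (_ * _).
  have := C0 i m0; rewrite eN mul1r => H; apply: (mulIf V0m).
  by rewrite H /f mulrC mulrAC divfK// mulrC.
split; last by exists f.
have [|k _ Hk] := @nonvanishing [:: v0; (fun th => v0 (pshift 1 th))] 0.
  move=> p; rewrite !inE => /orP[] /eqP->; split=> //; first exact: expsum_shift.
  exact: shift_neq0.
have h0 := Hk v0 (mem_head _ _).
have h1 : v0 (pshift 1 (num a k)) != 0.
  by apply: (Hk (fun th => v0 (pshift 1 th))); rewrite !inE eqxx orbT.
have pk := point_num a k; have := E _ pk; rewrite !vf//; last exact: point_shift.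
move=> H; apply: (mulIf f0); apply: (mulIf h1); apply: (mulIf h0).
by rewrite mul1r -[RHS]mulrA [RHS]mulrCA -H; ring.
Qed.

(** This isolates the leading monomial of a polynomial right-hand side. Indices far from [J] are
    settled by growth. The finitely many offsets near it give recurrences i u_(k+e) that are
    pairwise distinct from M u_(k+h), and [good_index] separates them. *)
Lemma isolated_multiple M s b : (0 < M)%N -> exists J, forall i j, (i <= M)%N ->
  (i, j) != (M, J) ->
  (M * u (s + J) + b < i * u (s + j))%N || (i * u (s + j) + b < M * u (s + J))%N.
Proof.
move=> M0.
have [h Hh] := growth_iter n_ge2 cn0 u_rec Drs rs1 nd M.+2.
pose B := (\sum_(j < n) u j)%N.
have [K0 HK0] := growth_superlinear n_ge2 cn0 u_rec u_neq0 Drs rs1 nd 1.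
pose L := [seq (fun k => x.1 * u (k + x.2))%N | x <- [seq (i, e) | i <- iota 1 M, e <- iota 0 (2 * h).+1]].
have [|k kk Hk] := good_index n_ge2 cn0 Drs rs1 nd (L := L) b.+1 (s + n + K0 + M * B + M.+2 * b + 2)%N.
  by move=> l /mapP[x _ ->]; apply/LR_mul/LR_shift.
have kh : (K0 <= k + h)%N by lia.
have uk := HK0 _ kh; rewrite mul1n in uk.
exists (k + h - s)%N => i j iM ij; rewrite subnKC; last by lia.
have [->|i0] := posnP i.
  by rewrite mul0n add0n; apply/orP; right; nia.
have [far1|near1] := leqP (k + 2 * h) (s + j).
  have : (M.+2 * u (k + h) <= u (s + j))%N.
    have -> : (s + j = k + h + (s + j - (k + h)))%N by lia.
    by apply: Hh; lia.
  by move=> H; apply/orP; left; nia.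
have [far2|near2] := ltnP (s + j) k.
  suff : (M * u (s + j) + b < u (k + h))%N by move=> H; apply/orP; right; nia.
  have [sn|ns] := ltnP (s + j) n.
    have : (u (s + j) <= B)%N by rewrite /B (bigD1 (Ordinal sn))//= leq_addr.
    by nia.
  have : (M.+2 * u (s + j) <= u (k + h))%N.
    have -> : (k + h = s + j + (k + h - (s + j)))%N by lia.
    by apply: Hh; lia.
  case: (leqP (u (s + j)) b) => ub; first by nia.
  by nia.
pose e := (s + j - k)%N.
have ek : (s + j = k + e)%N by rewrite /e; lia.
have mem i' e' : (0 < i' <= M)%N -> (e' < (2 * h).+1)%N -> (fun k => i' * u (k + e'))%N \in L.
  move=> i'M e'h; apply/mapP; exists (i', e') => //; apply/allpairsPdep.
  by exists i', e'; split=> //; rewrite mem_iota; move: i'M e'h; clear; lia.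
have := Hk (fun k => M * u (k + h))%N (fun k => i * u (k + e))%N (mem _ _ _ _) (mem _ _ _ _).
rewrite /gap -ek; move=> H.
suff /H : (fun k => M * u (k + h))%N <> (fun k => i * u (k + e))%N.
  move=> /(_ ltac:(lia) ltac:(lia) ltac:(lia) ltac:(lia)) /orP[] G; apply/orP; [left|right]; lia.
move=> E; have {}E x : (M * u (x + h) = i * u (x + e))%N.
  exact: (congr1 (fun f : nat -> nat => f x) E).
have tail := u_tail_indep n_ge2 cn0 Drs nd u_rec u_neq0 u_ngeo.
case: (ltngtP h e) => he.
- have t0 : (0 < e - h)%N by lia.
  apply: (@tail M i h _ t0 M0) => x; rewrite E; congr (_ * u _)%N; lia.
- have t0 : (0 < h - e)%N by lia.
  apply: (@tail i M e _ t0 i0) => x; rewrite -E; congr (_ * u _)%N; lia.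
- have iM' : i = M.
    have := E k; rewrite -he => /eqP; rewrite eqn_pmul2r; last by lia.
    by move=> /eqP.
  case/negP: ij; rewrite iM' xpair_eqE eqxx /=; apply/eqP; lia.
Qed.

Lemma telescope_sum1 e (Q : {poly algC}) th N :
  telescope_sum e 1 Q th N = \sum_(j < N) e ^+ j * Q.[th (u _sh j)].
Proof.
elim: N => [|N IHN] /=; first by rewrite big_ord0.
rewrite big_ord_recr /= -IHN hornerC mul1r addrC; congr (_ + _).
by rewrite big1 ?mulr1// => j _; rewrite hornerC.
Qed.

(** Sum the equation over [N] steps. If [Q] has degree M > 0, its leading term at the isolated index
    [J] has an exponent that no other term shares, although its coefficient is nonzero. If [Q] is a
    constant f and e = 1, the sum is N f, and a diagonal coefficient gives f = 0. *)
Lemma polynomial_rhs (v v0 : pt -> algC) e (Q : {poly algC}) : e != 0 ->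
  expsum v -> expsum v0 -> ~ pzero v0 ->
  (forall th, point th -> e * v (pshift 1 th) * v0 th - v0 (pshift 1 th) * v th =
     v0 th * v0 (pshift 1 th) * Q.[th u]) ->
  (size Q <= 1)%N /\ (e = 1 -> Q = 0).
Proof.
move=> en e1 e0 v0n0 E.
have [q [L [V [V0 [injL LL vE v0E]]]]] := common_support e1 e0.
have EN N th : point th -> e ^+ N * v (pshift N th) * v0 th - v0 (pshift N th) * v th =
    v0 th * v0 (pshift N th) * \sum_(j < N) e ^+ j * Q.[th (u _sh j)].
  move=> pth; rewrite -telescope_sum1 -(telescope_add e1 e0 v0n0 _ N pth).
    by rewrite big1 ?mul1r// => j _; rewrite hornerC.
  by move=> th' pth'; rewrite hornerC mul1r E.
have [m0 V0m] : exists m, V0 m != 0.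
  apply: contrapT => /forallNP H; apply: v0n0 => th pth.
  by rewrite v0E// big1// => i _; have /negP := H i; rewrite negbK => /eqP->; rewrite mul0r.
have szQ : (size Q <= 1)%N.
  rewrite leqNgt; apply/negP => szQ; pose M := (size Q).-1.
  have QM : Q`_M != 0 by rewrite -lead_coefE lead_coef_eq0 -size_poly_gt0 ltnW.
  have M0 : (0 < M)%N by rewrite /M; lia.
  have [s _ Hs] := good_index n_ge2 cn0 Drs rs1 nd (L := [seq L i | i <- enum 'I_q]) 1 0
    ltac:(by move=> l /mapP[i _ ->]).
  have mem i : L i \in [seq L i | i <- enum 'I_q] by apply: map_f; rewrite mem_enum.
  pose b := (\sum_i L i s)%N.
  have bP i : (L i s <= b)%N by rewrite /b (bigD1 i)//= leq_addr.
  have [J HJ] := isolated_multiple s b M0.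
  have [k sk Hk] := good_index n_ge2 cn0 Drs rs1 nd (L := [seq L i | i <- enum 'I_q])
    (b + M * u (s + J)).+1 (s + J).+1 ltac:(by move=> l /mapP[i _ ->]).
  pose N := (k - s)%N; have sN : (s + N = k)%N by rewrite /N; lia.
  have JN : (J < N)%N by rewrite /N; lia.
  (* With the least exponent at [k], any other exponent of [v0] there is larger by more than all
     remaining contributions together. *)
  have [l0 V0l lmin] : exists2 l0, V0 l0 != 0 & forall l, V0 l != 0 -> (L l0 k <= L l k)%N.
    have := @arg_minnP _ m0 (fun l => V0 l != 0) (fun l => L l k) V0m.
    by case=> l0 h1 h2; exists l0.
  pose I := (('I_q * 'I_q) + ('I_N * 'I_M.+1) * ('I_q * 'I_q))%type.
  pose C (x : I) := match x with
    | inl y => e ^+ N * V y.1 * V0 y.2 - V0 y.1 * V y.2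
    | inr z => - (e ^+ z.1.1 * Q`_(z.1.2) * V0 z.2.1 * V0 z.2.2) end.
  pose Ex (x : I) := match x with
    | inl y => fun k => (L y.1 (k + N) + L y.2 k)%N
    | inr z => fun k => ((L z.2.1 (k + N) + L z.2.2 k) + z.1.2 * u (k + z.1.1))%N end.
  pose i0 : I := inr ((Ordinal JN, ord_max), (l0, m0)).
  suff /eqP : C i0 = 0.
    rewrite /= oppr_eq0 !mulf_eq0 expf_eq0 (negPf en) andbF.
    by rewrite (negPf QM) (negPf V0l) (negPf V0m).
  apply: (@pzero_unique I C Ex i0).
  - case=> [y|z] /=; first by apply: LR_add => //; apply: LR_shift.
    apply: LR_add; first by apply: LR_add => //; apply: LR_shift.
    by apply: LR_mul; apply: LR_shift.
  - move=> th pth; have := EN N th pth => /eqP; rewrite -subr_eq0 => /eqP E0; rewrite -[RHS]E0.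
    have [_ thD] := pth; have pN := point_shift N pth.
    rewrite big_sumType /=; congr (_ + _).
      rewrite !vE// !v0E// [e ^+ N * _]mulr_sumr !big_distrl /= -sumrB.
      rewrite -(pair_bigA _ (fun l m => (e ^+ N * V l * V0 m - V0 l * V m) * th (fun k => L l (k + N) + L m k)%N)) /=.
      apply: eq_bigr => l _; rewrite !mulr_sumr -sumrB; apply: eq_bigr => m _.
      by rewrite thD /pshift; ring.
    have S2 : \sum_(y : 'I_q * 'I_q) V0 y.1 * th ((L y.1) _sh N) * (V0 y.2 * th (L y.2)) =
        v0 th * v0 (pshift N th).
      rewrite -(pair_bigA _ (fun l m => V0 l * th ((L l) _sh N) * (V0 m * th (L m)))) /= !v0E//.
      rewrite [RHS]mulrC big_distrl; apply: eq_bigr => l _ /=.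
      by rewrite mulr_sumr.
    rewrite -S2 mulr_sumr -sumrN -(pair_bigA _ (fun x y => C (inr (x, y)) * th (Ex (inr (x, y))))) /=.
    rewrite -(pair_bigA _ (fun (j : 'I_N) (i : 'I_M.+1) => \sum_(y : 'I_q * 'I_q)
      - (e ^+ j * Q`_i * V0 y.1 * V0 y.2) * th (fun k => (L y.1 (k + N) + L y.2 k) + i * u (k + j))%N)) /=.
    apply: eq_bigr => j _; rewrite (@horner_coef_wide _ M.+1); last by rewrite /M; lia.
    rewrite !mulr_sumr -sumrN; apply: eq_bigr => i _.
    rewrite mulr_suml -sumrN; apply: eq_bigr => y _.
    by rewrite !thD (point_mul i (u _sh j) pth); ring.
  have Es (x : I) : Ex x = Ex i0 -> Ex x s = (L l0 k + L m0 s + M * u (s + J))%N.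
    by move=> ->; rewrite /= sN.
  have gp (l : 'I_q) : L l k != L l0 k -> gap (b + M * u (s + J)).+1 k (L l) (L l0).
    by move=> ne; apply: Hk => // E'; rewrite E' eqxx in ne.
  case=> [[l m]|[[j i] [l m]]] ne Cn /Es /=; rewrite sN.
    have [E0|/gp] := eqVneq (L l k) (L l0 k); last first.
      by rewrite /gap; have := bP m; have := bP m0; lia.
    have := HJ 0%N J; rewrite mul0n; have := bP m; have := bP m0.
    by rewrite xpair_eqE andbC eqxx /= (ltn_eqF M0) => h1 h2 /(_ isT isT); lia.
  have V0l' : V0 l != 0 by apply: contraNneq Cn => /= ->; rewrite mulr0 mul0r oppr0.
  have lm := lmin l V0l'.
  have [E0|/gp] := eqVneq (L l k) (L l0 k); last first.
    by rewrite /gap; have := bP m; have := bP m0; lia.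
  rewrite E0 => Eq.
  have ij : ((i : nat), (j : nat)) = (M, J).
    apply/eqP; apply: contraT => /(HJ _ _ (leq_ord i)).
    by have := bP m; have := bP m0; lia.
  case: ij => iM jJ; rewrite iM jJ in Eq.
  have ll : l = l0.
    apply/injL; apply: contrapT => ll; have := Hk (L l) (L l0) (mem _) (mem _) ll.
    by rewrite /gap; lia.
  have mm : m = m0.
    apply/injL; apply: contrapT => mm; have := Hs (L m) (L m0) (mem _) (mem _) mm.
    by rewrite /gap; lia.
  case/negP: ne; rewrite /i0 ll mm; apply/eqP; congr (inr ((_, _), _)); exact: val_inj.
split=> // e1'; have QE := size1_polyC szQ; set f := Q`_0 in QE.
rewrite QE; suff -> : f = 0 by [].
have [N N0 sep] := spread_fin 1 injL LL.
have Cz th : point th -> \sum_l \sum_m (V l * V0 m - V0 l * V m - N%:R * f * V0 l * V0 m) *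
    (th ((L l) _sh N) * th (L m)) = 0.
  move=> pth; have := EN N th pth => /eqP; rewrite -subr_eq0 => /eqP E0; rewrite -[RHS]E0.
  have pN := point_shift N pth.
  have dd (X Y : 'I_q -> algC) : \sum_l \sum_m X l * Y m * (th ((L l) _sh N) * th (L m)) =
      (\sum_l X l * pshift N th (L l)) * (\sum_m Y m * th (L m)).
    rewrite big_distrl; apply: eq_bigr => l _ /=; rewrite mulr_sumr; apply: eq_bigr => m _.
    by rewrite /pshift; ring.
  rewrite e1' QE expr1n mul1r [X in _ = _ - _ * X](eq_bigr (fun=> f)); last by move=> j _; rewrite expr1n mul1r hornerC.
  rewrite sumr_const card_ord -mulr_natl !vE// !v0E//.
  rewrite [X in _ = _ - X * _]mulrC [X in _ = _ - X]mulrC -!dd mulr_sumr -!sumrB.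
  apply: eq_bigr => l _; rewrite mulr_sumr -!sumrB; apply: eq_bigr => m _; ring.
have := @bilinear_zero q L N _ LL sep Cz m0 m0.
rewrite (mulrC (V _)) subrr sub0r => /eqP; rewrite oppr_eq0 !mulf_eq0 (negPf V0m) !orbF.
by rewrite pnatr_eq0 (gtn_eqF N0) => /eqP.
Qed.

End DifferenceEquations.

(** * Difference equations known at numerical points *)

Section NumericDifferenceEquations.
Variables (n : nat) (c u : nat -> nat).
Hypotheses (n_ge2 : (2 <= n)%N) (cn0 : c n <> 0%N).
Variable rs : seq algC.
Hypotheses (Drs : Phi n c algC = root_poly rs) (rs1 : 1 \notin rs) (nd : nondeg (1 :: rs)).
Hypothesis (u_rec : linear_recurrence n c u).
Hypothesis (u_neq0 : exists2 i, (i < n)%N & u i <> 0%N).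
Hypothesis (u_ngeo : ~ exists q : algC, forall k, (u k.+1)%:R = q * (u k)%:R).
Variables (R : realType) (K : valuedFieldType R) (jC : {rmorphism algC -> K}) (a : algC).
Hypothesis (a01 : 0 < absv (jC a) < 1).

Local Notation LR := (linear_recurrence n c).
Local Notation expsum := (expsum n c).
Local Notation "u '_sh' j" := (fun k => u (k + j)%N) (at level 2).
Local Notation pt := ((nat -> nat) -> algC).

Let transfer := expsum_transfer n_ge2 cn0 Drs rs1 nd a01.
Let nonvanishing := expsum_num_neq0 n_ge2 cn0 Drs rs1 nd a01.
Let cancel_expsum := pzero_mul n_ge2 cn0 Drs rs1 nd a01.

Let NEP := no_extra_pole n_ge2 cn0 Drs rs1 nd u_rec u_neq0 u_ngeo a01.
Let NPO := no_pole n_ge2 cn0 Drs rs1 nd u_rec u_neq0 u_ngeo a01.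
Let HOM := homogeneous_solution n_ge2 cn0 Drs rs1 nd u_rec a01.
Let PRH := polynomial_rhs n_ge2 cn0 Drs rs1 nd u_rec u_neq0 u_ngeo a01.

(* In the two lemmas below the equations are only assumed at the points [num k],
   where they are identities between algebraic numbers. *)
Variables (I : finType) (b : I -> algC) (k0 : nat).
Hypotheses (b_neq0 : forall i, b i != 0) (b_inj : injective b).
Hypothesis regular : forall k i, (k0 <= k)%N -> 1 - b i * a ^+ u k != 0.

Let u0 th : point th -> th (u _sh 0) = th u.
Proof. by move=> _; congr th; apply/funext => k; rewrite addn0. Qed.

Lemma multiplicative_equation (v v0 : pt -> algC) (x1 x0 : algC) (nu1 nu0 : I -> nat) :
  x1 != 0 -> x0 != 0 -> expsum v -> expsum v0 -> ~ pzero v -> ~ pzero v0 ->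
  (forall k, (k0 <= k)%N ->
    x1 * \prod_i (1 - b i * a ^+ u k) ^+ nu1 i * v (num a k.+1) * v0 (num a k) =
    x0 * \prod_i (1 - b i * a ^+ u k) ^+ nu0 i * v0 (num a k.+1) * v (num a k)) ->
  [/\ x1 = x0, nu1 = nu0 & exists2 f, f != 0 & forall th, point th -> v th = f * v0 th].
Proof.
move=> x1n x0n e1 e0 vn0 v0n0 E.
(* The common factors are cancelled: by truncation, for each [i] one of [m1 i] and [m0 i] is zero,
   so [no_extra_pole] applies in one direction or the other. *)
pose m1 i := (nu1 i - nu0 i)%N; pose m0 i := (nu0 i - nu1 i)%N; pose mm i := minn (nu1 i) (nu0 i).
have E' th : point th -> (x1 *: pole_poly b m1).[th u] * v (pshift 1 th) * v0 th =
    (x0 *: pole_poly b m0).[th u] * v0 (pshift 1 th) * v th.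
  move=> pth; apply/eqP; rewrite -subr_eq0; apply/eqP; move: th pth; apply: (transfer (k0 := k0)).
    apply: expsumB; (apply: expsumM => //; apply: expsumM; last exact: expsum_shift);
      apply: (expsum_ext _ (expsum_poly u_rec _ 0)) => th' /u0 uE; rewrite uE; reflexivity.
  move=> k kk; rewrite !hornerZ !pole_polyE pshift_num addn1.
  pose P := \prod_i (1 - b i * a ^+ u k) ^+ mm i.
  have P0 : P != 0 by apply/prodf_neq0 => i _; rewrite expf_neq0// regular.
  apply/eqP; rewrite subr_eq0; apply/eqP; apply: (mulfI P0); have := E k kk.
  have -> : \prod_i (1 - b i * a ^+ u k) ^+ nu1 i = P * \prod_i (1 - b i * num a k u) ^+ m1 i.
    rewrite -big_split; apply: eq_bigr => i _ /=; rewrite -exprD; congr (_ ^+ _).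
    by rewrite /mm /m1; lia.
  have -> : \prod_i (1 - b i * a ^+ u k) ^+ nu0 i = P * \prod_i (1 - b i * num a k u) ^+ m0 i.
    rewrite -big_split; apply: eq_bigr => i _ /=; rewrite -exprD; congr (_ ^+ _).
    by rewrite /mm /m0; lia.
  move=> Ek; transitivity (x1 * (P * \prod_i (1 - b i * num a k u) ^+ m1 i) * v (num a k.+1) * v0 (num a k)); first by ring.
  by rewrite Ek; ring.
have nu01 : nu1 =1 nu0.
  move=> i; case: (ltngtP (nu1 i) (nu0 i)) => // lt.
    case: (@NEP _ b b_neq0 b_inj v0 v x0 x1 m0 m1 i) => //; last by rewrite /m1; lia.
      by move=> th pth; rewrite E'.
    by rewrite /m0 subn_gt0.
  case: (@NEP _ b b_neq0 b_inj v v0 x1 x0 m1 m0 i) => //; last by rewrite /m0; lia.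
  by rewrite /m1 subn_gt0.
have [|e1' f] := @HOM v v0 (x1 / x0) e1 e0 vn0 v0n0.
  move=> th pth; apply: (mulfI x0n); have := E' th pth.
  rewrite !hornerZ !pole_polyE !big1 ?mulr1 => [H||].
  - transitivity (x1 * v (pshift 1 th) * v0 th); first by field.
    by rewrite H mulrA.
  - by move=> i _; rewrite /m0 nu01 subnn expr0.
  - by move=> i _; rewrite /m1 nu01 subnn expr0.
split=> //; last exact/funext.
by rewrite -(divfK x0n x1) e1' mul1r.
Qed.

Section Inhomogeneous.
Variables (nI : finType) (be : nI -> algC) (ex : nI -> nat) (cc : nI -> algC).
Hypothesis be_cover : forall j, be j = 0 \/ exists i, be j = b i.

Let ex1 j := (ex j).+1.
(** Total coefficient at the pole parameter [x] and order [k]; several indices may share both, and x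
    = 0 stands for the polynomial part. *)
Let coefd x k := \sum_(j | (be j == x) && (ex1 j == k)) cc j.
Let Mx := (\max_j ex1 j)%N.

Let coefd0 x : coefd x 0 = 0.
Proof. by rewrite /coefd big_pred0// => j; rewrite andbF. Qed.

Let regroup (x : algC) : (forall i, 1 - b i * x != 0) ->
  \sum_j cc j * (x / (1 - be j * x)) ^+ ex1 j =
  \sum_(k < Mx.+1) coefd 0 k * x ^+ k + \sum_i \sum_(k < Mx.+1) coefd (b i) k * (x / (1 - b i * x)) ^+ k.
Proof.
move=> reg; pose T (y : algC) (j : nI) := cc j * (x / (1 - y * x)) ^+ ex1 j.
have inner y : \sum_(k < Mx.+1) coefd y k * (x / (1 - y * x)) ^+ k = \sum_(j | be j == y) T y j.
  rewrite (partition_big (fun j => inord (ex1 j) : 'I_Mx.+1) xpredT)//=.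
  apply: eq_bigr => k _; rewrite /coefd mulr_suml.
  have exk j : (inord (ex1 j) == k) = (ex1 j == k :> nat).
    rewrite -val_eqE /= inordK// ltnS; exact: (@bigop.leq_bigmax _ (fun j => ex1 j)).
  apply: eq_big => [j|j /andP[_ /eqP <-]//].
  by rewrite exk.
have in0 := inner 0; rewrite (_ : 1 - 0 * x = 1) ?divr1 in in0; last by rewrite mul0r subr0.
rewrite in0 [X in _ = _ + X](eq_bigr (fun i => \sum_(j | be j == b i) T (b i) j)); last first.
  by move=> i _; rewrite inner.
rewrite (bigID (fun j => be j == 0)) /=; congr (_ + _).
  by apply: eq_bigr => j /eqP->; rewrite /T.
rewrite (exchange_big_dep (fun j => be j != 0))/=; last first.
  by move=> i j _ /eqP->.
apply: eq_bigr => j bj0; have [/eqP|[i bi]] := be_cover j; first by rewrite (negPf bj0).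
rewrite (big_pred1 i) => [|i']; first by rewrite /T -bi.
by rewrite /= bi eq_sym (inj_eq b_inj).
Qed.

(** Multiply by the factors 1 - b_i y to their highest orders [M i]. If [M i] is positive, the
    numerator at 1/b_i is the leading coefficient there up to a nonzero factor, which [no_pole]
    forbids. What remains is a polynomial, and [polynomial_rhs] makes it constant. *)
Lemma additive_equation (v v0 : pt -> algC) (x c0 : algC) :
  x != 0 -> expsum v -> expsum v0 -> ~ pzero v0 ->
  (forall k, (k0 <= k)%N ->
    x * v (num a k.+1) * v0 (num a k) - v0 (num a k.+1) * v (num a k) =
    v0 (num a k) * v0 (num a k.+1) *
      (c0 + \sum_j cc j * (a ^+ u k / (1 - be j * a ^+ u k)) ^+ (ex j).+1)) ->
  (x = 1 -> c0 = 0) /\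
  forall j, \sum_(j' | (be j' == be j) && (ex j' == ex j)) cc j' = 0.
Proof.
move=> xn e1 e0 v0n0 E.
pose M i := (\max_(k < Mx.+1) (if coefd (b i) k == 0%R then 0 else k))%N.
have MP i k : coefd (b i) k != 0 -> (k <= Mx)%N -> (k <= M i)%N.
  move=> ck kM; pose k' : 'I_Mx.+1 := Ordinal (kM : (k < Mx.+1)%N).
  by rewrite /M (bigD1 k')//= (negPf ck) leq_maxl.
have Mle i : (M i <= Mx)%N.
  by apply/bigmax_leqP => k _; case: ifP => // _; rewrite -ltnS.
have M0 i : (0 < M i)%N -> coefd (b i) (M i) != 0.
  have [|k kE] := @bigop.eq_bigmax _ (fun k : 'I_Mx.+1 => if coefd (b i) k == 0%R then 0 else k : nat)%N.
    by rewrite card_ord.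
  by rewrite /M kE; case: ifP => [_|/negbT].
pose Q0 : {poly algC} := c0%:P + \sum_(k < Mx.+1) coefd 0 k *: 'X^k.
pose Q : {poly algC} := pole_poly b M * Q0 +
  \sum_i \sum_(k < (M i).+1) coefd (b i) k *: ('X^k * (1 - b i *: 'X) ^+ (M i - k) *
    \prod_(i' | i' != i) (1 - b i' *: 'X) ^+ M i').
have lE i y : (1 - b i *: 'X).[y] = 1 - b i * y.
  by rewrite hornerD hornerN hornerZ hornerX hornerC.
have QE k : (k0 <= k)%N -> (pole_poly b M).[a ^+ u k] *
   (c0 + \sum_j cc j * (a ^+ u k / (1 - be j * a ^+ u k)) ^+ (ex j).+1) = Q.[a ^+ u k].
  move=> kk; have reg i : 1 - b i * a ^+ u k != 0 by apply: regular.
  rewrite regroup// addrA mulrDr /Q hornerD hornerM; congr (_ * _ + _).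
    rewrite /Q0 hornerD hornerC horner_sum; congr (_ + _).
    by apply: eq_bigr => l _; rewrite hornerZ hornerXn.
  rewrite mulr_sumr horner_sum; apply: eq_bigr => i _.
  rewrite horner_sum (big_ord_widen Mx.+1 (fun l => (coefd (b i) l *: ('X^l * (1 - b i *: 'X) ^+ (M i - l) *
    \prod_(i' | i' != i) (1 - b i' *: 'X) ^+ M i')).[a ^+ u k])) ?ltnS//.
  rewrite [RHS]big_mkcond mulr_sumr; apply: eq_bigr => l _ /=.
  case: ltnP => [lM|Ml]; last first.
    have [->|cl] := eqVneq (coefd (b i) l) 0; first by rewrite mul0r mulr0.
    by have := MP i l cl; rewrite -ltnS ltn_ord leqNgt Ml => /(_ isT).
  rewrite pole_polyE hornerZ !hornerM hornerXn horner_exp lE horner_prod [X in X * _](bigD1 i)//=.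
  have -> : \prod_(i0 | i0 != i) ((1 - b i0 *: 'X) ^+ M i0).[a ^+ u k] =
      \prod_(i0 | i0 != i) (1 - b i0 * a ^+ u k) ^+ M i0.
    by apply: eq_bigr => i' _; rewrite horner_exp lE.
  rewrite -[in LHS](subnK (lM : (l <= M i)%N)) exprD exprMn exprVn.
  have yl : (1 - b i * a ^+ u k) ^+ l != 0 by rewrite expf_neq0.
  move: ((1 - b i * a ^+ u k) ^+ l) yl ((1 - b i * a ^+ u k) ^+ _) (\prod_(_ | _) _) => y y0 z P.
  by field.
have Ep th : point th -> (pole_poly b M).[th u] * (x * v (pshift 1 th) * v0 th - v0 (pshift 1 th) * v th) =
     v0 th * v0 (pshift 1 th) * Q.[th u].
  have ep f : expsum (fun th => f.[th u]).
    by apply: (expsum_ext _ (expsum_poly u_rec f 0)) => th' /u0->.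
  move=> pth; apply/eqP; rewrite -subr_eq0; apply/eqP; move: th pth; apply: (transfer (k0 := k0)).
    apply: expsumB; apply: expsumM; rewrite //; last by apply: expsumM => //; exact: expsum_shift.
    by apply: expsumB; do ?apply: expsumM; rewrite //; do ?exact: expsum_shift; exact: expsum_const.
  move=> k kk; rewrite pshift_num addn1 -QE// E//; apply/eqP; rewrite subr_eq0; apply/eqP; rewrite /num; ring.
have Mz i : M i = 0%N.
  apply/eqP; apply: contraT; rewrite -lt0n => Mi.
  case: (@NPO _ b b_neq0 v v0 x M Q i xn e1 e0 v0n0 Ep Mi).
  have b1 : 1 - b i * (b i)^-1 = 0 by rewrite mulfV ?subrr.
  rewrite /Q hornerD hornerM pole_poly_pole// mul0r add0r horner_sum (bigD1 i)//= [X in _ + X]big1 ?addr0; last first.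
    move=> i' i'i; rewrite horner_sum big1// => k _; rewrite hornerZ hornerM horner_prod (bigD1 i) 1?eq_sym//=.
    by rewrite horner_exp lE b1 expr0n (gtn_eqF Mi) mul0r !mulr0.
  rewrite horner_sum big_ord_recr /= big1 ?add0r => [|k _]; last first.
    rewrite hornerZ !hornerM [X in _ * (_ * X * _)]horner_exp lE b1 expr0n.
    by rewrite subn_eq0 leqNgt ltn_ord /= mulr0 mul0r mulr0.
  rewrite hornerZ !hornerM subnn expr0 hornerC mulr1 hornerXn !mulf_neq0 ?M0//.
    by rewrite expf_neq0 ?invr_eq0.
  rewrite horner_prod; apply/prodf_neq0 => i' i'i; rewrite horner_exp lE expf_neq0// subr_eq0 eq_sym.
  apply: contra i'i => /eqP E'; apply/eqP/b_inj.
  by rewrite -[LHS](divfK (b_neq0 i)) E' mul1r.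
have QQ0 : Q = Q0.
  rewrite /Q /pole_poly big1 ?mul1r; last by move=> i _; rewrite Mz expr0.
  rewrite big1 ?addr0// => i _; rewrite big1// => k _.
  have -> : (k : nat) = 0%N by have := ltn_ord k; have := Mz i; lia.
  by rewrite coefd0 scale0r.
have [szQ Qz] : (size Q0 <= 1)%N /\ (x = 1 -> Q0 = 0).
  apply: (@PRH v v0 x Q0 xn e1 e0 v0n0) => th pth; have := Ep th pth.
  by rewrite QQ0 pole_polyE big1 ?mul1r// => i _; rewrite Mz expr0.
have Q0k k : (k <= Mx)%N -> Q0`_k = c0 *+ (k == 0%N) + coefd 0 k.
  move=> kM; rewrite /Q0 coefD coefC coef_sum; congr (_ + _); first by case: k {kM}.
  rewrite (bigD1 (Ordinal (kM : (k < Mx.+1)%N)))//= coefZ coefXn eqxx mulr1 big1 ?addr0// => l lk.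
  rewrite coefZ coefXn; case: eqP => [kl|]; last by rewrite mulr0.
  by case/negP: lk; apply/eqP/val_inj.
split=> [x1|j].
  by have := Q0k 0%N (leq0n _); rewrite Qz// coef0 coefd0 addr0.
have exj : (ex1 j <= Mx)%N by exact: (@bigop.leq_bigmax _ (fun j => ex1 j)).
suff : coefd (be j) (ex1 j) = 0.
  by move=> H; rewrite -[RHS]H; apply: eq_bigl => j'; rewrite /ex1 eqSS.
case: (be_cover j) => [-> |[i ->]].
  have := Q0k (ex1 j) exj; rewrite nth_default ?mulr0n ?add0r => [<-//|].
  by apply: leq_trans szQ _.
by apply/eqP; apply: contraT => /MP/(_ exj); rewrite Mz.
Qed.

End Inhomogeneous.

End NumericDifferenceEquations.

(** * Independence of the approximating sequences *)

Section AlgebraicIndependenceOfSequences.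
Variables (n : nat) (c u : nat -> nat).
Hypotheses (n_ge2 : (2 <= n)%N) (cn0 : c n <> 0%N).
Variable rs : seq algC.
Hypotheses (Drs : Phi n c algC = root_poly rs) (rs1 : 1 \notin rs) (nd : nondeg (1 :: rs)).
Hypothesis (u_rec : linear_recurrence n c u).
Hypothesis (u_neq0 : exists2 i, (i < n)%N & u i <> 0%N).
Hypothesis (u_ngeo : ~ exists q : algC, forall k, (u k.+1)%:R = q * (u k)%:R).
Variables (R : realType) (K : valuedFieldType R) (jC : {rmorphism algC -> K}) (a : algC).
Hypothesis (a01 : 0 < absv (jC a) < 1).
Variables (I : finType) (b : I -> algC) (k0 : nat).
Hypotheses (b_neq0 : forall i, b i != 0) (b_inj : injective b).
Hypothesis regular : forall k i, (k0 <= k)%N -> 1 - b i * a ^+ u k != 0.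
Variables (nI : finType) (al be : nI -> algC) (ll ex : nI -> nat).
Hypothesis al_neq0 : forall j, al j != 0.
Hypothesis be_cover : forall j, be j = 0 \/ exists i, be j = b i.
Hypothesis param_inj : forall j j', al j = al j' -> ll j = ll j' -> be j = be j' ->
  ex j = ex j' -> j = j'.
Variables (Y : I -> nat -> algC) (S : nI -> nat -> algC).
Hypothesis Y_neq0 : forall i k, (k0 <= k)%N -> Y i k != 0.
Hypothesis YS : forall i k, (k0 <= k)%N -> Y i k.+1 = (1 - b i * a ^+ u k) * Y i k.
Let xi j k := a ^+ u k / (1 - be j * a ^+ u k).
Hypothesis SS : forall j k, (k0 <= k)%N ->
  S j k.+1 = S j k + (k ^_ ll j)%:R * al j ^+ k * xi j k ^+ (ex j).+1.

Local Notation LR := (linear_recurrence n c).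
Local Notation expsum := (expsum n c).
Local Notation pt := ((nat -> nat) -> algC).

(* [((x, d), (nu, mu))] stands for the sequence [x^k k^d prod_i Y_i(k)^(nu_i) prod_j S_j(k)^(mu_j)]. *)
Definition mon := ((algC * nat) * ({ffun I -> nat} * {ffun nI -> nat}))%type.
Implicit Types m : mon.

Definition mon_seq m k : algC :=
  m.1.1 ^+ k * (k%:R) ^+ m.1.2 * (\prod_i Y i k ^+ m.2.1 i) * \prod_j S j k ^+ m.2.2 j.

(* Weights are chosen so that, up to terms whose weight drops by two, the shift
   acts on monomials as a derivation. *)
Definition wt m : nat := (m.1.2 + \sum_j m.2.2 j * (ll j).+1)%N.

Definition mon_mul m m' : mon :=
  ((m.1.1 * m'.1.1, (m.1.2 + m'.1.2)%N),
   ([ffun i => (m.2.1 i + m'.2.1 i)%N], [ffun j => (m.2.2 j + m'.2.2 j)%N])).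

Lemma mon_mulE m m' k : mon_seq (mon_mul m m') k = mon_seq m k * mon_seq m' k.
Proof.
rewrite /mon_seq /= exprMn exprD.
have -> : \prod_i Y i k ^+ [ffun i => (m.2.1 i + m'.2.1 i)%N] i =
   (\prod_i Y i k ^+ m.2.1 i) * \prod_i Y i k ^+ m'.2.1 i.
  by rewrite -big_split; apply: eq_bigr => i _; rewrite ffunE exprD.
have -> : \prod_j S j k ^+ [ffun j => (m.2.2 j + m'.2.2 j)%N] j =
   (\prod_j S j k ^+ m.2.2 j) * \prod_j S j k ^+ m'.2.2 j.
  by rewrite -big_split; apply: eq_bigr => i _; rewrite ffunE exprD.
ring.
Qed.

Lemma wt_mul m m' : wt (mon_mul m m') = (wt m + wt m')%N.
Proof.
rewrite /wt /= addnACA -big_split; congr (_ + _)%N.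
by apply: eq_bigr => j _; rewrite ffunE mulnDl.
Qed.

Local Notation rel := (seq ((pt -> algC) * mon)).

Definition rel_seq (s : rel) k : algC := \sum_(x <- s) x.1 (num a k) * mon_seq x.2 k.
Definition rel_coef (s : rel) m : pt -> algC := fun th => \sum_(x <- s | x.2 == m) x.1 th.
(** Here [p] is the drop in weight below [w]. Written with an addition, the bound excludes every
    monomial when p > w instead of being truncated. *)
Definition rel_ok p w (s : rel) :=
  forall x, x \in s -> [/\ expsum x.1, x.2.1.1 != 0 & (wt x.2 + p <= w)%N].

Let Delta (th : pt) := \prod_i (1 - b i * th u).
Let delta k := Delta (num a k).

Let expsum_lin i : expsum (fun th => 1 - b i * th u).
Proof. by apply: expsumB; [|apply: expsumM]; do ?exact: expsum_const; exact: expsum_mono. Qed.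

Let expsum_Delta : expsum Delta.
Proof. by apply: expsum_prod => i _; exact: expsum_lin. Qed.

Let delta_neq0 k : (k0 <= k)%N -> delta k != 0.
Proof. by move=> kk; apply/prodf_neq0 => i _; exact: regular. Qed.

Let snu (nu : {ffun I -> nat}) (th : pt) := \prod_i (1 - b i * th u) ^+ nu i.

Let expsum_snu nu : expsum (snu nu).
Proof. by apply: expsum_prod => i _; apply/expsumX/expsum_lin. Qed.

Let snu_neq0 nu k : (k0 <= k)%N -> snu nu (num a k) != 0.
Proof. by move=> kk; apply/prodf_neq0 => i _; rewrite expf_neq0 ?regular. Qed.

(** Up to a power of [delta], which clears the poles, [f] is a relation of weight at most w - p. *)
Definition low p w (f : nat -> algC) := exists N (t : rel), rel_ok p w t /\
  forall k, (k0 <= k)%N -> delta k ^+ N * f k = rel_seq t k.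

Lemma rel_seq_scale (g : pt -> algC) (t : rel) k :
  rel_seq [seq ((fun th => g th * x.1 th), x.2) | x <- t] k = g (num a k) * rel_seq t k.
Proof. by rewrite /rel_seq big_map mulr_sumr; apply: eq_bigr => x _; rewrite mulrA. Qed.

Lemma rel_ok_scale p w g (t : rel) : expsum g -> rel_ok p w t ->
  rel_ok p w [seq ((fun th => g th * x.1 th), x.2) | x <- t].
Proof. by move=> eg Ht _ /mapP[x /Ht[e1 e2 e3] ->]; split=> //=; apply: expsumM. Qed.

Lemma rel_ok_cat p w (s t : rel) : rel_ok p w s -> rel_ok p w t -> rel_ok p w (s ++ t).
Proof. by move=> Hs Ht x; rewrite mem_cat => /orP[/Hs|/Ht]. Qed.

Lemma rel_seq_cat (s t : rel) k : rel_seq (s ++ t) k = rel_seq s k + rel_seq t k.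
Proof. by rewrite /rel_seq big_cat. Qed.

Lemma low_ext p w f g : (forall k, (k0 <= k)%N -> f k = g k) -> low p w f -> low p w g.
Proof. by move=> fg [N [t [Ht E]]]; exists N, t; split=> // k kk; rewrite -fg// E. Qed.

Lemma low_add p w f g : low p w f -> low p w g -> low p w (fun k => f k + g k).
Proof.
move=> [N [t [Ht E]]] [N' [t' [Ht' E']]].
exists (N + N')%N, ([seq ((fun th => Delta th ^+ N' * x.1 th), x.2) | x <- t] ++
  [seq ((fun th => Delta th ^+ N * x.1 th), x.2) | x <- t']); split.
  by apply: rel_ok_cat; apply: rel_ok_scale => //; apply: expsumX.
move=> k kk; rewrite rel_seq_cat !rel_seq_scale -E// -E'// -/(delta k) exprD.
ring.
Qed.

Lemma low_mul p w f q v g : low p w f -> low q v g -> low (p + q) (w + v) (fun k => f k * g k).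
Proof.
move=> [N [t [Ht E]]] [N' [t' [Ht' E']]].
exists (N + N')%N, [seq ((fun th => x.1 th * y.1 th), mon_mul x.2 y.2) | x <- t, y <- t']; split.
  move=> _ /allpairsPdep[x [y [/Ht[e1 e2 e3] /Ht'[f1 f2 f3] ->]]]; split=> /=.
  - exact: expsumM.
  - by rewrite mulf_neq0.
  - by rewrite wt_mul addnACA leq_add.
move=> k kk; rewrite exprD mulrACA E// E'// /rel_seq big_allpairs_dep mulr_suml.
apply: eq_bigr => x _; rewrite mulr_sumr; apply: eq_bigr => y _ /=.
by rewrite mon_mulE; ring.
Qed.

Lemma low_weak p w p' w' f : (w + p' <= w' + p)%N -> low p w f -> low p' w' f.
Proof.
move=> le [N [t [Ht E]]]; exists N, t; split=> // x /Ht[e1 e2 e3]; split=> //.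
by lia.
Qed.

Lemma low_0 p w : low p w (fun=> 0).
Proof. by exists 0%N, [::]; split=> // k kk; rewrite /rel_seq big_nil mulr0. Qed.

Lemma low_mon m : m.1.1 != 0 -> low 0 (wt m) (mon_seq m).
Proof.
move=> m0; exists 0%N, [:: ((fun=> 1), m)]; split=> [x|k kk].
  by rewrite mem_seq1 => /eqP-> /=; split=> //; [exact: expsum_const|rewrite addn0].
by rewrite /rel_seq big_seq1 /= expr0.
Qed.

Definition mon1 : mon := ((1, 0%N), ([ffun=> 0%N], [ffun=> 0%N])).

Lemma mon_seq1 (x : algC) d k : mon_seq ((x, d), ([ffun=> 0%N], [ffun=> 0%N])) k = x ^+ k * k%:R ^+ d.
Proof.
rewrite /mon_seq /= !big1 ?mulr1// => i _; by rewrite ffunE expr0.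
Qed.

Lemma wt1 (x : algC) d : wt ((x, d), ([ffun=> 0%N], [ffun=> 0%N])) = d.
Proof. by rewrite /wt big1 ?addn0// => j _; rewrite ffunE. Qed.

Lemma low_expsum g : expsum g -> low 0 0 (fun k => g (num a k)).
Proof.
move=> eg; exists 0%N, [:: (g, mon1)]; split=> [x|k kk].
  by rewrite mem_seq1 => /eqP-> /=; rewrite wt1 oner_neq0.
by rewrite /rel_seq big_seq1 mon_seq1 expr0 expr1n !mulr1 mul1r.
Qed.

Lemma low_const e : low 0 0 (fun=> e).
Proof. exact: (low_expsum (expsum_const n c e)). Qed.

Lemma low_powk d : low 0 d (fun k => k%:R ^+ d).
Proof.
have := @low_mon ((1, d), ([ffun=> 0%N], [ffun=> 0%N])) (oner_neq0 _).
by rewrite wt1; apply: low_ext => k kk; rewrite mon_seq1 expr1n mul1r.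
Qed.

Lemma low_chi x : x != 0 -> low 0 0 (fun k => x ^+ k).
Proof.
move=> x0; have := @low_mon ((x, 0%N), ([ffun=> 0%N], [ffun=> 0%N])) x0.
by rewrite wt1; apply: low_ext => k kk; rewrite mon_seq1 expr0 mulr1.
Qed.

Lemma low_S j : low 0 (ll j).+1 (S j).
Proof.
have := @low_mon ((1, 0%N), ([ffun=> 0%N], [ffun j' => (j' == j : nat)])) (oner_neq0 _).
have -> : wt ((1, 0%N), ([ffun=> 0%N], [ffun j' => (j' == j : nat)])) = (ll j).+1.
  rewrite /wt /= add0n (bigD1 j)//= ffunE eqxx mul1n big1 ?addn0// => j' /negPf jj.
  by rewrite ffunE jj.
apply: low_ext => k kk; rewrite /mon_seq /= expr1n expr0 !mul1r big1 ?mul1r; last first.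
  by move=> i _; rewrite ffunE expr0.
rewrite (bigD1 j)//= ffunE eqxx expr1 big1 ?mulr1// => j' /negPf jj.
by rewrite ffunE jj expr0.
Qed.

(* [Delta^N xi_j^(ex_j + 1)] as an exponential sum. *)
Definition Xi N j : pt -> algC := fun th =>
  th u ^+ (ex j).+1 * (\prod_(i | b i != be j) (1 - b i * th u) ^+ N) *
  \prod_(i | b i == be j) (1 - b i * th u) ^+ (N - (ex j).+1).

Lemma expsum_Xi N j : expsum (Xi N j).
Proof.
apply: expsumM; first apply: expsumM.
- by apply/expsumX/expsum_mono.
- by apply: expsum_prod => i _; apply/expsumX/expsum_lin.
- by apply: expsum_prod => i _; apply/expsumX/expsum_lin.
Qed.

Lemma XiE N j k : (k0 <= k)%N -> ((ex j).+1 <= N)%N ->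
  Xi N j (num a k) = delta k ^+ N * xi j k ^+ (ex j).+1.
Proof.
move=> kk eN; rewrite /Xi /delta /Delta -prodrXl [in RHS](bigID (fun i => b i != be j)) /= /num.
have ebN (F : I -> algC) : \prod_(i | ~~ (b i != be j)) F i = \prod_(i | b i == be j) F i.
  by apply: eq_bigl => i; rewrite negbK.
rewrite ebN; set P := \prod_(i | b i != be j) (1 - b i * a ^+ u k) ^+ N.
rewrite /xi; have [be0|[i0 bi0]] := be_cover j.
  rewrite be0 mul0r subr0 divr1 !big_pred0 => [|i|i]; do ?exact: negbTE; ring.
have e1 (F : I -> algC) : \prod_(i | b i == be j) F i = F i0.
  by rewrite (big_pred1 i0)// => i; rewrite /= bi0 (inj_eq b_inj).
rewrite !e1 bi0 -{2}(subnK eN) [in RHS]exprD exprMn exprVn.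
have := regular i0 kk; move: (1 - _) => y y0.
have : y ^+ (ex j).+1 != 0 by rewrite expf_neq0.
move: (y ^+ (ex j).+1) (y ^+ (N - _)) => z w z0; field.
exact: z0.
Qed.

Lemma low_xi j : low 0 0 (fun k => xi j k ^+ (ex j).+1).
Proof.
exists (ex j).+1, [:: (Xi (ex j).+1 j, mon1)]; split=> [x|k kk].
  by rewrite mem_seq1 => /eqP->; split; [exact: expsum_Xi|rewrite /= oner_neq0|rewrite /= wt1].
by rewrite /rel_seq big_seq1 -XiE// /= mon_seq1 expr0 expr1n !mulr1.
Qed.

(** [d] is the part of f(k+1) - f(k) whose weight drops by one; the rest drops by two. Jets multiply
    by the Leibniz rule. *)
Definition jet w f d := [/\ low 0 w f, low 1 w d &
  low 2 w (fun k => f k.+1 - f k - d k)].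

Lemma jet_mul w f d v g e : jet w f d -> jet v g e ->
  jet (w + v) (fun k => f k * g k) (fun k => f k * e k + d k * g k).
Proof.
move=> [f0 f1 f2] [g0 g1 g2]; split; first exact: (low_mul f0 g0).
  by apply: low_add; [exact: (low_mul f0 g1)|exact: (low_mul f1 g0)].
have fr : low 1 w (fun k => f k.+1 - f k).
  apply: (low_ext (f := fun k => d k + (f k.+1 - f k - d k))); first by move=> k _; ring.
  by apply: low_add => //; apply: low_weak f2; lia.
have gr : low 1 v (fun k => g k.+1 - g k).
  apply: (low_ext (f := fun k => e k + (g k.+1 - g k - e k))); first by move=> k _; ring.
  by apply: low_add => //; apply: low_weak g2; lia.
apply: (low_ext (f := fun k => (f k.+1 - f k) * (g k.+1 - g k) +
  (f k * (g k.+1 - g k - e k) + (f k.+1 - f k - d k) * g k))); first by move=> k _; ring.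
apply: low_add; first exact: (low_mul fr gr).
apply: low_add; first exact: (low_mul f0 g2).
exact: (low_mul f2 g0).
Qed.

Lemma jet_ext w f d f' d' : (forall k, f k = f' k) -> (forall k, (k0 <= k)%N -> d k = d' k) ->
  jet w f d -> jet w f' d'.
Proof.
move=> ff dd [h0 h1 h2]; split.
- by apply: low_ext h0 => k _.
- by apply: low_ext h1.
- by apply: low_ext h2 => k kk; rewrite !ff dd.
Qed.

Lemma jet_1 : jet 0 (fun=> 1) (fun=> 0).
Proof.
split; [exact: low_const|exact: low_0|].
by apply: (low_ext _ (low_0 _ _)) => k _; rewrite subrr subr0.
Qed.

Lemma jet_exp w f d e : jet w f d ->
  jet (e * w) (fun k => f k ^+ e) (fun k => e%:R * f k ^+ e.-1 * d k).
Proof.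
move=> jf; elim: e => [|e IHe].
  by apply: (jet_ext _ _ jet_1) => k; rewrite ?expr0 ?mul0r.
rewrite mulSn; apply: (jet_ext _ _ (jet_mul jf IHe)) => k; first by rewrite exprS.
move=> _ /=; case: e {IHe} => [|e]; first by rewrite /= expr0; ring.
by rewrite /= [e.+2%:R]mulrS exprS; ring.
Qed.

Lemma jet_k : jet 1 (fun k => k%:R) (fun=> 1).
Proof.
split.
- by apply: (low_ext _ (low_powk 1)) => k _; rewrite expr1.
- by apply: low_weak (low_const 1).
- by apply: (low_ext _ (low_0 _ _)) => k _; rewrite -natr1; ring.
Qed.

Lemma ffact_lead l : exists f : nat -> algC, low 2 l.+1 f /\
  forall k, (k ^_ l)%:R = k%:R ^+ l + f k.
Proof.
elim: l => [|l [f [lf E]]].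
  by exists (fun=> 0); split=> [|k]; [exact: low_0|rewrite addr0 expr0 ffactn0].
have mulf k : (k ^_ l.+1)%:R = (k ^_ l)%:R * (k%:R - l%:R) :> algC.
  rewrite ffactnSr natrM; case: (leqP l k) => lk; first by rewrite natrB.
  by rewrite ffact_small// !mul0r.
exists (fun k => - l%:R * k%:R ^+ l + f k * (k%:R - l%:R)); split=> [|k].
  apply: low_add.
    by apply: low_weak (low_mul (low_const _) (low_powk l)); lia.
  have lk : low 0 1 (fun k => k%:R - l%:R).
    apply: low_add; first by apply: (low_ext _ (low_powk 1)) => k _; rewrite expr1.
    by apply: low_weak (low_const _).
  by apply: low_weak (low_mul lf lk); lia.
by rewrite mulf E exprSr; ring.
Qed.

Lemma jet_S j : jet (ll j).+1 (S j) (fun k => k%:R ^+ ll j * al j ^+ k * xi j k ^+ (ex j).+1).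
Proof.
have lax : low 0 0 (fun k => al j ^+ k * xi j k ^+ (ex j).+1).
  exact: (low_mul (low_chi (al_neq0 j)) (low_xi j)).
split; first exact: low_S.
  by apply: (low_ext _ (low_weak _ (low_mul (low_powk (ll j)) lax))) => [k _|]; [ring|lia].
have [f [lf E]] := ffact_lead (ll j).
apply: (low_ext _ (low_weak _ (low_mul lf lax))) => [k kk|]; last by lia.
by rewrite SS// E; ring.
Qed.

Lemma jet_prod (r : seq nI) (w : nI -> nat) (F D : nI -> nat -> algC) : uniq r ->
  (forall j, jet (w j) (F j) (D j)) ->
  jet (\sum_(j <- r) w j) (fun k => \prod_(j <- r) F j k)
    (fun k => \sum_(j <- r) D j k * \prod_(j' <- r | j' != j) F j' k).
Proof.
move=> + jF; elim: r => [_|j r IHr /andP[jr ur]].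
  by rewrite big_nil; apply: (jet_ext _ _ jet_1) => k; rewrite big_nil.
rewrite big_cons; apply: (jet_ext _ _ (jet_mul (jF j) (IHr ur))) => k; first by rewrite big_cons.
move=> _; rewrite [RHS]big_cons big_cons eqxx /= [RHS]addrC; congr (_ + _).
  rewrite mulr_sumr; apply: eq_big_seq => i ir.
  rewrite big_cons ifT; first ring.
  by apply: contraNneq jr => ->.
congr (_ * _); rewrite [LHS]big_seq [RHS]big_seq_cond; apply: eq_bigl => i.
by case: (boolP (i \in r)) => //= ir; apply/esym; apply: contraNneq jr => <-.
Qed.

(** The two kinds of terms in the derivative of a monomial: a power of k is lowered, or one S_j is
    replaced by its increment k^l alpha^k xi^(e+1), whose power of xi is put into the
    coefficient. *)
Definition lower_pow m : mon := ((m.1.1, m.1.2.-1), m.2).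
Definition lower_sum m j : mon := ((m.1.1 * al j, (m.1.2 + ll j)%N),
  (m.2.1, [ffun j' => (m.2.2 j' - (j' == j))%N])).

Lemma wt_lower_pow m : (0 < m.1.2)%N -> (wt (lower_pow m)).+1 = wt m.
Proof. by rewrite /wt /=; case: m.1.2. Qed.

Lemma wt_lower_sum m j : (0 < m.2.2 j)%N -> (wt (lower_sum m j)).+1 = wt m.
Proof.
move=> mj; rewrite /wt /= (bigD1 j)//= [in RHS](bigD1 j)//= ffunE eqxx.
rewrite (eq_bigr (fun i => m.2.2 i * (ll i).+1)%N); last first.
  by move=> i /negPf ij; rewrite ffunE ij subn0.
rewrite subn1; case: (m.2.2 j) mj => // e _; rewrite mulSn /=.
by move: (e * _)%N (\sum_(_ | _) _)%N => x y; lia.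
Qed.

Lemma mon_step m : m.1.1 != 0 -> exists2 err, low 2 (wt m) err &
  forall k, (k0 <= k)%N -> mon_seq m k.+1 = m.1.1 * snu m.2.1 (num a k) *
    (mon_seq m k + m.1.2%:R * mon_seq (lower_pow m) k +
     \sum_j (m.2.2 j)%:R * xi j k ^+ (ex j).+1 * mon_seq (lower_sum m j) k) + err k.
Proof.
move=> chi0; have js := @jet_prod (index_enum nI) _ _ _ (index_enum_uniq nI)
  (fun j => jet_exp (m.2.2 j) (jet_S j)).
have [_ _] := jet_mul (jet_exp m.1.2 jet_k) js; rewrite muln1 => l2.
have chiY0 : m.1.1 != 0 := chi0.
pose Z k := m.1.1 ^+ k * \prod_i Y i k ^+ m.2.1 i.
have lZ : low 0 0 Z.
  have := @low_mon ((m.1.1, 0%N), (m.2.1, [ffun=> 0%N])) chi0.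
  have -> : wt ((m.1.1, 0%N), (m.2.1, [ffun=> 0%N])) = 0%N.
    by rewrite /wt big1// => j _; rewrite ffunE.
  apply: low_ext => k _; rewrite /mon_seq /= expr0 mulr1 [X in _ * X]big1 ?mulr1// => j _.
  by rewrite ffunE expr0.
have := low_mul (low_mul (low_const m.1.1) (low_mul (low_expsum (expsum_snu m.2.1)) lZ)) l2.
rewrite !addn0 !add0n => l3; eexists; first exact: l3.
move=> k kk /=.
have -> : mon_seq m k.+1 = m.1.1 * snu m.2.1 (num a k) * Z k *
    (k.+1%:R ^+ m.1.2 * \prod_j S j k.+1 ^+ m.2.2 j).
  rewrite /mon_seq /Z exprS.
  have -> : \prod_i Y i k.+1 ^+ m.2.1 i = snu m.2.1 (num a k) * \prod_i Y i k ^+ m.2.1 i.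
    by rewrite -big_split; apply: eq_bigr => i _; rewrite YS// exprMn.
  ring.
have -> : mon_seq m k = Z k * (k%:R ^+ m.1.2 * \prod_j S j k ^+ m.2.2 j).
  by rewrite /mon_seq /Z; ring.
have -> : mon_seq (lower_pow m) k = Z k * (k%:R ^+ m.1.2.-1 * \prod_j S j k ^+ m.2.2 j).
  by rewrite /mon_seq /Z /=; ring.
set A := \sum_j _ * mon_seq _ k; set B := \sum_j _ * \prod_(_ | _ != _) _.
have -> : A = Z k * k%:R ^+ m.1.2 * B.
  rewrite mulr_sumr; apply: eq_bigr => j _; case E : (m.2.2 j) => [|e]; first by rewrite !mul0r mulr0.
  rewrite /mon_seq /= [(_ * al j) ^+ k]exprMn exprD [in LHS](bigD1 j)//= ffunE eqxx E subSS subn0.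
  have -> : \prod_(i | i != j) S i k ^+ [ffun j' => (m.2.2 j' - (j' == j))%N] i =
      \prod_(i | i != j) S i k ^+ m.2.2 i.
    by apply: eq_bigr => i /negPf ij; rewrite ffunE ij subn0.
  by rewrite /Z; ring.
ring.
Qed.

Lemma low_large p w f : low p w f -> exists N0, forall N, (N0 <= N)%N ->
  exists t : rel, rel_ok p w t /\ forall k, (k0 <= k)%N -> delta k ^+ N * f k = rel_seq t k.
Proof.
move=> [N [t [Ht E]]]; exists N => N' NN.
exists [seq ((fun th => Delta th ^+ (N' - N) * x.1 th), x.2) | x <- t]; split.
  by apply: rel_ok_scale => //; apply: expsumX.
by move=> k kk; rewrite rel_seq_scale -E// mulrA -exprD subnK.
Qed.

Lemma rel_seqE (s : rel) (T : seq mon) k : uniq T ->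
  (forall m, ~ pzero (rel_coef s m) -> m \in T) ->
  rel_seq s k = \sum_(m <- T) rel_coef s m (num a k) * mon_seq m k.
Proof.
move=> uT HT; pose T' := undup (T ++ [seq x.2 | x <- s]).
have -> : rel_seq s k = \sum_(m <- T') rel_coef s m (num a k) * mon_seq m k.
  rewrite /rel_seq; under [RHS]eq_bigr => m _ do rewrite /rel_coef mulr_suml.
  rewrite (exchange_big_dep xpredT)//= big_seq_cond [in RHS]big_seq_cond.
  apply: eq_bigr => x; rewrite andbT => xs.
  have x2 : x.2 \in T' by rewrite mem_undup mem_cat (map_f (fun y => y.2)) ?orbT.
  rewrite (big_rem x.2)//= eqxx big1_seq ?addr0// => m /andP[/eqP <-].
  by rewrite mem_rem_uniq ?undup_uniq// inE eqxx.
rewrite (bigID (mem T)) /= [X in _ + X]big1 ?addr0.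
  rewrite -big_filter; apply: perm_big; apply: uniq_perm => //.
    by rewrite filter_uniq ?undup_uniq.
  by move=> m; rewrite mem_filter mem_undup mem_cat; case: (m \in T).
move=> m mT; have z : pzero (rel_coef s m) by apply: contrapT => /HT; rewrite (negPf mT).
by rewrite z ?mul0r//; exact: point_num.
Qed.

(** Induction on the bound [W] for the weight, then on the number of monomials of top weight. Let
    [m0] be one of these and [V0] its coefficient. The combination of the relation and its shift in
    which [m0] cancels has fewer of them, so all its coefficients vanish. In weight [W] this is a
    multiplicative equation: top coefficients are multiples of [V0], and top monomials have the same
    alpha^k and Y parts. In weight W - 1 it is an additive equation, whose inhomogeneous part comes
    from differentiating the top monomials. *)
Lemma rel_vanish W : forall s : rel, (forall x, x \in s -> expsum x.1 /\ x.2.1.1 != 0) ->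
  (exists k1, forall k, (k1 <= k)%N -> rel_seq s k = 0) ->
  (forall m, ~ pzero (rel_coef s m) -> (wt m < W)%N) -> forall m, pzero (rel_coef s m).
Proof.
elim: W => [|W IHW] s Hs s0 sW.
  by move=> m; apply: contrapT => /sW.
suff H : forall q (T : seq mon), (size T <= q)%N -> forall s : rel,
    (forall x, x \in s -> expsum x.1 /\ x.2.1.1 != 0) ->
    (exists k1, forall k, (k1 <= k)%N -> rel_seq s k = 0) ->
    (forall m, ~ pzero (rel_coef s m) -> (wt m <= W)%N /\ (wt m = W -> m \in T)) ->
    forall m, pzero (rel_coef s m).
  apply: (H _ [seq x.2 | x <- s] (leqnn _)) => // m mn; split; first exact: sW.
  move=> _; apply: contrapT => ms; apply: mn => th _; rewrite /rel_coef big1_seq// => x /andP[/eqP xm xs].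
  by case: ms; rewrite -xm; apply: map_f.
move=> {s Hs s0 sW} q; elim: q => [|q IHc] T sT s Hs s0 sW.
  apply: IHW => // m /sW[mW mT]; rewrite ltn_neqAle mW andbT; apply/eqP => /mT.
  by move: sT; rewrite leqn0 size_eq0 => /eqP ->.
case: T sT sW => [_|m0 T' sT sW]; first exact: (IHc [::]).
have [m0n|m0n] := pselect (~ pzero (rel_coef s m0) /\ wt m0 = W); last first.
  apply: (IHc T') => // m mn; have [mW mT] := sW m mn; split=> // wm.
  have := mT wm; rewrite inE => /orP[/eqP mm|//]; case: m0n; rewrite -mm; split=> //.
have [nz0 w0] := m0n.
pose V m := rel_coef s m; pose V0 := V m0.
have eV m : expsum (V m) by apply: expsum_sum => x /Hs[].
pose T0 := undup [seq m <- [seq x.2 | x <- s] | ~~ `[< pzero (V m) >]].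
have T0P m : m \in T0 <-> ~ pzero (V m).
  rewrite mem_undup mem_filter; split=> [/andP[/asboolPn//]|mn].
  apply/andP; split; first exact/asboolPn.
  apply: contrapT => ms; apply: mn => th _; rewrite /V /rel_coef big1_seq// => x /andP[/eqP xm xs].
  by case: ms; rewrite -xm; apply: map_f.
have uT0 : uniq T0 by exact: undup_uniq.
have chiT m : m \in T0 -> m.1.1 != 0.
  by rewrite mem_undup mem_filter => /andP[_ /mapP[x /Hs[_ ? ->]]].
have sE k : rel_seq s k = \sum_(m <- T0) V m (num a k) * mon_seq m k.
  by apply: rel_seqE => // m /T0P.
have m0T : m0 \in T0 by apply/T0P.
have [k1 sk] := s0.
have /choice[err errP] (m : mon) : exists err : nat -> algC, m.1.1 != 0 -> low 2 (wt m) err /\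
  forall k, (k0 <= k)%N -> mon_seq m k.+1 = m.1.1 * snu m.2.1 (num a k) *
    (mon_seq m k + m.1.2%:R * mon_seq (lower_pow m) k +
     \sum_j (m.2.2 j)%:R * xi j k ^+ (ex j).+1 * mon_seq (lower_sum m j) k) + err k.
  have [->|/mon_step[err l E]] := eqVneq m.1.1 0; first by exists (fun=> 0).
  by exists err.
have /choice[Ne NeP] (m : mon) : exists N0, m.1.1 != 0 -> forall N, (N0 <= N)%N ->
  exists t : rel, rel_ok 2 (wt m) t /\ forall k, (k0 <= k)%N -> delta k ^+ N * err m k = rel_seq t k.
  have [m00|/errP[/low_large[N0 H] _]] := eqVneq m.1.1 0; first by exists 0%N => /eqP.
  by exists N0.
pose N := (\sum_(m <- T0) Ne m + \sum_j (ex j).+1)%N.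
have /choice[tm tmP] (m : mon) : exists t : rel, m \in T0 ->
    rel_ok 2 (wt m) t /\ forall k, (k0 <= k)%N -> delta k ^+ N * err m k = rel_seq t k.
  case: (boolP (m \in T0)) => [mT|]; last by exists [::].
  have [|t Ht] := NeP m (chiT m mT) N; last by exists t.
  by rewrite /N (big_rem m)//=; lia.
have exN j : ((ex j).+1 <= N)%N by rewrite /N [X in (_ + X)%N](bigD1 j)//=; lia.
pose sg (f : pt -> algC) : pt -> algC := fun th => f (pshift 1 th).
have esg f : expsum f -> expsum (sg f) by exact: expsum_shift.
have sgE f k : sg f (num a k) = f (num a k.+1) by rewrite /sg pshift_num addn1.
(* Coefficients of the new relation: [A] comes from the monomial itself and is zero for [m0], [B]
   and [C] come from its derivative, [E] from the error, which drops the weight by two. *)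
pose A m : pt -> algC := fun th => Delta th ^+ N *
  (m.1.1 * snu m.2.1 th * V0 th * sg (V m) th - m0.1.1 * snu m0.2.1 th * sg V0 th * V m th).
pose B m : pt -> algC := fun th => m.1.2%:R * (Delta th ^+ N * (m.1.1 * snu m.2.1 th * V0 th * sg (V m) th)).
pose C m j : pt -> algC := fun th => (m.2.2 j)%:R * (Xi N j th * (m.1.1 * snu m.2.1 th * V0 th * sg (V m) th)).
pose E m : rel := [seq ((fun th => V0 th * sg (V m) th * x.1 th), x.2) | x <- tm m].
have eD : expsum (fun th => Delta th ^+ N) by apply: expsumX.
have eG m : expsum (fun th => m.1.1 * snu m.2.1 th * V0 th * sg (V m) th).
  apply: expsumM; last exact: esg.
  by apply: expsumM; [apply: expsumM; [exact: expsum_const|exact: expsum_snu]|exact: eV].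
have eA m : expsum (A m).
  apply: expsumM => //; apply: expsumB; first exact: eG.
  apply: expsumM; last exact: eV.
  apply: expsumM; last by apply: esg; exact: eV.
  by apply: expsumM; [exact: expsum_const|exact: expsum_snu].
have eB m : expsum (B m).
  by apply: expsumM; [exact: expsum_const|apply: expsumM; [exact: eD|exact: eG]].
have eC m j : expsum (C m j).
  by apply: expsumM; [exact: expsum_const|apply: expsumM; [exact: expsum_Xi|exact: eG]].
pose blk m : rel := (A m, m) :: (B m, lower_pow m) ::
  [seq (C m j, lower_sum m j) | j <- index_enum nI] ++ E m.
pose s' : rel := flatten [seq blk m | m <- T0].
have s'ok x : x \in s' -> expsum x.1 /\ x.2.1.1 != 0.
  move=> /flatten_mapP[m mT]; rewrite !inE mem_cat => /orP[/eqP->|/orP[/eqP->|/orP[]]].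
  - by split; [exact: eA|exact: chiT].
  - by split; [exact: eB|rewrite /=; exact: chiT].
  - by move=> /mapP[j _ ->]; split; [exact: eC|rewrite /= mulf_neq0 ?chiT ?al_neq0].
  - move=> /mapP[y yt ->]; have [/(_ y yt)[ey y0 _] _] := tmP m mT; split=> //=.
    by apply: expsumM => //; apply: expsumM; [exact: eV|apply: esg; exact: eV].
have lin (x y z : algC) (F G : mon -> algC) : z * (x * \sum_(m <- T0) F m - y * \sum_(m <- T0) G m) =
    \sum_(m <- T0) z * (x * F m - y * G m).
  by rewrite !mulr_sumr -sumrB mulr_sumr.
have s'E k : (k0 <= k)%N -> rel_seq s' k = delta k ^+ N *
   (V0 (num a k) * rel_seq s k.+1 - m0.1.1 * snu m0.2.1 (num a k) * V0 (num a k.+1) * rel_seq s k).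
  move=> kk; rewrite /rel_seq big_flatten big_map -/(rel_seq s k) -/(rel_seq s k.+1) !sE.
  rewrite lin; apply: eq_big_seq => m mT.
  rewrite /blk !big_cons big_cat /= big_map /E.
  have -> : \sum_(i <- [seq ((fun th => V0 th * sg (V m) th * x.1 th), x.2) | x <- tm m]) i.1 (num a k) * mon_seq i.2 k =
     V0 (num a k) * sg (V m) (num a k) * (delta k ^+ N * err m k).
    have [_ ->//] := tmP m mT; exact: (rel_seq_scale (fun th => V0 th * sg (V m) th)).
  have -> : \sum_j C m j (num a k) * mon_seq (lower_sum m j) k =
     delta k ^+ N * (m.1.1 * snu m.2.1 (num a k) * V0 (num a k) * sg (V m) (num a k)) *
     \sum_j (m.2.2 j)%:R * xi j k ^+ (ex j).+1 * mon_seq (lower_sum m j) k.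
    rewrite mulr_sumr; apply: eq_bigr => j _; rewrite /C XiE//.
    move: (xi j k ^+ (ex j).+1) (delta k ^+ N) => z1 z2; ring.
  have [_ ->//] := errP m (chiT m mT).
  rewrite /A /B sgE sgE -/(delta k); move: (\sum_j _) (delta k ^+ N) => z1 z2; ring.
have s'0 k : (maxn k0 k1 <= k)%N -> rel_seq s' k = 0.
  by rewrite geq_max => /andP[kk kk1]; rewrite s'E// !sk ?mulr0 ?subrr ?mulr0// leqW.
have T0W m : m \in T0 -> (wt m <= W)%N by move/T0P/sW => [].
have s'coef m th : rel_coef s' m th = \sum_(m' <- T0)
   ((if m' == m then A m' th else 0) + ((if lower_pow m' == m then B m' th else 0) +
    (\sum_(j | lower_sum m' j == m) C m' j th + rel_coef (E m') m th))).
  rewrite /rel_coef /s' big_flatten big_map; apply: eq_bigr => m' _.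
  rewrite /blk !big_cons /= big_cat /= big_map.
  by case: ifP; case: ifP; rewrite ?add0r.
have Ecoef m m' th : m' \in T0 -> (W <= (wt m).+1)%N -> rel_coef (E m') m th = 0.
  move=> mT mW; rewrite /rel_coef big1_seq// => x /andP[/eqP xm /mapP[y yt xy]].
  have wy : wt y.2 = wt m by rewrite -xm xy.
  have [/(_ y yt)[_ _ w2] _] := tmP m' mT; have := leq_trans w2 (T0W m' mT); rewrite wy.
  by move: mW; move: (wt m) => z; clear; lia.
have topE m th : wt m = W -> rel_coef s' m th = if m \in T0 then A m th else 0.
  move=> mW; rewrite s'coef; under eq_big_seq => m' mT.
    rewrite Ecoef ?mW// addr0 big1 ?addr0; last first.
      move=> j /eqP lm; have [m20|m20] := posnP (m'.2.2 j); first by rewrite /C m20 mul0r.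
      by have := wt_lower_sum m20; rewrite lm mW; have := T0W m' mT; lia.
    have -> : (if lower_pow m' == m then B m' th else 0) = 0.
      case: eqP => // lm; have [m20|m20] := posnP m'.1.2; first by rewrite /B m20 mul0r.
      by have := wt_lower_pow m20; rewrite lm mW; have := T0W m' mT; lia.
    rewrite addr0; over.
  case: ifP => mT; last first.
    by rewrite big1_seq// => m' /andP[_ mT']; case: eqP => // mm; rewrite -mm mT' in mT.
  rewrite (bigD1_seq m)//= eqxx big1 ?addr0// => m' /negPf-> //.
have z' m : pzero (rel_coef s' m).
  apply: (IHc T' _ s') => //; first by exists (maxn k0 k1).
  move=> {}m mn; split.
    rewrite leqNgt; apply/negP => Wm; apply: mn => th _; rewrite s'coef big1_seq// => m' /andP[_ mT].
    rewrite Ecoef//; last by lia.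
    rewrite addr0 ifF ?add0r; last by apply/eqP => mm; have := T0W m' mT; rewrite mm; lia.
    rewrite big1 ?addr0; last first.
      move=> j /eqP lm; have [m20|m20] := posnP (m'.2.2 j); first by rewrite /C m20 mul0r.
      by have := wt_lower_sum m20; rewrite lm; have := T0W m' mT; lia.
    case: eqP => // lm; have [m20|m20] := posnP m'.1.2; first by rewrite /B m20 mul0r.
    by have := wt_lower_pow m20; rewrite lm; have := T0W m' mT; lia.
  move=> mW; have mT : m \in T0.
    by apply/negPn/negP => mT; apply: mn => th _; rewrite topE// (negPf mT).
  have [_ /(_ mW)] := sW m ((T0P m).1 mT); rewrite inE => /orP[/eqP mm|//].
  by case: mn => th _; rewrite topE// mT mm /A -/V0; ring.
exfalso.
pose top m := (m \in T0) && (wt m == W).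
have topm0 : top m0 by rewrite /top m0T w0 eqxx.
have /choice[f fP] (m : mon) : exists f : algC, top m ->
    [/\ m.1.1 = m0.1.1, m.2.1 = m0.2.1, f != 0 & forall th, point th -> V m th = f * V0 th].
  case: (boolP (top m)) => [/andP[mT /eqP mW]|]; last by exists 0.
  have [||||||k kk|-> nn [f fn fE]] := multiplicative_equation n_ge2 cn0 Drs rs1 nd u_rec u_neq0 u_ngeo
      a01 b_neq0 b_inj regular (v := V m) (v0 := V0) (x1 := m.1.1) (x0 := m0.1.1)
      (nu1 := m.2.1) (nu0 := m0.2.1).
  - exact: chiT.
  - exact: chiT.
  - exact: eV.
  - exact: eV.
  - exact/T0P.
  - exact/T0P.
  - have := z' m _ (point_num a k); rewrite topE// mT /A => /eqP.
    rewrite mulf_eq0 expf_eq0 (negPf (delta_neq0 kk)) andbF /= subr_eq0 !sgE => /eqP; rewrite -!mulrA => E0.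
    rewrite -[\prod_i _]/(snu m.2.1 (num a k)) [V m (num a k.+1) * _]mulrC; exact: E0.
  - by exists f => _; split=> //; apply/ffunP => i; rewrite nn.
pose fl m : algC := if top m then f m else 0.
have fl0 m : top m -> fl m != 0 by move=> tm'; rewrite /fl tm'; have [] := fP m tm'.
(* [c0] and [cc] collect what the top monomials contribute to the monomial [ms] of weight W - 1. *)
have key ms : wt ms = W.-1 -> (0 < W)%N -> ms.2.1 = m0.2.1 -> ms.1.1 != 0 ->
   let c0 := \sum_(m <- T0 | lower_pow m == ms) m.1.2%:R * fl m in
   let cc j := \sum_(m <- T0 | lower_sum m j == ms) (m.2.2 j)%:R * fl m in
   (ms.1.1 = m0.1.1 -> c0 = 0) /\
   forall j, \sum_(j' | (be j' == be j) && (ex j' == ex j)) cc j' = 0.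
  move=> wms W0 nus chis c0 cc.
  pose v := if ms \in T0 then V ms else fun=> 0.
  have ev : expsum v by rewrite /v; case: ifP => _; [exact: eV|exact: expsum_const].
  have [|k kk|H1 H2] := additive_equation n_ge2 cn0 Drs rs1 nd u_rec u_neq0 u_ngeo
      a01 b_neq0 b_inj regular be_cover (cc := fun j => - cc j) (v := v) (v0 := V0)
      (x := ms.1.1 / m0.1.1) (c0 := - c0) (ex := ex) _ ev (eV m0) ((T0P m0).1 m0T).
  - by rewrite mulf_neq0 ?invr_eq0// chiT.
  - have := z' ms _ (point_num a k); rewrite s'coef.
    have -> : \sum_(m' <- T0) ((if m' == ms then A m' (num a k) else 0) +
        ((if lower_pow m' == ms then B m' (num a k) else 0) +
        (\sum_(j | lower_sum m' j == ms) C m' j (num a k) + rel_coef (E m') ms (num a k)))) =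
       (if ms \in T0 then A ms (num a k) else 0) + delta k ^+ N * (m0.1.1 * snu m0.2.1 (num a k)) *
       (V0 (num a k) * V0 (num a k.+1)) * (c0 + \sum_j cc j * xi j k ^+ (ex j).+1).
      rewrite big_split /=; congr (_ + _).
        rewrite -big_mkcond; case: ifP => mT.
          by rewrite -big_filter filter_pred1_uniq// big_seq1.
        by rewrite big1_seq// => m' /andP[/eqP-> ]; rewrite mT.
      have topP m j : m \in T0 -> (lower_sum m j == ms) -> (0 < m.2.2 j)%N -> top m.
        by move=> mT /eqP lm m20; rewrite /top mT -(wt_lower_sum m20) lm wms prednK ?eqxx.
      have topQ m : m \in T0 -> (lower_pow m == ms) -> (0 < m.1.2)%N -> top m.
        by move=> mT /eqP lm m20; rewrite /top mT -(wt_lower_pow m20) lm wms prednK ?eqxx.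
      have GE m : top m -> m.1.1 * snu m.2.1 (num a k) * V0 (num a k) * sg (V m) (num a k) =
          m0.1.1 * snu m0.2.1 (num a k) * (V0 (num a k) * V0 (num a k.+1)) * fl m.
        move=> tm'; have [-> -> _ VE] := fP m tm'; rewrite sgE VE /fl ?tm'; last exact: point_num.
        ring.
      rewrite big_split /= mulrDr; congr (_ + _).
        rewrite /c0 -big_mkcond mulr_sumr big_seq_cond [RHS]big_seq_cond; apply: eq_bigr => m /andP[mT lm].
        have [m20|m20] := posnP m.1.2; first by rewrite /B m20; ring.
        by rewrite /B GE ?(topQ m)// -/(delta k); ring.
      transitivity (\sum_(m <- T0) \sum_(j | lower_sum m j == ms) C m j (num a k)).
        by apply: eq_big_seq => m mT; rewrite Ecoef ?addr0// wms prednK.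
      rewrite (exchange_big_dep xpredT)//= mulr_sumr; apply: eq_bigr => j _.
      rewrite /cc mulr_suml mulr_sumr big_seq_cond [RHS]big_seq_cond; apply: eq_bigr => m /andP[mT lm].
      have [m20|m20] := posnP (m.2.2 j); first by rewrite /C m20; ring.
      by rewrite /C GE ?(topP m j)// XiE//; move: (xi j k ^+ _) (delta k ^+ N) => z1 z2; ring.
    have -> : (if ms \in T0 then A ms (num a k) else 0) = delta k ^+ N * (snu m0.2.1 (num a k)) *
       (ms.1.1 * V0 (num a k) * v (num a k.+1) - m0.1.1 * V0 (num a k.+1) * v (num a k)).
      by rewrite /v; case: ifP => _; [rewrite /A !sgE nus -/(delta k)|]; ring.
    move=> E0; have H0 : delta k ^+ N * snu m0.2.1 (num a k) * (
       (ms.1.1 * V0 (num a k) * v (num a k.+1) - m0.1.1 * V0 (num a k.+1) * v (num a k)) +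
       m0.1.1 * (V0 (num a k) * V0 (num a k.+1) * (c0 + \sum_j cc j * xi j k ^+ (ex j).+1))) = 0.
      by rewrite -[RHS]E0; ring.
    move/eqP: H0; rewrite mulf_eq0 mulf_eq0 expf_eq0 (negPf (delta_neq0 kk)) andbF (negPf (snu_neq0 _ kk)) /=.
    rewrite addr_eq0 => /eqP H0; have m01 : m0.1.1 != 0 := chiT _ m0T.
    apply: (mulfI m01); transitivity (ms.1.1 * V0 (num a k) * v (num a k.+1) - m0.1.1 * V0 (num a k.+1) * v (num a k)).
      by rewrite mulrBr; congr (_ - _); [field|ring].
    rewrite H0 -mulrN -mulrN opprD; congr (_ * (_ * (_ + _))).
    by rewrite -sumrN; apply: eq_bigr => j _; rewrite mulNr.
  - split=> [e1|j]; first by apply/eqP; rewrite -oppr_eq0; apply/eqP/H1; rewrite e1 divff ?chiT.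
    by apply/eqP; rewrite -oppr_eq0 -sumrN; apply/eqP/H2.
have topnu m : top m -> m.2.1 = m0.2.1 by case/fP.
have topchi m : top m -> m.1.1 = m0.1.1 by case/fP.
have topT m : top m -> m \in T0 by case/andP.
have topW m : top m -> wt m = W by case/andP => _ /eqP.
(* A positive power of k in a top monomial would make [c0] nonzero: the monomial can be recovered
   from its lowering, so nothing cancels its contribution. *)
have [[m [tpm m20]]|nod] := pselect (exists m, top m /\ (0 < m.1.2)%N).
  have := wt_lower_pow m20; rewrite (topW m)// => w1.
  have [||||+ _] := key (lower_pow m).
  - by rewrite -w1.
  - by rewrite -w1.
  - by rewrite /= topnu.
  - by rewrite /= chiT ?topT.
  rewrite /= => /(_ (topchi m tpm)) /eqP; apply/negP.
  rewrite big_mkcond (bigD1_seq m) ?topT//= eqxx big1_seq ?addr0.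
    by rewrite mulf_neq0 ?fl0// pnatr_eq0 -lt0n.
  move=> m' /andP[mm mT']; case: (eqVneq _ _) => // lm.
  have [->|m'0] := posnP m'.1.2; first by rewrite mul0r.
  case/eqP: mm; case: m m' m20 m'0 lm {tpm w1 mT'} => [[x d] r] [[x' d'] r'] /= d0 d'0 [-> dd ->].
  by congr (_, _, _); move: d0 d'0 dd; clear; lia.
have d0 m : top m -> m.1.2 = 0%N.
  by move=> tm'; apply/eqP; rewrite -leqn0 leqNgt; apply/negP => mm; apply: nod; exists m.
(* Likewise for a sum S_j: the pole, its order and the lowered monomial determine alpha_j and l_j,
   hence [j] by [param_inj], and then the monomial. *)
have [[m [j [tpm m20]]]|nos] := pselect (exists m j, top m /\ (0 < m.2.2 j)%N).
  have := wt_lower_sum m20; rewrite (topW m)// => w1.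
  have [||||_ /(_ j)] := key (lower_sum m j).
  - by rewrite -w1.
  - by rewrite -w1.
  - by rewrite /= topnu.
  - by rewrite /= mulf_neq0 ?chiT ?topT.
  move=> /eqP; apply/negP; have inj m' j' : top m' -> ex j' = ex j -> be j' = be j ->
      (0 < m'.2.2 j')%N -> lower_sum m' j' = lower_sum m j -> m' = m /\ j' = j.
    move=> tm' exj bej m'0 lm; have [e1 e2 _ e4] : [/\ m'.1.1 * al j' = m.1.1 * al j,
        (m'.1.2 + ll j')%N = (m.1.2 + ll j)%N, m'.2.1 = m.2.1 & (lower_sum m' j').2.2 = (lower_sum m j).2.2].
      by rewrite lm; move: lm; rewrite /lower_sum => -[-> -> -> _].
    rewrite !d0// !add0n in e2; rewrite !topchi// in e1.
    have jj : j' = j by apply: param_inj => //; apply: (mulfI (chiT _ m0T)).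
    split=> //; case: m' m tm' tpm m'0 m20 e4 {lm e1 w1} => [[x' d'] [nu' mu']] [[x d] [nu mu]] t' t.
    rewrite /= jj => m'0 m20 /ffunP E4.
    have := topchi _ t'; have := topchi _ t; have := topnu _ t'; have := topnu _ t; have := d0 _ t'; have := d0 _ t.
    rewrite /= => -> -> -> -> -> ->; congr (_, (_, _)); apply/ffunP => i; have := E4 i; rewrite !ffunE.
    by case: eqP => [->|_] /=; [move: m'0 m20; clear; lia|rewrite !subn0].
  rewrite (bigD1 j) ?eqxx//= [X in _ + X]big1 ?addr0.
    rewrite big_mkcond (bigD1_seq m) ?topT//= eqxx big1_seq ?addr0.
      by rewrite mulf_neq0 ?fl0// pnatr_eq0 -lt0n.
    move=> m' /andP[mm mT']; case: (eqVneq _ _) => // lm.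
    have [->|m'0] := posnP (m'.2.2 j); first by rewrite mul0r.
    case: (boolP (top m')) => tm'; last by rewrite /fl (negPf tm') mulr0.
    by have [m'm _] := inj m' j tm' erefl erefl m'0 lm; rewrite m'm eqxx in mm.
  move=> j' /andP[/andP[/eqP bej /eqP exj] jj]; rewrite big1_seq// => m' /andP[/eqP lm mT'].
  have [->|m'0] := posnP (m'.2.2 j'); first by rewrite mul0r.
  case: (boolP (top m')) => tm'; last by rewrite /fl (negPf tm') mulr0.
  by have [_ jj'] := inj m' j' tm' exj bej m'0 lm; rewrite jj' eqxx in jj.
have mu0 m j : top m -> m.2.2 j = 0%N.
  by move=> tm'; apply/eqP; rewrite -leqn0 leqNgt; apply/negP => mm; apply: nos; exists m, j.
(* In weight zero every monomial is [m0], and the relation is a single term whose Y_i are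
   nonzero. *)
have W0 : W = 0%N.
  by rewrite -w0 /wt d0// big1// => j _; rewrite mu0.
have allm m : m \in T0 -> m = m0.
  move=> mT; have tpm : top m by rewrite /top mT W0; have := T0W m mT; rewrite W0 leqn0.
  case: m {mT} tpm => [[x' d'] [nu' mu']] t'.
  have := topchi _ t'; have := topnu _ t'; have := d0 _ t'; have := d0 _ topm0.
  have M1 := mu0 _ ^~ t'; have M2 := mu0 _ ^~ topm0.
  case: (m0) M1 M2 => [[x d] [nu mu]] /= M1 M2 -> -> -> ->; congr (_, (_, _)).
  by apply/ffunP => j; rewrite M1 M2.
apply: nz0; apply: (expsum_transfer n_ge2 cn0 Drs rs1 nd a01 (k0 := maxn k0 k1)) => [|k]; first exact: eV.
rewrite geq_max => /andP[kk kk1]; have := sk k kk1; rewrite sE.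
have -> : T0 = [:: m0].
  move: uT0 m0T allm; case: (T0) => [//|x [|y r]] /= ux m0x al0.
    by rewrite (al0 x) ?mem_head.
  have xm := al0 x (mem_head _ _).
  have ym : y = m0 by apply: al0; rewrite inE mem_head orbT.
  by move: ux; rewrite xm ym inE eqxx.
rewrite big_seq1 => /eqP; rewrite mulf_eq0 => /orP[/eqP//|].
rewrite /mon_seq d0// expr0 mulr1 => /eqP z; exfalso; move/eqP: z; apply/negP.
rewrite !mulf_neq0 ?expf_neq0 ?chiT//; apply/prodf_neq0 => i _; first by rewrite expf_neq0 ?Y_neq0.
by rewrite mu0 ?expr0 ?oner_neq0.
Qed.

Theorem sequences_independent (s : rel) k1 : (forall x, x \in s -> expsum x.1 /\ x.2.1.1 != 0) ->
  (forall k, (k1 <= k)%N -> rel_seq s k = 0) -> forall m, pzero (rel_coef s m).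
Proof.
move=> Hs s0; apply: (@rel_vanish (\sum_(x <- s) (wt x.2).+1)%N) => // [|m mn]; first by exists k1.
have [x xs xm] : exists2 x, x \in s & x.2 = m.
  apply: contrapT => nx; apply: mn => th _; rewrite /rel_coef big1_seq// => x /andP[/eqP xm xs].
  by case: nx; exists x.
by rewrite (big_rem x)//= xm; lia.
Qed.

End AlgebraicIndependenceOfSequences.

(** * Liouville's inequality *)

Lemma absv_nat_le (R : realType) (K : valuedFieldType R) m : absv (m%:R : K) <= m%:R.
Proof.
elim: m => [|m IHm]; first by rewrite absv0.
by rewrite -!natr1 (le_trans (absvD _ _))// lerD// absv1.
Qed.

Section Liouville.
Variables (R : realType) (v : place) (K : valuedFieldType R).
Hypothesis Kv : forall q : rat, absv (ratr q : K) = rat_absv R v q.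

Lemma absv_int_le (q : rat) : q \is a Num.int -> absv (ratr q : K) <= ratr `|q|.
Proof.
move=> /intrP[m ->]; rewrite -intr_norm !ratr_int; case: m => m.
  by rewrite ger0_norm//; exact: absv_nat_le.
by rewrite NegzE rmorphN absvN normrN ger0_norm//; exact: absv_nat_le.
Qed.

(** At a prime, this holds because the power of p dividing a nonzero integer is at most its absolute
    value. *)
Lemma absv_int_ge (q : rat) : q \is a Num.int -> q != 0 ->
  1 <= absv (ratr q : K) * ratr `|q|.
Proof.
move=> qi q0; have [m qm] := intrP qi; rewrite Kv.
have n1 : 1 <= ratr `|q| :> R.
  rewrite qm -intr_norm ratr_int -[1]/(1%:~R) ler_int.
  by rewrite -gtz0_ge1 normr_gt0; apply: contraNneq q0; rewrite qm => ->.
case: v => [|p pr] /=.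
  by rewrite -ratr_norm -[1]mul1r ler_pM.
rewrite (negPf q0) qm numq_int denq_int logn1 expr0 mul1r.
have m0 : (0 < `|m|)%N by rewrite absz_gt0; apply: contraNneq q0; rewrite qm => ->.
rewrite mulrC ler_pdivlMr ?exprn_gt0 ?ltr0n ?prime_gt0// mul1r -intr_norm ratr_int.
rewrite -natrX -[(`|m|)]gez0_abs ?normr_ge0// absz_id pmulrn ler_nat.
by apply: dvdn_leq => //; rewrite pfactor_dvdnn.
Qed.

Lemma det_le (F : numFieldType) m (A : 'M[F]_m) h : (forall i k, `|A i k| <= h) ->
  `|\det A| <= m`!%:R * h ^+ m.
Proof.
move=> Ah; rewrite /determinant (le_trans (ler_norm_sum _ _ _))//.
have -> : m`!%:R * h ^+ m = \sum_(s : 'S_m) h ^+ m.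
  by rewrite sumr_const card_Sn mulr_natl.
apply: ler_sum => s _; rewrite normrM normr_sign mul1r normr_prod.
rewrite -[m in h ^+ m]card_ord -prodr_const.
by apply: ler_prod => i _; rewrite normr_ge0 Ah.
Qed.

Variables (L : fieldExtType rat) (jL : {rmorphism L -> K}).
Local Notation d := (\dim {:L}).
Let X := vbasis {:L}.

Let Xb : basis_of {:L} X. Proof. exact: vbasisP. Qed.

Let d_gt0 : (0 < d)%N.
Proof. by rewrite adim_gt0. Qed.

(** Multiplication by [z] in a rational basis, acting on row vectors; hence the reversed order in
    [rmxM]. *)
Definition rmx (z : L) : 'M[rat]_d := \matrix_(i, k) coord X k (z * X`_i).

Lemma rmxE z (i : 'I_d) : z * X`_i = \sum_k rmx z i k *: X`_k.
Proof.
by rewrite [LHS](coord_basis Xb) ?memvf//; apply: eq_bigr => k _; rewrite mxE.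
Qed.

Let freeX (c1 c2 : 'I_d -> rat) : \sum_k c1 k *: X`_k = \sum_k c2 k *: X`_k -> c1 =1 c2.
Proof.
move=> E i; have fX := basis_free Xb.
by rewrite -(coord_sum_free c1 i fX) -(coord_sum_free c2 i fX) E.
Qed.

Lemma rmxM z w : rmx (z * w) = rmx w *m rmx z.
Proof.
apply/matrixP => i k; rewrite [RHS]mxE; move: k; apply: freeX.
rewrite -rmxE -mulrA rmxE mulr_sumr; under eq_bigr => k _.
  by rewrite -scalerAr rmxE scaler_sumr; over.
rewrite exchange_big; apply: eq_bigr => k _ /=.
by rewrite scaler_suml; apply: eq_bigr => l _; rewrite scalerA.
Qed.

Lemma rmxD z w : rmx (z + w) = rmx z + rmx w.
Proof. by apply/matrixP => i k; rewrite !mxE mulrDl linearD. Qed.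

Lemma rmxZ q z : rmx (q *: z) = q *: rmx z.
Proof. by apply/matrixP => i k; rewrite !mxE -scalerAl linearZ. Qed.

Lemma rmx1 : rmx 1 = 1%:M.
Proof.
apply/matrixP => i k; move: k; apply: freeX; rewrite -rmxE mul1r (bigD1 i)//= mxE eqxx scale1r.
by rewrite big1 ?addr0// => k /negPf ki; rewrite mxE eq_sym ki scale0r.
Qed.

Lemma rmx_det z : z != 0 -> \det (rmx z) != 0.
Proof.
move=> z0; have := congr1 determinant (rmxM z^-1 z); rewrite mulVf// rmx1 det1 det_mulmx.
by move=> E; apply: contra_eq_neq E => ->; rewrite mul0r oner_neq0.
Qed.

Variable delta : nat.
Hypothesis delta_gt0 : (0 < delta)%N.
Definition Hsize := (2 * delta * d.+1)%N.
Local Notation H := Hsize.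

Definition mxsize m (A : 'M[rat]_m) : rat := \sum_i \sum_k `|A i k|.
Definition integral_mx m (A : 'M[rat]_m) := forall i k, A i k \is a Num.int.

(** One number [B] bounds the denominator and the size at once: a product adds the bounds and a sum
    costs one unit. The base [H] exceeds 2 delta and delta d, as needed for sums and for the element
    1. *)
Definition bd (B : nat) (z : L) :=
  integral_mx (delta%:R ^+ B *: rmx z) /\ mxsize (delta%:R ^+ B *: rmx z) <= H%:R ^+ B.

Lemma mxsizeM m (A B : 'M[rat]_m) : mxsize (A *m B) <= mxsize A * mxsize B.
Proof.
rewrite /mxsize mulr_suml; apply: ler_sum => i _; rewrite mulr_suml.
apply: (@le_trans _ _ (\sum_k \sum_l `|A i l| * `|B l k|)).
  apply: ler_sum => k _; rewrite mxE (le_trans (ler_norm_sum _ _ _))//.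
  by apply: ler_sum => l _; rewrite normrM.
rewrite exchange_big; apply: ler_sum => l _ /=; rewrite -mulr_sumr ler_wpM2l//.
rewrite [leRHS](bigD1 l)//= lerDl sumr_ge0// => i' _.
by rewrite sumr_ge0.
Qed.

Lemma mxsizeD m (A B : 'M[rat]_m) : mxsize (A + B) <= mxsize A + mxsize B.
Proof.
rewrite /mxsize -big_split; apply: ler_sum => i _; rewrite -big_split; apply: ler_sum => k _.
by rewrite mxE ler_normD.
Qed.

Lemma mxsizeZ m q (A : 'M[rat]_m) : mxsize (q *: A) = `|q| * mxsize A.
Proof.
rewrite /mxsize mulr_sumr; apply: eq_bigr => i _; rewrite mulr_sumr; apply: eq_bigr => k _.
by rewrite mxE normrM.
Qed.

Lemma mxsize_ge0 m (A : 'M[rat]_m) : 0 <= mxsize A.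
Proof. by rewrite sumr_ge0// => i _; rewrite sumr_ge0. Qed.

Let dH : (delta <= H)%N.
Proof. by rewrite /H; nia. Qed.
Let dH2 : (2 * delta <= H)%N.
Proof. by rewrite /H; nia. Qed.

Lemma bd_mono B B' z : (B <= B')%N -> bd B z -> bd B' z.
Proof.
move=> le [Bi Bs]; rewrite /bd -(subnK le) exprD -scalerA; split.
  by move=> i k; rewrite mxE rpredM ?rpredX ?rpred_nat.
rewrite mxsizeZ exprD ler_pM ?mxsize_ge0 ?normr_ge0// ger0_norm ?exprn_ge0 ?ler0n//.
by rewrite lerXn2r ?nnegrE ?ler0n// ler_nat.
Qed.

Lemma bd_mul B B' z w : bd B z -> bd B' w -> bd (B + B') (z * w).
Proof.
move=> [zi zs] [wi ws]; rewrite /bd rmxM exprD.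
have -> : (delta%:R ^+ B * delta%:R ^+ B') *: (rmx w *m rmx z) =
   (delta%:R ^+ B' *: rmx w) *m (delta%:R ^+ B *: rmx z).
  by rewrite -scalemxAl -scalemxAr scalerA mulrC.
split.
  by move=> i k; rewrite mxE rpred_sum// => l _; rewrite rpredM.
by rewrite (le_trans (mxsizeM _ _))// mulrC exprD ler_pM ?mxsize_ge0.
Qed.

Lemma bd_add B z w : bd B z -> bd B w -> bd B.+1 (z + w).
Proof.
move=> [zi zs] [wi ws]; rewrite /bd rmxD exprS -scalerA scalerDr; split.
  by move=> i k; rewrite mxE rpredM ?rpred_nat// mxE rpredD.
rewrite mxsizeZ normr_nat (@le_trans _ _ (delta%:R * (2 * H%:R ^+ B)))//.
  by rewrite ler_wpM2l ?ler0n// (le_trans (mxsizeD _ _))// mulr2n mulrDl mul1r lerD.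
by rewrite mulrA exprS ler_wpM2r ?exprn_ge0 ?ler0n// -natrM ler_nat mulnC.
Qed.

Lemma bd_opp B z : bd B z -> bd B (- z).
Proof.
have E : rmx (- z) = -1 *: rmx z by rewrite -rmxZ scaleN1r.
move=> [zi zs]; rewrite /bd E scalerA mulrN1 scaleNr; split.
  by move=> i k; rewrite mxE rpredN.
by rewrite -scaleN1r mxsizeZ normrN1 mul1r.
Qed.

Lemma bd_sum (T : eqType) (r : seq T) (F : T -> L) B : bd B 0 -> (forall i, i \in r -> bd B (F i)) ->
  bd (B + size r) (\sum_(i <- r) F i).
Proof.
move=> B0; elim: r => [|i r IHr] HF; first by rewrite big_nil addn0.
rewrite big_cons /= addnS; apply: bd_add.
  by apply: (@bd_mono B); [exact: leq_addr|apply: HF; exact: mem_head].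
by apply: IHr => k kr; apply: HF; rewrite inE kr orbT.
Qed.

Let size1 : mxsize (1%:M : 'M[rat]_d) = d%:R.
Proof.
rewrite /mxsize (eq_bigr (fun=> 1)); first by rewrite sumr_const card_ord.
move=> i _; rewrite (bigD1 i)//= mxE eqxx normr1 big1 ?addr0// => k /negPf ki.
by rewrite mxE eq_sym ki normr0.
Qed.

Lemma bd_nat m : bd m.+1 m%:R.
Proof.
have -> : m%:R = m%:R *: (1 : L) by rewrite scaler_nat.
rewrite /bd rmxZ rmx1; split.
  by move=> i k; rewrite !mxE rpredM ?rpredX ?rpred_nat// rpredM ?rpred_nat.
rewrite !mxsizeZ size1 !ger0_norm ?exprn_ge0 ?ler0n// /H -!natrM -!natrX -!natrM ler_nat.
rewrite -mulnA [(2 * (delta * _))%N]mulnCA expnMn leq_mul// expnMn leq_mul//.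
  by apply: ltnW; apply: (leq_trans (ltn_expl m (ltnSn 1))); rewrite leq_exp2l.
by rewrite expnS (leq_trans (leqnSn _))// leq_pmulr// expn_gt0.
Qed.

Lemma bd_1 : bd 1 1.
Proof.
rewrite /bd rmx1 !expr1; split; first by move=> i k; rewrite !mxE rpredM ?rpred_nat.
by rewrite mxsizeZ size1 normr_nat -natrM ler_nat /H; nia.
Qed.

Lemma bd_0 B : bd B 0.
Proof.
have -> : (0 : L) = 0 *: (1 : L) by rewrite scale0r.
rewrite /bd rmxZ scale0r scaler0; split; first by move=> i k; rewrite mxE rpred0.
rewrite -(scale0r (1%:M : 'M[rat]_d)) mxsizeZ normr0 mul0r.
by rewrite exprn_ge0 ?ler0n.
Qed.

Lemma bd_exp B z m : bd B z -> bd (m * B).+1 (z ^+ m).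
Proof.
move=> Bz; elim: m => [|m IHm]; first by rewrite expr0; exact: bd_1.
by rewrite exprS mulSn -addnS; apply: bd_mul.
Qed.

Lemma bd_prod (T : eqType) (r : seq T) (F : T -> L) (B : T -> nat) :
  (forall i, i \in r -> bd (B i) (F i)) -> bd (\sum_(i <- r) B i).+1 (\prod_(i <- r) F i).
Proof.
elim: r => [|i r IHr] HF; first by rewrite !big_nil; exact: bd_1.
rewrite !big_cons -addnS; apply: bd_mul; first by apply: HF; exact: mem_head.
by apply: IHr => k kr; apply: HF; rewrite inE kr orbT.
Qed.

Lemma bd_integral z : integral_mx (delta%:R *: rmx z) -> exists B, bd B z.
Proof.
move=> zi; pose S := mxsize (delta%:R *: rmx z).
exists (Num.truncn S).+1; split.
  by move=> i k; rewrite exprSr -scalerA mxE rpredM ?rpredX ?rpred_nat.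
rewrite exprSr -scalerA mxsizeZ ger0_norm ?exprn_ge0 ?ler0n// -/S.
set m := Num.truncn S; have Sm : S <= m.+1%:R by rewrite ltW// truncnS_gt.
rewrite (@le_trans _ _ (delta%:R ^+ m * m.+1%:R))//; first by rewrite ler_wpM2l ?exprn_ge0 ?ler0n.
rewrite -!natrX -natrM ler_nat (@leq_trans ((2 * delta) ^ m.+1))//; last by rewrite leq_exp2r.
rewrite mulnC expnMn leq_mul//; first by rewrite ltnW// ltn_expl.
by rewrite expnS leq_pmull.
Qed.

(* Cramer's rule bounds [jL z] below by the nonzero integer [det (delta^B M_z)],
   for which [|m|_v >= 1/|m|]. *)
Lemma liouville : exists C : nat, forall B z, bd B z -> z != 0 -> 1 <= C%:R ^+ B.+1 * absv (jL z).
Proof.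
have [i0 _] : exists i0 : 'I_d, True by exists (Ordinal d_gt0).
pose w (i : 'I_d) : K := jL X`_i.
have w0 : w i0 != 0.
  rewrite fmorph_eq0; apply: contraTneq (basis_free Xb) => X0.
  apply/negP => /freeP/(_ (fun k => (k == i0)%:R)).
  rewrite (bigD1 i0)//= X0 scaler0 add0r big1 => [|k /negPf->]; last by rewrite scale0r.
  by move=> /(_ erefl i0); rewrite eqxx; apply/eqP; rewrite oner_eq0.
pose W := \sum_i absv (w i) / absv (w i0).
have aw0 : 0 < absv (w i0) by rewrite lt_neqAle eq_sym absv_eq0 w0 absv_ge0.
have [c Wc] : exists c : nat, W <= c%:R.
  by exists (Num.truncn W).+1; rewrite ltW// truncnS_gt.
have H0 : (0 < H)%N by rewrite /H; nia.
pose C1 := (d`! * d`! * c.+1)%N.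
have f0 : (0 < d`!)%N := fact_gt0 _.
exists (C1 * (delta * H ^ d * H ^ d))%N => B z [zi zs] z0.
pose N := delta%:R ^+ B *: rmx z.
have Nle i k : `|N i k| <= H%:R ^+ B.
  rewrite (le_trans _ zs)// /mxsize (bigD1 i)//= (bigD1 k)//= -addrA lerDl addr_ge0//.
    by rewrite sumr_ge0.
  by rewrite sumr_ge0// => i' _; rewrite sumr_ge0.
have detN : \det N != 0 by rewrite detZ mulf_neq0 ?rmx_det// !expf_neq0// pnatr_eq0 -lt0n.
have deti : \det N \is a Num.int.
  by rewrite rpred_sum// => s _; rewrite rpredM ?rpred_sign// rpred_prod// => i _; apply: zi.
have adji i k : \adj N i k \is a Num.int.
  rewrite mxE rpredM ?rpred_sign// rpred_sum// => s _.
  by rewrite rpredM ?rpred_sign// rpred_prod// => l _; rewrite mxE mxE; exact: zi.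
have Hge1 : 1 <= H%:R ^+ B :> rat by rewrite exprn_ege1// ler1n.
have adjle i k : `|\adj N i k| <= d`!%:R * (H%:R ^+ B) ^+ d.
  rewrite mxE /cofactor normrM normr_sign mul1r (le_trans (@det_le _ _ _ (H%:R ^+ B) _))//.
    by move=> l m; rewrite mxE mxE; exact: Nle.
  apply: ler_pM; [exact: ler0n|by rewrite !exprn_ge0 ?ler0n| |].
    by rewrite ler_nat; have := factS d.-1; rewrite prednK// => ->; rewrite leq_pmull.
  by rewrite ler_weXn2l// leq_pred.
have [jQ [rE jZ]] : exists jQ : {rmorphism rat -> K}, (forall q, ratr q = jQ q) /\
    forall q (y : L), jL (q *: y) = jQ q * jL y.
  exists (jL \o GRing.in_alg L); split=> [q|q y]; first by rewrite fmorph_eq_rat.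
  by rewrite /= -rmorphM -scalerAl mul1r.
have NE i : \sum_k jQ (N i k) * w k = delta%:R ^+ B * jL z * w i.
  rewrite -mulrA /w -rmorphM rmxE rmorph_sum mulr_sumr; apply: eq_bigr => k _.
  by rewrite jZ mxE rmorphM rmorphXn rmorph_nat mulrA.
have DE : jQ (\det N) * w i0 = delta%:R ^+ B * jL z * \sum_i jQ (\adj N i0 i) * w i.
  transitivity (\sum_i jQ (\adj N i0 i) * (\sum_k jQ (N i k) * w k)); last first.
    by rewrite mulr_sumr; apply: eq_bigr => i _; rewrite NE mulrCA.
  under eq_bigr => i _ do rewrite mulr_sumr.
  rewrite exchange_big (bigD1 i0)//= [X in _ + X]big1 ?addr0.
    under eq_bigr => i _ do rewrite mulrA -rmorphM.
    rewrite -mulr_suml -rmorph_sum; congr (jQ _ * _).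
    by have := congr1 (fun A : 'M[rat]_d => A i0 i0) (mul_adj_mx N); rewrite [LHS]mxE [RHS]mxE eqxx => ->.
  move=> k /negPf ki; under eq_bigr => i _ do rewrite mulrA -rmorphM.
  rewrite -mulr_suml -rmorph_sum.
  have := congr1 (fun A : 'M[rat]_d => A i0 k) (mul_adj_mx N); rewrite [LHS]mxE [RHS]mxE eq_sym ki mulr0n => ->.
  by rewrite rmorph0 mul0r.
have ratr_le (q : rat) (r : nat) : q <= r%:R -> ratr q <= r%:R :> R.
  by move=> qr; rewrite -(ratr_nat R r) ler_rat.
pose h := (d`! * H ^ (B * d))%N.
have deth : ratr `|\det N| <= h%:R :> R.
  by apply: ratr_le; rewrite /h natrM natrX exprM -natrX; apply: det_le => i k; rewrite natrX.
have adjh i : absv (jQ (\adj N i0 i)) <= h%:R.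
  rewrite -rE (le_trans (absv_int_le (adji _ _)))//; apply: ratr_le.
  by rewrite /h natrM natrX exprM; exact: adjle.
have SE : absv (\sum_i jQ (\adj N i0 i) * w i) <= h%:R * (W * absv (w i0)).
  have -> : W * absv (w i0) = \sum_i absv (w i).
    by rewrite /W mulr_suml; apply: eq_bigr => i _; rewrite divfK// gt_eqF.
  rewrite mulr_sumr; elim/big_ind2: _ => [|x x' y y' xx yy|i _]; first by rewrite absv0.
    by rewrite (le_trans (absvD _ _))// lerD.
  by rewrite absvM ler_wpM2r ?absv_ge0.
have az : 0 <= absv (jL z) by exact: absv_ge0.
have dB : absv (delta%:R ^+ B : K) <= (delta ^ B)%:R by rewrite -natrX; exact: absv_nat_le.
have D1 : absv (jQ (\det N)) <= (delta ^ B * h * c)%:R * absv (jL z).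
  rewrite -(ler_pM2r aw0) -absvM DE !absvM.
  apply: (@le_trans _ _ ((delta ^ B)%:R * absv (jL z) * (h%:R * (c%:R * absv (w i0))))).
    rewrite ler_pM ?mulr_ge0 ?absv_ge0//; first by rewrite ler_wpM2r.
    by rewrite (le_trans SE)// ler_wpM2l ?ler0n// ler_wpM2r ?absv_ge0.
  rewrite [(delta ^ B * h * c)%:R]natrM [(delta ^ B * h)%:R]natrM; move: (delta ^ B)%:R (absv (jL z)) h%:R c%:R (absv (w i0)) => x1 x2 x3 x4 x5.
  by rewrite le_eqVlt; apply/orP; left; apply/eqP; ring.
have := absv_int_ge deti detN; rewrite rE; move/le_trans; apply.
apply: (@le_trans _ _ ((delta ^ B * h * c)%:R * absv (jL z) * h%:R)).
  by rewrite ler_pM ?absv_ge0// ler0q normr_ge0.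
rewrite mulrAC -natrM -natrX ler_wpM2r// ler_nat.
have E1 : (delta ^ B * h * c * h = d`! * d`! * c * (delta * H ^ d * H ^ d) ^ B)%N.
  by rewrite /h !expnMn mulnC [(B * d)%N]mulnC !expnM; ring.
have C1g : (0 < C1)%N by rewrite /C1 !muln_gt0 f0.
have G1 : (0 < delta * H ^ d * H ^ d)%N by rewrite !muln_gt0 delta_gt0 !expn_gt0 H0.
rewrite E1 [((C1 * _) ^ _)%N]expnMn leq_mul//; last by rewrite leq_pexp2l.
rewrite expnS (@leq_trans C1)//; last by rewrite leq_pmulr// expn_gt0 C1g.
by rewrite /C1 leq_mul.
Qed.
End Liouville.

(** * Dimension growth of monomials *)

Section Growth.
Variables (L : fieldType) (K : fieldType) (j : {rmorphism L -> K}).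

Definition spanned (T : Type) m (w : T -> K) :=
  exists (B : 'I_m -> K) (e : T -> 'I_m -> L), forall t, w t = \sum_i j (e t i) * B i.

Lemma spanned_le T m m' (w : T -> K) : (m <= m')%N -> spanned m w -> spanned m' w.
Proof.
move=> le [B [e E]]; exists (fun i => if insub (val i) is Some i' then B i' else 0).
exists (fun t i => if insub (val i) is Some i' then e t i' else 0) => t; rewrite E.
pose F k := j (if insub k is Some i' then e t i' else 0) * (if insub k is Some i' then B i' else 0).
rewrite (eq_bigr (fun i : 'I_m => F i)); last by move=> i _; rewrite /F valK.
rewrite (big_ord_widen m' F le) big_mkcond /=; apply: eq_bigr => i _; rewrite /F.
by case: ifP => // /negbT im; rewrite insubN// mulr0.
Qed.

Lemma spanned_scale T m (w : T -> K) z : z != 0 -> spanned m (fun t => z * w t) -> spanned m w.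
Proof.
move=> z0 [B [e E]]; exists (fun i => z^-1 * B i), e => t.
apply: (mulfI z0); rewrite E mulr_sumr; apply: eq_bigr => i _.
by rewrite mulrCA mulVKf.
Qed.

Lemma spanned_lin T T' m (w : T -> K) (w' : T' -> K) : spanned m w ->
  (forall t', exists s : seq (L * T), w' t' = \sum_(x <- s) j x.1 * w x.2) -> spanned m w'.
Proof.
move=> [B [e E]] /choice[s sE]; exists B, (fun t' i => \sum_(x <- s t') x.1 * e x.2 i) => t'.
rewrite sE; under eq_bigr => x _ do rewrite E mulr_sumr.
rewrite exchange_big; apply: eq_bigr => i _ /=.
by rewrite rmorph_sum mulr_suml; apply: eq_bigr => x _; rewrite rmorphM mulrA.
Qed.

Lemma spanned_sub (T : finType) T' (A : {set T}) (w : T -> K) (w' : T' -> K) :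
  (forall t, exists s : seq (L * T), (forall x, x \in s -> x.2 \in A) /\
     w' t = \sum_(x <- s) j x.1 * w x.2) -> spanned #|A| w'.
Proof.
move=> H; exists (fun i : 'I_#|A| => w (enum_val i)); move/choice: H => [s sE].
exists (fun t i => \sum_(x <- s t | x.2 == enum_val i) x.1) => t.
have [sA ->] := sE t; under [RHS]eq_bigr => i _ do rewrite rmorph_sum mulr_suml.
rewrite (exchange_big_dep xpredT)//= big_seq [RHS]big_seq; apply: eq_bigr => x /sA xA.
have [i0 i0x] : exists i0 : 'I_#|A|, enum_val i0 = x.2.
  by exists (enum_rank_in xA x.2); rewrite enum_rankK_in.
rewrite (big_pred1 i0); first by rewrite i0x.
by move=> i /=; rewrite -i0x (inj_eq enum_val_inj) eq_sym.
Qed.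

Lemma card_ord_lt n m : (#|[pred z : 'I_n | z < m]| <= m)%N.
Proof.
rewrite -sum1_card -(big_mkord (fun z => z < m)%N (fun=> 1%N)).
suff -> : (\sum_(0 <= z < n | z < m) 1 = minn n m)%N by exact: geq_minr.
elim: n => [|n IHn]; first by rewrite big_geq// min0n.
rewrite big_mkcond big_nat_recr//= -big_mkcond IHn; case: ltnP => nm; clear - nm; lia.
Qed.

Section Monomials.
Variables (T : finType) (w : T -> K).
Definition mval (x : T -> nat) : K := \prod_t w t ^+ x t.

(** The exponent #|T| always works, since there are (A + 1)^#|T| monomials; the exponent #|T| - 1
    expresses a dependence. *)
Definition grows e := exists C, forall A, spanned (C * A.+1 ^ e) (fun x : {ffun T -> 'I_A.+1} => mval (fun t => x t)).

Variables (W : T -> nat) (mu : T -> nat) (rel : seq (L * (T -> nat))).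
Hypothesis W_gt0 : forall t, (0 < W t)%N.
Let wt (x : T -> nat) := (\sum_t x t * W t)%N.
Hypothesis rel_lt : forall y, y \in rel -> (wt y.2 < wt mu)%N.
Hypothesis relE : mval mu = \sum_(y <- rel) j y.1 * mval y.2.

Let reduce (x : T -> nat) : exists s : seq (L * (T -> nat)),
  (forall y, y \in s -> (wt y.2 <= wt x)%N /\ exists t, (y.2 t < mu t)%N) /\
  mval x = \sum_(y <- s) j y.1 * mval y.2.
Proof.
have [q] := ubnP (wt x); elim: q x => // q IHq x; rewrite ltnS => xq.
have [[t xt]|nlt] := pselect (exists t, (x t < mu t)%N).
  exists [:: (1, x)]; split; last by rewrite big_seq1 rmorph1 mul1r.
  by move=> y; rewrite mem_seq1 => /eqP->; split=> //; exists t.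
have le t : (mu t <= x t)%N by rewrite leqNgt; apply/negP => xt; apply: nlt; exists t.
pose sh (y : T -> nat) t := (x t - mu t + y t)%N.
have wtsh y : (wt (sh y) + wt mu = wt x + wt y)%N.
  rewrite /wt -!big_split; apply: eq_bigr => t _ /=; rewrite -!mulnDl /sh; congr (_ * _)%N.
  by rewrite addnAC subnK.
have vsh y : mval (sh y) = mval (fun t => x t - mu t)%N * mval y.
  by rewrite /mval -big_split; apply: eq_bigr => t _ /=; rewrite -exprD.
have xE : mval x = \sum_(y <- rel) j y.1 * mval (sh y.2).
  under eq_bigr => y _ do rewrite vsh mulrCA.
  rewrite -mulr_sumr -relE -vsh; apply: eq_bigr => t _; by rewrite /sh subnK.
have {IHq} H (y : L * (T -> nat)) : exists s : seq (L * (T -> nat)), y \in rel ->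
    (forall z, z \in s -> (wt z.2 <= wt x)%N /\ exists t, (z.2 t < mu t)%N) /\
    mval (sh y.2) = \sum_(z <- s) j z.1 * mval z.2.
  case: (boolP (y \in rel)) => [yr|]; last by exists [::].
  have yx : (wt (sh y.2) < wt x)%N by rewrite -(ltn_add2r (wt mu)) wtsh ltn_add2l; exact: rel_lt.
  have [s [sP sE]] := IHq _ (leq_trans yx xq); exists s => _; split=> // z /sP[z1 z2]; split=> //.
  exact: (leq_trans z1 (ltnW yx)).
move/choice: H => [s sP].
exists (flatten [seq [seq (y.1 * z.1, z.2) | z <- s y] | y <- rel]); split.
  move=> _ /flatten_mapP[y yr /mapP[z zs ->]]; have [/(_ z zs)] := sP y yr; by [].
rewrite xE big_flatten big_map; apply: eq_big_seq => y yr; rewrite big_map /=.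
have [_ ->] := sP y yr; rewrite mulr_sumr; apply: eq_bigr => z _.
by rewrite rmorphM mulrA.
Qed.

(** Monomials divisible by the leading monomial [mu] are rewritten by the relation, which lowers the
    weight. In the remaining ones some exponent is below that of [mu], and as all weights are
    positive the others are at most [A * M]; so their number is O((A + 1)^(#|T| - 1)). *)
Lemma relation_grows : grows #|T|.-1.
Proof.
pose M := (\sum_t W t)%N.
exists ((\sum_t mu t) * M.+1 ^ #|T|.-1)%N => A.
pose bnd := (A * M)%N.
pose SB : {set {ffun T -> 'I_bnd.+1}} :=
  finset (fun x : {ffun T -> 'I_bnd.+1} => [exists t, (x t < mu t)%N]).
suff H : spanned #|SB| (fun x : {ffun T -> 'I_A.+1} => mval (fun t => x t)).
  apply: spanned_le H; pose F t t' := if t' == t then [pred z : 'I_bnd.+1 | (z < mu t)%N] else predT.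
  apply: (@leq_trans (\sum_t #|family (F t)|)).
    apply: (@leq_trans #|(\bigcup_t finset (fun x => x \in family (F t)))%SET|).
      apply: subset_leq_card; apply/fintype.subsetP => x; rewrite inE => /existsP[t xt].
      apply/finset.bigcupP; exists t => //; rewrite inE; apply/familyP => t'.
      by rewrite /F; case: eqP => [->|].
    elim/big_ind2: _ => [|A1 a1 A2 a2 h1 h2|t _]; [by rewrite cards0| |by rewrite cardsE].
    by rewrite cardsU (leq_trans (leq_subr _ _))// leq_add.
  rewrite -mulnA big_distrl; apply: leq_sum => t _; rewrite card_family foldrE big_image /=.
  rewrite (bigD1 t)//= /F eqxx leq_mul ?card_ord_lt//.
  rewrite (eq_bigr (fun=> bnd.+1)); last first.
    by move=> t' /negPf ->; rewrite -[RHS]card_ord; apply: eq_card.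
  rewrite prod_nat_const (_ : #|_| = #|T|.-1); last first.
    by rewrite -(cardC1 t); apply: eq_card => t'; rewrite !inE.
  rewrite -expnMn; case: (#|T|.-1) => [|q]; first by rewrite !expn0.
  rewrite leq_exp2r// /bnd mulSn !mulnS [(M * A)%N]mulnC; lia.
apply: (@spanned_sub _ _ SB (fun x => mval (fun t => x t))) => x.
have [s [sP sE]] := reduce (fun t => x t).
have xb : (wt (fun t => x t) <= bnd)%N.
  by rewrite /wt /bnd /M big_distrr; apply: leq_sum => t _; rewrite leq_mul2r -ltnS ltn_ord orbT.
pose z (y : T -> nat) : {ffun T -> 'I_bnd.+1} := [ffun t => inord (y t)].
have zE y t' : y \in s -> z y.2 t' = y.2 t' :> nat.
  move=> /sP[yx _]; rewrite ffunE inordK// ltnS (leq_trans _ (leq_trans yx xb))// /wt (bigD1 t')//=.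
  by rewrite (leq_trans (leq_pmulr _ (W_gt0 t')))// leq_addr.
exists [seq (y.1, z y.2) | y <- s]; split.
  move=> _ /mapP[y ys ->]; rewrite inE /=; apply/existsP.
  by have [_ [t yt]] := sP y ys; exists t; rewrite zE.
rewrite sE big_map; apply: eq_big_seq => y ys; congr (_ * _).
by apply: eq_bigr => t _; rewrite zE.
Qed.
End Monomials.

Lemma kronecker_inj n B (x y : 'I_n -> nat) : (forall i, (x i < B)%N /\ (y i < B)%N) ->
  (\sum_i x i * B ^ i = \sum_i y i * B ^ i)%N -> forall i, x i = y i.
Proof.
elim: n x y => [x y _ _ []//|n IHn x y H]; rewrite !big_ord_recl /= expn0 !muln1.
have E (z : 'I_n.+1 -> nat) : (\sum_(i < n) z (lift ord0 i) * B ^ bump 0 i =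
    (\sum_(i < n) z (lift ord0 i) * B ^ i) * B)%N.
  by rewrite big_distrl; apply: eq_bigr => i _; rewrite /= /bump add1n expnSr mulnA.
rewrite !E; have [x0 y0] := H ord0.
set X := (\sum_(i < n) x _ * _)%N; set Y := (\sum_(i < n) y _ * _)%N => XY.
have B0 : (0 < B)%N by apply: leq_trans x0.
have e0 : x ord0 = y ord0.
  by have := congr1 (modn^~ B) XY; rewrite /= ![(_ + _ * B)%N]addnC !modnMDl !modn_small.
have eX : X = Y by move: XY; rewrite e0 => /addnI/eqP; rewrite eqn_pmul2r// => /eqP.
move=> i; have [k ->|->//] := unliftP ord0 i.
by apply: (IHn (fun i => x (lift ord0 i)) (fun i => y (lift ord0 i))).
Qed.

Lemma big_codom_inj (T : finType) n (s : 'I_n -> T) (V : Type) (idx : V) (op : Monoid.com_law idx)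
  (F : T -> V) : injective s -> (forall t, t \notin codom s -> F t = idx) ->
  \big[op/idx]_t F t = \big[op/idx]_i F (s i).
Proof.
move=> si F0; rewrite (bigID (mem (codom s))) /= [X in op _ X]big1// Monoid.mulm1.
rewrite -(@big_uniq _ _ _ _ (codom s)) ?big_image//=.
by rewrite map_inj_uniq ?enum_uniq.
Qed.

(* A polynomial relation between some of the [w t] singles out, for Kronecker
   weights, a monomial of strictly largest weight. *)
Lemma polynomial_relation_grows (T : finType) (w : T -> K) n (s : 'I_n -> T) (P : mpoly.mpoly n L) :
  injective s -> P != 0 -> mpoly.mmap j (w \o s) P = 0 -> grows w #|T|.-1.
Proof.
move=> si P0 Pw; pose B := (\sum_(m <- msupp P) \sum_i m i).+1.
have mB m i : m \in msupp P -> (m i < B)%N.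
  by move=> mP; rewrite ltnS (big_rem m)//= (bigD1 i)//= -!addnA leq_addr.
pose kr (m : multinom n) := (\sum_i m i * B ^ i)%N.
have [m0 m0P m0max] : exists2 m0, m0 \in msupp P & forall m, m \in msupp P -> (kr m <= kr m0)%N.
  have : msupp P != [::] by rewrite msupp_eq0.
  elim: (msupp P) => // m r IHr _; have [->|/IHr[m' m'r m'max]] := eqVneq r [::].
    by exists m; [rewrite mem_head|move=> m'; rewrite mem_seq1 => /eqP->].
  case: (leqP (kr m) (kr m')) => mm.
    exists m'; first by rewrite inE m'r orbT.
    by move=> m2; rewrite inE => /orP[/eqP->|/m'max].
  exists m; first exact: mem_head.
  by move=> m2; rewrite inE => /orP[/eqP->//|/m'max/leq_trans]; apply; exact: ltnW.
pose ext (m : multinom n) t := if [pick i | s i == t] is Some i then m i : nat else 0%N.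
pose W t := if [pick i | s i == t] is Some i then (B ^ i)%N else 1%N.
have exts m i : ext m (s i) = m i.
  rewrite /ext; case: pickP => [i' /eqP/si->//|/(_ i)]; by rewrite eqxx.
have Ws i : W (s i) = (B ^ i)%N.
  rewrite /W; case: pickP => [i' /eqP/si->//|/(_ i)]; by rewrite eqxx.
have ext0 m t : t \notin codom s -> ext m t = 0%N.
  rewrite /ext; case: pickP => // i /eqP<-; by rewrite codom_f.
have wtE m : (\sum_t ext m t * W t)%N = kr m.
  rewrite (big_codom_inj _ si) => [|t /ext0->//].
  by apply: eq_bigr => i _; rewrite exts Ws.
have mvE m : mval w (ext m) = \prod_i w (s i) ^+ m i.
  rewrite /mval (big_codom_inj _ si) => [|t /ext0->//].
  by apply: eq_bigr => i _; rewrite exts.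
have c0 : mcoeff m0 P != 0 by rewrite -mcoeff_msupp.
apply: (@relation_grows T w W (ext m0) [seq (- (mcoeff m P / mcoeff m0 P), ext m) | m <- rem m0 (msupp P)]).
- by move=> t; rewrite /W; case: pickP => // i _; rewrite expn_gt0.
- move=> y /mapP[m]; rewrite mem_rem_uniq ?msupp_uniq// inE => /andP[mm mP] ->; rewrite /= !wtE.
  rewrite ltn_neqAle m0max// andbT; apply: contra_neq mm => E.
  apply/mnmP => i; apply: (@kronecker_inj n B) E i => i; by rewrite !mB.
- rewrite big_map mvE /=; move: Pw; rewrite /mmap (big_rem m0)//= /mmap1 => E.
  apply: (@mulfI _ (j (mcoeff m0 P))); first by rewrite fmorph_eq0.
  move/eqP: E; rewrite addr_eq0 => /eqP ->; rewrite mulr_sumr -sumrN; apply: eq_bigr => m _.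
  by rewrite mvE mulrA -rmorphM mulrN mulrCA mulfV// mulr1 rmorphN mulNr.
Qed.

(* Elements of the subfield generated over [L] by the [w t]. *)
Section Rational.
Variables (T : finType) (w : T -> K).

Definition pol z := exists s : seq (L * (T -> nat)), z = \sum_(x <- s) j x.1 * mval w x.2.
Definition ratl z := exists x y, [/\ pol x, pol y, y != 0 & z * y = x].

Lemma mvalD x y : mval w (fun t => x t + y t)%N = mval w x * mval w y.
Proof. by rewrite /mval -big_split; apply: eq_bigr => t _; rewrite exprD. Qed.

Lemma pol_add x y : pol x -> pol y -> pol (x + y).
Proof. by move=> [s ->] [t ->]; exists (s ++ t); rewrite big_cat. Qed.

Lemma pol_mul x y : pol x -> pol y -> pol (x * y).
Proof.
move=> [s ->] [t ->]; exists [seq (x.1 * y.1, (fun i => x.2 i + y.2 i)%N) | x <- s, y <- t].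
rewrite big_allpairs_dep mulr_suml; apply: eq_bigr => x' _; rewrite mulr_sumr; apply: eq_bigr => y' _ /=.
by rewrite mvalD rmorphM; ring.
Qed.

Lemma pol_const e : pol (j e).
Proof. by exists [:: (e, fun=> 0%N)]; rewrite big_seq1 /mval big1 ?mulr1// => t _; rewrite expr0. Qed.

Lemma pol_gen t : pol (w t).
Proof.
exists [:: (1, fun t' => (t' == t : nat))]; rewrite big_seq1 rmorph1 mul1r /mval (bigD1 t)//= eqxx expr1.
by rewrite big1 ?mulr1// => t' /negPf->; rewrite expr0.
Qed.

Lemma pol_ratl x : pol x -> ratl x.
Proof.
move=> px; exists x, 1; rewrite mulr1 oner_neq0; split=> //.
by rewrite -(rmorph1 j); exact: pol_const.
Qed.

Lemma ratl_const e : ratl (j e). Proof. exact/pol_ratl/pol_const. Qed.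
Lemma ratl_gen t : ratl (w t). Proof. exact/pol_ratl/pol_gen. Qed.

Lemma ratl_add z z' : ratl z -> ratl z' -> ratl (z + z').
Proof.
move=> [x [y [px py y0 E]]] [x' [y' [px' py' y'0 E']]].
exists (x * y' + x' * y), (y * y'); split; [|exact: pol_mul|exact: mulf_neq0|].
  by apply: pol_add; apply: pol_mul.
by rewrite -E -E'; ring.
Qed.

Lemma ratl_mul z z' : ratl z -> ratl z' -> ratl (z * z').
Proof.
move=> [x [y [px py y0 E]]] [x' [y' [px' py' y'0 E']]].
exists (x * x'), (y * y'); split; [exact: pol_mul|exact: pol_mul|exact: mulf_neq0|].
by rewrite -E -E'; ring.
Qed.

Lemma ratl_opp z : ratl z -> ratl (- z).
Proof. by move=> rz; rewrite -mulN1r -(rmorph1 j) -rmorphN; apply: ratl_mul => //; exact: ratl_const. Qed.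

Lemma ratl_sub z z' : ratl z -> ratl z' -> ratl (z - z').
Proof. by move=> rz rz'; apply: ratl_add => //; apply: ratl_opp. Qed.

Lemma ratl_sum (I : Type) (r : seq I) (P : pred I) (F : I -> K) :
  (forall i, P i -> ratl (F i)) -> ratl (\sum_(i <- r | P i) F i).
Proof.
move=> HF; elim/big_ind: _ => //; last exact: ratl_add.
by rewrite -(rmorph0 j); exact: ratl_const.
Qed.

Lemma ratl_div z z' : ratl z -> ratl (z * z') -> z != 0 -> ratl z'.
Proof.
move=> [x [y [px py y0 E]]] [x' [y' [px' py' y'0 E']]] z0.
exists (x' * y), (x * y'); split; [exact: pol_mul|exact: pol_mul| |].
  by rewrite mulf_neq0// -E mulf_neq0.
by rewrite -E -E'; ring.
Qed.

Lemma pol_mval_bound (U : T -> K) : (forall t, pol (U t)) -> exists d, forall x : T -> nat,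
  exists s : seq (L * (T -> nat)), (forall y, y \in s -> (\sum_t y.2 t <= d * \sum_t x t)%N) /\
    mval U x = \sum_(y <- s) j y.1 * mval w y.2.
Proof.
move=> /choice[S SE]; pose d := (\sum_t \sum_(y <- S t) \sum_t' y.2 t')%N; exists d.
have dS t y : y \in S t -> (\sum_t' y.2 t' <= d)%N.
  by move=> yS; rewrite /d [X in (_ <= X)%N](bigD1 t)//= (big_rem y)//= -!addnA leq_addr.
pose rep B z := exists s : seq (L * (T -> nat)), (forall y, y \in s -> (\sum_t y.2 t <= B)%N) /\
    z = \sum_(y <- s) j y.1 * mval w y.2.
have rep1 : rep 0%N 1.
  exists [:: (1, fun=> 0%N)]; split; first by move=> y; rewrite mem_seq1 => /eqP->; rewrite big1.
  by rewrite big_seq1 rmorph1 mul1r /mval big1// => t _; rewrite expr0.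
have repM B B' z z' : rep B z -> rep B' z' -> rep (B + B')%N (z * z').
  move=> [s [sB ->]] [t [tB ->]].
  exists [seq (x.1 * y.1, (fun i => x.2 i + y.2 i)%N) | x <- s, y <- t]; split.
    by move=> _ /allpairsPdep[x [y [/sB xs /tB ys ->]]]; rewrite /= big_split leq_add.
  rewrite big_allpairs_dep mulr_suml; apply: eq_bigr => x' _; rewrite mulr_sumr; apply: eq_bigr => y' _ /=.
  by rewrite mvalD rmorphM; ring.
have repX t m : rep (d * m)%N (U t ^+ m).
  elim: m => [|m IHm]; first by rewrite muln0 expr0.
  rewrite exprS mulnS; apply: repM => //; exists (S t); split; [exact: dS|exact: SE].
move=> x; rewrite big_distrr /= /mval -/(rep _ _).
by elim/big_ind2: _ => // *; exact: repM.
Qed.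

(** Multiplied by the power A #|T| of a common denominator [Q], a monomial of degree at most [A] in
    each [U t] becomes a polynomial of degree O(A) in the [w t]; scaling by a nonzero element
    preserves the dimension. *)
Lemma ratl_grows (U : T -> K) e : (forall t, ratl (U t)) -> grows w e -> grows U e.
Proof.
move=> /choice[x /choice[y HU]] [C HC].
pose Q := \prod_t y t; have Q0 : Q != 0 by apply/prodf_neq0 => t _; have [] := HU t.
have pQ (P : pred T) : pol (\prod_(t | P t) y t).
  elim/big_ind: _ => [||t _]; [|exact: pol_mul|by have [] := HU t].
  by rewrite -(rmorph1 j); exact: pol_const.
have pUQ t : pol (U t * Q).
  by rewrite /Q (bigD1 t)//= mulrA; have [px _ _ ->] := HU t; exact: pol_mul.
pose TT := #|T|.
have [d dP] := @pol_mval_bound (fun t => U t * Q) pUQ.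
have [d' d'P] := @pol_mval_bound (fun t => Q) (fun _ => pQ xpredT).
pose D := ((d + d') * TT)%N.
exists (C * D.+1 ^ e)%N => A.
pose A' := (D * A)%N; have nn z1 z2 : ((z1 * z2).+1 <= z1.+1 * z2.+1)%N by rewrite mulSn mulnS; lia.
have HA' := HC A'.
have [/eqP TT0|TT0] := posnP TT.
  apply: (@spanned_le _ (C * A'.+1 ^ e)).
    rewrite -mulnA -expnMn leq_mul2l; apply/orP; right; case: (e) => [|e']; first by rewrite !expn0.
    by rewrite leq_exp2r// /A' nn.
  apply: (spanned_lin HA') => z; exists [:: (1, [ffun=> ord0])]; rewrite big_seq1 rmorph1 mul1r.
  rewrite /mval !big_pred0// => t; move: TT0; rewrite /TT => /eqP/card0_eq/(_ t); by rewrite inE.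
have [t0 _] : exists t0 : T, true by move: TT0; rewrite /TT => /card_gt0P[t0 _]; exists t0.
apply: (@spanned_scale _ _ _ (Q ^+ (A * TT))); first by rewrite expf_neq0.
apply: (@spanned_le _ (C * A'.+1 ^ e)).
  rewrite -mulnA -expnMn leq_mul2l; apply/orP; right; case: (e) => [|e']; first by rewrite !expn0.
  by rewrite leq_exp2r// /A' nn.
apply: (spanned_lin HA') => z.
have zA : (\sum_t (z t : nat) <= A * TT)%N.
  rewrite (@leq_trans (\sum_(t : T) A))//; first by apply: leq_sum => t _; rewrite -ltnS.
  by rewrite sum_nat_const mulnC.
have [s1 [s1P s1E]] := dP (fun t => z t).
(* The surplus power of [Q], carried by the single variable [t0] of a family constantly equal to
   [Q]. *)
have [s2 [s2P s2E]] := d'P (fun t => if t == t0 then A * TT - \sum_t (z t : nat) else 0)%N.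
pose s := [seq (x.1 * y.1, (fun i => x.2 i + y.2 i)%N) | x <- s1, y <- s2].
pose cv (f : T -> nat) : {ffun T -> 'I_A'.+1} := [ffun t => inord (f t)].
exists [seq (y.1, cv y.2) | y <- s]; rewrite big_map.
have le1 t (f : T -> nat) : (f t <= \sum_t f t)%N by rewrite (bigD1 t)//= leq_addr.
have sX X : (\sum_t (if t == t0 then X else 0) = X)%N by rewrite -big_mkcond big_pred1_eq.
have sb yy : yy \in s -> forall t, (yy.2 t <= A')%N.
  move=> /allpairsPdep[x1 [y1 [/s1P xs /s2P ys ->]]] t /=.
  have h1 := leq_trans (le1 t x1.2) xs; have h2 := leq_trans (le1 t y1.2) ys.
  rewrite sX in h2.
  rewrite (leq_trans (leq_add h1 h2))// /A' /D -/TT -mulnA [(TT * A)%N]mulnC; move: zA; move: (\sum_t z t)%N (A * TT)%N => w1 w2 w12.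
  by rewrite mulnDl leq_add// leq_mul2l ?w12 ?leq_subr orbT.
transitivity (\sum_(yy <- s) j yy.1 * mval w yy.2); last first.
  apply: eq_big_seq => yy /sb ys; congr (_ * _); apply: eq_bigr => t _; congr (_ ^+ _).
  by rewrite ffunE inordK// ltnS.
have -> : Q ^+ (A * TT) * mval U (fun t => z t) = mval (fun t => U t * Q) (fun t => z t) *
    mval (fun=> Q) (fun t => if t == t0 then A * TT - \sum_t (z t : nat) else 0)%N.
  have QE N : mval (fun=> Q) (fun t => if t == t0 then N else 0%N) = Q ^+ N.
    by rewrite /mval (bigD1 t0)//= eqxx big1 ?mulr1// => t /negPf->; rewrite expr0.
  rewrite QE.
  rewrite [X in _ = X * _](_ : _ = mval U (fun t => z t) * Q ^+ (\sum_t z t)); last first.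
    rewrite /mval -prodrXr -big_split; apply: eq_bigr => t _ /=; by rewrite exprMn.
  by rewrite -mulrA -exprD subnKC// mulrC.
rewrite s1E s2E /s big_allpairs_dep mulr_suml; apply: eq_bigr => x1 _.
rewrite mulr_sumr; apply: eq_bigr => y1 _ /=.
by rewrite mvalD rmorphM; ring.
Qed.
End Rational.
End Growth.

(** * Orders of magnitude along the index *)

Section Small.
Variables (R : realType) (K : valuedFieldType R) (q : R) (u : nat -> nat).
Hypothesis q01 : 0 < q < 1.

(** The geometric factor absorbs powers of k and the alpha^k. It is harmless in the end because [u]
    grows faster than any linear function. *)
Definition small A (F : nat -> K) := exists C k1 : nat, forall k, (k1 <= k)%N ->
  absv (F k) <= C.+1%:R ^+ k.+1 * q ^+ (A * u k).

Let q0 : 0 <= q. Proof. by case/andP: q01 => /ltW. Qed.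
Let q1 : q <= 1. Proof. by case/andP: q01 => _ /ltW. Qed.

Lemma nat_bound (x : R) : exists C : nat, x <= C%:R.
Proof. by exists (Num.truncn x).+1; rewrite ltW// truncnS_gt. Qed.

Lemma small_ext A F G : (exists k1, forall k, (k1 <= k)%N -> F k = G k) -> small A F -> small A G.
Proof.
move=> [k1 FG] [C [k2 H]]; exists C, (maxn k1 k2) => k; rewrite geq_max => /andP[kk kk2].
by rewrite -FG// H.
Qed.

Lemma small_mono A B F : (B <= A)%N -> small A F -> small B F.
Proof.
move=> BA [C [k1 H]]; exists C, k1 => k kk; rewrite (le_trans (H k kk))//.
by rewrite ler_wpM2l ?exprn_ge0 ?ler0n// ler_wiXn2l// leq_mul2r BA orbT.
Qed.

Lemma small_add A F G : small A F -> small A G -> small A (fun k => F k + G k).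
Proof.
move=> [C [k1 H]] [C' [k2 H']]; exists (C + C').+1, (maxn k1 k2) => k; rewrite geq_max => /andP[kk kk2].
rewrite (le_trans (absvD _ _))// (le_trans (lerD (H k kk) (H' k kk2)))// -mulrDl ler_wpM2r ?exprn_ge0//.
rewrite -!natrX -natrD ler_nat.
rewrite (@leq_trans ((C.+1 + C'.+1) ^ k.+1))//; last by rewrite leq_exp2r//; lia.
elim: k {kk kk2} => [|k IHk]; first by rewrite !expn1.
rewrite !(expnS _ k.+1) mulnDl leq_add// leq_mul2l ?(leq_trans _ IHk)//= ?leq_addr ?leq_addl ?orbT//.
Qed.

Lemma small_mul A B F G : small A F -> small B G -> small (A + B) (fun k => F k * G k).
Proof.
move=> [C [k1 H]] [C' [k2 H']]; exists (C.+1 * C'.+1)%N, (maxn k1 k2) => k; rewrite geq_max => /andP[kk kk2].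
rewrite absvM (le_trans (ler_pM (absv_ge0 _) (absv_ge0 _) (H k kk) (H' k kk2)))//.
rewrite mulrACA -exprMn -exprD mulnDl ler_wpM2r ?exprn_ge0// lerXn2r ?nnegrE ?mulr_ge0 ?ler0n//.
by rewrite -natrM ler_nat.
Qed.

Lemma small_0 A : small A (fun=> 0).
Proof. by exists 0%N, 0%N => k _; rewrite absv0 mulr_ge0 ?exprn_ge0 ?ler0n. Qed.

Lemma small_const z : small 0 (fun=> z).
Proof.
have [C HC] := nat_bound (absv z); exists C, 0%N => k _; rewrite mul0n expr0 mulr1 (le_trans HC)//.
rewrite -natrX ler_nat (leq_trans (leqnSn C))// -[X in (X <= _)%N]expn1 leq_pexp2l//.
Qed.

Lemma small_sum A (T : eqType) (r : seq T) (F : T -> nat -> K) :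
  (forall t, t \in r -> small A (F t)) -> small A (fun k => \sum_(t <- r) F t k).
Proof.
elim: r => [|t r IHr] H.
  by apply: (small_ext _ (small_0 A)); exists 0%N => k _; rewrite big_nil.
have := small_add (H t (mem_head _ _)) (IHr (fun x xr => H x (mem_behead (s := t :: r) xr))).
by apply: small_ext; exists 0%N => k _; rewrite big_cons.
Qed.

Lemma small0_mul A F G : small 0 F -> small A G -> small A (fun k => F k * G k).
Proof. exact: small_mul. Qed.

Lemma small0_exp F m : small 0 F -> small 0 (fun k => F k ^+ m).
Proof.
move=> sF; elim: m => [|m IHm].
  by apply: (small_ext _ (small_const 1)); exists 0%N => k _; rewrite expr0.
by apply: (small_ext _ (small0_mul sF IHm)); exists 0%N => k _; rewrite exprS.
Qed.

Lemma small0_prod (T : eqType) (r : seq T) (F : T -> nat -> K) :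
  (forall t, t \in r -> small 0 (F t)) -> small 0 (fun k => \prod_(t <- r) F t k).
Proof.
elim: r => [|t r IHr] H.
  by apply: (small_ext _ (small_const 1)); exists 0%N => k _; rewrite big_nil.
have := small0_mul (H t (mem_head _ _)) (IHr (fun x xr => H x (mem_behead (s := t :: r) xr))).
by apply: small_ext; exists 0%N => k _; rewrite big_cons.
Qed.

Lemma small_k : small 0 (fun k => k%:R).
Proof.
exists 1%N, 0%N => k _; rewrite mul0n expr0 mulr1 (le_trans (absv_nat_le K k))// -natrX ler_nat.
by rewrite (leq_trans (ltnW (ltn_expl k (ltnSn 1))))// leq_exp2l.
Qed.

Lemma small_pow z : small 0 (fun k => z ^+ k).
Proof.
have [C HC] := nat_bound (absv z); exists C, 0%N => k _; rewrite mul0n expr0 mulr1.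
have -> : absv (z ^+ k) = absv z ^+ k by elim: k => [|k IHk]; rewrite ?expr0 ?absv1// !exprS absvM IHk.
rewrite (@le_trans _ _ (C.+1%:R ^+ k))//; last by rewrite ler_weXn2l// ler1n.
by rewrite lerXn2r ?nnegrE ?absv_ge0 ?ler0n// (le_trans HC)// ler_nat.
Qed.

Lemma small_num A (z : K) (lam : nat -> nat) : absv z = q ->
  (exists k1, forall k, (k1 <= k)%N -> (A * u k <= lam k)%N) -> small A (fun k => z ^+ lam k).
Proof.
move=> zq [k1 H]; exists 0%N, k1 => k kk; rewrite expr1n mul1r.
have -> m : absv (z ^+ m) = q ^+ m by elim: m => [|m IHm]; rewrite ?expr0 ?absv1// !exprS absvM IHm zq.
by rewrite ler_wiXn2l// H.
Qed.

Definition near0 A F F' := [/\ small 0 F, small 0 F' & small A (fun k => F k - F' k)].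

Lemma near0_refl A F : small 0 F -> near0 A F F.
Proof.
by move=> sF; split=> //; apply: (small_ext _ (small_0 A)); exists 0%N => k _; rewrite subrr.
Qed.

Lemma near0_ext A F F' G G' : (forall k, F k = G k) -> (forall k, F' k = G' k) -> near0 A F F' -> near0 A G G'.
Proof.
move=> FG FG' [s s' sd]; split.
- by apply: small_ext s; exists 0%N.
- by apply: small_ext s'; exists 0%N.
- by apply: small_ext sd; exists 0%N => k _; rewrite FG FG'.
Qed.

Lemma near0_add A F F' G G' : near0 A F F' -> near0 A G G' -> near0 A (fun k => F k + G k) (fun k => F' k + G' k).
Proof.
move=> [f f' fd] [g g' gd]; split; do ?exact: small_add.
by apply: (small_ext _ (small_add fd gd)); exists 0%N => k _; ring.
Qed.

Lemma near0_mul A F F' G G' : near0 A F F' -> near0 A G G' -> near0 A (fun k => F k * G k) (fun k => F' k * G' k).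
Proof.
move=> [f f' fd] [g g' gd]; split; do ?exact: small0_mul.
apply: (small_ext _ (small_add (small0_mul g fd) (small0_mul f' gd))); exists 0%N => k _; ring.
Qed.

Lemma near0_exp A F F' m : near0 A F F' -> near0 A (fun k => F k ^+ m) (fun k => F' k ^+ m).
Proof.
move=> ff; elim: m => [|m IHm].
  by apply: (near0_ext _ _ (near0_refl A (small_const 1))) => k; rewrite expr0.
by apply: (near0_ext _ _ (near0_mul ff IHm)) => k; rewrite exprS.
Qed.

Lemma near0_prod A (T : eqType) (r : seq T) (F F' : T -> nat -> K) : (forall t, t \in r -> near0 A (F t) (F' t)) ->
  near0 A (fun k => \prod_(t <- r) F t k) (fun k => \prod_(t <- r) F' t k).
Proof.
elim: r => [|t r IHr] H.
  by apply: (near0_ext _ _ (near0_refl A (small_const 1))) => k; rewrite big_nil.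
have := near0_mul (H t (mem_head _ _)) (IHr (fun x xr => H x (mem_behead (s := t :: r) xr))).
by apply: near0_ext => k; rewrite big_cons.
Qed.

End Small.

Section PigeonholeScale.
(** If the ratio exceeded (c+1)^(h+1) at every scale from D0 on, iterating from D0 + 1 would force
    growth with exponent h + 1, against the exponent h. *)
Lemma polynomial_growth_scale (N : nat -> nat) h c D0 : (0 < c)%N -> (forall D, (0 < D)%N -> (0 < N D)%N) ->
  (forall D, (N D <= D ^ h)%N) ->
  exists2 D, (D0 <= D)%N & (N (c.+1 * D) <= c.+1 ^ h.+1 * N D)%N.
Proof.
move=> c0 N0 Nh; apply: contrapT => H.
pose E := D0.+1.
have G t : (c.+1 ^ (h.+1 * t) <= N (c.+1 ^ t * E))%N.
  elim: t => [|t IHt]; first by rewrite muln0 mul1n N0.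
  have : (c.+1 ^ h.+1 * N (c.+1 ^ t * E) < N (c.+1 * (c.+1 ^ t * E)))%N.
    rewrite ltnNge; apply/negP => le; apply: H; exists (c.+1 ^ t * E)%N => //.
    by rewrite (leq_trans (leqnSn D0))// leq_pmull// expn_gt0.
  rewrite mulnA -expnS => lt; rewrite (leq_trans _ (ltnW lt))// mulnS expnD leq_mul//.
have /= := leq_trans (G (E ^ h)%N) (Nh _); rewrite expnMn -expnM mulSn [(E ^ h * h)%N]mulnC expnD.
rewrite mulnC leq_pmul2l ?expn_gt0// leqNgt => /negP; apply.
by rewrite ltn_expl.
Qed.
End PigeonholeScale.

Section LinearSystem.
Lemma kernel_vector (L : fieldType) (U E : finType) (M : U -> E -> L) : (#|E| < #|U|)%N ->
  exists y : U -> L, (exists i, y i != 0) /\ forall e, \sum_i y i * M i e = 0.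
Proof.
move=> EU; pose A : 'M[L]_(#|U|, #|E|) := \matrix_(i, k) M (enum_val i) (enum_val k).
have : kermx A != 0.
  rewrite -mxrank_eq0 mxrank_ker -lt0n subn_gt0; exact: leq_ltn_trans (rank_leq_col A) EU.
move=> /rowV0Pn[w wk w0]; have wA : w *m A = 0 by apply/sub_kermxP.
exists (fun i => w 0 (enum_rank i)); split.
  have [i wi] : exists i, w 0 i != 0.
    apply: contrapT => H; move/eqP: w0; apply; apply/rowP => i; rewrite mxE; apply/eqP.
    by apply: contrapT => /negP wi; apply: H; exists i.
  by exists (enum_val i); rewrite enum_valK.
move=> e; have H := congr1 (fun B : 'rV[L]_#|E| => B 0 (enum_rank e)) wA; rewrite /= !mxE in H; rewrite -[RHS]H.
rewrite (reindex (@enum_val U predT))/=; last by exists enum_rank => i _; [exact: enum_valK|exact: enum_rankK].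
by apply: eq_bigr => i _; rewrite mxE enum_valK enum_rankK.
Qed.
End LinearSystem.

(** * Mahler's method *)

Section MahlerSetup.
Variables (n : nat) (c u : nat -> nat).
Hypotheses (n_ge2 : (2 <= n)%N) (cn0 : c n <> 0%N).
Variable rs : seq algC.
Hypotheses (Drs : Phi n c algC = root_poly rs) (rs1 : 1 \notin rs) (nd : nondeg (1 :: rs)).
Hypothesis (u_rec : linear_recurrence n c u).
Hypothesis (u_neq0 : exists2 i, (i < n)%N & u i <> 0%N).
Variables (R : realType) (K : valuedFieldType R) (L : fieldExtType rat) (jL : {rmorphism L -> K}).
Variable (a : L).
Hypothesis (a01 : 0 < absv (jL a) < 1).
Variables (I J : finType) (b : I -> L) (k0 : nat).
Hypothesis regular : forall k i, (k0 <= k)%N -> 1 - b i * a ^+ u k != 0.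
Variables (al be : J -> L) (ll ex : J -> nat).
Hypothesis be_cover : forall j, be j = 0 \/ exists i, be j = b i.
Variable gam : (I + J)%type -> K.
Local Notation small := (small (absv (jL a)) u).

Definition term_ j r : L := (r ^_ ll j)%:R * al j ^+ r * (a ^+ u r / (1 - be j * a ^+ u r)) ^+ (ex j).+1.
Definition Yseq i k : L := \prod_(k0 <= r < k) (1 - b i * a ^+ u r).
Definition Sseq j k : L := \sum_(k0 <= r < k) term_ j r.
Definition gseq (t : I + J) k : L := match t with inl i => Yseq i k | inr j => Sseq j k end.

(** A single exponent, at least every pole order [ex j + 1] and positive even without sums, so that
    one power of the product of factors clears all denominators. *)
Definition es := (\sum_j (ex j).+1).+1.
Lemma ex_es j : ((ex j).+1 <= es)%N.
Proof. by rewrite /es (bigD1 j)//= -addnS leq_addr. Qed.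

Local Notation W := ((I + J) + option J)%type.
Local Notation V := (W + 'I_n)%type.

Definition vals k (x : V) : K := match x with
  | inl (inl t) => gam t
  | inl (inr None) => k%:R
  | inl (inr (Some j)) => jL (al j) ^+ k
  | inr i => jL a ^+ u (k + i) end.

(* No bound is required on the exponents of the [a ^ u (k + i)]. *)
Definition rp (w : W -> nat) (F : nat -> K) := exists s : seq (L * (V -> nat)),
  (forall y, y \in s -> forall x, (y.2 (inl x) <= w x)%N) /\
  forall k, (k0 <= k)%N -> F k = \sum_(y <- s) jL y.1 * mval (vals k) y.2.

Lemma rp_ext w F G : (forall k, (k0 <= k)%N -> F k = G k) -> rp w F -> rp w G.
Proof. by move=> FG [s [sw E]]; exists s; split=> // k kk; rewrite -FG// E. Qed.

Lemma rp_le w w' F : (forall x, (w x <= w' x)%N) -> rp w F -> rp w' F.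
Proof.
by move=> ww [s [sw E]]; exists s; split=> // y ys x; rewrite (leq_trans (sw y ys x)).
Qed.

Lemma rp_add w F G : rp w F -> rp w G -> rp w (fun k => F k + G k).
Proof.
move=> [s [sw E]] [s' [sw' E']]; exists (s ++ s'); split; last by move=> k kk; rewrite E// E'// big_cat.
by move=> y; rewrite mem_cat => /orP[/sw|/sw'].
Qed.

Lemma rp_mul w w' F G : rp w F -> rp w' G -> rp (fun x => w x + w' x)%N (fun k => F k * G k).
Proof.
move=> [s [sw E]] [s' [sw' E']].
exists [seq (x.1 * y.1, (fun i => x.2 i + y.2 i)%N) | x <- s, y <- s']; split.
  by move=> _ /allpairsPdep[x [y [/sw xs /sw' ys ->]]] z; rewrite leq_add.
move=> k kk; rewrite E// E'// big_allpairs_dep mulr_suml; apply: eq_bigr => x _.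
rewrite mulr_sumr; apply: eq_bigr => y _ /=.
by rewrite mvalD rmorphM; ring.
Qed.

Lemma rp_const w e : rp w (fun=> jL e).
Proof.
exists [:: (e, fun=> 0%N)]; split; first by move=> y; rewrite mem_seq1 => /eqP->.
by move=> k _; rewrite big_seq1 /mval big1 ?mulr1// => x _; rewrite expr0.
Qed.

Lemma rp_exp w F m : rp w F -> rp (fun x => m * w x)%N (fun k => F k ^+ m).
Proof.
move=> rF; elim: m => [|m IHm].
  by apply: (rp_ext _ (rp_const _ 1)) => k _; rewrite rmorph1 expr0.
apply: (rp_ext _ (rp_le _ (rp_mul rF IHm))) => [k _|x]; first by rewrite exprS.
by rewrite mulSn.
Qed.

Lemma rp_sum w (T : eqType) (r : seq T) (F : T -> nat -> K) :
  (forall t, t \in r -> rp w (F t)) -> rp w (fun k => \sum_(t <- r) F t k).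
Proof.
elim: r => [|t r IHr] H.
  by apply: (rp_ext _ (rp_const _ 0)) => k _; rewrite rmorph0 big_nil.
have := rp_add (H t (mem_head _ _)) (IHr (fun x xr => H x (mem_behead (s := t :: r) xr))).
by apply: rp_ext => k _; rewrite big_cons.
Qed.

Lemma rp_prod (T : eqType) (r : seq T) (w : T -> W -> nat) (F : T -> nat -> K) :
  (forall t, t \in r -> rp (w t) (F t)) ->
  rp (fun x => \sum_(t <- r) w t x)%N (fun k => \prod_(t <- r) F t k).
Proof.
elim: r => [|t r IHr] H.
  by apply: (rp_ext _ (rp_const _ 1)) => k _; rewrite rmorph1 big_nil.
have := rp_mul (H t (mem_head _ _)) (IHr (fun x xr => H x (mem_behead (s := t :: r) xr))).
move/(rp_le (w' := fun x => \sum_(t <- t :: r) w t x)%N) => H'.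
by apply: rp_ext (H' _) => [k _|x]; rewrite big_cons.
Qed.

Definition e1 (x : W) : W -> nat := fun y => (y == x : nat).

Lemma mval_gen (w : V -> K) x : mval w (fun y => (y == x : nat)) = w x.
Proof.
rewrite /mval (bigD1 x)//= eqxx expr1 big1 ?mulr1// => y /negPf->.
by rewrite expr0.
Qed.

Lemma rp_gen x : rp (e1 x) (fun k => vals k (inl x)).
Proof.
exists [:: (1, fun y => (y == inl x : nat))]; split.
  by move=> y; rewrite mem_seq1 => /eqP-> z; rewrite /e1 /= eqE.
by move=> k _; rewrite big_seq1 mval_gen rmorph1 mul1r.
Qed.

Lemma rp_x0 (i : 'I_n) : rp (fun=> 0%N) (fun k => jL a ^+ u (k + i)).
Proof.
exists [:: (1, fun y => (y == inr i : nat))]; split.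
  by move=> y; rewrite mem_seq1 => /eqP-> z.
by move=> k _; rewrite big_seq1 mval_gen rmorph1 mul1r.
Qed.

(** For r >= n the recurrence, whose coefficients are natural numbers, turns a^(u(k+r)) into a
    monomial in earlier shifts. *)
Lemma rp_x r : rp (fun=> 0%N) (fun k => jL a ^+ u (k + r)).
Proof.
elim/ltn_ind: r => r IHr; case: (ltnP r n) => [rn|nr]; first exact: (rp_x0 (Ordinal rn)).
have := @rp_prod _ (index_iota 1 n.+1) (fun _ _ => 0%N) (fun i k => (jL a ^+ u (k + (r - i))) ^+ c i) _.
have H i : i \in index_iota 1 n.+1 -> rp (fun=> 0%N) (fun k => (jL a ^+ u (k + (r - i))) ^+ c i).
  rewrite mem_index_iota => /andP[i1 iN].
  by apply: (rp_le _ (rp_exp (c i) (IHr (r - i)%N _))) => [x|]; [rewrite muln0|lia].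
move/(_ H)/(rp_le (w' := fun=> 0%N)) => H'; apply: rp_ext (H' _) => [k _|x]; last by rewrite big1.
have -> : (k + r = (k + r - n) + n)%N by lia.
rewrite u_rec -prodrXr; apply: eq_big_seq => i; rewrite mem_index_iota => /andP[i1 iN].
by rewrite -exprM mulnC; congr (_ ^+ (_ * u _)); lia.
Qed.

Lemma rp_lin i r : rp (fun=> 0%N) (fun k => jL (1 - b i * a ^+ u (k + r))).
Proof.
have := rp_add (rp_const (fun=> 0%N) 1) (rp_mul (rp_const (fun=> 0%N) (- b i)) (rp_x r)).
by apply: rp_ext => k _; rewrite rmorphB rmorphM rmorphXn rmorphN rmorph1 mulNr.
Qed.

Lemma small_vals x : small 0 (fun k => vals k x).
Proof.
case: x => [[t|[j|]]|i] /=; [exact: small_const|exact: small_pow|exact: small_k|].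
by apply: small_num => //; exists 0%N.
Qed.

Lemma small_mval (y : V -> nat) : small 0 (fun k => mval (vals k) y).
Proof. by apply: small0_prod => // x _; apply: small0_exp => //; exact: small_vals. Qed.

Lemma rp_small w F : rp w F -> small 0 F.
Proof.
move=> [s [_ E]]; apply: (small_ext (F := fun k => \sum_(y <- s) jL y.1 * mval (vals k) y.2)).
  by exists k0 => k /E.
apply: small_sum => // y _; apply: small0_mul => //; [exact: small_const|exact: small_mval].
Qed.

(* The product of the factors separating [Y_i(k)] from [Y_i(k + M)]. *)
Definition fstep M i k : L := \prod_(r < M) (1 - b i * a ^+ u (k + r)).
Definition fall M k : L := \prod_i fstep M i k.

Lemma rp0_prod (T : finType) (P : pred T) (F : T -> nat -> K) : (forall t, rp (fun=> 0%N) (F t)) ->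
  rp (fun=> 0%N) (fun k => \prod_(t | P t) F t k).
Proof.
move=> H; have := @rp_prod _ [seq t <- index_enum T | P t] (fun _ _ => 0%N) F (fun t _ => H t).
move/(rp_le (w' := fun=> 0%N)) => H'; apply: rp_ext (H' _) => [k _|x]; last by rewrite big1.
by rewrite big_filter.
Qed.

Lemma rp0_exp F m : rp (fun=> 0%N) F -> rp (fun=> 0%N) (fun k => F k ^+ m).
Proof. by move=> /(rp_exp m); apply: rp_le => x; rewrite muln0. Qed.

Lemma rp0_mul F G w : rp (fun=> 0%N) F -> rp w G -> rp w (fun k => F k * G k).
Proof. by move=> rF rG; apply: rp_le (rp_mul rF rG) => x. Qed.

Lemma rp_fstep M i : rp (fun=> 0%N) (fun k => jL (fstep M i k)).
Proof.
apply: (rp_ext _ (rp0_prod xpredT (fun r : 'I_M => rp_lin i r))) => k _.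
by rewrite /fstep rmorph_prod.
Qed.

Lemma rp_fall M : rp (fun=> 0%N) (fun k => jL (fall M k)).
Proof.
apply: (rp_ext _ (rp0_prod xpredT (rp_fstep M))) => k _; by rewrite /fall rmorph_prod.
Qed.

Lemma fstep_neq0 M i k : (k0 <= k)%N -> fstep M i k != 0.
Proof. by move=> kk; apply/prodf_neq0 => r _; apply: regular; rewrite (leq_trans kk) ?leq_addr. Qed.

Lemma fall_neq0 M k : (k0 <= k)%N -> fall M k != 0.
Proof. by move=> kk; apply/prodf_neq0 => i _; apply: fstep_neq0. Qed.

(* [fall M k ^ es] clears the denominators of the terms of [S_j]. *)
Lemma rp_quotient M j r : (r < M)%N ->
  rp (fun=> 0%N) (fun k => jL (fall M k ^+ es / (1 - be j * a ^+ u (k + r)) ^+ (ex j).+1)).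
Proof.
move=> rM; have [be0|[i bi]] := be_cover j.
  apply: (rp_ext _ (rp0_exp es (rp_fall M))) => k _.
  by rewrite be0 mul0r subr0 expr1n divr1 rmorphXn.
pose r' := Ordinal rM.
have H1 := rp0_prod (fun s => s != r') (fun s : 'I_M => rp_lin i s).
have H2 := rp0_prod (fun i' => i' != i) (rp_fstep M).
apply: (rp_ext _ (rp0_mul (rp0_exp (es - (ex j).+1) (rp_lin i r)) (rp0_exp es (rp0_mul H1 H2)))) => k kk.
have aE : fall M k = (1 - b i * a ^+ u (k + r)) * (\prod_(t | t != r') (1 - b i * a ^+ u (k + t)) *
    \prod_(t | t != i) fstep M t k).
  by rewrite mulrA /fall (bigD1 i)//=; congr (_ * _); rewrite /fstep (bigD1 r').
rewrite aE bi -!rmorph_prod -rmorphM -!rmorphXn -rmorphM; congr (jL _).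
set x := 1 - b i * a ^+ u (k + r).
have xE : x ^+ es = x ^+ (es - (ex j).+1) * x ^+ (ex j).+1 by rewrite -exprD subnK ?ex_es.
have : x ^+ (ex j).+1 != 0 by rewrite expf_neq0// regular// (leq_trans kk) ?leq_addr.
by rewrite [in RHS]exprMn xE; move: (x ^+ (ex j).+1) => y y0; field.
Qed.

Definition Pfac M (t : I + J) k : L := match t with
  | inl i => fall M k ^+ es.-1 * \prod_(i' | i' != i) fstep M i' k
  | inr j => fall M k ^+ es end.
Definition Qfac M (t : I + J) k : L := match t with
  | inl i => 0
  | inr j => - \sum_(r < M) (fall M k ^+ es * term_ j (k + r)) end.

(** The values at [k] are expressed through those at k + M, which are close enough to the limits
    [gam] to be replaced by them. The power of [fall M k] makes the coefficients polynomial. *)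
Lemma gseq_step M t k : (k0 <= k)%N ->
  fall M k ^+ es * gseq t k = Pfac M t k * gseq t (k + M) + Qfac M t k.
Proof.
move=> kk; case: t => [i|j] /=.
  have -> : Yseq i (k + M) = Yseq i k * fstep M i k.
    rewrite /Yseq (big_cat_nat (n := k)) ?leq_addr//=; congr (_ * _).
    by rewrite -{1}[k]add0n big_addn addKn big_mkord; apply: eq_bigr => r _; rewrite addnC.
  by rewrite addr0 /es exprSr {2}/fall (bigD1 i)//=; ring.
have -> : Sseq j (k + M) = Sseq j k + \sum_(r < M) term_ j (k + r).
  rewrite /Sseq (big_cat_nat (n := k)) ?leq_addr//=; congr (_ + _).
  by rewrite -{1}[k]add0n big_addn addKn big_mkord; apply: eq_bigr => r _; rewrite addnC.
by rewrite mulrDr [X in _ + X - _]mulr_sumr addrK.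
Qed.

Definition wfac (t : I + J) : W -> nat := match t with
  | inl i => fun=> 0%N
  | inr j => fun x => (ll j * e1 (inr None) x + e1 (inr (Some j)) x)%N end.

Lemma rp_kr r : rp (e1 (inr None)) (fun k => (k + r)%:R).
Proof.
apply: (rp_ext _ (rp_add (rp_gen (inr None)) (rp_const _ r%:R))) => k _.
by rewrite /= natrD rmorph_nat.
Qed.

Lemma rp_ffact r l : rp (fun x => l * e1 (inr None) x)%N (fun k => ((k + r) ^_ l)%:R).
Proof.
elim: l => [|l IHl].
  by apply: (rp_ext _ (rp_const _ 1)) => k _; rewrite ffactn0 rmorph1.
have H : rp (e1 (inr None)) (fun k => (k + r)%:R - l%:R).
  apply: (rp_ext _ (rp_add (rp_kr r) (rp_const _ (- l%:R)))) => k _.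
  by rewrite rmorphN rmorph_nat.
apply: (rp_ext _ (rp_le _ (rp_mul H IHl))) => [k _|x]; last by rewrite mulSn.
rewrite ffactnSr natrM mulrC; case: (leqP l (k + r)) => lk; first by rewrite natrB.
by rewrite ffact_small// !mul0r.
Qed.

Lemma rp_Pfac M t : rp (fun=> 0%N) (fun k => jL (Pfac M t k)).
Proof.
case: t => [i|j] /=.
  apply: (rp_ext _ (rp0_mul (rp0_exp es.-1 (rp_fall M)) (rp0_prod (fun i' => i' != i) (rp_fstep M)))).
  by move=> k _; rewrite rmorphM rmorphXn; congr (_ * _); rewrite rmorph_prod.
by apply: (rp_ext _ (rp0_exp es (rp_fall M))) => k _; rewrite rmorphXn.
Qed.

Lemma rp_Qfac M t : rp (wfac t) (fun k => jL (Qfac M t k)).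
Proof.
case: t => [i|j] /=; first by apply: (rp_ext _ (rp_const _ 0)).
have H (r : 'I_M) : r \in index_enum 'I_M -> rp (wfac (inr j)) (fun k => jL (- (fall M k ^+ es * term_ j (k + r)))).
  move=> _; have Hx := rp0_exp (ex j).+1 (rp_x r).
  have Hal : rp (e1 (inr (Some j))) (fun k => jL (al j) ^+ (k + r)).
    apply: (rp_ext _ (rp0_mul (rp_const (fun=> 0%N) (al j ^+ r)) (rp_gen (inr (Some j))))) => k _ /=.
    by rewrite rmorphXn -exprD addnC.
  have := rp0_mul (rp0_mul (rp_const (fun=> 0%N) (-1)) (rp0_mul (rp_quotient j (ltn_ord r)) Hx)) (rp_mul (rp_ffact r (ll j)) Hal).
  apply: rp_ext => k kk; rewrite /term_ -[jL (al j) ^+ _]rmorphXn -[jL a ^+ _]rmorphXn -[_%:R](rmorph_nat jL) -[jL _ ^+ (ex j).+1]rmorphXn -!rmorphM.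
  by congr (jL _); rewrite exprMn exprVn; ring.
by apply: (rp_ext _ (rp_sum H)) => k _; rewrite -rmorph_sum sumrN.
Qed.

Definition rest d (e : J -> nat) (lam : 'I_n -> nat) k : L :=
  k%:R ^+ d * (\prod_j (al j ^+ k) ^+ e j) * \prod_(i < n) (a ^+ u (k + i)) ^+ lam i.
Definition punk nu d e lam k : L := rest d e lam k * \prod_t gseq t k ^+ nu t.
Definition Yall k : L := \prod_i Yseq i k.
(** This is Yall^(es G) times [punk], arranged so that each factor separately has height O(u k):
    every [gseq] receives the power of [Yall] that clears its denominators. *)
Definition Zunk G nu d e lam k : L :=
  rest d e lam k * Yall k ^+ (es * (G - \sum_t nu t)) * \prod_t (Yall k ^+ es * gseq t k) ^+ nu t.

Lemma Yseq_neq0 i k : Yseq i k != 0.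
Proof.
by rewrite /Yseq prodf_seq_neq0; apply/allP => r; rewrite mem_index_iota => /andP[kr _] /=; apply: regular.
Qed.

Lemma Yall_neq0 k : Yall k != 0.
Proof. by apply/prodf_neq0 => i _; apply: Yseq_neq0. Qed.

Lemma ZunkE G nu d e lam k : (\sum_t nu t <= G)%N ->
  Zunk G nu d e lam k = Yall k ^+ (es * G) * punk nu d e lam k.
Proof.
move=> le; rewrite /Zunk /punk.
have -> : \prod_t (Yall k ^+ es * gseq t k) ^+ nu t =
    Yall k ^+ (es * \sum_t nu t) * \prod_t gseq t k ^+ nu t.
  by rewrite big_distrr /= -prodrXr -big_split; apply: eq_bigr => t _; rewrite /= exprMn exprM.
rewrite -{2}(subnK le) mulnDr exprD; ring.
Qed.

Section Heights.
Variables (delta B0 : nat).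
Hypothesis delta_gt0 : (0 < delta)%N.
Hypotheses (Ba : bd delta B0 a) (Bb : forall i, bd delta B0 (b i)) (Bal : forall j, bd delta B0 (al j)).

Definition BD m (F : nat -> L) := exists k1, forall k, (k1 <= k)%N -> bd delta (m * u k) (F k).

Lemma growth_basic : exists C k1, forall k, (k1 <= k)%N -> [/\ (0 < u k)%N, (k.+1 <= u k)%N,
  (\sum_(r < k.+1) u r <= C * u k)%N & forall i, (i < n)%N -> (u (k + i) <= C * u k)%N].
Proof.
have [C [k1 H1]] := growth_upper n_ge2 cn0 u_rec u_neq0 Drs rs1 nd.
have [C' [k2 H2]] := growth_sum n_ge2 cn0 u_rec u_neq0 Drs rs1 nd.
have [k3 H3] := growth_superlinear n_ge2 cn0 u_rec u_neq0 Drs rs1 nd 2.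
exists (C' + C.+1 ^ n)%N, (k1 + k2 + k3 + 1)%N => k kk.
have [kk1 kk2 kk3 kk0] : [/\ k1 <= k, k2 <= k, k3 <= k & 0 < k]%N by split; lia.
have [_ uk Hu] := H1 k kk1; have uk3 := H3 k kk3.
split=> //.
- by apply: leq_trans uk3; lia.
- by apply: (leq_trans (H2 k kk2)); rewrite leq_mul2r leq_addr orbT.
- move=> i iN; apply: (leq_trans (Hu i (k + i)%N (leqnn _))).
  rewrite leq_mul2r; apply/orP; right; rewrite (@leq_trans (C.+1 ^ i.+1))//; first by rewrite leq_exp2r.
  by rewrite (leq_trans _ (leq_addl _ _))// leq_pexp2l.
Qed.

Lemma BD_le m m' F : (m <= m')%N -> BD m F -> BD m' F.
Proof.
move=> mm [k1 H]; exists k1 => k kk; apply: bd_mono (H k kk) => //.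
by rewrite leq_mul2r mm orbT.
Qed.

Lemma BD_mul m m' F G : BD m F -> BD m' G -> BD (m + m') (fun k => F k * G k).
Proof.
move=> [k1 H] [k2 H']; exists (maxn k1 k2) => k; rewrite geq_max => /andP[kk kk2].
by rewrite mulnDl; apply: bd_mul; [exact: H|exact: H'].
Qed.

Lemma BD_of m F : (exists k1, forall k, (k1 <= k)%N -> exists2 B, bd delta B (F k) & (B <= m * u k)%N) -> BD m F.
Proof. by move=> [k1 H]; exists k1 => k /H[B BF /bd_mono]; apply. Qed.

Lemma BD_ext m F G : (forall k, F k = G k) -> BD m F -> BD m G.
Proof. by move=> FG [k1 H]; exists k1 => k /H; rewrite FG. Qed.

Lemma BD_1 : BD 1 (fun=> 1).
Proof.
have [C [k1 H]] := growth_basic; apply: BD_of; exists k1 => k /H[uk _ _ _].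
by exists 1%N; [exact: bd_1|rewrite mul1n].
Qed.

Lemma BD_exp m F q : BD m F -> BD (q * m + 1) (fun k => F k ^+ q).
Proof.
move=> BF; elim: q => [|q IHq]; first by apply: BD_ext BD_1 => k; rewrite expr0.
by apply: BD_ext (BD_le _ (BD_mul BF IHq)) => [k|]; [rewrite exprS|rewrite mulSn addnA].
Qed.

Lemma BD_prod (T : eqType) (r : seq T) (m : T -> nat) (F : T -> nat -> L) : (forall t, t \in r -> BD (m t) (F t)) ->
  BD (\sum_(t <- r) m t + 1) (fun k => \prod_(t <- r) F t k).
Proof.
elim: r => [|t r IHr] H; first by apply: BD_ext (BD_le _ BD_1) => [k|]; rewrite big_nil.
have := BD_mul (H t (mem_head _ _)) (IHr (fun x xr => H x (mem_behead (s := t :: r) xr))).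
move=> H'; apply: BD_ext (BD_le _ H') => [k|]; rewrite big_cons// addnA.
by [].
Qed.

Lemma bd_x r : bd delta (u r * B0).+1 (a ^+ u r).
Proof. exact: bd_exp. Qed.

Definition wlin r := (u r * B0 + B0 + 2)%N.

Lemma bd_lin i r : bd delta (wlin r) (1 - b i * a ^+ u r).
Proof.
rewrite /wlin addnS addn1; apply: (bd_add delta_gt0).
  by apply: bd_mono (bd_1 L delta_gt0).
by apply: bd_opp; apply: bd_mono (bd_mul (Bb i) (bd_x r)) => //; lia.
Qed.

Lemma wlin_sum : exists C, exists k1, forall k, (k1 <= k)%N ->
  (\sum_(r <- index_iota k0 k) wlin r <= C * u k)%N /\ forall r, (r < k)%N -> (wlin r <= C * u k)%N.
Proof.
have [C [k1 H]] := growth_basic; exists (C * B0 + B0 + 2)%N, (k1 + k0)%N => k kk.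
have [_ ku su _] := H k (leq_trans (leq_addr _ _) kk).
have E : (\sum_(r < k) wlin r <= (C * B0 + B0 + 2) * u k)%N.
  have -> : (\sum_(r < k) wlin r = (\sum_(r < k) u r) * B0 + k * (B0 + 2))%N.
    rewrite big_distrl -[k in (k * _)%N]card_ord -sum_nat_const -big_split.
    by apply: eq_bigr => r _; rewrite /= addnA.
  have : ((\sum_(r < k) u r) * B0 <= C * u k * B0)%N.
    by rewrite leq_mul2r (leq_trans _ su) ?orbT// big_ord_recr leq_addr.
  have : (k * (B0 + 2) <= u k * (B0 + 2))%N by rewrite leq_mul2r (ltnW ku) orbT.
  move=> h1 h2; apply: leq_trans (leq_add h2 h1) _.
  by rewrite leq_eqVlt; apply/orP; left; apply/eqP; ring.
split; last first.
  by move=> r rk; apply: leq_trans E; rewrite (bigD1 (Ordinal rk))//= leq_addr.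
rewrite (leq_trans _ E)// -(big_mkord xpredT wlin) [X in (_ <= X)%N](big_cat_nat (n := k0))//=; last lia.
by rewrite leq_addl.
Qed.

Definition pairs k := [seq (i, r) | i <- index_enum I, r <- index_iota k0 k].
Definition lin (p : I * nat) : L := 1 - b p.1 * a ^+ u p.2.

Lemma Yall_pairs k : Yall k = \prod_(p <- pairs k) lin p.
Proof. by rewrite /pairs big_allpairs_dep. Qed.

Lemma pairs_sum : exists C k1, forall k, (k1 <= k)%N -> (\sum_(p <- pairs k) wlin p.2 <= C * u k)%N.
Proof.
have [C [k1 H]] := wlin_sum; exists (#|I| * C)%N, k1 => k /H[Hs _].
rewrite /pairs big_allpairs_dep -mulnA -sum_nat_const; exact: leq_sum.
Qed.

Lemma bd_pairs (s : seq (I * nat)) : bd delta (\sum_(p <- s) wlin p.2).+1 (\prod_(p <- s) lin p).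
Proof. by apply: (bd_prod delta_gt0) => p _; apply: bd_lin. Qed.

Lemma BD_Yall : exists m, BD m Yall.
Proof.
have [C [k1 H]] := pairs_sum; have [C' [k2 H']] := growth_basic.
exists C.+1; apply: BD_of; exists (k1 + k2)%N => k kk; rewrite Yall_pairs.
eexists; first exact: bd_pairs.
have /H Hk : (k1 <= k)%N by lia.
have /H'[uk _ _ _] : (k2 <= k)%N by lia.
by rewrite mulSn; move: Hk uk; move: (_ * _)%N (\sum_(p <- _) _)%N => X Y; lia.
Qed.

Lemma bd_quotient j : exists m k1, forall k r, (k1 <= k)%N -> (k0 <= r < k)%N ->
  bd delta (m * u k) (Yall k ^+ es / (1 - be j * a ^+ u r) ^+ (ex j).+1).
Proof.
have [mY [kY HY]] := BD_Yall; have [C' [k2 H']] := growth_basic.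
have [Cw [kw Hw]] := wlin_sum; have [Cp [kp Hp]] := pairs_sum.
exists (es * mY + 1 + (es * Cw + 1 + (es * (Cp + 1) + 1)))%N, (kY + k2 + kw + kp)%N => k r kk /andP[kr rk].
have /HY bY : (kY <= k)%N by lia.
have /H'[uk _ _ _] : (k2 <= k)%N by lia.
have /Hw[_ /(_ r rk) wr] : (kw <= k)%N by lia.
have /Hp pk : (kp <= k)%N by lia.
have [be0|[i bi]] := be_cover j.
  rewrite be0 mul0r subr0 expr1n divr1; apply: bd_mono (bd_exp delta_gt0 es bY) => //.
  by rewrite mulnDl mulnDl mul1n mulnA; lia.
have p0 : (i, r) \in pairs k by apply/allpairsP; exists (i, r); rewrite /= mem_index_enum mem_index_iota kr rk.
have -> : Yall k ^+ es / (1 - be j * a ^+ u r) ^+ (ex j).+1 =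
   lin (i, r) ^+ (es - (ex j).+1) * (\prod_(p <- rem (i, r) (pairs k)) lin p) ^+ es.
  rewrite Yall_pairs (big_rem _ p0)/= bi exprMn -/(lin (i, r)).
  have -> : lin (i, r) ^+ es = lin (i, r) ^+ (es - (ex j).+1) * lin (i, r) ^+ (ex j).+1.
    by rewrite -exprD subnK ?ex_es.
  have : lin (i, r) ^+ (ex j).+1 != 0 by rewrite expf_neq0// regular.
  by move: (lin (i, r) ^+ (ex j).+1) => y y0; field.
have h1 := bd_exp delta_gt0 (es - (ex j).+1) (bd_lin i r).
have h2 := bd_exp delta_gt0 es (bd_pairs (rem (i, r) (pairs k))).
apply: bd_mono (bd_mul h1 h2) => //.
have s2 : (\sum_(p <- rem (i, r) (pairs k)) wlin p.2 <= Cp * u k)%N.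
  by apply: leq_trans pk; rewrite [X in (_ <= X)%N](big_rem _ p0)/= leq_addl.
have t1 : ((es - (ex j).+1) * wlin r <= es * Cw * u k)%N.
  by rewrite -mulnA leq_mul// leq_subr.
have t2 : (es * (\sum_(p <- rem (i, r) (pairs k)) wlin p.2).+1 <= es * (Cp + 1) * u k)%N.
  by rewrite -mulnA leq_mul2l; apply/orP; right; rewrite mulnDl mul1n; move: s2; move: (\sum_(p <- _) _)%N (Cp * _)%N => X Y; lia.
have G (x y z w : nat) : (0 < w)%N -> ((x * w).+1 + (y * w).+1 <= (z + 1 + (x + 1 + (y + 1))) * w)%N.
  by move=> w0; rewrite !mulnDl !mul1n; move: (x * w)%N (y * w)%N (z * w)%N; clear - w0; lia.
by apply: leq_trans (G _ _ _ _ uk); rewrite leq_add.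
Qed.

Lemma bd_ffact r l : bd delta (l * r.+1).+1 ((r ^_ l)%:R : L).
Proof.
elim: l => [|l IHl]; first by rewrite ffactn0; apply: bd_mono (bd_1 L delta_gt0).
rewrite ffactnSr natrM; apply: bd_mono (bd_mul IHl (bd_nat L delta (r - l))) => //.
by rewrite mulSn; lia.
Qed.

(** A term of S_j multiplied by [Yall ^ es] has height O(u k), and adding at most k <= u k of them
    costs that many further units. *)
Lemma BD_gseq : exists m, forall t, BD m (fun k => Yall k ^+ es * gseq t k).
Proof.
suff /choice[m Hm] (t : I + J) : exists m, BD m (fun k => Yall k ^+ es * gseq t k).
  by exists (\sum_t m t)%N => t; apply: BD_le (Hm t); rewrite (bigD1 t)//= leq_addr.
have [mY HY] := BD_Yall; have [C [k2 H2]] := growth_basic.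
case: t => [i|j].
  have [Cw [kw Hw]] := wlin_sum.
  exists (es * mY + 1 + (Cw + 1))%N; apply: BD_mul; first exact: BD_exp.
  apply: BD_of; exists (kw + k2)%N => k kk; eexists; first by apply: (bd_prod delta_gt0) => r _; apply: bd_lin.
  have /Hw[h _] : (kw <= k)%N by lia.
  have /H2[uk _ _ _] : (k2 <= k)%N by lia.
  by rewrite mulnDl mul1n; move: h uk; move: (Cw * _)%N (\sum_(p <- _) _)%N => X Y; lia.
have [mq [kq Hq]] := bd_quotient j.
exists ((ll j + 1) + (B0 + 1) + ((ex j).+1 * (C * B0 + 1) + 1) + mq + 1)%N; apply: BD_of.
exists (kq + k2)%N => k kk; have /H2[uk ku su _] : (k2 <= k)%N by lia.
have kq' : (kq <= k)%N by lia.
set MM := (_ + mq)%N; exists (MM * u k + size (index_iota k0 k))%N; last first.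
  by rewrite size_iota mulnDl mul1n leq_add2l; lia.
rewrite /= /Sseq mulr_sumr; apply: (bd_sum delta_gt0) => [|r]; first exact: bd_0.
rewrite mem_index_iota => rk; have rk' : (r < k)%N by case/andP: rk.
have -> : Yall k ^+ es * term_ j r = (r ^_ ll j)%:R * al j ^+ r * (a ^+ u r) ^+ (ex j).+1 *
    (Yall k ^+ es / (1 - be j * a ^+ u r) ^+ (ex j).+1).
  by rewrite /term_ exprMn exprVn; ring.
have ur : (u r <= C * u k)%N.
  by apply: leq_trans su; rewrite (bigD1 (Ordinal (leqW rk' : (r < k.+1)%N)))//= leq_addr.
have h4 := Hq k r kq' rk.
have := bd_mul (bd_mul (bd_mul (bd_ffact r (ll j)) (bd_exp delta_gt0 r (Bal j))) (bd_exp delta_gt0 (ex j).+1 (bd_x r))) h4.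
apply: bd_mono => //; rewrite /MM mulnDl leq_add2r mulnDl leq_add//; first last.
  rewrite mulnDl mul1n -mulnA -addn1 leq_add// leq_mul2l; apply/orP; right.
  rewrite mulnDl mul1n -addn1 leq_add// -mulnA [(B0 * _)%N]mulnC mulnA leq_mul2r ur orbT//.
rewrite mulnDl leq_add// mulnDl mul1n -addn1 leq_add//.
  by rewrite leq_mul2l (leq_trans _ ku) ?orbT//; lia.
by rewrite mulnC leq_mul2l (leq_trans _ ku) ?orbT//; lia.
Qed.

(** The constant [m] must be independent of [D], because the order of vanishing per unit of [D] is
    fixed from it before [D] is chosen. *)
Lemma BD_Zunk : exists m, forall D nu d e lam, (0 < D)%N -> (forall t, (nu t < D)%N) -> (d < D)%N ->
  (forall j, (e j < D)%N) -> (forall i, (lam i < D)%N) ->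
  BD (m * D) (Zunk (#|{: I + J}| * D) nu d e lam).
Proof.
have [mY HY] := BD_Yall; have [C [k2 H2]] := growth_basic; have [mg Hg] := BD_gseq.
exists (3 + (#|J| * (B0 + 2) + 1) + (n * (C * B0 + 2) + 1) + (es * #|{: I + J}| * mY + 1) + (#|{: I + J}| * (mg + 1) + 1))%N.
move=> D nu d e lam D0 nuD dD eD lamD.
have Hk : BD 2 (fun k => k%:R).
  apply: BD_of; exists k2 => k /H2[uk ku _ _]; exists k.+1; first exact: bd_nat.
  by rewrite mulSn mul1n (leq_trans ku)// leq_addr.
have Hal j : BD (B0 + 1) (fun k => al j ^+ k).
  apply: BD_of; exists k2 => k /H2[uk ku _ _]; exists (k * B0).+1; first exact: bd_exp.
  by rewrite mulnDl mul1n -addn1 leq_add// mulnC leq_mul2l (ltnW ku) orbT.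
have Hx (i : 'I_n) : BD (C * B0 + 1) (fun k => a ^+ u (k + i)).
  apply: BD_of; exists k2 => k /H2[uk _ _ uki]; exists (u (k + i) * B0).+1; first exact: bd_x.
  by rewrite mulnDl mul1n -addn1 leq_add// mulnAC leq_mul2r uki ?orbT.
have H1 := BD_exp d Hk.
have H3 := BD_prod (r := index_enum J) (fun j _ => BD_exp (e j) (Hal j)).
have H4 := BD_prod (r := index_enum 'I_n) (fun i _ => BD_exp (lam i) (Hx i)).
have H5 := BD_exp (es * (#|{: I + J}| * D - \sum_t nu t)) HY.
have H6 := BD_prod (r := index_enum (I + J)%type) (fun t _ => BD_exp (nu t) (Hg t)).
apply: BD_le (BD_mul (BD_mul (BD_mul (BD_mul H1 H3) H4) H5) H6).
have P1 x : (x + 1 <= x * D + D)%N by rewrite leq_add// leq_pmulr.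
do 4 rewrite mulnDl.
apply: leq_add; [apply: leq_add; [apply: leq_add; [apply: leq_add|]|]|].
- by clear - D0 dD; lia.
- rewrite mulnDl mul1n leq_add// -mulnA -sum_nat_const; apply: leq_sum => j _.
  rewrite mulnDr mulnDl muln1; have := leq_mul (leqnn B0) (ltnW (eD j)).
  by have := eD j; rewrite [(e j * _)%N]mulnC; clear; lia.
- rewrite mulnDl mul1n leq_add// -mulnA -[X in (_ <= X * _)%N]card_ord -sum_nat_const; apply: leq_sum => i _.
  rewrite mulnDr mulnDl muln1; have := leq_mul (leqnn (C * B0)%N) (ltnW (lamD i)).
  by have := lamD i; rewrite [(lam i * _)%N]mulnC; clear; lia.
- rewrite mulnDl mul1n; apply: leq_add => //.
  by rewrite [X in (_ <= X)%N]mulnAC leq_mul2r -mulnA leq_mul2l leq_subr !orbT.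
- rewrite mulnDl mul1n leq_add// -mulnA -sum_nat_const; apply: leq_sum => t _.
  rewrite mulnDl mul1n; have := leq_mul (leqnn mg) (ltnW (nuD t)).
  by have := nuD t; rewrite [(nu t * _)%N]mulnC; clear; lia.
Qed.

End Heights.

Definition chi (e : J -> nat) : L := \prod_j al j ^+ e j.
Definition lamf (lam : 'I_n -> nat) k := (\sum_i lam i * u (k + i))%N.

Lemma restE d e lam k : rest d e lam k = k%:R ^+ d * chi e ^+ k * a ^+ lamf lam k.
Proof.
rewrite /rest /chi /lamf -prodrXl -prodrXr; congr (_ * _ * _); apply: eq_bigr => i _.
  by rewrite -!exprM mulnC.
by rewrite -exprM mulnC.
Qed.

Lemma LR_lamf lam : linear_recurrence n c (lamf lam).
Proof.
move=> k; rewrite /lamf; under [RHS]eq_bigr => i _ do rewrite big_distrr.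
rewrite exchange_big; apply: eq_bigr => l _ /=.
rewrite (_ : k + n + l = k + l + n)%N ?u_rec ?big_distrr /=; last by rewrite addnAC.
apply: eq_big_nat => i /andP[i1 iN]; rewrite mulnCA; congr (_ * (_ * u _))%N; lia.
Qed.

(** The result of [gseq_step] for fall^(es G) times [punk], with each [gseq] at k + M replaced by
    its limit. *)
Definition Funk M G (nu : I + J -> nat) d e lam k : K :=
  jL (rest d e lam k) * jL (fall M k) ^+ (es * (G - \sum_t nu t)) *
  \prod_t (jL (Pfac M t k) * gam t + jL (Qfac M t k)) ^+ nu t.

Definition wunk (nu : I + J -> nat) d (e : J -> nat) : W -> nat := fun x => match x with
  | inl t => nu t
  | inr None => (d + \sum_j nu (inr j) * ll j)%N
  | inr (Some j) => (e j + nu (inr j))%N end.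

Lemma rp_Funk M G nu d e lam : rp (wunk nu d e) (Funk M G nu d e lam).
Proof.
have H1 : rp (fun x => d * e1 (inr None) x + \sum_j e j * e1 (inr (Some j)) x)%N (fun k => jL (rest d e lam k)).
  have h1 := rp_exp d (rp_gen (inr None)).
  have h2 := rp_prod (r := index_enum J) (fun j _ => rp_exp (e j) (rp_gen (inr (Some j)))).
  have h3 := rp0_prod xpredT (fun i : 'I_n => rp0_exp (lam i) (rp_x0 i)).
  apply: (rp_ext _ (rp0_mul h3 (rp_mul h1 h2))) => k _.
  rewrite /rest !rmorphM !rmorphXn rmorph_nat [RHS]mulrC !rmorph_prod; congr (_ * (_ * _)).
    by apply: eq_bigr => i _; rewrite !rmorphXn.
  by apply: eq_bigr => i _; rewrite !rmorphXn.
have H2 t : rp (fun x => e1 (inl t) x + wfac t x)%N (fun k => jL (Pfac M t k) * gam t + jL (Qfac M t k)).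
  apply: rp_add; last by apply: rp_le (rp_Qfac M t) => x; rewrite leq_addl.
  by apply: rp_le (rp0_mul (rp_Pfac M t) (rp_gen (inl t))) => x; rewrite leq_addr.
have H3 := rp_prod (r := index_enum (I + J)%type) (fun t _ => rp_exp (nu t) (H2 t)).
have H4 := rp0_exp (es * (G - \sum_t nu t)) (rp_fall M).
apply: (rp_ext _ (rp_le _ (rp0_mul H4 (rp_mul H1 H3)))) => [k _|x].
  by rewrite /Funk mulrCA mulrA.
have sumE (y : W) : (\sum_t nu t * (e1 (inl t) y + wfac t y) =
   \sum_i nu (inl i) * (y == inl (inl i)) + \sum_j nu (inr j) * ((y == inl (inr j)) + (ll j * (y == inr None) + (y == inr (Some j)))))%N.
  by rewrite big_sumType /=; congr (_ + _)%N; apply: eq_bigr => i _; rewrite /e1 ?addn0.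
rewrite sumE; case: x => [[i|j]|[j|]] /=.
- rewrite /e1 /= muln0 add0n big1 ?add0n => [|j _]; last by rewrite muln0.
  rewrite [X in (_ + X)%N]big1 ?addn0 => [|j _]; last by rewrite !(muln0, addn0).
  rewrite (bigD1 i)//= eqxx muln1 big1 ?addn0// => i' /negPf ii.
  by rewrite (_ : (_ == _ :> W) = (i == i'))// eq_sym ii muln0.
- rewrite /e1 /= muln0 add0n big1 ?add0n => [|j' _]; last by rewrite muln0.
  rewrite [X in (X + _)%N]big1 ?add0n => [|i _]; last by rewrite muln0.
  rewrite (bigD1 j)//= eqxx !(muln0, addn0) muln1 big1 ?addn0// => j' /negPf jj.
  by rewrite (_ : (_ == _ :> W) = (j == j'))// eq_sym jj !(muln0, addn0).
- rewrite /e1 /= muln0 add0n; rewrite [X in (_ + (X + _))%N]big1 ?add0n => [|i _]; last by rewrite muln0.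
  apply: leq_add.
    rewrite (bigD1 j)//= eqxx muln1 big1 ?addn0// => j' /negPf jj.
    by rewrite (_ : (_ == _ :> W) = (j == j'))// eq_sym jj muln0.
  rewrite (bigD1 j)//= eqxx !(muln0, add0n) muln1 big1 ?addn0// => j' /negPf jj.
  by rewrite (_ : (_ == _ :> W) = (j == j'))// eq_sym jj !(muln0, addn0).
- rewrite /e1 eqxx muln1 /=; rewrite [X in (d + X + _)%N]big1 ?addn0 => [|j _]; last by rewrite muln0.
  rewrite leq_add2l big1 ?add0n => [|i _]; last by rewrite muln0.
  by apply: leq_sum => j _; rewrite muln1 add0n addn0.
Qed.

Lemma geo_small (q X eps : R) : 0 < q < 1 -> 0 < eps -> exists m : nat, X * q ^+ m <= eps.
Proof.
move=> /andP[q0 q1] e0; have [C HC] := nat_bound (`|X| / ((q^-1 - 1) * eps)).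
have h0 : 0 < q^-1 - 1 by rewrite subr_gt0 invf_gt1.
exists C; have bern m : 1 + m%:R * (q^-1 - 1) <= q ^- m.
  elim: m => [|m IHm]; first by rewrite mul0r addr0 expr0 invr1.
  rewrite exprS invfM; apply: le_trans (ler_wpM2l _ IHm); last by rewrite invr_ge0 ltW.
  rewrite -natr1; have : 0 <= m%:R * (q^-1 - 1) * (q^-1 - 1) by rewrite !mulr_ge0 ?ler0n ?ltW.
  by nra.
apply: (@le_trans _ _ (`|X| * q ^+ C)); first by rewrite ler_wpM2r ?exprn_ge0 ?(ltW q0)// ler_norm.
rewrite -[q ^+ C]invrK ler_pdivrMr ?invr_gt0 ?exprn_gt0//.
rewrite ler_pdivrMr ?mulr_gt0// in HC; apply: (le_trans HC).
rewrite mulrA mulrC ler_wpM2l ?(ltW e0)//; apply: le_trans (bern C); by rewrite lerDr ler01.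
Qed.

(** The factor q^kap beats cc^m and leaves q^(D uk). As uk >= m2 (k + 1), this beats the remaining
    factors, which are geometric in k. *)
Lemma final_estimate (q cc c3 : R) (Bu m kap D uk k m2 : nat) : 0 < q < 1 -> 1 <= cc -> 0 <= c3 ->
  cc ^+ m * q ^+ kap <= q -> cc ^+ (Bu + 1) * c3 * q ^+ m2 <= 2^-1 -> (0 < D)%N -> (m2 * k.+1 <= uk)%N ->
  cc ^+ (Bu + m * D * uk).+1 * (c3 ^+ k.+1 * q ^+ (kap * D * uk)) < 1.
Proof.
move=> /andP[q0 q1] cc1 c30 Hk Hm D0 um.
have cc0 : 0 <= cc by exact: le_trans cc1.
have -> : cc ^+ (Bu + m * D * uk).+1 * (c3 ^+ k.+1 * q ^+ (kap * D * uk)) =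
    cc ^+ (Bu + 1) * c3 ^+ k.+1 * (cc ^+ m * q ^+ kap) ^+ (D * uk).
  rewrite exprMn -!exprM -!mulnA -mulrACA -exprD; congr (_ ^+ _ * _); lia.
set X := cc ^+ (Bu + 1) * c3; have X0 : 0 <= X by rewrite mulr_ge0 ?exprn_ge0.
apply: (@le_lt_trans _ _ (X ^+ k.+1 * q ^+ (m2 * k.+1))).
  apply: ler_pM.
  - by rewrite mulr_ge0 ?exprn_ge0.
  - by rewrite exprn_ge0// mulr_ge0 ?exprn_ge0 ?(ltW q0).
  - rewrite /X exprMn ler_wpM2r ?exprn_ge0// -exprM ler_weXn2l// mulnS leq_addr//.
  - apply: (@le_trans _ _ (q ^+ (D * uk))).
      by rewrite lerXn2r ?nnegrE ?mulr_ge0 ?exprn_ge0 ?(ltW q0).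
    by rewrite ler_wiXn2l ?(ltW q0) ?(ltW q1)// (leq_trans um)// leq_pmull.
rewrite exprM -exprMn; apply: (@le_lt_trans _ _ (2^-1 ^+ k.+1)).
  by rewrite lerXn2r ?nnegrE ?mulr_ge0 ?exprn_ge0 ?(ltW q0)// invr_ge0 ler0n.
by rewrite exprn_ilt1 ?invr_ge0 ?ler0n// invf_lt1 ?ltr1n ?ltr0n.
Qed.

Lemma small_inv_lin i r : small 0 (fun k => (jL (1 - b i * a ^+ u (k + r)))^-1).
Proof.
have h2 : 0 < 2^-1 :> R by rewrite invr_gt0 ltr0n.
have [m Hm] := geo_small (absv (jL (b i))) a01 h2.
have [k3 H3] := growth_superlinear n_ge2 cn0 u_rec u_neq0 Drs rs1 nd 1.
have [q0 q1] := andP a01; exists 1%N, (k3 + m)%N => k kk; rewrite mul0n expr0 mulr1.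
set z := 1 - b i * a ^+ u (k + r); have zz : 2^-1 <= absv (jL z).
  have : absv (1 : K) <= absv (jL z) + absv (jL (b i * a ^+ u (k + r))).
    rewrite -(rmorph1 jL) (_ : 1 = z + b i * a ^+ u (k + r)) ?rmorphD ?absvD// /z.
    by rewrite subrK.
  rewrite absv1 rmorphM rmorphXn absvM => h.
  have um : (m <= u (k + r))%N by have := H3 (k + r)%N; rewrite mul1n => H; apply: leq_trans (H _); lia.
  have aX w : absv (jL a ^+ w) = absv (jL a) ^+ w by elim: w => [|w IHw]; rewrite ?expr0 ?absv1// !exprS absvM IHw.
  have : absv (jL (b i)) * absv (jL a ^+ u (k + r)) <= 2^-1.
    by rewrite aX (le_trans _ Hm)// ler_wpM2l ?absv_ge0// ler_wiXn2l// ltW.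
  have -> : 2^-1 = 1 - 2^-1 :> R by field.
  by move: h; lra.
have z0 : 0 < absv (jL z) by apply: lt_le_trans zz.
have -> : absv (jL z)^-1 = (absv (jL z))^-1.
  have zn : absv (jL z) != 0 by rewrite gt_eqF.
  by apply: (mulfI zn); rewrite -absvM mulfV ?absv1 ?mulfV// -absv_eq0.
apply: (@le_trans _ _ 2); first by rewrite invf_ple ?posrE ?ltr0n// invrK.
by rewrite -[2 in leLHS]expr1 ler_weXn2l// ler1n.
Qed.

(** * The auxiliary polynomial and the contradiction *)

Section Main.
Variables (QsC : {rmorphism L -> algC}) (jC : {rmorphism algC -> K}).
Hypothesis jLE : forall z, jL z = jC (QsC z).
Hypothesis u_ngeo : ~ exists q : algC, forall k, (u k.+1)%:R = q * (u k)%:R.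
Hypotheses (b_neq0 : forall i, b i != 0) (b_inj : injective b) (al_neq0 : forall j, al j != 0).
Hypothesis param_inj : forall j j', al j = al j' -> ll j = ll j' -> be j = be j' ->
  ex j = ex j' -> j = j'.

(** By [inj], two different indices give either different monomials or different exponents in the
    coefficient of the same monomial, so [sequences_independent] isolates each [y x]. *)
Lemma nonvanishing (U : finType) (nu : U -> I + J -> nat) (d : U -> nat) (e : U -> J -> nat)
    (lam : U -> 'I_n -> nat) (y : U -> L) :
  (forall x x', nu x =1 nu x' -> d x = d x' -> chi (e x) = chi (e x') -> lamf (lam x) = lamf (lam x') -> x = x') ->
  (exists k1, forall k, (k1 <= k)%N -> \sum_x y x * punk (nu x) (d x) (e x) (lam x) k = 0) ->
  forall x, y x = 0.
Proof.
move=> inj [k1 p0] x0; pose mn x : mon I J := ((QsC (chi (e x)), d x), ([ffun i => nu x (inl i)], [ffun j => nu x (inr j)])).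
pose s := [seq ((fun th : (nat -> nat) -> algC => QsC (y x) * th (lamf (lam x))), mn x) | x <- index_enum U].
have injQ : injective QsC by exact: fmorph_inj.
have s0 : forall k, (k1 <= k)%N -> rel_seq (QsC a) (fun i k => QsC (Yseq i k)) (fun j k => QsC (Sseq j k)) s k = 0.
  move=> k kk; transitivity (QsC (\sum_x y x * punk (nu x) (d x) (e x) (lam x) k)); last by rewrite p0// rmorph0.
  rewrite /rel_seq big_map rmorph_sum; apply: eq_bigr => x _.
  rewrite /mon_seq /num /= /punk restE !rmorphM !rmorphXn rmorph_nat big_sumType /= !rmorphM !rmorph_prod.
  have -> : \prod_i QsC (Yseq i k) ^+ [ffun i0 => nu x (inl i0)] i = \prod_i QsC (Yseq i k ^+ nu x (inl i)).
    by apply: eq_bigr => i _; rewrite ffunE rmorphXn.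
  have -> : \prod_j QsC (Sseq j k) ^+ [ffun j0 => nu x (inr j0)] j = \prod_j QsC (Sseq j k ^+ nu x (inr j)).
    by apply: eq_bigr => j _; rewrite ffunE rmorphXn.
  ring.
have Qb0 i : QsC (b i) != 0 by rewrite fmorph_eq0.
have Qreg k i : (k0 <= k)%N -> 1 - QsC (b i) * QsC a ^+ u k != 0.
  by move=> kk; rewrite -rmorphXn -rmorphM -(rmorph1 QsC) -rmorphB fmorph_eq0 regular.
have Qa01 : 0 < absv (jC (QsC a)) < 1 by rewrite -jLE.
have z : pzero (rel_coef s (mn x0)).
  apply: (sequences_independent n_ge2 cn0 Drs rs1 nd u_rec u_neq0 u_ngeo Qa01 (b := fun i => QsC (b i))
    Qb0 (inj_comp injQ b_inj) Qreg (al := fun j => QsC (al j)) (be := fun j => QsC (be j)) (ll := ll) (ex := ex)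
    _ _ _ _ _ _ _ s0).
  - by move=> j; rewrite fmorph_eq0.
  - by move=> j; have [->|[i ->]] := be_cover j; [left; rewrite rmorph0|right; exists i].
  - by move=> j j' /injQ h1 h2 /injQ h3 h4; apply: param_inj.
  - by move=> i k _; rewrite fmorph_eq0 Yseq_neq0.
  - move=> i k kk; rewrite /Yseq big_nat_recr//= mulrC rmorphM; congr (_ * _).
    by rewrite rmorphB rmorph1 rmorphM rmorphXn.
  - move=> j k kk; rewrite /Sseq big_nat_recr//= rmorphD; congr (_ + _).
    by rewrite /term_ !rmorphM !rmorphXn rmorph_nat fmorph_div rmorphXn rmorphB rmorph1 rmorphM rmorphXn.
  - move=> x /mapP[x1 _ ->] /=; split; last by rewrite fmorph_eq0; apply/prodf_neq0 => j _; rewrite expf_neq0.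
    apply: expsumM; [exact: expsum_const|apply: expsum_mono; exact: LR_lamf].
pose s1 := [seq (QsC (y x), lamf (lam x)) | x <- index_enum U & mn x == mn x0].
have cf0 : cf s1 (lamf (lam x0)) = 0.
  apply: (pzero_cf n_ge2 cn0 Drs rs1 nd Qa01).
    by move=> _ /mapP[x _ ->]; exact: LR_lamf.
  by move=> th pth; rewrite -[RHS](z th pth) /ev /s1 big_map big_filter /rel_coef /s big_map.
move: cf0; rewrite /cf /s1 big_map big_filter_cond (big_pred1 x0) => [/eqP|x /=]; first by rewrite fmorph_eq0 => /eqP.
apply/andP/eqP => [[/eqP[h1 h2 h3 h4] /eqP h5]|->//].
apply: inj => //; last exact: injQ.
move=> [i|j]; first by have := congr1 (fun f : {ffun I -> nat} => f i) h3; rewrite !ffunE.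
by have := congr1 (fun f : {ffun J -> nat} => f j) h4; rewrite !ffunE.
Qed.

Lemma common_delta (s : seq L) : exists2 delta, (0 < delta)%N & forall z, z \in s -> integral_mx (delta%:R *: rmx z).
Proof.
elim: s => [|z s [delta d0 Hd]]; first by exists 1%N.
have [delta' d'0 Hd'] : exists2 delta', (0 < delta')%N & integral_mx (delta'%:R *: rmx z).
  pose D := (\prod_i \prod_k `|denq (rmx z i k)|)%N; exists D.
    by rewrite prodn_gt0// => i; rewrite prodn_gt0// => k; rewrite absz_gt0 denq_neq0.
  move=> i k; rewrite mxE /D (bigD1 i)//= (bigD1 k)//= -mulnA natrM mulrAC rpredM ?rpred_nat//.
  rewrite -[X in _ * X]divq_num_den mulrC -mulrA natr_absz ger0_norm ?denq_ge0//.
  by rewrite mulVf ?mulr1 ?rpred_int// intr_eq0 denq_neq0.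
exists (delta * delta')%N; first by rewrite muln_gt0 d0.
move=> z'; rewrite inE natrM => /orP[/eqP->|/Hd zi] i k.
  by rewrite -scalerA mxE rpredM ?rpred_nat.
by rewrite mulrC -scalerA mxE rpredM ?rpred_nat.
Qed.

Hypothesis Kv : exists v, forall r : rat, absv (ratr r : K) = rat_absv R v r.
Hypothesis gam_lim : forall t A, exists J0 k1, forall k r, (k1 <= k)%N -> (k + J0 <= r)%N ->
  absv (jL (gseq t r) - gam t) <= absv (jL a) ^+ (A * u k).

Lemma near_Funk A G nu d e lam : exists M0, forall M, (M0 <= M)%N -> (\sum_t nu t <= G)%N ->
  small A (fun k => jL (fall M k ^+ (es * G) * punk nu d e lam k) - Funk M G nu d e lam k).
Proof.
have /choice[J0 HJ] t := gam_lim t A.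
exists (\sum_t J0 t)%N => M MM le.
have Hn t : near0 (absv (jL a)) u A (fun k => jL (gseq t (k + M))) (fun=> gam t).
  have [k1 H] := HJ t.
  have sd : small A (fun k => jL (gseq t (k + M)) - gam t).
    exists 0%N, k1 => k kk; rewrite expr1n mul1r H//.
    by rewrite leq_add2l (leq_trans _ MM)// (bigD1 t)//= leq_addr.
  split=> //; last exact: small_const.
  have := small_add a01 (small_mono a01 (leq0n A) sd) (small_const _ u (gam t)).
  by apply: small_ext; exists 0%N => k _; rewrite subrK.
have sP t := rp_small (rp_Pfac M t); have sQ t := rp_small (rp_Qfac M t).
have sR : small 0 (fun k => jL (rest d e lam k)).
  have H1 : small 0 (fun k => k%:R ^+ d * jL (chi e) ^+ k).
    by apply: small0_mul => //; [apply: small0_exp => //; exact: small_k|exact: small_pow].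
  have H2 : small 0 (fun k => jL a ^+ lamf lam k) by apply: small_num => //; exists 0%N.
  apply: (small_ext _ (small0_mul a01 H1 H2)); exists 0%N => k _.
  by rewrite restE !rmorphM !rmorphXn rmorph_nat.
have n1 t : near0 (absv (jL a)) u A (fun k => (jL (Pfac M t k) * jL (gseq t (k + M)) + jL (Qfac M t k)) ^+ nu t)
    (fun k => (jL (Pfac M t k) * gam t + jL (Qfac M t k)) ^+ nu t).
  apply: (near0_exp a01); apply: (near0_add a01); last exact: (near0_refl a01).
  by apply: (near0_mul a01) => //; exact: (near0_refl a01).
have n2 := near0_prod a01 (r := index_enum (I + J)%type) (fun t _ => n1 t).
have n3 := near0_mul a01 (near0_refl a01 A (small0_mul a01 sR (small0_exp a01 (es * (G - \sum_t nu t)) (rp_small (rp_fall M))))) n2.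
have [_ _ n4] := n3; apply: (small_ext _ n4); exists k0 => k kk; congr (_ - _).
rewrite /punk -{2}(subnK le) mulnDr exprD !rmorphM -rmorphXn.
have -> : \prod_t (jL (Pfac M t k) * jL (gseq t (k + M)) + jL (Qfac M t k)) ^+ nu t =
    jL (fall M k ^+ (es * \sum_t nu t)) * jL (\prod_t gseq t k ^+ nu t).
  rewrite -rmorphM big_distrr /= -prodrXr -big_split rmorph_prod; apply: eq_bigr => t _ /=.
  by rewrite exprM -exprMn gseq_step// rmorphXn rmorphD rmorphM.
by ring.
Qed.

Lemma small_fall_inv M : small 0 (fun k => (jL (fall M k))^-1).
Proof.
have H i := small0_prod a01 (r := index_enum 'I_M) (fun r _ => small_inv_lin i r).
apply: (small_ext _ (small0_prod a01 (r := index_enum I) (fun i _ => H i))); exists 0%N => k _.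
by rewrite /fall rmorph_prod -prodfV; apply: eq_bigr => i _; rewrite /fstep rmorph_prod -prodfV.
Qed.

Lemma small_Yall : small 0 (fun k => jL (Yall k)).
Proof.
have H i : small 0 (fun k => jL (Yseq i k)).
  have [C HC] := nat_bound (absv (jL (b i))); exists C, 0%N => k _; rewrite mul0n expr0 mulr1.
  apply: (@le_trans _ _ (C.+1%:R ^+ k)); last by rewrite ler_weXn2l// ler1n.
  elim: k => [|k IHk]; first by rewrite /Yseq big_geq// rmorph1 absv1.
  case: (leqP k0 k) => kk; last first.
    by rewrite /Yseq big_geq// rmorph1 absv1 exprn_ege1// ler1n.
  rewrite /Yseq big_nat_recr//= rmorphM absvM exprSr ler_pM ?absv_ge0//.
  rewrite rmorphB rmorph1 (le_trans (absvD _ _))// absv1 absvN rmorphM rmorphXn absvM -natr1 addrC lerD//.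
  rewrite (le_trans _ HC)// ler_piMr ?absv_ge0//.
  have -> m : absv (jL a ^+ m) = absv (jL a) ^+ m by elim: m => [|w IHw]; rewrite ?expr0 ?absv1// !exprS absvM IHw.
  by case/andP: a01 => q0 q1; rewrite exprn_ile1// ltW.
apply: (small_ext _ (small0_prod a01 (r := index_enum I) (fun i _ => H i))); exists 0%N => k _.
by rewrite /Yall rmorph_prod.
Qed.

Definition Xval D (x : {ffun J -> 'I_D} * {ffun 'I_n -> 'I_D}) : L * (nat -> nat) :=
  (chi (fun j => x.1 j), lamf (fun i => x.2 i)).
(** Duplicates are removed: the [al j] may be multiplicatively dependent and the shifts of [u]
    linearly dependent, so that different exponents may give the same sequence. *)
Definition Xseq D := undup [seq Xval x | x <- enum {: {ffun J -> 'I_D} * {ffun 'I_n -> 'I_D}}].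

Lemma size_Xseq D : (size (Xseq D) <= D ^ (#|J| + n))%N.
Proof.
rewrite (leq_trans (size_undup _))// size_map -cardT card_prod !card_ffun !card_ord -expnD.
by [].
Qed.

Lemma mem_Xseq D (e : J -> nat) (lam : 'I_n -> nat) : (0 < D)%N -> (forall j, (e j < D)%N) ->
  (forall i, (lam i < D)%N) -> (chi e, lamf lam) \in Xseq D.
Proof.
case: D => // D _ eD lamD; rewrite mem_undup; apply/mapP.
exists ([ffun j => inord (e j)], [ffun i => inord (lam i)]); first by rewrite mem_enum.
rewrite /Xval /=; congr (_, _).
  by apply: eq_bigr => j _; rewrite ffunE inordK.
by apply/funext => k; apply: eq_bigr => i _; rewrite ffunE inordK.
Qed.

Lemma mval_vals k (y : V -> nat) : mval (vals k) y = mval gam (fun t => y (inl (inl t))) *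
  (k%:R ^+ y (inl (inr None)) * jL (chi (fun j => y (inl (inr (Some j))))) ^+ k) *
  jL a ^+ lamf (fun i => y (inr i)) k.
Proof.
rewrite /mval big_sumType /= big_sumType /=; congr (_ * _ * _).
  rewrite (bigD1 None)//=; congr (_ * _).
  rewrite (reindex_omap Some id) /=; last by case.
  rewrite rmorph_prod -prodrXl; apply: eq_big => [j|j _]; first by rewrite eqxx.
  by rewrite rmorphXn -!exprM mulnC.
by rewrite /lamf -prodrXr; apply: eq_bigr => i _; rewrite -exprM mulnC.
Qed.

Lemma small_high A T0 C1 (y : V -> nat) : (0 < C1)%N ->
  (exists k1, forall k, (k1 <= k)%N -> forall i, (u k <= C1 * u (k + i))%N) ->
  (C1 * A <= T0)%N -> (T0 <= \sum_(i < n) y (inr i))%N -> small A (fun k => mval (vals k) y).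
Proof.
move=> C10 [k1 H1] AT Ty.
have sl : small A (fun k => jL a ^+ lamf (fun i => y (inr i)) k).
  apply: small_num => //; exists k1 => k kk; rewrite -(leq_pmul2l C10) mulnA.
  apply: (@leq_trans (\sum_(i < n) y (inr i) * u k)%N).
    by rewrite -big_distrl leq_mul2r (leq_trans AT Ty) orbT.
  by rewrite /lamf big_distrr; apply: leq_sum => i _; rewrite /= mulnCA leq_mul2l H1 ?orbT.
have s0 : small 0 (fun k => mval gam (fun t => y (inl (inl t))) *
  (k%:R ^+ y (inl (inr None)) * jL (chi (fun j => y (inl (inr (Some j))))) ^+ k)).
  apply: (small0_mul a01); first exact: small_const.
  by apply: (small0_mul a01); [apply: small0_exp => //; exact: small_k|exact: small_pow].
apply: (small_ext _ (small0_mul a01 s0 sl)); exists 0%N => k _; by rewrite mval_vals.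
Qed.

Lemma small_combination (U : finType) (nu : U -> I + J -> nat) (d : U -> nat) (e : U -> J -> nat)
    (lam : U -> 'I_n -> nat) (y : U -> L) A G T0 C1 M (s : U -> seq (L * (V -> nat))) :
  (0 < C1)%N -> (exists k1, forall k, (k1 <= k)%N -> forall i, (u k <= C1 * u (k + i))%N) ->
  (C1 * A <= T0)%N ->
  (forall z, small A (fun k => jL (fall M k ^+ (es * G) * punk (nu z) (d z) (e z) (lam z) k) -
     Funk M G (nu z) (d z) (e z) (lam z) k)) ->
  (forall z k, (k0 <= k)%N -> Funk M G (nu z) (d z) (e z) (lam z) k =
     \sum_(x <- s z) jL x.1 * mval (vals k) x.2) ->
  (forall k, \sum_z \sum_(x <- s z | (\sum_(i < n) x.2 (inr i) < T0)%N) jL (y z) * (jL x.1 * mval (vals k) x.2) = 0) ->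
  small A (fun k => jL (\sum_z y z * punk (nu z) (d z) (e z) (lam z) k)).
Proof.
move=> C10 H1 AT sF FE low0.
have s1 : small A (fun k => \sum_z jL (y z) * (jL (fall M k ^+ (es * G) * punk (nu z) (d z) (e z) (lam z) k) -
     Funk M G (nu z) (d z) (e z) (lam z) k)).
  apply: small_sum => // z _; apply: (small0_mul a01); [exact: small_const|exact: sF].
have s2 : small A (fun k => \sum_z \sum_(x <- s z | (T0 <= \sum_(i < n) x.2 (inr i))%N) jL (y z) * (jL x.1 * mval (vals k) x.2)).
  apply: small_sum => // z _.
  have H : forall x, x \in [seq x <- s z | (T0 <= \sum_(i < n) x.2 (inr i))%N] ->
      small A (fun k => jL (y z) * (jL x.1 * mval (vals k) x.2)).
    move=> x; rewrite mem_filter => /andP[Tx _].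
    apply: (small0_mul a01); first exact: small_const.
    apply: (small0_mul a01); first exact: small_const.
    exact: small_high C10 H1 AT Tx.
  apply: (small_ext _ (small_sum a01 H)); exists 0%N => k _; by rewrite big_filter.
have s3 : small A (fun k => jL (fall M k) ^+ (es * G) * jL (\sum_z y z * punk (nu z) (d z) (e z) (lam z) k)).
  apply: (small_ext _ (small_add a01 s1 s2)); exists k0 => k kk.
  rewrite [in RHS]rmorph_sum [RHS]mulr_sumr -[X in _ + X]addr0 -[in X in _ + (_ + X)](low0 k).
  rewrite -[X in _ + X]big_split -[LHS]big_split; apply: eq_bigr => z _ /=.
  rewrite mulrBr (FE z k kk) mulr_sumr (bigID (fun x => (\sum_(i < n) x.2 (inr i) < T0)%N)) /=.
  rewrite [X in _ - (_ + X)](eq_bigl (fun x => (T0 <= \sum_(i < n) x.2 (inr i))%N)); last by move=> x; rewrite -leqNgt.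
  by rewrite !rmorphM rmorphXn; ring.
apply: (small_ext _ (small0_mul a01 (small0_exp a01 (es * G) (small_fall_inv M)) s3)); exists k0 => k kk.
by rewrite exprVn mulrA mulVf ?mul1r// expf_neq0// fmorph_eq0 fall_neq0.
Qed.

(* Siegel-type construction: there are more unknowns than low-order coefficients. *)
Lemma auxiliary_function D' N C T0 c2 (spn : spanned jL (C * D'.+1 ^ N) (fun x : {ffun I + J -> 'I_D'.+1} => mval gam (fun t => x t)))
    (U : finType) (nu : U -> I + J -> nat) (d : U -> nat) (e : U -> J -> nat)
    (lam : U -> 'I_n -> nat) (s : U -> seq (L * (V -> nat))) (Dk : nat) :
  (forall z x, x \in s z -> [/\ forall t, (x.2 (inl (inl t)) < D'.+1)%N, (x.2 (inl (inr None)) < Dk)%N &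
     forall j, (x.2 (inl (inr (Some j))) < c2)%N]) -> (T0 <= c2)%N -> (0 < c2)%N ->
  (C * D'.+1 ^ N * Dk * size (Xseq c2) < #|U|)%N ->
  exists y : U -> L, (exists z, y z != 0) /\ forall k,
    \sum_z \sum_(x <- s z | (\sum_(i < n) x.2 (inr i) < T0)%N) jL (y z) * (jL x.1 * mval (vals k) x.2) = 0.
Proof.
move=> sP Tc c20 EU; have [Bv [Ev HE]] := spn.
pose cvt (y : V -> nat) : {ffun I + J -> 'I_D'.+1} := [ffun t => inord (y (inl (inl t)))].
pose low (y : V -> nat) := (\sum_(i < n) y (inr i) < T0)%N.
pose yx (y : V -> nat) : L * (nat -> nat) := (chi (fun j => y (inl (inr (Some j)))), lamf (fun i => y (inr i))).
pose E := ('I_(C * D'.+1 ^ N) * 'I_Dk * 'I_(size (Xseq c2)))%type.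
pose nx (i : nat) := nth (0, fun=> 0%N) (Xseq c2) i.
pose match_ (y : V -> nat) (f : E) := (y (inl (inr None)) == f.1.2) && (yx y == nx f.2).
pose Mx z (f : E) := \sum_(x <- s z | low x.2 && match_ x.2 f) x.1 * Ev (cvt x.2) f.1.1.
have [|y [yn0 yM]] := @kernel_vector L U E Mx; first by rewrite !card_prod !card_ord.
exists y; split=> // k.
pose mono (f : E) := Bv f.1.1 * (k%:R ^+ f.1.2 * jL (nx f.2).1 ^+ k) * jL a ^+ (nx f.2).2 k.
transitivity (\sum_f jL (\sum_z y z * Mx z f) * mono f); last first.
  by rewrite big1// => f _; rewrite yM rmorph0 mul0r.
under [RHS]eq_bigr => f _ do rewrite rmorph_sum mulr_suml.
rewrite [RHS]exchange_big; apply: eq_bigr => z _ /=.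
under [RHS]eq_bigr => f _ do rewrite rmorphM /Mx rmorph_sum mulr_sumr mulr_suml.
rewrite (exchange_big_dep (fun x => low x.2)) /=; last by move=> f x _ /andP[].
rewrite big_seq_cond [RHS]big_seq_cond; apply: eq_bigr => x /andP[xs lx].
have [xt xk xc] := sP z x xs.
have yxX : yx x.2 \in Xseq c2.
  apply: mem_Xseq => // i; rewrite (leq_trans _ Tc)// (leq_ltn_trans _ lx)//.
  by rewrite (bigD1 i)//= leq_addr.
pose x0 : 'I_(size (Xseq c2)) := Ordinal (etrans (index_mem _ _) yxX).
pose d1 : 'I_Dk := Ordinal xk.
have nx0 : nx x0 = yx x.2 by rewrite /nx /= nth_index.
have mE f : match_ x.2 f = (f.1.2 == d1) && (f.2 == x0).
  rewrite /match_ eq_sym; congr (_ && _); rewrite -nx0 /nx nth_uniq ?ltn_ord ?undup_uniq//.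
  by rewrite eq_sym.
rewrite (eq_bigl (fun f => (f.1.2 == d1) && (f.2 == x0))); last by move=> f; rewrite /low lx mE.
rewrite (reindex_onto (fun i => (i, d1, x0)) (fun f => f.1.1)) /=; last first.
  by case=> [[i d2] x2] /= /andP[/eqP-> /eqP->].
rewrite (eq_bigl xpredT); last by move=> i; rewrite !eqxx.
rewrite mval_vals /mono /= nx0 /=.
have -> : mval gam (fun t => x.2 (inl (inl t))) = \sum_i jL (Ev (cvt x.2) i) * Bv i.
  by rewrite -HE; apply: eq_bigr => t _; rewrite ffunE inordK.
rewrite !mulr_suml !mulr_sumr; apply: eq_bigr => i _; rewrite rmorphM.
ring.
Qed.

(* A polynomial that vanishes to high order in the [gam t] gives small values of
   the same polynomial in the [gseq t k]; by Liouville's inequality these values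
   vanish for large [k], against the independence of the sequences. *)
Theorem mahler : (0 < #|{: I + J}|)%N -> ~ grows jL gam #|{: I + J}|.-1.
Proof.
move=> N0 [Cg HCg]; set N := #|{: I + J}| in N0 HCg.
have [v Kv'] := Kv.
pose lst := a :: [seq b i | i <- enum I] ++ [seq al j | j <- enum J].
have [delta d0 Hd] := common_delta lst.
have /choice[Bf HBf] z : exists B, z \in lst -> bd delta B z.
  case: (boolP (z \in lst)) => [/Hd/(bd_integral d0)[B HB]|_]; last by exists 0%N.
  by exists B.
pose B0 := (Bf a + \sum_i Bf (b i) + \sum_j Bf (al j))%N.
have Ba : bd delta B0 a.
  by apply: (bd_mono d0 _ (HBf a (mem_head _ _))); rewrite /B0 -addnA leq_addr.
have Bb i : bd delta B0 (b i).
  have bl : b i \in lst by rewrite inE mem_cat map_f ?mem_enum ?orbT.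
  apply: (bd_mono d0 _ (HBf _ bl)); rewrite /B0 (bigD1 i)//=; lia.
have Bal j : bd delta B0 (al j).
  have bl : al j \in lst by rewrite inE mem_cat [X in _ || (_ || X)]map_f ?mem_enum ?orbT.
  apply: (bd_mono d0 _ (HBf _ bl)); rewrite /B0 [X in (_ + X)%N](bigD1 j)//=; lia.
have [m Hm] := BD_Zunk d0 Ba Bb Bal.
have [C HC] := liouville Kv' jL d0.
have [q0 q1] := andP a01; set q := absv (jL a) in q0 q1.
(* [kap] is the order of smallness per unit of [D]: q^kap outweighs the constant of Liouville's
   inequality raised to the height [m]. *)
have [kap Hkap] := geo_small (C.+1%:R ^+ m) a01 q0.
have [C1 [k1 H1]] := growth_upper n_ge2 cn0 u_rec u_neq0 Drs rs1 nd.
have C10 : (0 < C1)%N.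
  have [_ uk Hu] := H1 k1 (leqnn _); have := Hu 0%N k1 (leq_addr _ _).
  by case: (C1) => // /(leq_trans uk).
have H1' : exists k1, forall k, (k1 <= k)%N -> forall i, (u k <= C1 * u (k + i))%N.
  exists k1 => k kk i; have [_ _ Hu] := H1 (k + i)%N (leq_trans kk (leq_addr _ _)).
  by have := Hu 0%N k; rewrite expn1; apply; rewrite addn0 leq_addr.
(* Monomials of total degree at least T0 D in the a^(u(k+i)) are small of order kap D. The degree in
   k stays below c1 D and the degrees in the alpha^k below 2 D; c2 + 1 = T0 + 2 covers both T0 D and
   2 D. *)
pose T0 := (C1 * kap)%N; pose c1 := (1 + \sum_j ll j)%N; pose c2 := T0.+1.
pose h := (#|J| + n)%N.
have NX0 D : (0 < D)%N -> (0 < size (Xseq D))%N.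
  move=> D0; have := @mem_Xseq D (fun=> 0%N) (fun=> 0%N) D0 (fun=> D0) (fun=> D0).
  by case: (Xseq D).
(* The threshold for [D] makes the factor D gained from the dependence exceed all constants in the
   number of equations. *)
have [D] := @polynomial_growth_scale (fun D => size (Xseq D)) h c2 (Cg * c1 * c2.+1 ^ h.+1).+1 (ltn0Sn _) NX0 size_Xseq.
case: D => [//|D'] D0 HD; set D := D'.+1 in D0 HD.
pose U := ({ffun I + J -> 'I_D} * 'I_D * 'I_(size (Xseq D)))%type.
have /choice[xe xP] (x : 'I_(size (Xseq D))) : exists z : {ffun J -> 'I_D} * {ffun 'I_n -> 'I_D}, Xval z = nth (0, fun=> 0%N) (Xseq D) x.
  by have := mem_nth (0, fun=> 0%N) (ltn_ord x); rewrite mem_undup => /mapP[z _ ->]; exists z.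
pose nu (z : U) (t : I + J) : nat := z.1.1 t; pose d (z : U) : nat := z.1.2.
pose e (z : U) (j : J) : nat := (xe z.2).1 j; pose lam (z : U) (i : 'I_n) : nat := (xe z.2).2 i.
pose G := (N * D)%N; pose A := (kap * D)%N.
have nuG z : (\sum_t nu z t <= G)%N.
  by rewrite /G /N -sum_nat_const; apply: leq_sum => t _; exact: (ltnW (ltn_ord (z.1.1 t))).
have /choice[M0 HM0] z := near_Funk A G (nu z) (d z) (e z) (lam z).
pose M := (\sum_z M0 z)%N.
have sF z : small A (fun k => jL (fall M k ^+ (es * G) * punk (nu z) (d z) (e z) (lam z) k) -
     Funk M G (nu z) (d z) (e z) (lam z) k).
  by apply: HM0 => //; rewrite /M (bigD1 z)//= leq_addr.
have /choice[s sP] z := rp_Funk M G (nu z) (d z) (e z) (lam z).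
have [||||y [[z0 yz0] y_low]] := @auxiliary_function D' N.-1 Cg (T0 * D) (c2.+1 * D) (HCg D') U nu d e lam s (c1 * D).
- move=> z x /(proj1 (sP z)) xw; split.
  + by move=> t; apply: leq_ltn_trans (xw (inl t)) _ => /=; exact: ltn_ord.
  + apply: leq_ltn_trans (xw (inr None)) _ => /=; rewrite /c1 mulnDl mul1n -addSn leq_add//.
      exact: ltn_ord.
    by rewrite big_distrl; apply: leq_sum => j _; rewrite mulnC leq_mul2l /nu ltnW ?orbT.
  + move=> j; apply: leq_ltn_trans (xw (inr (Some j))) _ => /=.
    rewrite /c2 !mulSn; have : (e z j < D)%N by exact: ltn_ord.
    have : (nu z (inr j) < D)%N by exact: ltn_ord.
    by move: (T0 * D)%N (e z j) (nu z (inr j)); clear; lia.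
- by rewrite leq_mul2r /c2 ltnW ?orbT// ltnW.
- by [].
- rewrite !card_prod card_ffun !card_ord -/N.
  have -> : (D ^ N * D * size (Xseq D) = D ^ N.-1 * D * (D * size (Xseq D)))%N.
    by rewrite -{1}(prednK N0) expnSr; ring.
  apply: (@leq_ltn_trans (D ^ N.-1 * D * (Cg * c1 * c2.+1 ^ h.+1 * size (Xseq D)))%N).
    have -> : (Cg * D ^ N.-1 * (c1 * D) * size (Xseq (c2.+1 * D)) =
        D ^ N.-1 * D * (Cg * c1 * size (Xseq (c2.+1 * D))))%N by ring.
    by rewrite leq_mul2l -[X in (_ <= X)%N]mulnA leq_mul2l HD !orbT.
  by rewrite ltn_pmul2l ?muln_gt0 ?expn_gt0// ltn_pmul2r ?NX0.
(* A common denominator makes the solution integral, so that it has a height not depending on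
   [k]. *)
have [del' del'0 Hdel'] := common_delta [seq y z | z <- enum {: U}].
pose yy z := del'%:R * y z.
have yy_low k : \sum_z \sum_(x <- s z | (\sum_(i < n) x.2 (inr i) < T0 * D)%N)
    jL (yy z) * (jL x.1 * mval (vals k) x.2) = 0.
  transitivity (jL del'%:R * \sum_z \sum_(x <- s z | (\sum_(i < n) x.2 (inr i) < T0 * D)%N)
    jL (y z) * (jL x.1 * mval (vals k) x.2)); last by rewrite y_low mulr0.
  rewrite mulr_sumr; apply: eq_bigr => z _; rewrite mulr_sumr; apply: eq_bigr => x _.
  by rewrite /yy [in LHS]rmorphM -mulrA.
have /choice[By HBy] z : exists B, bd delta B (yy z).
  apply: (bd_integral d0) => i k; rewrite mxE rpredM ?rpred_nat//.
  have /Hdel' : y z \in [seq y z | z <- enum {: U}] by rewrite map_f ?mem_enum.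
  by rewrite -rmxZ scaler_nat -mulr_natl => /(_ i k).
pose p k := \sum_z yy z * punk (nu z) (d z) (e z) (lam z) k.
have sp : small A (fun k => jL (p k)).
  apply: (small_combination C10 H1' (T0 := (T0 * D)%N)) sF _ yy_low; first by rewrite /A /T0 mulnA.
  by move=> z; exact: (proj2 (sP z)).
have pn0 k2 : exists2 k, (k2 <= k)%N & p k != 0.
  apply: contrapT => H; move/eqP: yz0; apply.
  have yyz0 : yy z0 = 0.
    apply: (@nonvanishing U nu d e lam yy); last first.
      exists k2 => k kk; apply/eqP; apply: contrapT => /negP pk; apply: H; by exists k.
    move=> [[f1 d1] x1] [[f2 d2] x2]; rewrite /nu /d /e /lam /= => h1 h2 h3 h4.
    have -> : f1 = f2 by apply/ffunP => t; apply: val_inj; exact: h1.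
    have -> : d1 = d2 by apply: val_inj.
    have xx : nth (0, fun=> 0%N) (Xseq D) x1 = nth (0, fun=> 0%N) (Xseq D) x2.
      by rewrite -!xP /Xval h3 h4.
    have uX : uniq (Xseq D) by exact: undup_uniq.
    have := nth_uniq (0, fun=> 0%N) (ltn_ord x1) (ltn_ord x2) uX.
    by rewrite xx eqxx => /esym/eqP x12; congr (_, _); apply: val_inj.
  move/eqP: yyz0; rewrite mulf_eq0 => /orP[/eqP dl|/eqP//].
  have : (del'%:R : algC) != 0 by rewrite pnatr_eq0 -lt0n.
  by rewrite -(rmorph_nat QsC) dl rmorph0 eqxx.
have sZ : small A (fun k => jL (Yall k ^+ (es * G) * p k)).
  apply: (small_ext _ (small0_mul a01 (small0_exp a01 (es * G) small_Yall) sp)); exists 0%N => k _.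
  by rewrite rmorphM rmorphXn.
have [C3 [k3 H3]] := sZ.
have /choice[kz Hkz] z : exists kz, forall k, (kz <= k)%N -> bd delta (m * D * u k) (Zunk G (nu z) (d z) (e z) (lam z) k).
  by apply: Hm => // *; exact: ltn_ord.
pose NU := #|{: U}|; pose BY := (\sum_z By z)%N.
have bZ k : (\sum_z kz z <= k)%N -> bd delta (BY + m * D * u k + NU) (Yall k ^+ (es * G) * p k).
  move=> kk; rewrite /p mulr_sumr; have -> : NU = size (index_enum {: U}) by rewrite /NU cardT enumT.
  apply: (bd_sum d0) => [|z _]; first exact: bd_0.
  rewrite mulrCA -ZunkE//; apply: bd_mul.
    by apply: (bd_mono d0 _ (HBy z)); rewrite /BY (bigD1 z)//= leq_addr.
  by apply: Hkz; apply: leq_trans kk; rewrite (bigD1 z)//= leq_addr.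
pose X := C.+1%:R ^+ (BY + NU + 1) * C3.+1%:R : R.
have h2 : 0 < 2^-1 :> R by rewrite invr_gt0 ltr0n.
have [m2 Hm2] := geo_small X a01 h2.
have [k4 H4] := growth_superlinear n_ge2 cn0 u_rec u_neq0 Drs rs1 nd (2 * m2).
have [k kk pk] := pn0 (k3 + k4 + \sum_z kz z + 1)%N.
have um2 : (m2 * k.+1 <= u k)%N.
  have k4k : (k4 <= k)%N by lia.
  apply: leq_trans (H4 k k4k); rewrite [(2 * m2)%N]mulnC -mulnA leq_mul2l; apply/orP; right; clear - kk; lia.
have k3k : (k3 <= k)%N by lia.
have kzk : (\sum_z kz z <= k)%N by lia.
have Zn0 : Yall k ^+ (es * G) * p k != 0 by rewrite mulf_neq0// expf_neq0// Yall_neq0.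
have := HC _ _ (bZ k kzk) Zn0; apply/negP; rewrite -ltNge.
apply: (@le_lt_trans _ _ (C.+1%:R ^+ (BY + NU + m * D * u k).+1 * (C3.+1%:R ^+ k.+1 * q ^+ (kap * D * u k)))).
  apply: ler_pM; [by apply: exprn_ge0; rewrite ler0n|exact: absv_ge0| |exact: H3].
  by rewrite addnAC lerXn2r ?nnegrE ?ler0n// ler_nat.
by apply: (final_estimate (m2 := m2)) => //; rewrite ?ler1n ?ler0n.
Qed.

End Main.

End MahlerSetup.

(** * Limits and derivatives *)

Section Limits.
Variables (R : realType) (K : valuedFieldType R).
Implicit Types (s t : nat -> K) (l : K).

Definition tends s l := forall e : R, 0 < e -> exists N, forall k, (N <= k)%N -> absv (s k - l) < e.

Lemma tends_lim s l : tends s l -> lim (s @ \oo) = l.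
Proof.
move=> H; apply: cvg_lim; first exact: metric_hausdorff.
apply/cvg_ballP => e e0; have [N HN] := H e e0.
exists N => // k /= Nk; rewrite /ball /= /absv_dist -absvN opprB.
exact: HN.
Qed.

Lemma tends_ext s t l : (exists k1, forall k, (k1 <= k)%N -> s k = t k) -> tends s l -> tends t l.
Proof.
move=> [k1 st] H e /H[N HN]; exists (maxn N k1) => k; rewrite geq_max => /andP[Nk kk].
by rewrite -st// HN.
Qed.

Lemma tends_const l : tends (fun=> l) l.
Proof. by move=> e e0; exists 0%N => k _; rewrite subrr absv0. Qed.

Lemma tends_add s t l m : tends s l -> tends t m -> tends (fun k => s k + t k) (l + m).
Proof.
move=> H H' e e0; have e2 : 0 < e / 2 by rewrite divr_gt0 ?ltr0n.
have [N HN] := H _ e2; have [N' HN'] := H' _ e2; exists (maxn N N') => k; rewrite geq_max => /andP[Nk N'k].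
have -> : s k + t k - (l + m) = (s k - l) + (t k - m) by ring.
rewrite (le_lt_trans (absvD _ _))// [ltRHS](splitr e) ltrD ?HN ?HN'//.
Qed.

Lemma tends_scale z s l : tends s l -> tends (fun k => z * s k) (z * l).
Proof.
move=> H e e0; have d0 : 0 < absv z + 1 by rewrite ltr_wpDl ?absv_ge0.
have [N HN] := H _ (divr_gt0 e0 d0); exists N => k /HN; rewrite ltr_pdivlMr// => h.
rewrite -mulrBr absvM; apply: le_lt_trans h.
by rewrite mulrC ler_wpM2l ?absv_ge0// lerDl ler01.
Qed.

Lemma tends_bounded s l : tends s l -> exists B : R, exists N, forall k, (N <= k)%N -> absv (s k) <= B.
Proof.
move=> /(_ _ ltr01)[N HN]; exists (1 + absv l), N => k /HN h.
have -> : s k = (s k - l) + l by ring.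
by rewrite (le_trans (absvD _ _))// lerD// ltW.
Qed.

Lemma tends_mul s t l m : tends s l -> tends t m -> tends (fun k => s k * t k) (l * m).
Proof.
move=> H H'; have [B [N HB]] := tends_bounded H.
have d0 : 0 < `|B| + 1 by rewrite ltr_wpDl.
have H1 : tends (fun k => s k * (t k - m)) 0.
  move=> e e0; have [N' HN'] := H' _ (divr_gt0 e0 d0).
  exists (maxn N N') => k; rewrite geq_max => /andP[/HB Bk /HN'].
  rewrite subr0 absvM ltr_pdivlMr// => h; apply: le_lt_trans h.
  by rewrite mulrC ler_wpM2l ?absv_ge0// (le_trans Bk)// (le_trans (ler_norm B))// lerDl ler01.
have := tends_add H1 (tends_scale m H).
by rewrite add0r mulrC; apply: tends_ext; exists 0%N => k _; ring.
Qed.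

Lemma tends_le s l (B : R) : tends s l -> (exists k1, forall k, (k1 <= k)%N -> absv (s k) <= B) -> absv l <= B.
Proof.
move=> H [k1 HB]; rewrite leNgt; apply/negP => Bl.
have Bl' : 0 < absv l - B by rewrite subr_gt0.
have [N HN] := H _ Bl'.
have h1 := HN (maxn N k1) (leq_maxl _ _); have h2 := HB (maxn N k1) (leq_maxr _ _).
have h3 : absv l <= absv (s (maxn N k1) - l) + absv (s (maxn N k1)).
  by rewrite -[absv (_ - l)]absvN opprB; have := absvD (l - s (maxn N k1)) (s (maxn N k1)); rewrite subrK.
move: h1 h2 h3; lra.
Qed.

Lemma tends_unique s l m : tends s l -> tends s m -> l = m.
Proof. by move=> /tends_lim <- /tends_lim <-. Qed.

Lemma tends_sum (T : eqType) (r : seq T) (F : T -> nat -> K) (f : T -> K) :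
  (forall i, i \in r -> tends (F i) (f i)) -> tends (fun k => \sum_(i <- r) F i k) (\sum_(i <- r) f i).
Proof.
elim: r => [|i r IHr] H.
  by rewrite big_nil; apply: (tends_ext _ (tends_const 0)); exists 0%N => k _; rewrite big_nil.
rewrite big_cons.
have := tends_add (H i (mem_head _ _)) (IHr (fun x xr => H x (mem_behead (s := i :: r) xr))).
by apply: tends_ext; exists 0%N => k _; rewrite big_cons.
Qed.

Hypothesis complete : forall F : set_system K, ProperFilter F -> cauchy F -> cvg F.

Lemma cauchy_tends s : (forall e : R, 0 < e -> exists N, forall k r, (N <= k)%N -> (N <= r)%N ->
  absv (s k - s r) < e) -> exists l, tends s l.
Proof.
move=> H; have cF : cauchy (s @ \oo).
  apply/cauchy_ballP => e e0; have [N HN] := H _ e0.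
  exists (s @` [set k | (N <= k)%N], s @` [set k | (N <= k)%N]) => /=.
    by split; exists N => // k Nk; exists k.
  move=> [x y] /= [[k Nk <-] [r Nr <-]]; rewrite /ball /= /absv_dist; exact: HN.
pose l : K := lim (s @ \oo); have sl : s @ \oo --> l by apply: complete.
exists l => e e0; have /cvg_ballP/(_ e e0)[N _ HN] := sl.
by exists N => k /HN; rewrite /ball /= /absv_dist -absvN opprB.
Qed.

Lemma fast_tends s (C : R) k0 : (forall k, (k0 <= k)%N -> absv (s k.+1 - s k) <= C / 2 ^+ k) ->
  exists2 l, tends s l & forall k, (k0 <= k)%N -> absv (s k - l) <= C * 2 / 2 ^+ k.
Proof.
move=> H; have p2 k : 0 < 2 ^+ k :> R by rewrite exprn_gt0 ?ltr0n.
have C0 : 0 <= C.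
  have := le_trans (absv_ge0 _) (H k0 (leqnn _)).
  by rewrite pmulr_lge0 ?invr_gt0.
have T k j : (k0 <= k)%N -> absv (s (k + j)%N - s k) <= C * 2 / 2 ^+ k - C * 2 / 2 ^+ (k + j).
  move=> kk; elim: j => [|j IHj]; first by rewrite addn0 !subrr absv0.
  have -> : s (k + j.+1)%N - s k = (s (k + j).+1 - s (k + j)%N) + (s (k + j)%N - s k) by rewrite addnS; ring.
  rewrite (le_trans (absvD _ _))// (le_trans (lerD (H _ (leq_trans kk (leq_addr _ _))) IHj))//.
  rewrite addnS exprS invfM; move: (2 ^+ (k + j))^-1 => w.
  by rewrite le_eqVlt; apply/orP; left; apply/eqP; field.
have T' k r : (k0 <= k)%N -> (k <= r)%N -> absv (s r - s k) <= C * 2 / 2 ^+ k.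
  move=> kk kr; rewrite -(subnKC kr) (le_trans (T _ _ kk))// lerBlDr lerDl.
  exact: divr_ge0 (mulr_ge0 C0 (ler0n _ 2)) (ltW (p2 _)).
have small (e : R) : 0 < e -> exists2 N, (k0 <= N)%N & C * 2 / 2 ^+ N < e.
  move=> e0; have h01 : 0 < (2^-1 : R) < 1 by rewrite invr_gt0 ltr0n invf_lt1 ?ltr1n ?ltr0n.
  have [m Hm] := geo_small (C * 2) h01 (divr_gt0 e0 (ltr0Sn _ 1)).
  exists (maxn m k0); first exact: leq_maxr.
  have : C * 2 / 2 ^+ maxn m k0 <= e / 2.
    apply: le_trans Hm; rewrite exprVn ler_wpM2l ?mulr_ge0//.
    by rewrite lef_pV2 ?posrE// ler_eXn2l ?ltr1n// leq_maxl.
  by move/le_lt_trans; apply; rewrite ltr_pdivrMr ?ltr0n// mulr_natr mulr2n ltrDl.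
have [|l tl] := @cauchy_tends s.
  move=> e e0; have [N kN HN] := small _ (divr_gt0 e0 (ltr0Sn _ 1)); exists N => k r Nk Nr.
  have -> : s k - s r = (s k - s N) + - (s r - s N) by ring.
  rewrite (le_lt_trans (absvD _ _))// absvN [ltRHS](splitr e) ltrD// (le_lt_trans _ HN)//; exact: T'.
exists l => // k kk; rewrite -absvN opprB.
have := tends_add tl (tends_const (- s k)).
by move/tends_le; apply; exists k => r kr; apply: T'.
Qed.

(** A norm on polynomials that bounds the values on the disc of radius [rho] and is handled by
    Horner's scheme uniformly for all absolute values. *)
Definition pn (rho : R) (Q : {poly K}) : R := \sum_(i < size Q) absv Q`_i * rho ^+ i.

Implicit Types P Q : {poly K}.

Section Norm.
Variable rho : R.
Hypothesis rho0 : 0 <= rho.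

Lemma pnE Q N : (size Q <= N)%N -> pn rho Q = \sum_(i < N) absv Q`_i * rho ^+ i.
Proof.
move=> QN; rewrite /pn (big_ord_widen N (fun i => absv Q`_i * rho ^+ i) QN) big_mkcond.
by apply: eq_bigr => i _; case: ifP => // /negbT; rewrite -leqNgt => /leq_sizeP->//; rewrite absv0 mul0r.
Qed.

Lemma pn_ge0 Q : 0 <= pn rho Q.
Proof. by apply: sumr_ge0 => i _; rewrite mulr_ge0 ?absv_ge0 ?exprn_ge0. Qed.

Lemma pnD P Q : pn rho (P + Q) <= pn rho P + pn rho Q.
Proof.
pose N := maxn (size P) (size Q).
rewrite (@pnE (P + Q) N) ?size_polyD// (@pnE P N) ?leq_maxl// (@pnE Q N) ?leq_maxr//.
rewrite -big_split; apply: ler_sum => i _ /=; rewrite coefD -mulrDl ler_wpM2r ?exprn_ge0//; exact: absvD.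
Qed.

Lemma pnZ c Q : pn rho (c *: Q) = absv c * pn rho Q.
Proof.
rewrite (@pnE (c *: Q) (size Q)) ?size_scale_leq// /pn mulr_sumr.
by apply: eq_bigr => i _; rewrite coefZ absvM mulrA.
Qed.

Lemma pn0 : pn rho 0 = 0. Proof. by rewrite /pn size_poly0 big_ord0. Qed.

Lemma pnN Q : pn rho (- Q) = pn rho Q.
Proof. by rewrite -scaleN1r pnZ absvN absv1 mul1r. Qed.

Lemma pn_sum (T : Type) (r : seq T) (P : pred T) (F : T -> {poly K}) :
  pn rho (\sum_(i <- r | P i) F i) <= \sum_(i <- r | P i) pn rho (F i).
Proof.
elim/big_ind2: _ => [|x x' y y' h h'|//]; first by rewrite pn0.
by rewrite (le_trans (pnD _ _))// lerD.
Qed.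

Lemma pnMXaddC Q c : pn rho (Q * 'X + c%:P) = pn rho Q * rho + absv c.
Proof.
rewrite (@pnE _ (size Q).+1); last first.
  by rewrite (leq_trans (size_polyD _ _))// geq_max size_polyC (leq_trans (size_polyMleq _ _))// ?size_polyX ?addn2//; case: eqP.
rewrite big_ord_recl /= expr0 mulr1 coefD coefMX coefC eqxx add0r addrC; congr (_ + _).
rewrite /pn mulr_suml; apply: eq_bigr => i _; rewrite coefD coefMX coefC /= addr0 exprSr mulrA.
by [].
Qed.

Lemma pnMX Q : pn rho (Q * 'X) = pn rho Q * rho.
Proof. by have := pnMXaddC Q 0; rewrite addr0 absv0 addr0. Qed.

Lemma pn1 : pn rho 1 = 1.
Proof. by rewrite /pn size_poly1 big_ord1 coefC absv1 expr0 mulr1. Qed.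

Lemma pn_lin x Q : pn rho ((1 - x *: 'X) * Q) <= (1 + absv x * rho) * pn rho Q.
Proof.
have -> : (1 - x *: 'X) * Q = Q + - (x *: (Q * 'X)) by rewrite mulrBl mul1r -scalerAl [Q * _]mulrC.
by rewrite (le_trans (pnD _ _))// pnN pnZ pnMX mulrDl mul1r [pn rho Q * rho]mulrC mulrA.
Qed.

Lemma pn_eval Q x : absv x <= rho -> absv Q.[x] <= pn rho Q.
Proof.
move=> xr; elim/poly_ind: Q => [|Q c IHQ]; first by rewrite horner0 absv0 pn0.
rewrite hornerMXaddC pnMXaddC (le_trans (absvD _ _))// lerD// absvM.
by rewrite ler_pM ?absv_ge0.
Qed.

Lemma pn_lip Q x h : absv x + 1 <= rho -> absv h <= 1 -> absv (Q.[x + h] - Q.[x]) <= absv h * pn rho Q.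
Proof.
move=> xr h1; have xhr : absv (x + h) <= rho by rewrite (le_trans (absvD _ _))// (le_trans _ xr)// lerD2l.
elim/poly_ind: Q => [|Q c IHQ]; first by rewrite !horner0 subrr absv0 pn0 mulr0.
rewrite !hornerMXaddC pnMXaddC.
have -> : Q.[x + h] * (x + h) + c - (Q.[x] * x + c) = x * (Q.[x + h] - Q.[x]) + h * Q.[x + h] by ring.
rewrite (le_trans (absvD _ _))// !absvM mulrDr.
have e1 := pn_eval Q xhr; have p0 := pn_ge0 Q; have a0 := absv_ge0 x; have b0 := absv_ge0 h; have c0 := absv_ge0 c.
apply: (@le_trans _ _ (absv x * (absv h * pn rho Q) + absv h * pn rho Q)).
  by rewrite lerD ?ler_wpM2l.
apply: (@le_trans _ _ (absv h * (pn rho Q * rho))); last by rewrite lerDl mulr_ge0.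
have : absv h * pn rho Q * (absv x + 1) <= absv h * pn rho Q * rho by rewrite ler_wpM2l// mulr_ge0.
by rewrite mulrDr mulr1 [absv x * _]mulrC mulrA.
Qed.

Lemma pn_taylor Q x h : absv x + 1 <= rho -> absv h <= 1 ->
  absv (Q.[x + h] - Q.[x] - h * Q^`().[x]) <= absv h ^+ 2 * pn rho Q.
Proof.
move=> xr h1; elim/poly_ind: Q => [|Q c IHQ].
  by rewrite deriv0 !horner0 mulr0 !subrr absv0 pn0 mulr0.
rewrite derivD derivC addr0 derivM derivX mulr1 !hornerE pnMXaddC.
set q' := Q^`().[x] in IHQ *.
have -> : Q.[x + h] * (x + h) + c - (Q.[x] * x + c) - h * (q' * x + Q.[x]) =
   x * (Q.[x + h] - Q.[x] - h * q') + h * (Q.[x + h] - Q.[x]) by ring.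
rewrite (le_trans (absvD _ _))// !absvM mulrDr.
have l1 := pn_lip Q xr h1; have p0 := pn_ge0 Q; have a0 := absv_ge0 x; have b0 := absv_ge0 h; have c0 := absv_ge0 c.
apply: (@le_trans _ _ (absv x * (absv h ^+ 2 * pn rho Q) + absv h * (absv h * pn rho Q))).
  by rewrite lerD ?ler_wpM2l.
apply: (@le_trans _ _ (absv h ^+ 2 * (pn rho Q * rho))); last by rewrite lerDl mulr_ge0 ?exprn_ge0.
have : absv h ^+ 2 * pn rho Q * (absv x + 1) <= absv h ^+ 2 * pn rho Q * rho.
  by rewrite ler_wpM2l// mulr_ge0 ?exprn_ge0.
by move: (pn rho Q) (absv x) (absv h) => z1 z2 z3; nra.
Qed.

End Norm.

Lemma pn_mono rho rho' Q : 0 <= rho <= rho' -> pn rho Q <= pn rho' Q.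
Proof.
move=> /andP[r0 rr]; apply: ler_sum => i _; rewrite ler_wpM2l ?absv_ge0//.
by rewrite lerXn2r// nnegrE (le_trans r0).
Qed.

Lemma pn_deriv rho Q : 0 <= rho -> pn rho Q^`() <= pn (rho + 1) Q.
Proof.
move=> r0; have r1 : 0 <= rho + 1 by rewrite addr_ge0.
elim/poly_ind: Q => [|Q c IHQ]; first by rewrite deriv0 !pn0.
rewrite derivD derivC addr0 derivM derivX mulr1 pnMXaddC// (le_trans (pnD _ _ _))// pnMX//.
rewrite mulrDr mulr1; apply: (@le_trans _ _ (pn (rho + 1) Q * rho + pn (rho + 1) Q)).
  rewrite lerD//; first by rewrite ler_wpM2r.
  by apply: pn_mono; rewrite r0 lerDl ler01.
by rewrite lerDl absv_ge0.
Qed.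

Lemma pn_derivn rho Q m : 0 <= rho -> pn rho Q^`(m) <= pn (rho + m%:R) Q.
Proof.
elim: m rho => [|m IHm] rho r0; first by rewrite derivn0 addr0.
rewrite derivnS (le_trans (pn_deriv _ r0))// (le_trans (IHm _ _))//; first by rewrite addr_ge0.
by rewrite -addrA nat1r.
Qed.

Lemma derivn_eval (Q : {poly K}) m b : absv Q^`(m).[b] <= pn (absv b + m%:R) Q.
Proof. by rewrite (le_trans (pn_eval _ (lexx _)))// ?absv_ge0// pn_derivn ?absv_ge0. Qed.

(** Convergence is rapid in every norm, so the pointwise limit may be differentiated through the
    polynomials. *)
Definition fast (Q : nat -> {poly K}) := forall rho : R, 0 <= rho ->
  exists C, forall k, pn rho (Q k.+1 - Q k) <= C / 2 ^+ k.

Definition flim (Q : nat -> {poly K}) x : K := lim ((fun k => (Q k).[x]) @ \oo).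

Lemma flimP (Q : nat -> {poly K}) x : fast Q -> tends (fun k => (Q k).[x]) (flim Q x).
Proof.
move=> /(_ (absv x) (absv_ge0 x))[C HC].
have [|l tl _] := @fast_tends (fun k => (Q k).[x]) C 0.
  by move=> k _; rewrite -hornerN -hornerD (le_trans (pn_eval _ (lexx _)))// absv_ge0.
by rewrite /flim (tends_lim tl).
Qed.

Lemma fast_deriv (Q : nat -> {poly K}) : fast Q -> fast (fun k => (Q k)^`()).
Proof.
move=> fQ rho r0; have [|C HC] := fQ (rho + 1); first by rewrite addr_ge0.
by exists C => k; rewrite -derivB (le_trans (pn_deriv _ r0)).
Qed.

Lemma fast_bounded (Q : nat -> {poly K}) rho : 0 <= rho -> fast Q -> exists B, forall k, pn rho (Q k) <= B.
Proof.
move=> r0 /(_ rho r0)[C HC]; exists (pn rho (Q 0%N) + C * 2) => k.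
have C0 : 0 <= C.
  have := le_trans (pn_ge0 r0 _) (HC 0%N); by rewrite expr0 divr1.
suff : pn rho (Q k) <= pn rho (Q 0%N) + C * 2 - C * 2 / 2 ^+ k.
  by move/le_trans; apply; rewrite lerBlDr lerDl divr_ge0 ?mulr_ge0 ?exprn_ge0.
elim: k => [|k IHk]; first by rewrite expr0 divr1 addrK.
have -> : Q k.+1 = Q k + (Q k.+1 - Q k) by ring.
rewrite (le_trans (pnD r0 _ _))// (le_trans (lerD IHk (HC k)))// exprS invfM.
by move: (2 ^+ k)^-1 => w; rewrite le_eqVlt; apply/orP; left; apply/eqP; field.
Qed.

Hypothesis dense0 : exists z : K, 0 < absv z < 1.

(** Powers of [z] are nonzero elements arbitrarily close to 0; this is what determines the limit in
    [derv]. *)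
Lemma dnbhs0_proper : ProperFilter (0^' : set_system K).
Proof.
apply: Build_ProperFilter_ex => A /nbhs_ballP[e /= e0 HA].
have [z /andP[z0 z1]] := dense0.
have [m Hm] := geo_small 1 (introT andP (conj z0 z1)) (divr_gt0 e0 (ltr0Sn _ 1)).
have zX k : absv (z ^+ k) = absv z ^+ k by elim: k => [|k IHk]; rewrite ?expr0 ?absv1// !exprS absvM IHk.
exists (z ^+ m); apply: HA; last by rewrite expf_neq0// -absv_eq0 gt_eqF.
rewrite /ball /= /absv_dist sub0r absvN zX; move: Hm; rewrite mul1r => /le_lt_trans; apply.
by rewrite ltr_pdivrMr ?ltr0n// mulr_natr mulr2n ltrDl.
Qed.

(** The second order Taylor estimate holds with one constant for all polynomials of the sequence,
    hence passes to the limit. *)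
Lemma derv_flim (Q : nat -> {poly K}) : fast Q -> derv (flim Q) = flim (fun k => (Q k)^`()).
Proof.
move=> fQ; apply/funext => x; have rho0 : 0 <= absv x + 1 by rewrite addr_ge0 ?absv_ge0.
have [B HB] := fast_bounded rho0 fQ.
have est h : absv h <= 1 -> absv (flim Q (x + h) - flim Q x - h * flim (fun k => (Q k)^`()) x) <= absv h ^+ 2 * B.
  move=> h1; have t1 := flimP (x + h) fQ; have t2 := tends_scale (-1) (flimP x fQ).
  have t3 := tends_scale (- h) (flimP x (fast_deriv fQ)).
  have := tends_add (tends_add t1 t2) t3; rewrite mulN1r mulNr; move/tends_le; apply.
  exists 0%N => k _; rewrite mulN1r mulNr (le_trans (pn_taylor rho0 (Q k) (lexx _) h1))//.
  by rewrite ler_wpM2l ?exprn_ge0 ?absv_ge0.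
have B0 : 0 <= B by exact: le_trans (pn_ge0 rho0 _) (HB 0%N).
apply: cvg_lim; [exact: metric_hausdorff|exact: dnbhs0_proper|].
have FF := dnbhs0_proper; apply/cvg_ballP => e e0.
have d0 : 0 < B + 1 by rewrite ltr_wpDl.
apply/nbhs_ballP; exists (Num.min 1 (e / (B + 1))); first by rewrite /= lt_min ltr01 divr_gt0.
move=> h; rewrite /ball /= /absv_dist sub0r absvN lt_min => /andP[h1 he] hn.
have h0 : 0 < absv h by rewrite lt_neqAle eq_sym absv_eq0 hn absv_ge0.
rewrite -absvN opprB -(ltr_pM2l h0) -absvM.
have -> : h * (h^-1 * (flim Q (x + h) - flim Q x) - flim (fun k => (Q k)^`()) x) =
   flim Q (x + h) - flim Q x - h * flim (fun k => (Q k)^`()) x by rewrite mulrBr mulVKf.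
apply: (le_lt_trans (est h (ltW h1))); rewrite expr2 -mulrA ltr_pM2l//.
move: he; rewrite ltr_pdivlMr// => /(le_lt_trans _); apply.
by rewrite ler_wpM2l ?absv_ge0// lerDl ler01.
Qed.

Lemma fast_derivn (Q : nat -> {poly K}) m : fast Q -> fast (fun k => (Q k)^`(m)).
Proof.
move=> fQ; elim: m => [|m IHm] //.
have -> : (fun k => (Q k)^`(m.+1)) = (fun k => (Q k)^`(m)^`()) by apply/funext => k; rewrite -[in RHS]derivnS.
exact: fast_deriv.
Qed.

Lemma iter_derv_flim (Q : nat -> {poly K}) m : fast Q -> iter m (@derv R K) (flim Q) = flim (fun k => (Q k)^`(m)).
Proof.
move=> fQ; elim: m => [|m IHm] //; rewrite iterS IHm derv_flim; last exact: fast_derivn.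
by congr flim; apply/funext => k; rewrite -[in RHS]derivnS.
Qed.

End Limits.

(** * Values of derivatives as limits of polynomial values *)

Section Values.
Variables (R : realType) (K : valuedFieldType R).
Hypothesis complete : forall F : set_system K, ProperFilter F -> cauchy F -> cvg F.
Variables (a : K) (u : nat -> nat).
Hypothesis a01 : 0 < absv a < 1.
Hypothesis u_super : forall A, exists k1, forall k, (k1 <= k)%N -> (A * k <= u k)%N.
Implicit Types (P Q : {poly K}) (x y : K).
Let q := absv a.

Lemma absvX (x : K) k : absv (x ^+ k) = absv x ^+ k.
Proof. by elim: k => [|k IHk]; rewrite ?expr0 ?absv1// !exprS absvM IHk. Qed.

Lemma derivn_sum (F : nzRingType) (J : Type) (r : seq J) (p : pred J) (f : J -> {poly F}) m :
  (\sum_(j <- r | p j) f j)^`(m) = \sum_(j <- r | p j) (f j)^`(m).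
Proof. by elim/big_rec2: _ => [|j g h _ <-]; rewrite ?linear0 ?derivnD. Qed.

Lemma absv_au k : absv (a ^+ u k) <= 1.
Proof. by rewrite absvX exprn_ile1 ?absv_ge0//; case/andP: a01 => _ /ltW. Qed.

Lemma decay (C : R) : 0 <= C -> exists2 B, 0 <= B & forall k, C ^+ k * q ^+ u k <= B / 2 ^+ k.
Proof.
move=> C0; have [m Hm] := geo_small (2 * C) a01 ltr01.
have [k1 H1] := u_super m; have [q0 q1] := andP a01.
have C20 : 0 <= 2 * C by rewrite mulr_ge0.
exists (1 + \sum_(k < k1) (2 * C) ^+ k); first by rewrite addr_ge0// sumr_ge0// => k _; rewrite exprn_ge0.
move=> k; rewrite ler_pdivlMr ?exprn_gt0 ?ltr0n// mulrAC -exprMn [C * 2]mulrC.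
case: (ltnP k k1) => kk.
  rewrite (@le_trans _ _ ((2 * C) ^+ k))//.
    by rewrite ler_piMr ?exprn_ge0// exprn_ile1 ?ltW.
  rewrite (bigD1 (Ordinal kk))//= addrCA lerDl addr_ge0// sumr_ge0// => k' _.
  by rewrite exprn_ge0.
rewrite (@le_trans _ _ 1)//; last by rewrite lerDl sumr_ge0// => k' _; rewrite exprn_ge0.
rewrite (@le_trans _ _ ((2 * C) ^+ k * q ^+ (m * k)))//.
  by rewrite ler_wpM2l ?exprn_ge0// ler_wiXn2l ?(ltW q0) ?(ltW q1)// H1.
by rewrite exprM -exprMn exprn_ile1// mulr_ge0 ?exprn_ge0 ?(ltW q0).
Qed.

Definition Apoly (F : comNzRingType) (z : F) n k : {poly F} := \prod_(i < n | i != k :> nat) (1 - z ^+ u i *: 'X).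
Definition gpoly (F : comNzRingType) (z : F) n : {poly F} := \prod_(i < n) (1 - z ^+ u i *: 'X).

Lemma gpolyS (F : comNzRingType) (z : F) n : gpoly z n.+1 = (1 - z ^+ u n *: 'X) * gpoly z n.
Proof. by rewrite /gpoly big_ord_recr /= mulrC. Qed.

Lemma ApolyS (F : comNzRingType) (z : F) n k :
  Apoly z n.+1 k = (if n == k then 1 else 1 - z ^+ u n *: 'X) * Apoly z n k.
Proof. by rewrite /Apoly big_mkcond big_ord_recr /= -big_mkcond /= mulrC; case: eqP. Qed.

Lemma pn_gpoly rho n : 0 <= rho -> pn rho (gpoly a n) <= (1 + rho) ^+ n.
Proof.
move=> r0; elim: n => [|n IHn]; first by rewrite /gpoly big_ord0 pn1 expr0.
rewrite gpolyS (le_trans (pn_lin r0 _ _))// exprS ler_pM ?pn_ge0 ?addr_ge0 ?mulr_ge0 ?absv_ge0//.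
by rewrite lerD2l ler_piMl// absv_au.
Qed.

Lemma pn_Apoly rho n k : 0 <= rho -> pn rho (Apoly a n k) <= (1 + rho) ^+ n.
Proof.
move=> r0; elim: n => [|n IHn]; first by rewrite /Apoly big_ord0 pn1 expr0.
rewrite ApolyS exprS; case: eqP => _.
  by rewrite mul1r (le_trans IHn)// ler_peMl ?exprn_ge0 ?addr_ge0// lerDl.
rewrite (le_trans (pn_lin r0 _ _))// ler_pM ?pn_ge0 ?addr_ge0 ?mulr_ge0 ?absv_ge0//.
by rewrite lerD2l ler_piMl// absv_au.
Qed.

Lemma pn_lin_sub rho n P : 0 <= rho -> pn rho ((1 - a ^+ u n *: 'X) * P - P) = q ^+ u n * (rho * pn rho P).
Proof.
move=> r0; have -> : (1 - a ^+ u n *: 'X) * P - P = - (a ^+ u n *: (P * 'X)).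
  by rewrite mulrBl mul1r -scalerAl [P * _]mulrC; ring.
by rewrite pnN// pnZ// pnMX// absvX [pn _ _ * _]mulrC.
Qed.

Lemma pn_ApolyS rho n k : 0 <= rho -> pn rho (Apoly a n.+1 k - Apoly a n k) <= q ^+ u n * (1 + rho) ^+ n.+1.
Proof.
move=> r0; rewrite ApolyS; case: eqP => _.
  by rewrite mul1r subrr pn0 mulr_ge0 ?exprn_ge0 ?absv_ge0 ?addr_ge0.
rewrite pn_lin_sub// ler_wpM2l ?exprn_ge0 ?absv_ge0// exprS ler_pM ?pn_ge0 ?pn_Apoly//.
by rewrite lerDr.
Qed.

Lemma fast_gpoly : fast (gpoly a).
Proof.
move=> rho r0; have [|B B0 HB] := decay (C := 1 + rho); first by rewrite addr_ge0.
exists (rho * B) => k; rewrite gpolyS pn_lin_sub// -mulrA mulrCA ler_wpM2l//.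
apply: le_trans (HB k); rewrite mulrC ler_wpM2r ?exprn_ge0 ?absv_ge0//; exact: pn_gpoly.
Qed.

Lemma fast_Apoly k : fast ((Apoly a)^~ k).
Proof.
move=> rho r0; have [|B B0 HB] := decay (C := 1 + rho); first by rewrite addr_ge0.
exists ((1 + rho) * B) => n; rewrite (le_trans (pn_ApolyS _ _ r0))// exprS mulrCA -mulrA ler_wpM2l ?addr_ge0//.
by apply: le_trans (HB n); rewrite mulrC.
Qed.

Lemma fast_geometric (Q : nat -> {poly K}) : (forall rho : R, 0 <= rho -> exists C D : R,
   [/\ 0 <= C, 0 <= D & forall n, pn rho (Q n.+1 - Q n) <= q ^+ u n * (D * C ^+ n)]) -> fast Q.
Proof.
move=> H rho /H[C [D [C0 D0 HQ]]]; have [B B0 HB] := decay C0; exists (D * B) => n.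
by rewrite (le_trans (HQ n))// -mulrA mulrCA ler_wpM2l// mulrC.
Qed.

Lemma nat_le_exp2 n : n%:R <= 2 ^+ n :> R.
Proof. by rewrite -natrX ler_nat ltnW// ltn_expl. Qed.

Definition Tpoly x n : {poly K} := \sum_(k < n) (a ^+ u k * x ^+ k) *: Apoly a n k.

Lemma fast_Tpoly x : fast (Tpoly x).
Proof.
apply: fast_geometric => rho r0; pose X := 1 + absv x; have X1 : 1 <= X by rewrite lerDl absv_ge0.
have X0 : 0 <= X by exact: le_trans X1.
have r1 : 0 <= 1 + rho by rewrite addr_ge0.
exists (2 * X * (1 + rho)), (2 * (1 + rho)); split; rewrite ?mulr_ge0// => n.
have -> : Tpoly x n.+1 - Tpoly x n = (a ^+ u n * x ^+ n) *: Apoly a n.+1 n +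
   \sum_(k < n) (a ^+ u k * x ^+ k) *: (Apoly a n.+1 k - Apoly a n k).
  rewrite /Tpoly big_ord_recr /= addrAC -sumrB addrC; congr (_ + _).
  by apply: eq_bigr => k _; rewrite scalerBr.
have xX k : (k <= n)%N -> absv x ^+ k <= X ^+ n.
  move=> kn; rewrite (@le_trans _ _ (X ^+ k))//; last by rewrite ler_weXn2l.
  by rewrite lerXn2r ?nnegrE ?absv_ge0// lerDr.
have B1 : pn rho ((a ^+ u n * x ^+ n) *: Apoly a n.+1 n) <= q ^+ u n * (X ^+ n * (1 + rho) ^+ n.+1).
  rewrite pnZ// absvM !absvX -mulrA ler_wpM2l ?exprn_ge0 ?absv_ge0//.
  by rewrite ler_pM ?exprn_ge0 ?absv_ge0 ?pn_ge0 ?pn_Apoly ?xX.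
have B2 : pn rho (\sum_(k < n) (a ^+ u k * x ^+ k) *: (Apoly a n.+1 k - Apoly a n k)) <=
    n%:R * (X ^+ n * (q ^+ u n * (1 + rho) ^+ n.+1)).
  rewrite (le_trans (pn_sum r0 _ _ _))// -[n in n%:R]card_ord -sum1_card natr_sum mulr_suml.
  apply: ler_sum => k _; rewrite mul1r pnZ// absvM ler_pM ?mulr_ge0 ?absv_ge0 ?pn_ge0 ?pn_ApolyS//.
  by rewrite (le_trans _ (xX k (ltnW (ltn_ord k))))// -(absvX x) ler_piMl ?absv_ge0 ?absv_au.
rewrite (le_trans (pnD r0 _ _))// (le_trans (lerD B1 B2))//.
have n2 := nat_le_exp2 n; have p2 : 1 <= 2 ^+ n :> R by rewrite exprn_ege1// ler1n.
have W0 : 0 <= q ^+ u n * (X ^+ n * (1 + rho) ^+ n.+1) by rewrite !mulr_ge0 ?exprn_ge0 ?absv_ge0.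
have -> : q ^+ u n * (2 * (1 + rho) * (2 * X * (1 + rho)) ^+ n) =
    q ^+ u n * (X ^+ n * (1 + rho) ^+ n.+1) * (2 * 2 ^+ n).
  by rewrite !exprMn exprS; ring.
have -> : n%:R * (X ^+ n * (q ^+ u n * (1 + rho) ^+ n.+1)) = q ^+ u n * (X ^+ n * (1 + rho) ^+ n.+1) * n%:R by ring.
move: (q ^+ u n * _) W0 => w w0; rewrite -[X in X + _]mulr1 -mulrDr ler_wpM2l//; lra.
Qed.

(** [Theta] is an iterated limit. Truncating the sum and the inner products at the same [n] has the
    same limit, because the inner products differ from their limits by O(2^-n) uniformly in [k]. *)
Lemma Theta_flim x y : Theta a u x y = flim (Tpoly x) y.
Proof.
have tA k : tends (fun n => (Apoly a n k).[y]) (flim ((Apoly a)^~ k) y) by apply: flimP => //; exact: fast_Apoly.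
have horA n k : (Apoly a n k).[y] = \prod_(i < n | i != k :> nat) (1 - a ^+ u i * y).
  by rewrite /Apoly horner_prod; apply: eq_bigr => i _; rewrite !hornerE.
have r0 := absv_ge0 y.
have [|B B0 HB] := decay (C := 1 + absv y); first by rewrite addr_ge0.
have errA n k : absv (flim ((Apoly a)^~ k) y - (Apoly a n k).[y]) <= (1 + absv y) * B * 2 / 2 ^+ n.
  have [|l tl Hl] := @fast_tends _ _ complete (fun n => (Apoly a n k).[y]) ((1 + absv y) * B) 0.
    move=> m _; rewrite -hornerN -hornerD (le_trans (pn_eval _ (lexx _)))// (le_trans (pn_ApolyS _ _ r0))//.
    by rewrite exprS mulrCA -mulrA ler_wpM2l ?addr_ge0//; apply: le_trans (HB m); rewrite mulrC.
  by rewrite (tends_unique (tA k) tl) -absvN opprB Hl.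
have [|B' B'0 HB'] := decay (C := absv x); first exact: absv_ge0.
have S' n : \sum_(k < n) absv (a ^+ u k * x ^+ k) <= B' * 2.
  suff : \sum_(k < n) absv (a ^+ u k * x ^+ k) <= B' * 2 - B' * 2 / 2 ^+ n.
    by move/le_trans; apply; rewrite lerBlDr lerDl divr_ge0 ?mulr_ge0 ?exprn_ge0.
  elim: n => [|n IHn]; first by rewrite big_ord0 expr0 divr1 subrr.
  have hn : absv (a ^+ u n * x ^+ n) <= B' / 2 ^+ n by rewrite absvM !absvX mulrC; exact: HB'.
  rewrite big_ord_recr /=; apply: (le_trans (lerD IHn hn)).
  rewrite exprS invfM; move: (2 ^+ n)^-1 => w.
  by rewrite le_eqVlt; apply/orP; left; apply/eqP; field.
rewrite /Theta; apply: tends_lim.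
pose s n := \sum_(k < n) a ^+ u k * x ^+ k * flim ((Apoly a)^~ k) y.
apply: (@tends_ext _ _ s).
  exists 0%N => n _; rewrite /series /= big_mkord; apply: eq_bigr => k _; congr (_ * _).
  by rewrite /flim; congr (lim (_ @ \oo)); apply/funext => m; rewrite horA.
have tT : tends (fun n => (Tpoly x n).[y]) (flim (Tpoly x) y) by apply: flimP => //; exact: fast_Tpoly.
have tD : tends (fun n => s n - (Tpoly x n).[y]) 0.
  move=> e e0; pose E := B' * 2 * ((1 + absv y) * B * 2).
  have h01 : 0 < (2^-1 : R) < 1 by rewrite invr_gt0 ltr0n invf_lt1 ?ltr1n ?ltr0n.
  have [m Hm] := geo_small E h01 (divr_gt0 e0 (ltr0Sn _ 1)).
  exists m => n mn; rewrite subr0 /s /Tpoly horner_sum -sumrB.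
  apply: (@le_lt_trans _ _ (e / 2)); last by rewrite ltr_pdivrMr ?ltr0n// mulr_natr mulr2n ltrDl.
  apply: le_trans Hm; rewrite exprVn.
  apply: (@le_trans _ _ (\sum_(k < n) absv (a ^+ u k * x ^+ k) * ((1 + absv y) * B * 2 / 2 ^+ m))); last first.
    rewrite -mulr_suml /E -[leRHS]mulrA; apply: ler_pM => //; first by apply: sumr_ge0 => k _; exact: absv_ge0.
    by rewrite divr_ge0 ?mulr_ge0 ?exprn_ge0 ?addr_ge0.
  elim/big_ind2: _ => [|z z' w w' h h'|k _]; first by rewrite absv0.
    by rewrite (le_trans (absvD _ _))// lerD.
  rewrite hornerZ -mulrBr absvM ler_wpM2l ?absv_ge0// (le_trans (errA n k))//.
  by rewrite ler_wpM2l ?mulr_ge0 ?addr_ge0// lef_pV2 ?posrE ?exprn_gt0// ler_eXn2l ?ltr1n.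
have := tends_add tD tT; rewrite add0r; apply: tends_ext; exists 0%N => n _; by rewrite subrK.
Qed.

Let dense0 : exists z : K, 0 < absv z < 1. Proof. by exists a. Qed.

Lemma Gfun_flim : Gfun a u = flim (gpoly a).
Proof.
apply/funext => y; rewrite /Gfun /flim; congr (lim (_ @ \oo)); apply/funext => n.
by rewrite /gpoly horner_prod; apply: eq_bigr => i _; rewrite !hornerE.
Qed.

Theorem G_value N y : tends (fun n => (gpoly a n)^`(N).[y]) (iter N (@derv R K) (Gfun a u) y).
Proof.
rewrite Gfun_flim iter_derv_flim//; last exact: fast_gpoly.
by apply: flimP => //; apply: fast_derivn; exact: fast_gpoly.
Qed.

(** The derivative in [y] is taken first, with the first argument fixed. As a function of that
    argument the result is again a rapid limit of polynomials, with coefficients a^(u k) times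
    derivatives of [Apoly] at [y]. *)
Theorem Theta_value l m x y : tends
  (fun n => \sum_(k < n) a ^+ u k * ((k ^_ l)%:R * x ^+ (k - l)) * (Apoly a n k)^`(m).[y])
  (pderv l m (Theta a u) x y).
Proof.
pose Rp n : {poly K} := \sum_(k < n) (a ^+ u k * (Apoly a n k)^`(m).[y]) *: 'X^k.
have E1 : (fun x' => iter m (@derv R K) (Theta a u x') y) = flim Rp.
  apply/funext => x'; have -> : Theta a u x' = flim (Tpoly x') by apply/funext => y'; exact: Theta_flim.
  rewrite iter_derv_flim//; last exact: fast_Tpoly.
  rewrite /flim; congr (lim (_ @ \oo)); apply/funext => n.
  rewrite /Tpoly /Rp derivn_sum !horner_sum; apply: eq_bigr => k _.
  by rewrite derivnZ !hornerZ hornerXn; ring.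
have fR : fast Rp.
  apply: fast_geometric => rho r0; pose s := absv y + m%:R; have s0 : 0 <= s by rewrite addr_ge0 ?absv_ge0.
  pose X := 1 + rho; have X1 : 1 <= X by rewrite lerDl.
  have X0 : 0 <= X by exact: le_trans X1.
  have r1 : 0 <= 1 + s by rewrite addr_ge0.
  exists (2 * X * (1 + s)), (2 * (1 + s)); split; rewrite ?mulr_ge0// => n.
  have -> : Rp n.+1 - Rp n = (a ^+ u n * (Apoly a n.+1 n)^`(m).[y]) *: 'X^n +
     \sum_(k < n) (a ^+ u k * (Apoly a n.+1 k - Apoly a n k)^`(m).[y]) *: 'X^k.
    rewrite /Rp big_ord_recr /= addrAC -sumrB addrC; congr (_ + _).
    by apply: eq_bigr => k _; rewrite -scalerBl derivnB hornerD hornerN mulrBr.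
  have pnX k : pn rho ('X^k : {poly K}) = rho ^+ k.
    by elim: k => [|k IHk]; rewrite ?expr0 ?pn1// exprSr pnMX// IHk exprSr.
  have xX k : (k <= n)%N -> rho ^+ k <= X ^+ n.
    move=> kn; rewrite (@le_trans _ _ (X ^+ k))//; last by rewrite ler_weXn2l.
    by rewrite lerXn2r ?nnegrE// lerDr.
  have B1 : pn rho ((a ^+ u n * (Apoly a n.+1 n)^`(m).[y]) *: 'X^n) <= q ^+ u n * (X ^+ n * (1 + s) ^+ n.+1).
    rewrite pnZ// absvM absvX pnX -mulrA ler_wpM2l ?exprn_ge0 ?absv_ge0// mulrC.
    rewrite ler_pM ?exprn_ge0 ?absv_ge0 ?xX// (le_trans (derivn_eval _ _ _))//; exact: pn_Apoly.
  have B2 : pn rho (\sum_(k < n) (a ^+ u k * (Apoly a n.+1 k - Apoly a n k)^`(m).[y]) *: 'X^k) <=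
      n%:R * (X ^+ n * (q ^+ u n * (1 + s) ^+ n.+1)).
    rewrite (le_trans (pn_sum r0 _ _ _))// -[n in n%:R]card_ord -sum1_card natr_sum mulr_suml.
    apply: ler_sum => k _; rewrite mul1r pnZ// absvM pnX mulrC.
    rewrite ler_pM ?exprn_ge0 ?mulr_ge0 ?absv_ge0 ?(xX k (ltnW (ltn_ord k)))//.
    rewrite (le_trans _ (pn_ApolyS n k s0))// (le_trans _ (derivn_eval _ _ _))//.
    by rewrite ler_piMl ?absv_ge0 ?absv_au.
  rewrite (le_trans (pnD r0 _ _))// (le_trans (lerD B1 B2))//.
  have n2 := nat_le_exp2 n; have p2 : 1 <= 2 ^+ n :> R by rewrite exprn_ege1// ler1n.
  have W0 : 0 <= q ^+ u n * (X ^+ n * (1 + s) ^+ n.+1) by rewrite !mulr_ge0 ?exprn_ge0 ?absv_ge0.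
  have -> : q ^+ u n * (2 * (1 + s) * (2 * X * (1 + s)) ^+ n) =
      q ^+ u n * (X ^+ n * (1 + s) ^+ n.+1) * (2 * 2 ^+ n).
    by rewrite !exprMn exprS; ring.
  have -> : n%:R * (X ^+ n * (q ^+ u n * (1 + s) ^+ n.+1)) = q ^+ u n * (X ^+ n * (1 + s) ^+ n.+1) * n%:R by ring.
  move: (q ^+ u n * _) W0 => w w0; rewrite -[X in X + _]mulr1 -mulrDr ler_wpM2l//; lra.
rewrite /pderv E1 iter_derv_flim//.
have := flimP complete x (fast_derivn l fR); apply: tends_ext; exists 0%N => n _.
rewrite /Rp derivn_sum horner_sum; apply: eq_bigr => k _.
by rewrite derivnZ hornerZ derivnXn hornerMn hornerXn -mulr_natl; ring.
Qed.

End Values.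

(** * Taylor coefficients *)

Section Taylor.
Variables (F : fieldType) (a : F) (u : nat -> nat) (be : F) (k0 : nat).
Local Notation z k := (a ^+ u k).
Hypothesis regular : forall k, (k0 <= k)%N -> 1 - be * z k != 0.

Definition shifted (P : {poly F}) : {poly F} := P \Po ('X + be%:P).

Lemma derivn_shifted P m : P^`(m).[be] = m`!%:R * (shifted P)`_m.
Proof.
have D : (shifted P)^`(m) = shifted P^`(m).
  elim: m => [|m IHm]; first by rewrite !derivn0.
  by rewrite !derivnS IHm /shifted deriv_comp derivD derivX derivC addr0 mulr1.
have -> : P^`(m).[be] = (shifted P^`(m)).[0] by rewrite horner_comp !hornerE.
by rewrite -D horner_coef0 coef_derivn addn0 ffactnn mulr_natl.
Qed.

Definition shifted_factor k : {poly F} := (1 - be * z k)%:P - z k *: 'X.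
(* Taylor coefficients at [be] are coefficients after the substitution [y = be + X]. *)
Definition gsh n : {poly F} := \prod_(i < n) shifted_factor i.
Definition Ash n k : {poly F} := \prod_(i < n | i != k :> nat) shifted_factor i.
(** After y = be + X the factor 1 - z y equals (1 - be z)(1 - xi X); the powers of xi in the sums
    originate here. *)
Definition xi k : F := z k / (1 - be * z k).
Definition Yfin n : F := \prod_(k0 <= r < n) (1 - be * z r).
Definition Tfin n : {poly F} := \prod_(k0 <= r < n) (1 - xi r *: 'X).
Definition Tfin' n k : {poly F} := \prod_(k0 <= r < n | r != k) (1 - xi r *: 'X).
Definition Sfin l al e n : F := \sum_(k0 <= k < n) (k ^_ l)%:R * al ^+ k * xi k ^+ e.+1.
Definition Vfin l al n : {poly F} := \sum_(k0 <= k < n) ((k ^_ l)%:R * al ^+ k * xi k) *: Tfin' n k.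

Lemma shifted_lin k : shifted (1 - z k *: 'X) = shifted_factor k.
Proof.
rewrite /shifted comp_polyB comp_polyC comp_polyZ comp_polyX /shifted_factor polyCB polyCM -!mul_polyC.
ring.
Qed.

Lemma shifted_gpoly n : shifted (gpoly u a n) = gsh n.
Proof. by rewrite /shifted rmorph_prod; apply: eq_bigr => i _; exact: shifted_lin. Qed.

Lemma shifted_Apoly n k : shifted (Apoly u a n k) = Ash n k.
Proof. by rewrite /shifted rmorph_prod; apply: eq_bigr => i _; exact: shifted_lin. Qed.

Lemma lin_regular k : (k0 <= k)%N -> shifted_factor k = (1 - be * z k) *: (1 - xi k *: 'X).
Proof.
move=> kk; rewrite /shifted_factor scalerBr scalerA /xi mulrCA divff ?regular// mulr1 -[X in _ = X - _]mul_polyC.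
by rewrite mulr1.
Qed.

Lemma prod_lin_regular n : \prod_(k0 <= r < n) shifted_factor r = Yfin n *: Tfin n.
Proof.
rewrite /Yfin /Tfin -scaler_prod; apply: eq_big_nat => r /andP[kr _].
exact: lin_regular.
Qed.

Lemma gsh_split n : (k0 <= n)%N -> gsh n = Yfin n *: (gsh k0 * Tfin n).
Proof.
move=> kn; rewrite scalerAr -prod_lin_regular /gsh -!(big_mkord xpredT).
by rewrite (big_cat_nat (leq0n _) kn).
Qed.

Lemma Ash_split_low n k : (k0 <= n)%N -> (k < k0)%N -> Ash n k = Yfin n *: (Ash k0 k * Tfin n).
Proof.
move=> kn kk; rewrite scalerAr -prod_lin_regular /Ash -!(big_mkord (fun i => i != k)).
rewrite (big_cat_nat (leq0n _) kn)/=; congr (_ * _).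
rewrite big_nat_cond [RHS]big_nat_cond; apply: eq_bigl => i; rewrite andbT.
by case: (boolP (k0 <= i < n)%N) => //= /andP[ki _]; rewrite gtn_eqF// (leq_trans kk).
Qed.

Lemma Ash_split_high n k : (k0 <= k < n)%N -> z k *: Ash n k = Yfin n *: (gsh k0 * (xi k *: Tfin' n k)).
Proof.
case/andP=> kk kn; rewrite /Ash -(big_mkord (fun i => i != k)).
rewrite (big_cat_nat (leq0n _) (leq_trans kk (ltnW kn)))/=.
have -> : \prod_(0 <= i < k0 | i != k) shifted_factor i = gsh k0.
  rewrite /gsh -(big_mkord xpredT) big_nat_cond [RHS]big_nat_cond; apply: eq_bigl => i; rewrite andbT.
  by case: (boolP (0 <= i < k0)%N) => //= ik; rewrite ltn_eqF// (leq_trans ik).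
have -> : \prod_(k0 <= i < n | i != k) shifted_factor i =
    (\prod_(k0 <= i < n | i != k) (1 - be * z i)) *: Tfin' n k.
  rewrite /Tfin' -scaler_prod big_nat_cond [RHS]big_nat_cond.
  by apply: eq_bigr => i /andP[/andP[ki _] _]; exact: lin_regular.
have -> : Yfin n = (1 - be * z k) * \prod_(k0 <= i < n | i != k) (1 - be * z i).
  by rewrite /Yfin (bigD1_seq k) ?iota_uniq ?mem_index_iota ?kk.
rewrite -!scalerAr !scalerA; congr (_ *: _); rewrite /xi.
by move: (\prod_(_ <= _ < _ | _) _) => w; field; exact: regular.
Qed.

Lemma deriv_gpoly n : (gpoly u a n)^`() = - \sum_(k < n) z k *: Apoly u a n k.
Proof.
elim: n => [|n IHn]; first by rewrite /gpoly !big_ord0 derivC oppr0.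
rewrite gpolyS derivM IHn derivB derivC derivZ derivX sub0r big_ord_recr /=.
have -> : Apoly u a n.+1 n = gpoly u a n.
  rewrite ApolyS eqxx mul1r /Apoly /gpoly; apply: eq_bigl => i.
  by rewrite ltn_eqF.
have -> : \sum_(k < n) z k *: Apoly u a n.+1 k = (1 - z n *: 'X) * \sum_(k < n) z k *: Apoly u a n k.
  rewrite mulr_sumr; apply: eq_bigr => k _; rewrite ApolyS gtn_eqF ?ltn_ord// -!mul_polyC; ring.
by rewrite -!mul_polyC; ring.
Qed.

(** Under [regular] no factor of index k0 or more vanishes at [be], so this is the order of
    vanishing at [be] of every partial product of G with at least k0 factors. *)
Definition mult := #|[pred j : 'I_k0 | 1 - be * z j == 0]|.

Lemma prod_lin_order (p : pred 'I_k0) : exists2 B : {poly F}, B`_0 != 0 &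
  \prod_(j | p j) shifted_factor j = 'X ^+ #|[pred j : 'I_k0 | p j && (1 - be * z j == 0)]| * B.
Proof.
pose bad (j : 'I_k0) := 1 - be * z j == 0.
exists ((\prod_(j | p j && bad j) - z j)%:P * \prod_(j | p j && ~~ bad j) shifted_factor j).
  rewrite coefCM mulf_neq0//.
    apply/prodf_neq0 => j /andP[_ bj]; rewrite oppr_eq0; apply/eqP => zj; move: bj.
    by rewrite /bad zj mulr0 subr0 oner_eq0.
  rewrite -horner_coef0 horner_prod; apply/prodf_neq0 => j /andP[_ bj].
  by rewrite /shifted_factor hornerD hornerN hornerZ hornerX hornerC mulr0 subr0.
rewrite (bigID bad) /= mulrA; congr (_ * _).
rewrite -prodr_const rmorph_prod /= -big_split /=; apply: eq_big => [j|j /andP[_ /eqP bj]]; first by rewrite inE.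
by rewrite /shifted_factor bj polyC0 sub0r -mul_polyC polyCN; ring.
Qed.

Lemma gsh_order : exists2 B : {poly F}, B`_0 != 0 & gsh k0 = 'X^mult * B.
Proof. by have [B B0 E] := prod_lin_order xpredT; exists B => //; rewrite /gsh E /mult. Qed.

(** Omitting one factor lowers the order of vanishing by at most one. *)
Lemma Ash_order k : (k < k0)%N -> exists B : {poly F}, 'X * Ash k0 k = 'X^mult * B.
Proof.
move=> kk; have [B _ E] := prod_lin_order (fun j => j != k :> nat).
pose k' := Ordinal kk; set bad := [pred j : 'I_k0 | 1 - be * z j == 0].
have Em : mult = ((k' \in bad) + #|[pred j : 'I_k0 | (j != k :> nat) && (1 - be * z j == 0)%R]|)%N.
  by rewrite /mult (cardD1 k'); congr (_ + _)%N; apply: eq_card => j; rewrite !inE.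
rewrite /Ash E Em; set e := #|_|; exists ((if k' \in bad then 1 else 'X) * B).
by rewrite exprD; case: (_ \in _); rewrite ?expr1 ?expr0; ring.
Qed.

Definition Pfin l al n : {poly F} := \sum_(k < n) (z k * ((k ^_ l)%:R * al ^+ (k - l))) *: Ash n k.
Definition Alow l al : {poly F} := \sum_(k < k0) (z k * ((k ^_ l)%:R * al ^+ (k - l))) *: Ash k0 k.

Lemma Alow_order l al : exists B : {poly F}, 'X * Alow l al = 'X^mult * B.
Proof.
have H (k : 'I_k0) : exists B : {poly F}, 'X * Ash k0 k = 'X^mult * B by exact: Ash_order.
have [B HB] := choice H.
exists (\sum_(k < k0) (z k * ((k ^_ l)%:R * al ^+ (k - l))) *: B k).
rewrite /Alow !mulr_sumr; apply: eq_bigr => k _; by rewrite -!scalerAr HB.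
Qed.

(** Terms with k < k0 keep all regular factors, the others omit one of them. The factor al^(-l)
    turns al^(k-l), which comes from differentiating x^k, into al^k. *)
Lemma Pfin_split l al n : al != 0 -> (k0 <= n)%N ->
  Pfin l al n = Yfin n *: (Tfin n * Alow l al + al ^- l *: (gsh k0 * Vfin l al n)).
Proof.
move=> al0 kn; rewrite /Pfin -(big_mkord xpredT (fun k => (z k * ((k ^_ l)%:R * al ^+ (k - l))) *: Ash n k)).
rewrite (big_cat_nat (leq0n _) kn)/= scalerDr; congr (_ + _).
  rewrite big_mkord /Alow mulr_sumr scaler_sumr; apply: eq_bigr => k _.
  by rewrite Ash_split_low// -!scalerAr !scalerA [Tfin n * _]mulrC [_ * Yfin n]mulrC.
rewrite /Vfin mulr_sumr !scaler_sumr; apply: eq_big_nat => k kk.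
transitivity (((k ^_ l)%:R * al ^+ (k - l)) *: (z k *: Ash n k)); first by rewrite scalerA mulrC.
rewrite Ash_split_high// -!scalerAr !scalerA; congr (_ *: _).
have -> : (k ^_ l)%:R * al ^+ (k - l) = al ^- l * ((k ^_ l)%:R * al ^+ k).
  case: (leqP l k) => lk; last by rewrite ffact_small// !mul0r mulr0.
  have -> : al ^+ k = al ^+ l * al ^+ (k - l) by rewrite -exprD subnKC.
  by rewrite mulrCA mulKf// expf_neq0.
ring.
Qed.

Lemma coef_div_lin (P Q : {poly F}) x : (1 - x *: 'X) * P = Q ->
  forall i, P`_i = \sum_(r < i.+1) Q`_r * x ^+ (i - r).
Proof.
move=> PQ; have E i : P`_i = Q`_i + x * (if i is i'.+1 then P`_i' else 0).
  rewrite -PQ mulrBl mul1r -scalerAl coefB coefZ coefXM.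
  by case: i => [|i] /=; rewrite subrK.
elim=> [|i IHi]; first by rewrite E mulr0 addr0 big_ord1 expr0 mulr1.
rewrite E IHi [in RHS]big_ord_recr /= subnn expr0 mulr1 [RHS]addrC; congr (_ + _).
rewrite mulr_sumr; apply: eq_bigr => r _; rewrite subSn ?exprS; last by rewrite -ltnS.
by rewrite mulrCA.
Qed.

(** [Tfin'] is [Tfin] divided by 1 - xi_k X, and the geometric series produces the sums of powers of
    xi_k. *)
Lemma coef_Vfin l al n i :
  (Vfin l al n)`_i = \sum_(r < i.+1) (Tfin n)`_r * Sfin l al (i - r) n.
Proof.
rewrite /Vfin coef_sum.
transitivity (\sum_(k0 <= k < n) \sum_(r < i.+1) (Tfin n)`_r * ((k ^_ l)%:R * al ^+ k * xi k ^+ (i - r).+1)).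
  apply: eq_big_nat => k kk; rewrite coefZ (@coef_div_lin _ (Tfin n) (xi k)).
    by rewrite mulr_sumr; apply: eq_bigr => r _; rewrite exprS; ring.
  by rewrite /Tfin (bigD1_seq k) ?iota_uniq ?mem_index_iota.
rewrite exchange_big; apply: eq_bigr => r _; by rewrite /Sfin mulr_sumr.
Qed.

Lemma Theta_coef l m al n :
  \sum_(k < n) z k * ((k ^_ l)%:R * al ^+ (k - l)) * (Apoly u a n k)^`(m).[be] = m`!%:R * (Pfin l al n)`_m.
Proof.
rewrite /Pfin coef_sum mulr_sumr; apply: eq_bigr => k _.
by rewrite derivn_shifted shifted_Apoly coefZ mulrCA.
Qed.

(* The values at [l = 0], [al = 1] are those of the derivative of [- G]. *)
Lemma Pfin01 n m : m`!%:R * (Pfin 0 1 n)`_m = - (m.+1)`!%:R * (gsh n)`_m.+1.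
Proof.
rewrite -Theta_coef mulNr -shifted_gpoly -derivn_shifted derivSn deriv_gpoly derivnN hornerN opprK.
rewrite derivn_sum horner_sum; apply: eq_bigr => k _.
by rewrite ffactn0 expr1n !mulr1 derivnZ hornerZ.
Qed.

End Taylor.

(** * Recovering the limits from the values *)

Section RationalLimits.
Variables (R : realType) (K : valuedFieldType R) (F : fieldType) (jL : {rmorphism F -> K}).
Variables (T : finType) (v : T -> K).
Implicit Types s t : nat -> F.

(* Limits in the field generated over [L] by the [v t]. *)
Definition rl s := exists2 l, tends (fun n => jL (s n)) l & ratl jL v l.

Lemma rl_ext s t : (exists k1, forall k, (k1 <= k)%N -> s k = t k) -> rl s -> rl t.
Proof. by move=> [k1 E] [l sl rl]; exists l => //; apply: tends_ext sl; exists k1 => k /E->. Qed.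

Lemma rl_const x : rl (fun=> x).
Proof. by exists (jL x); [exact: tends_const|exact: ratl_const]. Qed.

Lemma rl_add s t : rl s -> rl t -> rl (fun n => s n + t n).
Proof.
move=> [l sl rl] [m tm rm]; exists (l + m); last exact: ratl_add.
by apply: tends_ext (tends_add sl tm); exists 0%N => k _; rewrite rmorphD.
Qed.

Lemma rl_mul s t : rl s -> rl t -> rl (fun n => s n * t n).
Proof.
move=> [l sl rl] [m tm rm]; exists (l * m); last exact: ratl_mul.
by apply: tends_ext (tends_mul sl tm); exists 0%N => k _; rewrite rmorphM.
Qed.

Lemma rl_sub s t : rl s -> rl t -> rl (fun n => s n - t n).
Proof.
move=> rs rt; apply: (rl_ext _ (rl_add rs (rl_mul (rl_const (-1)) rt))).
by exists 0%N => n _; rewrite mulN1r.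
Qed.

Lemma rl_sum k (f : 'I_k -> nat -> F) : (forall i, rl (f i)) -> rl (fun n => \sum_(i < k) f i n).
Proof.
elim: k f => [|k IHk] f H; first by apply: (rl_ext _ (rl_const 0)); exists 0%N => n _; rewrite big_ord0.
apply: (rl_ext _ (rl_add (H ord0) (IHk (fun i => f (lift ord0 i)) (fun i => H _)))).
by exists 0%N => n _; rewrite big_ord_recl.
Qed.

Lemma rl_scaled x s : x != 0 -> rl (fun n => x * s n) -> rl s.
Proof.
move=> x0 H; apply: (rl_ext _ (rl_mul (rl_const x^-1) H)).
by exists 0%N => n _; rewrite mulKf.
Qed.

(** Division by a polynomial with nonzero constant term, one coefficient at a time. *)
Lemma rl_head (y : nat -> F) (B : {poly F}) (P : nat -> {poly F}) i : B`_0 != 0 ->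
  (forall r, (r < i)%N -> rl (fun n => y n * (P n)`_r)) ->
  rl (fun n => y n * (B * P n)`_i) -> rl (fun n => y n * (P n)`_i).
Proof.
move=> B0 H Hi; apply: (rl_scaled B0).
have H' : rl (fun n => \sum_(j < i) B`_j.+1 * (y n * (P n)`_(i - j.+1))).
  apply: rl_sum => j; apply: rl_mul; first exact: rl_const.
  by apply: H; move: (ltn_ord j); clear; lia.
apply: (rl_ext _ (rl_sub Hi H')); exists 0%N => n _.
rewrite coefM big_ord_recl subn0 mulrDr mulr_sumr [X in _ + X - _](eq_bigr (fun j : 'I_i => B`_j.+1 * (y n * (P n)`_(i - j.+1)))).
  by rewrite addrK mulrCA.
by move=> j _; rewrite /= mulrCA.
Qed.

Variables (a : F) (u : nat -> nat) (be : F) (k0 : nat).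
Hypothesis regular : forall k, (k0 <= k)%N -> 1 - be * a ^+ u k != 0.
Hypothesis nat_neq0 : forall m, m.+1%:R != 0 :> F.
Local Notation N := (mult a u be k0).
Local Notation Y := (Yfin a u be k0).
Local Notation Tn := (Tfin a u be k0).

Let fact_neq0 m : m`!%:R != 0 :> F.
Proof. by move: (fact_gt0 m); case: (m`!) => // k _; exact: nat_neq0. Qed.

Lemma Tfin0 n : (Tn n)`_0 = 1.
Proof.
rewrite -horner_coef0 /Tfin horner_prod big1// => i _.
by rewrite hornerD hornerN hornerZ hornerX hornerC mulr0 subr0.
Qed.

Lemma rl_Y : be = 0 \/ rl (fun n => (gpoly u a n)^`(N).[be]) -> rl Y.
Proof.
case=> [->|H].
  apply: (rl_ext _ (rl_const 1)); exists 0%N => n _; rewrite /Yfin big1// => i _.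
  by rewrite mul0r subr0.
have [B B0 E] := gsh_order a u be k0.
apply: (@rl_scaled (N`!%:R * B`_0)); first by rewrite mulf_neq0.
apply: rl_ext H; exists k0 => n kn.
rewrite derivn_shifted shifted_gpoly (gsh_split regular kn) E coefZ -!mulrA coefXnM ltnn subnn.
by rewrite coef0M Tfin0 mulr1 [_ * B`_0]mulrC.
Qed.

(** The values with l = 0 and alpha = 1 are minus the derivatives of G, one order higher, so they
    give the coefficients r >= 1; the coefficient 0 is [Y] itself. *)
Lemma rl_T M : rl Y -> (forall m, (N <= m < N + M)%N -> rl (fun n =>
    \sum_(k < n) a ^+ u k * ((k ^_ 0)%:R * 1 ^+ (k - 0)) * (Apoly u a n k)^`(m).[be])) ->
  forall r, (r <= M)%N -> rl (fun n => Y n * (Tn n)`_r).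
Proof.
move=> rY H; elim/ltn_ind=> -[_ _|i IHi iM].
  by apply: (rl_ext _ rY); exists 0%N => n _; rewrite Tfin0 mulr1.
have [B B0 E] := gsh_order a u be k0.
apply: (rl_head B0); first by move=> r ri; apply: IHi => //; exact: leq_trans (ltnW ri) iM.
have Ni : (N <= N + i < N + M)%N by rewrite leq_addr ltn_add2l.
apply: (@rl_scaled (- (N + i).+1`!%:R)); first by rewrite oppr_eq0.
apply: (rl_ext _ (H _ Ni)); exists k0 => n kn.
rewrite Theta_coef Pfin01 (gsh_split regular kn) E coefZ -!mulrA coefXnM.
by rewrite ltnNge -addnS leq_addr/= addKn.
Qed.

(** Triangular elimination. The coefficients of Y [Tfin] are known from [rl_T], then those of Y
    [Vfin] from the values at l and alpha. Each of the latter is a convolution of the coefficients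
    of Y [Tfin] with the sums, so the limits [sig] follow one after the other upon division by [y0].
    For be = 0, where no value of G is given, Y = 1. *)
Theorem taylor M l al (sig : nat -> K) y0 : al != 0 ->
  tends (fun n => jL (Y n)) y0 -> y0 != 0 ->
  (forall e, (e < M)%N -> tends (fun n => jL (Sfin a u be k0 l al e n)) (sig e)) ->
  be = 0 \/ rl (fun n => (gpoly u a n)^`(N).[be]) ->
  (forall m, (N <= m < N + M)%N -> rl (fun n =>
    \sum_(k < n) a ^+ u k * ((k ^_ 0)%:R * 1 ^+ (k - 0)) * (Apoly u a n k)^`(m).[be])) ->
  (forall m, (N <= m < N + M)%N -> rl (fun n =>
    \sum_(k < n) a ^+ u k * ((k ^_ l)%:R * al ^+ (k - l)) * (Apoly u a n k)^`(m).[be])) ->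
  ratl jL v y0 /\ forall e, (e < M)%N -> ratl jL v (sig e).
Proof.
move=> al0 Yy0 y00 Hsig /rl_Y rY H1 Hl.
have rT := rl_T rY H1.
have [B B0 E] := gsh_order a u be k0.
have [B' E'] := Alow_order a u be k0 l al.
have rV i : (i < M)%N -> rl (fun n => Y n * (Vfin a u be k0 l al n)`_i).
  elim/ltn_ind: i => i IHi iM.
  apply: (rl_head B0); first by move=> r ri; apply: IHi => //; exact: ltn_trans ri iM.
  have Ni : (N <= N + i < N + M)%N by rewrite leq_addr ltn_add2l.
  apply: (@rl_scaled ((N + i)`!%:R * al ^- l)); first by rewrite mulf_neq0 ?invr_neq0 ?expf_neq0.
  have rA : rl (fun n => (N + i)`!%:R * \sum_(j < i.+2) B'`_j * (Y n * (Tn n)`_(i.+1 - j))).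
    apply: rl_mul; first exact: rl_const.
    apply: rl_sum => j; apply: rl_mul; first exact: rl_const.
    by apply: rT; move: iM; clear; lia.
  apply: (rl_ext _ (rl_sub (Hl _ Ni) rA)); exists k0 => n kn.
  rewrite Theta_coef (Pfin_split regular _ al0 kn) coefZ coefD coefZ.
  have -> : (Tn n * Alow a u be k0 l al)`_(N + i) = (B' * Tn n)`_i.+1.
    have -> : (Tn n * Alow a u be k0 l al)`_(N + i) = ('X * (Tn n * Alow a u be k0 l al))`_(N + i).+1 by rewrite coefXM.
    by rewrite mulrCA E' mulrCA coefXnM ltnNge -addnS leq_addr/= addKn mulrC.
  have -> : \sum_(j < i.+2) B'`_j * (Y n * (Tn n)`_(i.+1 - j)) = Y n * (B' * Tn n)`_i.+1.
    by rewrite coefM mulr_sumr; apply: eq_bigr => j _; rewrite mulrCA.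
  rewrite E -mulrA coefXnM ltnNge leq_addr/= addKn; ring.
have [y1 Yy1 ry1] := rY; have y10 := tends_unique Yy0 Yy1; subst y1; split=> // e eM.
have /choice[w Hw] (r : 'I_M.+1) : exists w, tends (fun n => jL (Y n * (Tn n)`_r)) w /\ ratl jL v w.
  by have [|w] := rT r; [rewrite -ltnS|exists w].
elim/ltn_ind: e eM => i IHi iM.
have w0 : w ord0 = y0.
  apply: tends_unique (Hw ord0).1 _; apply: tends_ext Yy0; exists 0%N => n _.
  by rewrite Tfin0 mulr1.
apply: (@ratl_div _ _ _ _ _ y0) => //.
have [x Vx rx] := rV i iM.
pose wd r := if insub r is Some r' then w r' else 0.
have wdE r (rM : (r < M.+1)%N) : wd r = w (Ordinal rM) by rewrite /wd insubT.
have -> : y0 * sig i = x - \sum_(r < i) wd r.+1 * sig (i - r.+1)%N.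
  suff -> : x = \sum_(r < i.+1) wd r * sig (i - r)%N.
    by rewrite big_ord_recl subn0 addrK wdE -w0; congr (w _ * _); exact: val_inj.
  apply: tends_unique Vx _.
  have : tends (fun n => \sum_(r <- enum 'I_i.+1) jL (Y n * (Tn n)`_r) * jL (Sfin a u be k0 l al (i - r) n))
      (\sum_(r <- enum 'I_i.+1) wd r * sig (i - r)%N).
    apply: tends_sum => r _; apply: tends_mul.
      have rM : (r < M.+1)%N by move: (ltn_ord r) iM; clear; lia.
      by rewrite (wdE _ rM); have := (Hw (Ordinal rM)).1.
    by apply: Hsig; move: iM; clear; lia.
  rewrite big_enum; apply: tends_ext; exists 0%N => n _; rewrite big_enum/=.
  rewrite coef_Vfin mulr_sumr rmorph_sum; apply: eq_bigr => r _.
  by rewrite -rmorphM mulrA.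
apply: ratl_sub => //; apply: ratl_sum => r _; apply: ratl_mul.
  have rM : (r.+1 < M.+1)%N by move: (ltn_ord r) iM; clear; lia.
  by rewrite (wdE _ rM); exact: (Hw _).2.
by apply: IHi; move: (ltn_ord r) iM; clear; lia.
Qed.

End RationalLimits.

(** * Independence of the values *)

Section GeometricLimits.
Variables (R : realType) (K : valuedFieldType R).
Hypothesis complete : forall F : set_system K, ProperFilter F -> cauchy F -> cvg F.
Variables (L : fieldType) (jL : {rmorphism L -> K}) (a : L) (u : nat -> nat) (k0 n : nat).
Hypothesis a01 : 0 < absv (jL a) < 1.
Hypothesis u_super : forall A, exists k1, forall k, (k1 <= k)%N -> (A * k <= u k)%N.
Hypothesis u_iter : forall A, exists J, forall j k, (J <= j)%N -> (n <= k)%N -> (A * u k <= u (k + j))%N.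
Let q := absv (jL a).

(** For r >= k + J0 the exponent u r exceeds A u_k by a multiple of r large enough to absorb C^(r+1)
    and leave a convergent geometric series. *)
Lemma geometric_limit (s : nat -> K) (C : R) k0' : 0 <= C ->
  (forall r, (k0' <= r)%N -> absv (s r.+1 - s r) <= C ^+ r.+1 * q ^+ u r) ->
  exists l, tends s l /\ forall A, exists J0 k1, forall k r, (k1 <= k)%N -> (k + J0 <= r)%N ->
    absv (s r - l) <= q ^+ (A * u k).
Proof.
move=> C0 H; have [q0 q1] := andP a01; have qge0 := ltW q0; have qle1 := ltW q1.
have [B B0 HB] := decay a01 u_super C0.
have [|l sl _] := fast_tends complete (s := s) (C := C * B) (k0 := k0').
  move=> k kk; rewrite (le_trans (H k kk))// exprS -!mulrA ler_wpM2l//.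
exists l; split=> // A; have [m Hm] := geo_small (2 * C) a01 ltr01.
have [J HJ] := u_iter (2 * A); have [k1 Hk1] := u_super (2 * (m + m)).
exists J, (k0' + k1 + n + 1)%N => k r kk kr.
have inc r' : (k + J <= r')%N -> absv (s r'.+1 - s r') <= q ^+ (A * u k) / 2 / 2 ^+ r'.
  move=> kr'; have r'1 : (0 < r')%N by move: kk kr'; clear; lia.
  have Hu : (A * u k + m * r' + m * r' <= u r')%N.
    have h1 := HJ (r' - k)%N k; have h2 := Hk1 r'.
    rewrite subnKC in h1; last by move: kr'; clear; lia.
    have {}h1 : (2 * A * u k <= u r')%N by apply: h1; move: kk kr'; clear; lia.
    have {}h2 : (2 * (m + m) * r' <= u r')%N by apply: h2; move: kk kr'; clear; lia.
    by move: h1 h2; rewrite -!mulnA !mulnDl; clear; lia.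
  have Hr' : (k0' <= r')%N by move: kk kr'; clear; lia.
  rewrite (le_trans (H _ Hr'))// !ler_pdivlMr ?exprn_gt0//.
  rewrite (@le_trans _ _ (C ^+ r'.+1 * (q ^+ (A * u k) * (q ^+ m) ^+ r' * q ^+ m) * 2 ^+ r' * 2))//.
    rewrite -!mulrA ler_wpM2l ?exprn_ge0// !mulrA !ler_wpM2r ?exprn_ge0// -exprM -!exprD.
    rewrite ler_wiXn2l// (leq_trans _ Hu)// leq_add2l.
    by rewrite leq_pmulr.
  have -> : C ^+ r'.+1 * (q ^+ (A * u k) * (q ^+ m) ^+ r' * q ^+ m) * 2 ^+ r' * 2 =
      q ^+ (A * u k) * ((2 * C * q ^+ m) ^+ r' * (2 * C * q ^+ m)).
    by rewrite exprS !exprMn; ring.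
  have p0 : 0 <= 2 * C * q ^+ m by rewrite !mulr_ge0 ?exprn_ge0.
  by rewrite ler_piMr ?exprn_ge0// mulr_ile1 ?exprn_ge0 ?exprn_ile1.
have [l' sl' Hl'] := fast_tends complete inc.
rewrite (tends_unique sl sl') (le_trans (Hl' r kr))// divfK ?pnatr_eq0//.
by rewrite ler_pdivrMr ?exprn_gt0// ler_peMr ?exprn_ge0// exprn_ege1// ler1n.
Qed.

Lemma Y_limit be : exists l, tends (fun r => jL (\prod_(k0 <= i < r) (1 - be * a ^+ u i))) l /\
  forall A, exists J0 k1, forall k r, (k1 <= k)%N -> (k + J0 <= r)%N ->
    absv (jL (\prod_(k0 <= i < r) (1 - be * a ^+ u i)) - l) <= q ^+ (A * u k).
Proof.
have [q0 q1] := andP a01; have b0 : 0 <= 1 + absv (jL be) by rewrite addr_ge0 ?absv_ge0.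
apply: (geometric_limit (k0' := k0) b0) => r kr.
rewrite big_nat_recr//= -rmorphB -[X in _ - X]mulr1 -mulrBr addrC addKr rmorphM absvM rmorphN absvN rmorphM absvM rmorphXn absvX.
rewrite mulrA ler_wpM2r ?exprn_ge0 ?absv_ge0// exprSr ler_pM ?absv_ge0 ?lerDr//.
rewrite -[in (1 + _) ^+ r](subnKC kr) exprD rmorph_prod.
rewrite (@le_trans _ _ (\prod_(k0 <= i < r) (1 + absv (jL be))))//.
  elim/big_ind2: _ => [|x y z w xy zw|i _]; first by rewrite absv1.
    by rewrite absvM ler_pM ?absv_ge0.
  rewrite (le_trans _ (_ : absv (1 : K) + absv (jL be * jL a ^+ u i) <= _))//.
    by rewrite rmorphB rmorph1 rmorphM rmorphXn -[X in _ <= _ + X]absvN absvD.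
  by rewrite absv1 lerD2l absvM ler_piMr ?absv_ge0// absvX exprn_ile1 ?ltW.
by rewrite prodr_const_nat ler_peMl ?exprn_ge0// exprn_ege1// lerDl absv_ge0.
Qed.

Lemma S_limit al be l e :
  exists y, tends (fun r => jL (\sum_(k0 <= i < r) (i ^_ l)%:R * al ^+ i * (a ^+ u i / (1 - be * a ^+ u i)) ^+ e.+1)) y /\
  forall A, exists J0 k1, forall k r, (k1 <= k)%N -> (k + J0 <= r)%N ->
    absv (jL (\sum_(k0 <= i < r) (i ^_ l)%:R * al ^+ i * (a ^+ u i / (1 - be * a ^+ u i)) ^+ e.+1) - y) <= q ^+ (A * u k).
Proof.
have [q0 q1] := andP a01.
have C0 : 0 <= 2 ^+ l * (1 + absv (jL al)) * 2 ^+ e.+1 :> R by rewrite !mulr_ge0 ?exprn_ge0 ?addr_ge0 ?absv_ge0.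
have h0 : 0 < 2^-1 :> R by rewrite invr_gt0.
have [m Hm] := geo_small (absv (jL be)) a01 h0; have [k2 Hk2] := u_super m.+1.
have H2 r : (k2 + 1 <= r)%N -> absv (jL be * jL a ^+ u r) <= 2^-1.
  move=> kr; apply: le_trans Hm; rewrite absvM absvX ler_wpM2l ?absv_ge0// ler_wiXn2l ?(ltW q0) ?(ltW q1)//.
  by apply: leq_trans (Hk2 r _); move: kr; clear; nia.
apply: (geometric_limit (k0' := k0 + k2 + 1) C0) => r kr.
have kr0 : (k0 <= r)%N by move: kr; clear; lia.
rewrite big_nat_recr//= -rmorphB addrAC subrr add0r !rmorphM !absvM rmorph_nat rmorphXn absvX.
set z := jL a ^+ u r; have zq : absv z = q ^+ u r by rewrite absvX.
have z1 : absv z <= 1 by rewrite zq exprn_ile1 ?ltW.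
have w2 : absv (jL (1 - be * a ^+ u r)^-1) <= 2.
  rewrite fmorphV rmorphB rmorph1 rmorphM rmorphXn -/z.
  have hz : 2^-1 <= absv (1 - jL be * z).
    have := H2 r; rewrite -/z => hz; have {}hz : absv (jL be * z) <= 2^-1 by apply: hz; move: kr; clear; lia.
    have := absvD (1 - jL be * z) (jL be * z); rewrite subrK absv1; move: hz; lra.
  have n0 : absv (1 - jL be * z) != 0 by rewrite gt_eqF// (lt_le_trans _ hz)// invr_gt0.
  have Ei : absv (1 - jL be * z)^-1 = (absv (1 - jL be * z))^-1.
    by apply: (mulfI n0); rewrite -absvM !divff ?absv1//; rewrite -absv_eq0.
  rewrite Ei -[leRHS]invrK lef_pV2 ?posrE ?invr_gt0//; exact: lt_le_trans hz.
have fl : absv ((r ^_ l)%:R : K) <= (2 ^+ l) ^+ r.+1.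
  rewrite (le_trans (absv_nat_le _ _))// -exprM mulnC exprM -!natrX ler_nat.
  apply: (@leq_trans (r ^ l)).
    elim: (l) => [|l' IH]; first by rewrite ffactn0.
    by rewrite ffactnSr expnSr leq_mul// leq_subr.
  case: (posnP l) => [->//|l_gt0]; rewrite leq_exp2r//.
  by rewrite ltnW// (leq_trans (ltnSn r))// ltnW// ltn_expl.
rewrite rmorphXn absvX rmorphM absvM rmorphXn -/z !exprMn.
have al1 : absv (jL al) ^+ r <= (1 + absv (jL al)) ^+ r.+1.
  rewrite (@le_trans _ _ ((1 + absv (jL al)) ^+ r))//.
    by rewrite lerXn2r ?nnegrE ?lerDr ?addr_ge0 ?absv_ge0.
  by rewrite ler_weXn2l// lerDl absv_ge0.
have w3 : absv (jL (1 - be * a ^+ u r)^-1) ^+ e.+1 <= (2 ^+ e.+1) ^+ r.+1.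
  rewrite (@le_trans _ _ (2 ^+ e.+1))//; first by rewrite lerXn2r ?nnegrE ?absv_ge0.
  by rewrite -[leLHS]expr1 ler_weXn2l// exprn_ege1// ler1n.
have z3 : absv z ^+ e.+1 <= q ^+ u r.
  by rewrite -zq exprS ler_piMr ?absv_ge0// exprn_ile1 ?absv_ge0.
rewrite [absv z ^+ _ * _]mulrC mulrA ler_pM ?mulr_ge0 ?exprn_ge0 ?absv_ge0//.
by rewrite ler_pM ?mulr_ge0 ?exprn_ge0 ?absv_ge0// ler_pM ?exprn_ge0 ?absv_ge0.
Qed.

End GeometricLimits.

Section Independence.
Variables (n : nat) (c u : nat -> nat).
Hypotheses (n_ge2 : (2 <= n)%N) (cn0 : c n <> 0%N).
Variable rs : seq algC.
Hypotheses (Drs : Phi n c algC = root_poly rs) (rs1 : 1 \notin rs) (nd : nondeg (1 :: rs)).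
Hypothesis (u_rec : linear_recurrence n c u).
Hypothesis (u_neq0 : exists2 i, (i < n)%N & u i <> 0%N).
Hypothesis u_ngeo : ~ exists q : algC, forall k, (u k.+1)%:R = q * (u k)%:R.
Variables (R : realType) (K : valuedFieldType R) (L : fieldExtType rat) (jL : {rmorphism L -> K}).
Hypothesis complete : forall F : set_system K, ProperFilter F -> cauchy F -> cvg F.
Hypothesis Kv : exists v, forall r : rat, absv (ratr r : K) = rat_absv R v r.
Variable (a : L).
Hypothesis (a01 : 0 < absv (jL a) < 1).
Variables (QsC : {rmorphism L -> algC}) (jC : {rmorphism algC -> K}).
Hypothesis jLE : forall z, jL z = jC (QsC z).
Variables (I A : finType) (b : I -> L) (k0 : nat) (alf : A -> L) (one : A) (lmax mmax : nat).
Hypothesis regular : forall k i, (k0 <= k)%N -> 1 - b i * a ^+ u k != 0.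
Hypotheses (b_neq0 : forall i, b i != 0) (b_inj : injective b).
Hypotheses (alf_neq0 : forall i, alf i != 0) (alf_inj : injective alf) (alf_one : alf one = 1).

(* The indices of [alpha], [l], [beta] ([None] for [beta = 0]) and [m - N_beta]. *)
Definition box := (A * 'I_lmax.+1 * option I * 'I_mmax.+1)%type.
Definition beta_of (o : option I) : L := if o is Some i then b i else 0.
Definition value (t : I + box) : K := match t with
  | inl i => iter (mult a u (b i) k0) (@derv R K) (Gfun (jL a) u) (jL (b i))
  | inr (x, l, o, e) => pderv l (mult a u (beta_of o) k0 + e) (Theta (jL a) u) (jL (alf x)) (jL (beta_of o))
  end.
Let bal (t : box) := alf t.1.1.1.
Let bbe (t : box) := beta_of t.1.2.
Let bll (t : box) : nat := t.1.1.2.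
Let bex (t : box) : nat := t.2.

Let u_super B : exists k1, forall k, (k1 <= k)%N -> (B * k <= u k)%N.
Proof. exact: (growth_superlinear n_ge2 cn0 u_rec u_neq0 Drs rs1 nd). Qed.

Let u_iter B : exists J, forall j k, (J <= j)%N -> (n <= k)%N -> (B * u k <= u (k + j))%N.
Proof. exact: (growth_iter n_ge2 cn0 u_rec Drs rs1 nd). Qed.

Lemma beta_of_regular o k : (k0 <= k)%N -> 1 - beta_of o * a ^+ u k != 0.
Proof. by case: o => [i|] kk; [exact: regular|rewrite mul0r subr0 oner_eq0]. Qed.

Lemma gam_exists : exists gam : I + box -> K, forall t,
  tends (fun k => jL (gseq u a b k0 bal bbe bll bex t k)) (gam t) /\
  forall B, exists J0 k1, forall k r, (k1 <= k)%N -> (k + J0 <= r)%N ->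
    absv (jL (gseq u a b k0 bal bbe bll bex t r) - gam t) <= absv (jL a) ^+ (B * u k).
Proof.
suff H (t : I + box) : exists y, tends (fun k => jL (gseq u a b k0 bal bbe bll bex t k)) y /\
  forall B, exists J0 k1, forall k r, (k1 <= k)%N -> (k + J0 <= r)%N ->
    absv (jL (gseq u a b k0 bal bbe bll bex t r) - y) <= absv (jL a) ^+ (B * u k) by have [gam Hg] := choice H; exists gam.
case: t => [i|j]; first exact: (Y_limit complete k0 a01 u_super u_iter).
exact: (S_limit complete k0 a01 u_super u_iter).
Qed.

Lemma map_gpoly m : map_poly jL (gpoly u a m) = gpoly u (jL a) m.
Proof.
rewrite /gpoly rmorph_prod; apply: eq_bigr => i _.
by rewrite rmorphB rmorph1 /= map_polyZ map_polyX rmorphXn.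
Qed.

Lemma map_Apoly m k : map_poly jL (Apoly u a m k) = Apoly u (jL a) m k.
Proof.
rewrite /Apoly rmorph_prod; apply: eq_bigr => i _.
by rewrite rmorphB rmorph1 /= map_polyZ map_polyX rmorphXn.
Qed.

Lemma nat_neq0L m : m.+1%:R != 0 :> L.
Proof. by rewrite -(inj_eq (fmorph_inj QsC)) rmorph0 rmorph_nat pnatr_eq0. Qed.

Lemma value_limit_G i :
  tends (fun m => jL (gpoly u a m)^`(mult a u (b i) k0).[b i]) (value (inl i)).
Proof.
apply: tends_ext (G_value complete a01 u_super _ _); exists 0%N => m _.
by rewrite -map_gpoly derivn_map horner_map.
Qed.

Lemma value_limit_Theta x (l : 'I_lmax.+1) o (e : 'I_mmax.+1) : tends (fun N =>
  jL (\sum_(k < N) a ^+ u k * ((k ^_ l)%:R * alf x ^+ (k - l)) *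
    (Apoly u a N k)^`(mult a u (beta_of o) k0 + e).[beta_of o])) (value (inr (x, l, o, e))).
Proof.
apply: tends_ext (Theta_value complete a01 u_super _ _ _ _); exists 0%N => N _.
rewrite rmorph_sum; apply: eq_bigr => k _.
by rewrite !rmorphM !rmorphXn rmorph_nat -map_Apoly derivn_map horner_map.
Qed.

Lemma value_limit t : exists s, tends (fun k => jL (s k)) (value t).
Proof.
case: t => [i|[[[x l] o] e]]; eexists; [exact: value_limit_G|exact: value_limit_Theta].
Qed.

Lemma rl_G i : rl jL value (fun m => (gpoly u a m)^`(mult a u (b i) k0).[b i]).
Proof. by exists (value (inl i)); [exact: value_limit_G|exact: ratl_gen]. Qed.

Lemma rl_Theta x (l : 'I_lmax.+1) o m :
  (mult a u (beta_of o) k0 <= m < mult a u (beta_of o) k0 + mmax.+1)%N -> rl jL value (fun N =>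
  \sum_(k < N) a ^+ u k * ((k ^_ l)%:R * alf x ^+ (k - l)) * (Apoly u a N k)^`(m).[beta_of o]).
Proof.
case/andP=> m1 m2; have m3 : (m - mult a u (beta_of o) k0 < mmax.+1)%N by rewrite ltn_subLR.
exists (value (inr (x, l, o, Ordinal m3))); last exact: ratl_gen.
by have := value_limit_Theta x l o (Ordinal m3); rewrite /= subnKC.
Qed.

(** A relation between the values bounds the growth of their monomials. The limits [gam] are
    rational in the values, so their monomials grow no faster, against [mahler]. The box contains
    all combinations of parameters because the elimination uses all lower orders and the values with
    l = 0 and alpha = 1. *)
Theorem values_independent N (s : 'I_N -> I + box) (P : mpoly.mpoly N L) : injective s -> P != 0 ->
  mpoly.mmap jL (value \o s) P != 0.
Proof.
move=> s_inj P0; apply/eqP => EP; have Hv := polynomial_relation_grows s_inj P0 EP.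
have [gam Hgam] := gam_exists.
have ng : ~ grows jL gam #|{: I + box}|.-1.
  apply: (mahler n_ge2 cn0 Drs rs1 nd u_rec u_neq0 a01 regular (al := bal) (be := bbe) (ll := bll) (ex := bex) _ jLE u_ngeo b_neq0 b_inj _ _ Kv) => //.
  - by case=> -[[x l] [i|]] e; [right; exists i|left].
  - by case=> -[[x l] o] e; exact: alf_neq0.
  - case=> -[[x l] o] e [[[x' l'] o'] e']; rewrite /bal /bll /bbe /bex /= => /alf_inj <- /val_inj <- oo /val_inj <-.
    congr (_, _, _, _); case: o o' oo => [i|] [i'|] //= => [/b_inj->//|/eqP|/esym/eqP]; by rewrite (negPf (b_neq0 _)).
  - by move=> t B; exact: (Hgam t).2.
  - by apply/card_gt0P; exists (inr (one, ord0, None, ord0)).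
(* A vanishing limit is itself a polynomial relation, which [mahler] excludes; this permits division
   by the limit of Y. *)
have gam_neq0 t : gam t != 0.
  apply/eqP => g0; apply: ng.
  apply: (@polynomial_relation_grows _ _ jL _ gam 1 (fun=> t) (mpolyX _ (mnm1 ord0))).
  - by move=> i j _; rewrite !ord1.
  - apply/eqP => /(congr1 (mcoeff (mnm1 ord0))); rewrite mcoeffX eqxx mcoeff0 => /eqP.
    by rewrite oner_eq0.
  - by rewrite mmapX mmap1U.
apply: ng; apply: ratl_grows Hv => t.
have T o x l : (exists2 y0, ratl jL value y0 & tends (fun m => jL (Yfin a u (beta_of o) k0 m)) y0) /\
   forall e, ratl jL value (gam (inr (x, l, o, e))).
  have [y0 Yy0 y00] : exists2 y0, tends (fun m => jL (Yfin a u (beta_of o) k0 m)) y0 & y0 != 0.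
    case: o => [i|]; first by exists (gam (inl i)) => //; exact: (Hgam (inl i)).1.
    exists 1; last exact: oner_neq0.
    apply: tends_ext (tends_const 1); exists 0%N => m _; rewrite /Yfin big1 ?rmorph1// => i _.
    by rewrite mul0r subr0.
  pose sig e := if insub e is Some e' then gam (inr (x, l, o, e')) else 0.
  have sigE e : sig (nat_of_ord e) = gam (inr (x, l, o, e)) by rewrite /sig valK.
  have [|||||||ry rsig] := @taylor R K L jL _ value a u (beta_of o) k0 (@beta_of_regular o) nat_neq0L mmax.+1 l (alf x) sig y0.
  - exact: alf_neq0.
  - exact: Yy0.
  - exact: y00.
  - by move=> e eM; rewrite -[e]/(nat_of_ord (Ordinal eM)) sigE; exact: (Hgam (inr (x, l, o, Ordinal eM))).1.
  - by case: o {Yy0 sig sigE} => [i|]; [right; exact: rl_G|left].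
  - by move=> m Hm; have := rl_Theta one ord0 Hm; rewrite alf_one.
  - by move=> m Hm; exact: rl_Theta.
  by split; [exists y0|move=> e; rewrite -sigE; exact: rsig].
case: t => [i|[[[x l] o] e]]; last exact: (T o x l).2.
have [[y0 ry0 ty0] _] := T (Some i) one ord0.
by have -> : gam (inl i) = y0 by apply: tends_unique (Hgam (inl i)).1 ty0.
Qed.

End Independence.

(** * Algebraicity over the completion of Q *)

Section Algebraic.
Variables (R : realType) (K : valuedFieldType R).
Hypothesis complete : forall F : set_system K, ProperFilter F -> cauchy F -> cvg F.

Lemma Qv_approx (x : K) : Qv K x <-> forall e : R, 0 < e -> exists r : rat, absv (ratr r - x) < e.
Proof.
split=> [Hx e e0|H B /nbhs_ballP[e /= e0 HB]].
  have [_ [[r _ <-] Hr]] := Hx _ (nbhsx_ballx x e e0); exists r.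
  by move: Hr; rewrite /ball /= /absv_dist -absvN opprB.
have [r Hr] := H e e0; exists (ratr r); split; first by exists r.
by apply: HB; rewrite /ball /= /absv_dist -absvN opprB.
Qed.

Variable jQ : {rmorphism rat -> K}.
Let jQE r : ratr r = jQ r. Proof. by rewrite fmorph_eq_rat. Qed.

Lemma Qv_rat r : Qv K (jQ r).
Proof. by apply/Qv_approx => e e0; exists r; rewrite jQE subrr absv0. Qed.

Lemma Qv_add x y : Qv K x -> Qv K y -> Qv K (x + y).
Proof.
move=> /Qv_approx Hx /Qv_approx Hy; apply/Qv_approx => e e0.
have [r Hr] := Hx _ (divr_gt0 e0 (ltr0Sn _ 1)); have [r' Hr'] := Hy _ (divr_gt0 e0 (ltr0Sn _ 1)).
exists (r + r'); have -> : ratr (r + r') - (x + y) = (ratr r - x) + (ratr r' - y).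
  by rewrite !jQE rmorphD; ring.
rewrite (le_lt_trans (absvD _ _))// [ltRHS](splitr e); exact: ltrD.
Qed.

Lemma Qv_mul x y : Qv K x -> Qv K y -> Qv K (x * y).
Proof.
move=> /Qv_approx Hx /Qv_approx Hy; apply/Qv_approx => e e0.
have p (z : K) : 0 < absv z + 1 by rewrite ltr_wpDl ?absv_ge0.
have [s Hs] := Hy _ (divr_gt0 (divr_gt0 e0 (ltr0Sn _ 1)) (p x)).
have [r Hr] := Hx _ (divr_gt0 (divr_gt0 e0 (ltr0Sn _ 1)) (p (ratr s))).
exists (r * s); have -> : ratr (r * s) - x * y = (ratr r - x) * ratr s + x * (ratr s - y).
  by rewrite !jQE rmorphM; ring.
rewrite (le_lt_trans (absvD _ _))// (absvM (ratr r - x)) (absvM x) [ltRHS](splitr e) ltrD//.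
  rewrite (le_lt_trans (_ : _ <= absv (ratr r - x) * (absv (ratr s : K) + 1)))//.
    by rewrite ler_wpM2l ?absv_ge0// lerDl.
  by rewrite -ltr_pdivlMr.
rewrite (le_lt_trans (_ : _ <= (absv x + 1) * absv (ratr s - y)))//.
  by rewrite ler_wpM2r ?absv_ge0// lerDl.
by rewrite mulrC -ltr_pdivlMr.
Qed.

Definition approximable d (v : 'I_d -> K) x := forall e : R, 0 < e ->
  exists c : 'I_d -> rat, absv (\sum_i jQ (c i) * v i - x) < e.

(* Either the first vector lies in the closure of the span of the others, or it has a
   positive distance to it and then its coefficients form a Cauchy sequence. *)
Lemma approximable_span d (v : 'I_d -> K) x : approximable v x ->
  exists C : 'I_d -> K, (forall i, Qv K (C i)) /\ x = \sum_i C i * v i.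
Proof.
elim: d v x => [|d IHd] v x Hx.
  exists (fun=> 0); split; first by case.
  rewrite big_ord0; apply/eqP; rewrite -absv_eq0 eq_le absv_ge0 andbT leNgt; apply/negP => x0.
  by have [c] := Hx _ x0; rewrite big_ord0 sub0r absvN ltxx.
pose v0 := v ord0; pose v' i := v (lift ord0 i).
have glue (C0 : K) (C' : 'I_d -> K) : Qv K C0 -> (forall i, Qv K (C' i)) -> x = C0 * v0 + \sum_i C' i * v' i ->
    exists C : 'I_d.+1 -> K, (forall i, Qv K (C i)) /\ x = \sum_i C i * v i.
  move=> q0 q' E; exists (fun i => if unlift ord0 i is Some j then C' j else C0); split.
    by move=> i; case: (unlift _ _).
  rewrite E big_ord_recl unlift_none; congr (_ + _); apply: eq_bigr => i _; by rewrite liftK.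
have [Hv0|Hv0] := pselect (approximable v' v0).
  have [|C' [q' E]] := IHd v' x; last by apply: (glue (jQ 0) C') => //; [exact: Qv_rat|by rewrite rmorph0 mul0r add0r].
  move=> e e0; have [c Hc] := Hx _ (divr_gt0 e0 (ltr0Sn _ 1)).
  have p : 0 < absv (jQ (c ord0)) + 1 by rewrite ltr_wpDl ?absv_ge0.
  have [c' Hc'] := Hv0 _ (divr_gt0 (divr_gt0 e0 (ltr0Sn _ 1)) p).
  exists (fun i => c (lift ord0 i) + c ord0 * c' i).
  have -> : \sum_i jQ (c (lift ord0 i) + c ord0 * c' i) * v' i - x =
      (\sum_i jQ (c i) * v i - x) + jQ (c ord0) * (\sum_i jQ (c' i) * v' i - v0).
    rewrite big_ord_recl mulrBr mulr_sumr.
    have -> : \sum_i jQ (c (lift ord0 i) + c ord0 * c' i) * v' i =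
       \sum_(i < d) jQ (c (lift ord0 i)) * v (lift ord0 i) + \sum_i jQ (c ord0) * (jQ (c' i) * v' i).
      by rewrite -big_split; apply: eq_bigr => i _; rewrite rmorphD rmorphM mulrDl mulrA.
    rewrite -/v0; ring.
  rewrite (le_lt_trans (absvD _ _))// absvM [ltRHS](splitr e) ltrD//.
  move: (absv (\sum_i _ - v0)) Hc' (absv_ge0 (\sum_i jQ (c' i) * v' i - v0)) => w Hw w0.
  rewrite (le_lt_trans (_ : _ <= w * (absv (jQ (c ord0)) + 1)))//; last by rewrite -ltr_pdivlMr.
  by rewrite mulrC ler_wpM2l// lerDl.
have [dl dl0 Hdl] : exists2 dl : R, 0 < dl & forall c : 'I_d -> rat, dl <= absv (\sum_i jQ (c i) * v' i - v0).
  apply: contrapT => H; apply: Hv0 => e e0; apply: contrapT => H'; apply: H.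
  exists e => // c; rewrite leNgt; apply/negP => Hc; apply: H'; by exists c.
have h01 : 0 < (2^-1 : R) < 1 by rewrite invr_gt0 ltr0n invf_lt1 ?ltr1n ?ltr0n.
have h0 k : 0 < (2^-1 : R) ^+ k by rewrite exprn_gt0//; case/andP: h01.
have /choice[c Hc] k := Hx _ (h0 k).
have tc e : 0 < e -> exists N, forall k, (N <= k)%N -> absv (\sum_i jQ (c k i) * v i - x) < e.
  move=> e0; have [m Hm] := geo_small 1 h01 e0; exists m => k mk; apply: (lt_le_trans (Hc k)).
  apply: le_trans Hm; rewrite mul1r ler_wiXn2l//; by case/andP: h01 => /ltW ? /ltW.
have lip k r : absv (jQ (c k ord0) - jQ (c r ord0)) * dl <=
    absv (\sum_i jQ (c k i) * v i - \sum_i jQ (c r i) * v i).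
  have [->|ne] := eqVneq (c k ord0) (c r ord0); first by rewrite subrr absv0 mul0r absv_ge0.
  set f := c k ord0 - c r ord0; have f0 : f != 0 by rewrite subr_eq0.
  pose c' i := - (c k (lift ord0 i) - c r (lift ord0 i)) / f.
  have -> : \sum_i jQ (c k i) * v i - \sum_i jQ (c r i) * v i = - (jQ f * (\sum_i jQ (c' i) * v' i - v0)).
    rewrite -sumrB big_ord_recl mulrBr mulr_sumr opprB -mulrBl -rmorphB -/f -/v0; congr (_ + _).
    rewrite -sumrN; apply: eq_bigr => i _.
    by rewrite mulrA -rmorphM /c' mulrCA divff// mulr1 rmorphN rmorphB mulNr opprK mulrBl.
  by rewrite absvN absvM -rmorphB -/f ler_wpM2l ?absv_ge0.
have [|C0 tC0] := cauchy_tends complete (s := fun k => jQ (c k ord0)).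
  move=> e e0; have [N HN] := tc _ (divr_gt0 (mulr_gt0 e0 dl0) (ltr0Sn _ 1)).
  exists N => k r Nk Nr; rewrite -(ltr_pM2r dl0) (le_lt_trans (lip _ _))//.
  rewrite -(subrKA x) -[X in _ + X]opprB (le_lt_trans (absvD _ _))// absvN [ltRHS]splitr.
  by rewrite ltrD ?HN.
have QC0 : Qv K C0.
  by apply/Qv_approx => e e0; have [N HN] := tC0 e e0; exists (c N ord0); rewrite jQE HN.
have [|C' [q' E]] := IHd v' (x - C0 * v0); last by apply: (glue C0 C') => //; rewrite -E addrC subrK.
move=> e e0; have [N HN] := tc _ (divr_gt0 e0 (ltr0Sn _ 1)).
have p : 0 < absv v0 + 1 by rewrite ltr_wpDl ?absv_ge0.
have [N' HN'] := tC0 _ (divr_gt0 (divr_gt0 e0 (ltr0Sn _ 1)) p).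
pose k := maxn N N'; have {}HN := HN k (leq_maxl _ _); have {}HN' := HN' k (leq_maxr _ _).
exists (fun i => c k (lift ord0 i)).
have -> : \sum_i jQ (c k (lift ord0 i)) * v' i - (x - C0 * v0) =
    (\sum_i jQ (c k i) * v i - x) + - ((jQ (c k ord0) - C0) * v0).
  by rewrite big_ord_recl -/v0 /v'; ring.
rewrite (le_lt_trans (absvD _ _))// absvN absvM [ltRHS](splitr e) ltrD//.
rewrite (le_lt_trans (_ : _ <= absv (jQ (c k ord0) - C0) * (absv v0 + 1)))//; last by rewrite -ltr_pdivlMr.
by rewrite ler_wpM2l ?absv_ge0// lerDl.
Qed.

Lemma Qv_char_poly d (M : 'M[K]_d) : (forall i j, Qv K (M i j)) -> forall i, Qv K (char_poly M)`_i.
Proof.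
move=> HM; pose ok (P : {poly K}) := forall i, Qv K P`_i.
have Q0 : Qv K 0 by rewrite -(rmorph0 jQ); exact: Qv_rat.
have Q1 : Qv K 1 by rewrite -(rmorph1 jQ); exact: Qv_rat.
have QN1 : Qv K (-1) by rewrite -(rmorphN1 jQ); exact: Qv_rat.
have okC x : Qv K x -> ok x%:P by move=> Qx i; rewrite coefC; case: eqP.
have okD P Q : ok P -> ok Q -> ok (P + Q) by move=> HP HQ i; rewrite coefD; exact: Qv_add.
have okM P Q : ok P -> ok Q -> ok (P * Q).
  by move=> HP HQ i; rewrite coefM; elim/big_ind: _ => //; [exact: Qv_add|move=> j _; exact: Qv_mul].
have okX (b : bool) : ok ('X *+ b : {poly K}) by move=> i; rewrite coefMn coefX; case: (_ == _); case: b; rewrite ?mulr1n ?mulr0n ?mul0rn//.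
rewrite /char_poly /determinant; change (ok (\sum_(s : 'S_d) (-1) ^+ s * \prod_i char_poly_mx M i (s i))).
elim/big_ind: _ => [|P Q|s _]; [exact: (okC 0)|exact: okD|apply: (okM)].
  by rewrite -signr_odd; case: (odd _); rewrite ?expr1 ?expr0; [rewrite -polyCN|]; exact: okC.
apply: (big_ind ok) => [|P Q|i _]; [exact: (okC 1)|exact: okM|].
rewrite !mxE; apply: okD; first exact: okX.
by rewrite -polyCN; apply: okC; rewrite -mulN1r; exact: Qv_mul.
Qed.

(** Multiplication by [x] sends the image of each basis vector of [L] to a limit of rational
    combinations of these images, hence to a combination with coefficients in [Qv]. So [x] is an
    eigenvalue of a matrix over [Qv]. *)
Theorem limit_Qvbar (L : fieldExtType rat) (jL : {rmorphism L -> K}) (s : nat -> L) x :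
  tends (fun n => jL (s n)) x -> Qvbar K x.
Proof.
move=> sx; pose e := vbasis {:L}; pose v (i : 'I_(\dim {:L})) := jL e`_i.
have jZ q (y : L) : jL (q *: y) = jQ q * jL y.
  rewrite -jQE -(fmorph_eq_rat (jL \o GRing.in_alg L)) /=.
  by rewrite -rmorphM -scalerAl mul1r.
have expand y : jL y = \sum_i jQ (coord e i y) * v i.
  rewrite {1}(coord_vbasis (memvf y)) rmorph_sum; apply: eq_bigr => i _.
  exact: jZ.
have app i : approximable v (x * v i).
  move=> eps eps0; have p : 0 < absv (v i) + 1 by rewrite ltr_wpDl ?absv_ge0.
  have [N HN] := sx _ (divr_gt0 eps0 p); exists (fun j => coord e j (s N * e`_i)).
  rewrite -expand rmorphM -/(v i) -mulrBl absvM.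
  rewrite (le_lt_trans (_ : _ <= absv (jL (s N) - x) * (absv (v i) + 1)))//; last by rewrite -ltr_pdivlMr ?HN.
  by rewrite ler_wpM2l ?absv_ge0// lerDl.
have /choice[M HM] i := approximable_span (app i).
exists (char_poly (\matrix_(j, i) M i j)); split.
- by rewrite monic_neq0 ?char_poly_monic.
- by apply: Qv_char_poly => i j; rewrite mxE; exact: (HM j).1.
rewrite -eigenvalue_root_char; apply/eigenvalueP; exists (\row_i v i).
  apply/rowP => i; rewrite !mxE (HM i).2; apply: eq_bigr => j _; by rewrite !mxE mulrC.
apply/eqP => v0; have := expand 1; rewrite rmorph1 big1; first by move/eqP; rewrite oner_eq0.
by move=> i _; have := congr1 (fun w : 'rV_(\dim {:L}) => w 0 i) v0; rewrite !mxE => ->; rewrite mulr0.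
Qed.

End Algebraic.

(** * The theorem *)

Lemma mult_Nbeta (L : fieldType) (QsC : {rmorphism L -> algC}) (a be : L) u k0 : a != 0 ->
  (forall k, (k0 <= k)%N -> 1 - be * a ^+ u k != 0) -> mult a u be k0 = Nbeta (QsC a) u (QsC be).
Proof.
move=> a0 reg; pose p k := 1 - be * a ^+ u k == 0.
have -> : mult a u be k0 = size [seq k <- iota 0 k0 | p k].
  rewrite /mult -sum1_card (eq_bigl (fun j : 'I_k0 => p j)); last by move=> j; rewrite inE.
  by rewrite -(big_mkord p (fun=> 1%N)) sum1_count /index_iota subn0 size_filter.
rewrite /Nbeta; set A := [set k | _].
have -> : A = [set` [fset k in [seq k <- iota 0 k0 | p k]]%fset].
  apply/seteqP; split=> k /=; rewrite !inE /= mem_filter mem_iota add0n /p.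
    move=> E; have E' : be * a ^+ u k = 1.
      apply: (fmorph_inj QsC); rewrite rmorphM rmorphXn rmorph1 -E mulVf//.
      by rewrite expf_neq0// fmorph_eq0.
    rewrite E' subrr eqxx/= ltnNge; apply/negP => /reg; by rewrite E' subrr eqxx.
  case/andP=> /eqP/esym/eqP; rewrite eq_sym subr_eq0 => /eqP E _.
  have au0 : QsC a ^+ u k != 0 by rewrite expf_neq0// fmorph_eq0.
  by apply: (mulIf au0); rewrite mulVf// -rmorphXn -rmorphM -E rmorph1.
by rewrite set_fsetK card_fseq undup_id// filter_uniq// iota_uniq.
Qed.

Section SeveralValues.
Variables (n : nat) (c u : nat -> nat).
Hypotheses (n_ge2 : (2 <= n)%N) (cn0 : c n <> 0%N).
Variable rs : seq algC.
Hypotheses (Drs : Phi n c algC = root_poly rs) (rs1 : 1 \notin rs) (nd : nondeg (1 :: rs)).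
Hypothesis (u_rec : linear_recurrence n c u).
Hypothesis (u_neq0 : exists2 i, (i < n)%N & u i <> 0%N).
Hypothesis u_ngeo : ~ exists q : algC, forall k, (u k.+1)%:R = q * (u k)%:R.
Variables (R : realType) (K : valuedFieldType R) (iota : {rmorphism algC -> K}).
Hypothesis complete : forall F : set_system K, ProperFilter F -> cauchy F -> cvg F.
Hypothesis Kv : exists v, forall r : rat, absv (ratr r : K) = rat_absv R v r.
Variable (a : algC).
Hypothesis (a01 : 0 < absv (iota a) < 1).

(* [inl (alpha, beta, l, m)] stands for a value of a derivative of [Theta] and
   [inr beta] for one of [G]. *)
Definition param := ((algC * algC * nat * nat) + algC)%type.

Definition param_value (p : param) : K := match p with
  | inl (al, be, l, m) => pderv l m (Theta (iota a) u) (iota al) (iota be)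
  | inr be => iter (Nbeta a u be) (@derv R K) (Gfun (iota a) u) (iota be)
  end.

Definition valid (p : param) : Prop := match p with
  | inl (al, be, l, m) => al != 0 /\ (Nbeta a u be <= m)%N
  | inr be => be != 0
  end.

Lemma eventually_regular (I : finType) (b : I -> algC) :
  exists k0, forall k i, (k0 <= k)%N -> 1 - b i * a ^+ u k != 0.
Proof.
have [q0 q1] := andP a01.
have H i : exists k0, forall k, (k0 <= k)%N -> 1 - b i * a ^+ u k != 0.
  have [m Hm] := geo_small (absv (iota (b i)) * 2) a01 ltr01.
  have [k1 Hk1] := growth_superlinear n_ge2 cn0 u_rec u_neq0 Drs rs1 nd m.
  exists k1.+1 => k kk; rewrite subr_eq0; apply/eqP => /(congr1 (fun z => absv (iota z))).
  rewrite rmorph1 absv1 rmorphM absvM rmorphXn absvX => E.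
  have : absv (iota (b i)) * 2 * absv (iota a) ^+ u k <= 1.
    apply: le_trans Hm; rewrite ler_wpM2l ?mulr_ge0 ?absv_ge0// ler_wiXn2l ?(ltW q0) ?(ltW q1)//.
    by apply: (leq_trans _ (Hk1 k (ltnW kk))); rewrite leq_pmulr// (leq_ltn_trans _ kk).
  by rewrite mulrAC -E mul1r lern1.
have /choice[k0 Hk0] := H; exists (\max_i k0 i)%N => k i kk; apply: Hk0.
by apply: leq_trans kk; exact: leq_bigmax.
Qed.

Theorem params_independent N (p : 'I_N -> param) : (forall i, valid (p i)) ->
  (forall i, Qvbar K (param_value (p i))) /\
  (injective p -> forall P : mpoly.mpoly N rat, P != 0 -> mpoly.mmap ratr (param_value \o p) P != 0).
Proof.
move=> Vp.
pose pal (p : param) : algC := if p is inl (al, _, _, _) then al else 1.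
pose pbe (p : param) := match p with inl (_, be, _, _) => be | inr be => be end.
pose pl (p : param) := if p is inl (_, _, l, _) then l else 0%N.
pose pm (p : param) := if p is inl (_, _, _, m) then m else 0%N.
(* The elimination uses the values at alpha = 1, so 1 is adjoined. The parameter beta = 0 is left
   out of [bes], being represented by [None]. *)
pose als := 1 :: [seq pal (p i) | i <- enum 'I_N].
pose bes := [seq x <- [seq pbe (p i) | i <- enum 'I_N] | x != 0].
pose lmax := (\max_i pl (p i))%N; pose mmax := (\max_i pm (p i))%N.
have [L [QsC [s1 Es1 _]]] := num_field_exists (a :: als ++ bes).
have /choice[g Hg] x : exists y, x \in a :: als ++ bes -> QsC y = x.
  case: (boolP (x \in _)) => [|_]; last by exists 0.
  by rewrite -Es1 => /mapP[y _ ->]; exists y.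
pose jL : {rmorphism L -> K} := iota \o QsC.
have ga : QsC (g a) = a by rewrite Hg ?mem_head.
have gal (x : seq_sub als) : QsC (g (val x)) = val x by rewrite Hg// in_cons mem_cat (valP x) orbT.
have gbe (x : seq_sub bes) : QsC (g (val x)) = val x by rewrite Hg// in_cons mem_cat (valP x) !orbT.
have a01' : 0 < absv (jL (g a)) < 1 by rewrite /jL /= ga.
have a0 : g a != 0.
  by apply/eqP => a0; move: a01'; rewrite a0 rmorph0 absv0 ltxx.
pose b (i : seq_sub bes) := g (val i); pose alf (i : seq_sub als) := g (val i).
have one_in : 1 \in als by rewrite mem_head.
have [k0 Hk0] := eventually_regular (fun i : seq_sub bes => val i).
have reg k i : (k0 <= k)%N -> 1 - b i * g a ^+ u k != 0.
  move=> /(Hk0 _ i); apply: contraNneq => /(congr1 QsC).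
  by rewrite rmorphB rmorph1 rmorphM rmorphXn gbe ga rmorph0 => ->.
have b0 i : b i != 0.
  by rewrite -(fmorph_eq0 QsC) gbe; have := valP i; rewrite mem_filter => /andP[].
have binj : injective b by move=> i j /(congr1 QsC); rewrite !gbe => /val_inj.
have alf0 i : alf i != 0.
  rewrite -(fmorph_eq0 QsC) gal; have := valP i; rewrite inE => /orP[/eqP->|/mapP[j _ ->]]; first exact: oner_neq0.
  by rewrite /pal; have := Vp j; case: (p j) => [[[[al be] l] m] []//|be _]; exact: oner_neq0.
have alfinj : injective alf by move=> i j /(congr1 QsC); rewrite !gal => /val_inj.
have alf1 : alf (SeqSub one_in) = 1 by apply: (fmorph_inj QsC); rewrite gal rmorph1.
pose box' := (seq_sub bes + box (seq_sub bes) (seq_sub als) lmax mmax)%type.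
pose val' : box' -> K := @value u R K L jL (g a) (seq_sub bes) (seq_sub als) b k0 alf lmax mmax.
have NE o : mult (g a) u (beta_of b o) k0 = Nbeta a u (QsC (beta_of b o)).
  have H := @mult_Nbeta L QsC (g a) (beta_of b o) u k0 a0 _; rewrite ga in H; apply: H.
  by case: o => [i|] k kk; [exact: reg|rewrite mul0r subr0 oner_neq0].
pose back (t : box') : param := match t with
  | inl i => inr (val i)
  | inr (x, l, o, e) => inl (val x, QsC (beta_of b o), nat_of_ord l, (Nbeta a u (QsC (beta_of b o)) + e)%N)
  end.
have backE t : val' t = param_value (back t).
  case: t => [i|[[[x l] o] e]]; rewrite /val' /value /= ga.
    have E : QsC (b i) = val i by exact: gbe.
    have NEi : mult (g a) u (b i) k0 = Nbeta a u (val i) by rewrite -E; exact: (NE (Some i)).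
    by rewrite NEi E.
  have E : QsC (alf x) = val x by exact: gal.
  by rewrite NE E.
have /choice[sg Hsg] i : exists t, back t = p i.
  have := Vp i; have lM : (pl (p i) <= lmax)%N by rewrite /lmax; exact: (@leq_bigmax _ (fun i => pl (p i)) i).
  have mM : (pm (p i) <= mmax)%N by rewrite /mmax; exact: (@leq_bigmax _ (fun i => pm (p i)) i).
  have aM : (pal (p i) \in als) by rewrite in_cons (map_f (fun i => pal (p i))) ?orbT ?mem_enum.
  have bM : pbe (p i) != 0 -> pbe (p i) \in bes by move=> nz; rewrite mem_filter nz (map_f (fun i => pbe (p i))) ?mem_enum.
  case: (p i) lM mM aM bM => [[[[al be] l] m]|be] /= lM mM aM bM V; last by exists (inl (SeqSub (bM V))).
  case: V => al0 Nm.
  have [w Ew] : exists w, QsC (beta_of b w) = be.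
    have [->|nz] := eqVneq be 0; first by exists None; rewrite rmorph0.
    by exists (Some (SeqSub (bM nz))); rewrite /= gbe.
  have lM' : (l < lmax.+1)%N by [].
  have mM' : (m - Nbeta a u be < mmax.+1)%N by rewrite ltnS (leq_trans (leq_subr _ _)).
  by exists (inr (SeqSub aM, Ordinal lM', w, Ordinal mM')); rewrite /= Ew subnKC.
have vE i : param_value (p i) = val' (sg i) by rewrite backE Hsg.
split=> [i|p_inj P P0].
  rewrite vE; have [s Hs] := value_limit n_ge2 cn0 Drs rs1 nd u_rec u_neq0 complete a01' b k0 alf (sg i).
  exact: (limit_Qvbar complete (jL \o GRing.in_alg L) Hs).
have sg_inj : injective sg by move=> i j E; apply: p_inj; rewrite -!Hsg E.
pose P' := map_mpoly (GRing.in_alg L) P.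
have P'0 : P' != 0.
  apply: contra_neq P0 => E; apply/mpolyP => m.
  have := congr1 (mcoeff m) E; rewrite mcoeff_map_mpoly !mcoeff0 => /eqP.
  by rewrite fmorph_eq0 => /eqP.
have := values_independent n_ge2 cn0 Drs rs1 nd u_rec u_neq0 u_ngeo complete Kv a01' (jL := jL) (QsC := QsC) (jC := iota)
   (fun z => erefl) reg b0 binj alf0 alfinj alf1 sg_inj P'0.
congr (_ != 0); rewrite /mmap (perm_big _ (msupp_map_mpoly _ _))/=; last exact: fmorph_inj.
apply: eq_bigr => m _; rewrite mcoeff_map_mpoly; congr (_ * _).
  by rewrite -(fmorph_eq_rat (jL \o GRing.in_alg L)).
by rewrite /mmap1; apply: eq_bigr => i _; rewrite /= vE.
Qed.

End SeveralValues.

Theorem theorem1p7 (R : realType) (v : place) (K : valuedFieldType R)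
    (iota : {rmorphism algC -> K})
    (a : algC) (n : nat) (c u : nat -> nat) :
  is_Cv K v ->
  0 < absv (iota a) < 1 ->
  (2 <= n)%N ->
  c n <> 0%N ->
  linear_recurrence n c u ->
  (exists2 i, (i < n)%N & u i <> 0%N) ->
  condR n c u v ->
  let S := Theta_values iota a u `|` G_values iota a u in
  [/\ infinite_set S, S `<=` Qvbar K & alg_independent S].
Proof.
move=> [complete Kabs _ _] a01 n_ge2 cn0 u_rec u_neq0 HR S.
have [rs Drs [[rs1 nd] ngeo]] := condR_nondeg n_ge2 cn0 u_rec u_neq0 HR.
have Kv : exists v, forall r : rat, absv (ratr r : K) = rat_absv R v r by exists v.
have main := @params_independent n c u n_ge2 cn0 rs Drs rs1 nd u_rec u_neq0 ngeo R K iota complete Kv a a01.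
have SP z : S z -> exists p, valid u a p /\ param_value u iota a p = z.
  by case=> [[al [be [l [m [al0 Nm ->]]]]]|[be be0 ->]]; [exists (inl (al, be, l, m))|exists (inr be)].
have PS p : valid u a p -> S (param_value u iota a p).
  case: p => [[[[al be] l] m] [al0 Nm]|be be0]; last by right; exists be.
  by left; exists al, be, l, m.
split.
(* Infinitely many values: at alpha = 1 and beta = 0, an equality for two different [l] would be the
   relation X_0 - X_1 = 0 between them. *)
- pose p (l : nat) : param := inl (1, 0, l, Nbeta a u 0).
  have Vp l : valid u a (p l) by split; [exact: oner_neq0|].
  have p_inj : injective (fun l => param_value u iota a (p l)).
    move=> l l' E; apply/eqP; apply: contraT => ll'.
    pose w (i : 'I_2) := if i == ord0 then p l else p l'.
    have w_inj : injective w.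
      move=> i j; rewrite /w; case: (eqVneq i ord0) => [->|i0]; case: (eqVneq j ord0) => [->|j0] //.
      - by move=> [/eqP]; rewrite (negPf ll').
      - by move=> [/eqP]; rewrite eq_sym (negPf ll').
      - by move=> _; move: i j i0 j0 => [[|[]]//] ? [[|[]]//] ? _ _; apply: val_inj.
    have Vw i : valid u a (w i) by rewrite /w; case: ifP.
    have /(_ (mpolyX _ (mnm1 ord0) - mpolyX _ (mnm1 ord_max))) := (main 2%N w Vw).2 w_inj.
    have -> : ratr = iota \o ratr :> (rat -> K) by apply/funext => r; rewrite /= -(fmorph_eq_rat (iota \o ratr)).
    have E' : (param_value u iota a \o w) ord0 = (param_value u iota a \o w) ord_max by exact: E.
    set h := param_value u iota a \o w in E' *.
    have -> : mmap (iota \o ratr) h (mpolyX _ (mnm1 ord0) - mpolyX _ (mnm1 ord_max)) =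
       mmap (iota \o ratr) h (mpolyX _ (mnm1 ord0)) - mmap (iota \o ratr) h (mpolyX _ (mnm1 ord_max)).
      exact: raddfB.
    rewrite !mmapX !mmap1U E' subrr eqxx => H; apply: H.
    apply/eqP => /(congr1 (mcoeff (mnm1 ord0))); rewrite mcoeffB !mcoeffX eqxx mcoeff0.
    case: eqP => [/mnmP/(_ ord0)|_ /eqP]; first by rewrite !mnm1E.
    by rewrite subr0 oner_eq0.
  move=> /(finite_preimage (f := fun l => param_value u iota a (p l)) (in2W p_inj)).
  suff -> : (fun l => param_value u iota a (p l)) @^-1` S = setT by exact: infinite_nat.
  by apply/seteqP; split=> // l _; exact: PS.
- move=> z /SP[p [Vp <-]].
  exact: (main 1%N (fun=> p) (fun=> Vp)).1 ord0.
- move=> N s P s_inj Ss P0.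
  have /choice[p Hp] i := SP _ (Ss i).
  have -> : s = param_value u iota a \o p by apply/funext => i /=; rewrite (Hp i).2.
  apply: (main N p (fun i => (Hp i).1)).2 => //.
  by move=> i j E; apply: s_inj; rewrite -(Hp i).2 -(Hp j).2 E.
Qed.
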